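(* Let $x$ be a real number with $$\log x \geq \exp\left(-4W_{-1}\left(-\left(4\cdot 5^{3/4}\cdot 53.989^{3/4}\right)^{-1}\right)\right)\ (\approx 1.7\cdot 10^{13}).$$ Then $$\left|S(x)-\frac{x^2}{2}\right|\leq 6.794\,x^{B_1^*(x)+1}.$$
   Context: $\Lambda$ denotes the von Mangoldt function. For a positive integer $n$, $G(n)=\sum_{\ell+m=n}\Lambda(\ell)\Lambda(m)$ (sum over positive integers $\ell,m$), and $S(x)=\sum_{n\leq x}G(n)$. $W_{-1}$ denotes the branch of the Lambert $W$ function defined on $[-1/e,0)$ with values $\leq -1$. Let $B_1=\sup\{\Re(\rho)\}$, the supremum over the non-trivial zeros $\rho$ (zeros with $0<\Re\rho<1$) of the Riemann zeta function, and $$B_1^*(x)=\min\left\{B_1,\ 1-\frac{1}{53.989(\log x)^{2/3}(\log\log x)^{1/3}}\right\}.$$ *)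

(* Defs.v *)
From mathcomp Require Import ssreflect ssrbool eqtype ssrnat prime.
From Stdlib Require Import Reals.
From Coquelicot Require Import Coquelicot.
Open Scope R_scope.

(** von Mangoldt function: Lambda(n) = log p if n = p^k (p prime, k >= 1),
    0 otherwise.  For n > 1, n is a prime power iff n = p^(v_p(n)) where
    p = pdiv n is its smallest prime divisor. *)
Definition vonMangoldt (n : nat) : R :=
  if leq 2 n && (n == expn (pdiv n) (logn (pdiv n) n))
  then ln (INR (pdiv n)) else 0.

Definition G (n : nat) : R :=
  sum_n_m (fun l => vonMangoldt l * vonMangoldt (n - l)) 1 (n - 1).

Definition S_sum (x : R) : R := sum_n_m G 1 (Z.to_nat (Int_part x)).

Definition cpow_neg (n : R) (s : C) : C :=
  (Rpower n (- fst s) * cos (snd s * ln n), - (Rpower n (- fst s) * sin (snd s * ln n))).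

(** Dirichlet eta function eta(s) = sum_{n>=1} (-1)^{n-1} n^{-s}, convergent for Re s > 0. *)
Definition eta (s : C) : C :=
  (Series (fun k => (-1) ^ k * fst (cpow_neg (INR k.+1) s)),
   Series (fun k => (-1) ^ k * snd (cpow_neg (INR k.+1) s))).

(** Riemann zeta function on the half-plane Re s > 0 (s <> 1), via its
    analytic continuation zeta(s) = eta(s) / (1 - 2^{1-s}). *)
Definition riemann_zeta (s : C) : C :=
  Cdiv (eta s) (Cminus (RtoC 1) (Cmult (RtoC 2) (cpow_neg 2 s))).

Definition nontrivial_zero (rho : C) : Prop :=
  0 < fst rho < 1 /\ riemann_zeta rho = RtoC 0.

Definition B1 : R :=
  real (Lub_Rbar (fun r => exists rho, nontrivial_zero rho /\ r = fst rho)).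

Definition B1_star (x : R) : R :=
  Rmin B1 (1 - 1 / (53.989 * Rpower (ln x) (2/3) * Rpower (ln (ln x)) (1/3))).

(** w is the value W_{-1}(z) of the lower branch of Lambert W:
    w <= -1 and w e^w = z  (unique for z in [-1/e, 0)). *)
Definition is_LambertWm1 (z w : R) : Prop := w <= -1 /\ w * exp w = z.

(* Main.v *)
From mathcomp Require ssreflect ssrbool eqtype ssrnat div prime.
Require Import Defs.
From Stdlib Require Import Reals Lra Lia Psatz.
From Coquelicot Require Import Coquelicot.
Open Scope R_scope.

(** Write [x = exp L], let [b] be the exponent [B1_star x], and smooth psi on the logarithmic axis at scale [theta = x^(b-1)/10].
 The sum S(x) is sandwiched between convolutions of psi with its smoothed density; splitting off the main terms leaves one term that
 is linear in the error R of the smoothed psi and one that is bilinear.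
 If every zero has real part at most [b], then for [Z = (s-1) zeta] and [B > b] the reflection [s -> 2B - s] and the maximum principle
 give [Re (-Z'/Z)(B+it) <= log|t| + O(1)]. So [log(s+2) + Z'/Z] has nonnegative real part on [Re s > b]: Schwarz-Pick controls [Z'/Z]
 near the line [Re s = b], Poisson's formula bounds the linear term by a multiple of [x^(1+b)] free of logarithms, and Cauchy-Schwarz
 with a Plancherel inequality bounds the bilinear term, where the factor [sqrt theta] absorbs the powers of [L].
 If instead [b = 1 - delta < B1], the classical zero-free region is enough: [L] is so large that, at height [T = exp(3 delta L)],
 the gain [exp(-c L/log T)] beats [exp(-delta L)], and R is small uniformly. The Lambert condition says [5 log L <= delta L]. *)

(* No functional equation, zero counting or explicit formula enters. The functional equation is
   replaced by the crude inequality |Z(B-1+it)| <= 0.9 (t^2 + 13/4) |Z(B+1+it)|, read off from an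
   Euler-Maclaurin remainder. It is available only for B >= 0.45, so the exponent must be known not
   to be small; [B1_ge_half] supplies this: were all zeros further left, the mean square of the
   error of psi would be smaller than the gaps between consecutive integers allow. A pointwise bound
   of Z'/Z on a line near Re s = b would leave a logarithm in the linear term. Writing -Z'/Z =
   log(s+2) - 2 Re P + conj P leaves on that line only a term of constant sign, whose Poisson
   integral is a single value of P on the real axis. That value gives the 2.52 which, counted twice,
   makes up most of 6.794. Contour integration rests on one fact: the integral of a holomorphic
   function over a vertical segment has a derivative, in the abscissa, that depends on the two end
   points alone. *)
Tactic Notation "note" open_constr(t) "as" simple_intropattern(p) := pose proof t as p.
Tactic Notation "note" open_constr(t) := pose proof t.
Tactic Notation "etr" := eapply Rle_trans.
Tactic Notation "via" uconstr(t) := eapply Rle_trans; [apply t|].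
Tactic Notation "mid" uconstr(t) := apply Rle_trans with t.
Tactic Notation "minmax" := rewrite Rmin_left, Rmax_right by lra.
Tactic Notation "minmax" "in" hyp(h) := rewrite Rmin_left, Rmax_right in h by lra.
Tactic Notation "ha" ident(h) ":" lconstr(P) "by" tactic3(t) := assert (h : P) by t.
Tactic Notation "ha" ident(h) ":" lconstr(P) := assert (h : P).
Ltac refl := reflexivity.
Ltac asm := assumption.
Notation "!!" := ltac:(lra) (only parsing).
Notation mle_l := Rmult_le_compat_l (only parsing).
Notation mle_r := Rmult_le_compat_r (only parsing).
Notation mle := Rmult_le_compat (only parsing).
Notation inv_pos := Rinv_0_lt_compat (only parsing).
Notation inv_le := Rinv_le_contravar (only parsing).
Notation div_pos := Rdiv_lt_0_compat (only parsing).
Notation mul_pos := Rmult_lt_0_compat (only parsing).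
Notation mul_nn := Rmult_le_pos (only parsing).
Notation pair_eq := injective_projections (only parsing).
Notation RCN := R_CompleteNormedModule (only parsing).
Notation RNM := R_NormedModule (only parsing).
Notation add_le := Rplus_le_compat (only parsing).
Notation add_le_l := Rplus_le_compat_l (only parsing).
Notation add_le_r := Rplus_le_compat_r (only parsing).
Notation abs_btw := Rabs_le_between (only parsing).
Notation exs_sc := ex_series_scal (only parsing).
Notation mle_rr := Rmult_le_reg_r (only parsing).
Notation mle_rl := Rmult_le_reg_l (only parsing).
Notation c_cst := continuous_const (only parsing).
Notation RI_uniq := is_RInt_unique (only parsing).

Lemma exp_le x y : x <= y -> exp x <= exp y.
Proof. intros [H|H]; [left; apply exp_increasing, H|right; f_equal; exact H]. Qed.

Lemma div_ge0 a b : 0 <= a -> 0 < b -> 0 <= a/b.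
Proof. intros H1 H2. apply mul_nn; [exact H1|left; apply inv_pos, H2]. Qed.

(* [ar] closes goals on signs, monotonicity, continuity and holomorphy; [!!] is a premise proved by [lra]. *)
Ltac pos := first [lra | lazymatch goal with
 | |- 0 < _*_ => apply mul_pos; pos
 | |- 0 <= _*_ => apply mul_nn; pos
 | |- 0 < _/_ => apply div_pos; pos
 | |- 0 <= _/_ => apply div_ge0; pos
 | |- 0 < / _ => apply inv_pos; pos
 | |- 0 <= / _ => left; apply inv_pos; pos
 | |- 0 < exp _ => apply exp_pos
 | |- 0 <= exp _ => left; apply exp_pos
 | |- 0 <= _ ^ 2 => apply pow2_ge_0
 | |- 0 < _ ^ _ => apply pow_lt; pos
 | |- 0 <= _ ^ _ => apply pow_le; pos
 | |- 0 <= Cmod _ => apply Cmod_ge_0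
 | |- 0 <= Rabs _ => apply Rabs_pos
 | |- 0 <= sqrt _ => apply sqrt_pos
 | |- 0 < PI => apply PI_RGT_0
 | |- 0 < _ + _ => first [apply Rplus_lt_le_0_compat; pos | apply Rplus_le_lt_0_compat; pos]
 | |- 0 <= _ + _ => apply Rplus_le_le_0_compat; pos
 | |- _ <> 0 => apply Rgt_not_eq; red; pos
 end].

Ltac mono := first [lra | asm | apply Rle_refl | lazymatch goal with
 | |- 0 <= _ => pos
 | |- ?a*_ <= ?a*_ => apply mle_l; [pos | mono]
 | |- _ * ?a <= _ * ?a => apply mle_r; [pos | mono]
 | |- _*_ <= _*_ => apply mle; [pos | pos | mono | mono]
 | |- ?a/_ <= ?a/_ => apply mle_l; [pos | mono]
 | |- _ / ?a <= _ / ?a => apply mle_r; [pos | mono]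
 | |- _/_ <= _/_ => apply mle; [pos | pos | mono | mono]
 | |- / _ <= / _ => apply inv_le; [pos | mono]
 | |- _ + _ <= _ + _ => apply add_le; mono
 | |- exp _ <= exp _ => apply exp_le; mono
 | |- ln _ <= ln _ => apply ln_le; [pos | mono]
 | |- _ ^ ?n <= _ ^ ?n => apply pow_incr; split; [pos | mono]
 end].

Ltac ar := first [lra | solve [pos] | solve [mono] | split; first [lra | solve [pos] | solve [mono]]].

(** * Complex differentiability *)

Definition Cd (f : C -> C) (s l : C) : Prop :=
 forall eps, 0 < eps -> exists d, 0 < d /\ forall h : C, Cmod h < d ->
  Cmod (f (s + h) - f s - l*h)%C <= eps*Cmod h.

(** Two derivatives are asked for because differentiation under the integral sign needs a continuous
    first derivative, which the second one provides. [Cd] at a point of [U] speaks of a full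
    neighbourhood in the plane, so [U] may be any set of points. *)
Definition hol (U : C -> Prop) (f : C -> C) : Prop :=
 exists f1 f2, (forall s, U s -> Cd f s (f1 s)) /\ (forall s, U s -> Cd f1 s (f2 s)).

Ltac cgen := match goal with |- @eq _ ?x ?y => change (@eq C x y) end;
 repeat match goal with |- context [@pair R R ?a ?b] =>
  let p := fresh "p" in pose (p := ((a, b) : C)); change (@pair R R a b) with p; clearbody p end.
Ltac req := match goal with |- @eq _ ?x ?y => change (@eq R x y) end.
Ltac cring := cgen; ring.
Ltac rmins := repeat match goal with
 | H : _ < Rmin _ _ |- _ => apply Rmin_Rgt_l in H; destruct H
 | H : Rmin _ _ > _ |- _ => apply Rmin_Rgt_l in H; destruct H end.

Lemma Cmod_tri3 a b c : Cmod (a + b + c)%C <= Cmod a + Cmod b + Cmod c.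
Proof. note (Cmod_triangle (a+b)%C c); note (Cmod_triangle a b); lra. Qed.

Lemma Cmod_sub_le a b : Cmod (a - b)%C <= Cmod a + Cmod b.
Proof. note (Cmod_triangle a (-b)%C) as H; rewrite Cmod_opp in H; exact H. Qed.

Lemma Cmod_sub_ge a b : Cmod a - Cmod b <= Cmod (a - b)%C.
Proof.
 note (Cmod_triangle (a - b)%C b) as H.
 replace (a - b + b)%C with a in H by ring; lra.
Qed.

Lemma Cmod_sym a b : Cmod (a - b)%C = Cmod (b - a)%C.
Proof. rewrite <- Cmod_opp; f_equal; ring. Qed.

Lemma Cmod_fst z : Rabs (fst z) <= Cmod z.
Proof. exact (re_le_Cmod z). Qed.

Lemma Cmod_sq z : Cmod z ^ 2 = fst z ^ 2 + snd z ^ 2.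
Proof. exact (Cmod2_alt z). Qed.

Lemma Cmod_snd z : Rabs (snd z) <= Cmod z.
Proof.
 rewrite <- (Rabs_pos_eq (Cmod z)) by apply Cmod_ge_0.
 apply Rsqr_le_abs_0. unfold Rsqr. note (Cmod_sq z). nra.
Qed.

Lemma Cmod_le_sum z : Cmod z <= Rabs (fst z) + Rabs (snd z).
Proof.
 note (Rabs_pos (fst z)); note (Rabs_pos (snd z)).
 rewrite <- (Rabs_pos_eq (Cmod z)) by apply Cmod_ge_0.
 rewrite <- (Rabs_pos_eq (Rabs (fst z) + Rabs (snd z))) by lra.
 apply Rsqr_le_abs_0. unfold Rsqr. note (Cmod_sq z).
 note (Rsqr_abs (fst z)) as A1; note (Rsqr_abs (snd z)) as A2.
 unfold Rsqr in A1, A2. nra.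
Qed.

Lemma Cmult_nz (a b : C) : a <> 0%C -> b <> 0%C -> (a*b)%C <> 0%C.
Proof.
 intros Ha Hb. apply Cmod_gt_0. rewrite Cmod_mult.
 apply mul_pos; apply Cmod_gt_0; asm.
Qed.

(** Take w = conj z/|z|. This reduces estimates for complex-valued maps to the real function Re (w
    f): the mean value inequality, the norms of integrals and series, and [P_growth] all pass
    through it. *)
Lemma Cmod_dual z M : (forall w, Cmod w = 1 -> fst (w*z)%C <= M) -> Cmod z <= M.
Proof.
 intros H. destruct (Req_dec (Cmod z) 0) as [E|E].
 - rewrite E. specialize (H 1%C). rewrite Cmod_1 in H. specialize (H eq_refl).
  apply Cmod_eq_0 in E. subst z. simpl in H. lra.
 - ha P : 0 < Cmod z by (note (Cmod_ge_0 z); lra).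
  ha Zn : z <> 0%C by (apply Cmod_gt_0; exact P).
  specialize (H (Cconj z/Cmod z)%C).
  ha A : Cmod (Cconj z/Cmod z)%C = 1.
  { rewrite Cmod_div.
   - rewrite Cmod_conj, Cmod_R, Rabs_pos_eq by lra. field; lra.
   - intros K. apply E. injection K. auto. }
  specialize (H A).
  replace (fst (Cconj z/Cmod z*z)%C) with (Cmod z) in H; [ar|].
  note (Cmod_sq z) as Q. simpl.
  transitivity (Cmod z ^ 2/Cmod z). { field; lra. }
  rewrite Q. simpl. field; lra.
Qed.

Lemma Cd_ext (f g : C -> C) (s l : C) : (forall z, f z = g z) -> Cd f s l -> Cd g s l.
Proof.
 intros E H eps He. destruct (H eps He) as [d [Hd Hh]]. exists d; split; [ar|].
 intros h Hm. rewrite <- !E. apply Hh; exact Hm.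
Qed.

Lemma Cd_ext_loc (f g : C -> C) (s l : C) r : 0 < r -> (forall z, Cmod (z - s)%C < r -> f z = g z) ->
 Cd f s l -> Cd g s l.
Proof.
 intros Hr E H eps He. destruct (H eps He) as [d [Hd Hh]]. exists (Rmin d r); split.
 { apply Rmin_pos; asm. }
 intros h Hm. note (Rmin_l d r); note (Rmin_r d r).
 rewrite <- (E (s + h)%C), <- (E s).
 - apply Hh; lra.
 - replace (s - s)%C with (RtoC 0) by ring. rewrite Cmod_0; lra.
 - replace (s + h - s)%C with h by ring. lra.
Qed.

Lemma Cd_eq (f : C -> C) (s l : C) l' : l = l' -> Cd f s l -> Cd f s l'.
Proof. now intros ->. Qed.

Lemma Cd_lip (f : C -> C) (s l : C) : Cd f s l -> exists d, 0 < d /\ forall h : C, Cmod h < d ->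
 Cmod (f (s + h) - f s)%C <= (Cmod l + 1)*Cmod h.
Proof.
 intros H. destruct (H 1 Rlt_0_1) as [d [Hd Hh]]. exists d; split; [ar|].
 intros h Hm. specialize (Hh h Hm).
 note (Cmod_triangle (f (s + h) - f s - l*h)%C (l*h)%C) as T.
 replace (f (s + h) - f s - l*h + l*h)%C with (f (s + h) - f s)%C in T by ring.
 rewrite Cmod_mult in T. lra.
Qed.

Lemma Cd_cont (f : C -> C) (s l : C) : Cd f s l -> forall eps, 0 < eps -> exists d, 0 < d /\ forall h : C,
 Cmod h < d -> Cmod (f (s + h) - f s)%C < eps.
Proof.
 intros H eps He. destruct (Cd_lip f s l H) as [d [Hd Hh]].
 note (Cmod_ge_0 l).
 exists (Rmin d (eps/(Cmod l + 2))). split.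
 { apply Rmin_pos; [lra|]. ar. }
 intros h Hm. note (Rmin_l d (eps/(Cmod l + 2))); note (Rmin_r d (eps/(Cmod l + 2))).
 specialize (Hh h !!).
 assert (Cmod h*(Cmod l + 2) < eps).
 { apply Rlt_le_trans with (eps/(Cmod l + 2)*(Cmod l + 2)).
  - apply Rmult_lt_compat_r; lra.
  - right; field; lra. }
 note (Cmod_ge_0 h). nra.
Qed.

Lemma Cd_const c s : Cd (fun _ => c) s 0%C.
Proof.
 intros eps He. exists 1; split; [lra|]. intros h _.
 replace (c - c - 0*h)%C with (RtoC 0) by ring. rewrite Cmod_0.
 ar.
Qed.

Lemma Cd_id s : Cd (fun z => z) s 1%C.
Proof.
 intros eps He. exists 1; split; [lra|]. intros h _.
 replace (s + h - s - 1*h)%C with (RtoC 0) by ring. rewrite Cmod_0.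
 ar.
Qed.

Lemma Cd_plus (f g : C -> C) (s l m : C) : Cd f s l -> Cd g s m -> Cd (fun z => f z + g z)%C s (l + m)%C.
Proof.
 intros Hf Hg eps He.
 destruct (Hf (eps/2) !!) as [d1 [Hd1 H1]].
 destruct (Hg (eps/2) !!) as [d2 [Hd2 H2]].
 exists (Rmin d1 d2); split; [apply Rmin_pos; asm|].
 intros h Hm. note (Rmin_l d1 d2); note (Rmin_r d1 d2).
 specialize (H1 h !!); specialize (H2 h !!).
 replace (f (s + h) + g (s + h) - (f s + g s) - (l + m)*h)%C
  with ((f (s + h) - f s - l*h) + (g (s + h) - g s - m*h))%C by ring.
 note (Cmod_triangle (f (s + h) - f s - l*h)%C (g (s + h) - g s - m*h)%C). lra.
Qed.

Lemma Cd_mult (f g : C -> C) (s l m : C) : Cd f s l -> Cd g s m ->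
 Cd (fun z => f z*g z)%C s (l*g s + f s*m)%C.
Proof.
 intros Hf Hg eps He.
 note (Cmod_ge_0 l) as P1; note (Cmod_ge_0 m) as P2; note (Cmod_ge_0 (g s)) as P3; note (Cmod_ge_0 (f s)) as P4.
 set (K := Cmod (g s) + Cmod (f s) + (Cmod l + 1)*(Cmod m + 1) + 1).
 ha KP : 0 < K by (unfold K; nra).
 destruct (Hf (eps/K/2) ltac:(repeat apply div_pos; lra)) as [d1 [Hd1 H1]].
 destruct (Hg (eps/K/2) ltac:(repeat apply div_pos; lra)) as [d2 [Hd2 H2]].
 destruct (Cd_lip f s l Hf) as [d3 [Hd3 H3]].
 destruct (Cd_lip g s m Hg) as [d4 [Hd4 H4]].
 ha E0 : 0 < eps/K/2 by ar.
 set (d := Rmin (Rmin d1 d2) (Rmin (Rmin d3 d4) (eps/K/2))).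
 exists d; split; [unfold d; repeat apply Rmin_pos; asm|].
 intros h Hm.
 assert (Cmod h < d1 /\ Cmod h < d2 /\ Cmod h < d3 /\ Cmod h < d4 /\ Cmod h < eps/K/2) as (A1&A2&A3&A4&A5).
 { unfold d in Hm; rmins; repeat split; lra. }
 specialize (H1 h A1); specialize (H2 h A2); specialize (H3 h A3); specialize (H4 h A4).
 replace (f (s + h)*g (s + h) - f s*g s - (l*g s + f s*m)*h)%C
  with ((f (s + h) - f s - l*h)*g s + f s*(g (s + h) - g s - m*h)
     + (f (s + h) - f s)*(g (s + h) - g s))%C by ring.
 via Cmod_tri3. rewrite !Cmod_mult.
 set (e := eps/K/2) in *. note (Cmod_ge_0 h).
 ha B1 : Cmod (f (s + h) - f s - l*h)%C*Cmod (g s) <= e*Cmod h*Cmod (g s).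
 { apply mle_r; asm. }
 ha B2 : Cmod (f s)*Cmod (g (s + h) - g s - m*h)%C <= Cmod (f s)*(e*Cmod h).
 { ar. }
 ha B3 : Cmod (f (s + h) - f s)%C*Cmod (g (s + h) - g s)%C
   <= ((Cmod l + 1)*Cmod h)*((Cmod m + 1)*Cmod h).
 { ar. }
 ha B4 : ((Cmod l + 1)*Cmod h)*((Cmod m + 1)*Cmod h) <= ((Cmod l + 1)*(Cmod m + 1))*(e*Cmod h).
 { replace (((Cmod l + 1)*Cmod h)*((Cmod m + 1)*Cmod h)) with (((Cmod l + 1)*(Cmod m + 1))*(Cmod h*Cmod h)) by ring.
  ar. }
 ha EK : e*K = eps/2 by (unfold e; field; lra).
 assert (e*Cmod h*K = eps/2*Cmod h) by (rewrite <- EK; ring).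
 unfold K in *. nra.
Qed.

Lemma Cd_inv (f : C -> C) (s l : C) : f s <> 0%C -> Cd f s l -> Cd (fun z => / f z)%C s (- l/(f s*f s))%C.
Proof.
 intros Hn Hf eps He.
 ha P : 0 < Cmod (f s) by (apply Cmod_gt_0; exact Hn).
 set (m := Cmod (f s)) in *. note (Cmod_ge_0 l) as Hl.
 ha m2 : 0 < m*m by nra.
 destruct (Hf (eps*(m*m)/4) ltac:(apply div_pos; nra)) as [d1 [Hd1 H1]].
 destruct (Cd_lip f s l Hf) as [d2 [Hd2 H2]].
 destruct (Cd_cont f s l Hf (m/2) !!) as [d3 [Hd3 H3]].
 set (q := eps*(m*m*m)/(4*(Cmod l + 1)*(Cmod l + 1))).
 ha Hq : 0 < q by (unfold q; apply div_pos; [ar| nra]).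
 set (d := Rmin (Rmin d1 d2) (Rmin d3 q)).
 exists d; split; [unfold d; repeat apply Rmin_pos; asm|].
 intros h Hm.
 assert (Cmod h < d1 /\ Cmod h < d2 /\ Cmod h < d3 /\ Cmod h < q) as (A1&A2&A3&A4).
 { unfold d in Hm. note (Rmin_l (Rmin d1 d2) (Rmin d3 q)); note (Rmin_r (Rmin d1 d2) (Rmin d3 q)).
  note (Rmin_l d1 d2); note (Rmin_r d1 d2); note (Rmin_l d3 q); note (Rmin_r d3 q).
  ar. }
 specialize (H1 h A1); specialize (H2 h A2); specialize (H3 h A3).
 set (w := f (s + h)%C) in *. set (v := f s) in *.
 ha Wm : m/2 <= Cmod w.
 { note (Cmod_sub_ge v (v - w)%C) as T. replace (v - (v - w))%C with w in T by ring.
  rewrite (Cmod_sym v w) in T. fold m in T. lra. }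
 ha Wn : w <> 0%C by (apply Cmod_gt_0; lra).
 replace (/ w - / v - - l/(v*v)*h)%C
  with ((- (w - v - l*h)/(v*w)) + (l*h)*(w - v)/(v*v*w))%C by (field; auto).
 via Cmod_triangle.
 rewrite !Cmod_div, !Cmod_mult, Cmod_opp by (repeat apply Cmult_nz; auto).
 fold m. note (Cmod_ge_0 h) as Hh0.
 ha C1 : Cmod (w - v - l*h)%C/(m*Cmod w) <= eps/2*Cmod h.
 { apply Rle_div_l; [apply mul_pos; lra|]. via H1.
  mid (eps/2*Cmod h*(m*(m/2))); [ar|].
  ar. }
 ha C2 : Cmod l*Cmod h*Cmod (w - v)%C/(m*m*Cmod w) <= eps/2*Cmod h.
 { apply Rle_div_l; [apply mul_pos; nra|].
  mid (eps/2*Cmod h*(m*m*(m/2))).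
  2:{ ar. }
  assert (Cmod h*(Cmod l + 1)*(Cmod l + 1) <= eps*(m*m*m)/4).
  { mid (q*((Cmod l + 1)*(Cmod l + 1))).
   - rewrite Rmult_assoc. apply mle_r; nra.
   - right. unfold q. field. lra. }
  assert (Cmod l*Cmod (w - v)%C <= (Cmod l + 1)*((Cmod l + 1)*Cmod h)).
  { ar. }
  nra. }
 lra.
Qed.

Lemma Cd_comp (f g : C -> C) (s l m : C) : Cd f (g s) l -> Cd g s m -> Cd (fun z => f (g z)) s (l*m)%C.
Proof.
 intros Hf Hg eps He.
 note (Cmod_ge_0 l); note (Cmod_ge_0 m).
 destruct (Hf (eps/(2*(Cmod m + 1))) ltac:(apply div_pos; lra)) as [d1 [Hd1 H1]].
 destruct (Hg (eps/(2*(Cmod l + 1))) ltac:(apply div_pos; lra)) as [d2 [Hd2 H2]].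
 destruct (Cd_lip g s m Hg) as [d3 [Hd3 H3]].
 destruct (Cd_cont g s m Hg d1 Hd1) as [d4 [Hd4 H4]].
 exists (Rmin d2 (Rmin d3 d4)); split; [repeat apply Rmin_pos; asm|].
 intros h Hm.
 note (Rmin_l d2 (Rmin d3 d4)); note (Rmin_r d2 (Rmin d3 d4)).
 note (Rmin_l d3 d4); note (Rmin_r d3 d4).
 specialize (H2 h !!); specialize (H3 h !!); specialize (H4 h !!).
 specialize (H1 (g (s + h) - g s)%C H4).
 replace (g s + (g (s + h) - g s))%C with (g (s + h))%C in H1 by ring.
 replace (f (g (s + h)) - f (g s) - l*m*h)%C
  with ((f (g (s + h)) - f (g s) - l*(g (s + h) - g s)) + l*(g (s + h) - g s - m*h))%C by ring.
 via Cmod_triangle. rewrite Cmod_mult. note (Cmod_ge_0 h).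
 ha C1 : eps/(2*(Cmod m + 1))*Cmod (g (s + h) - g s)%C <= eps/2*Cmod h.
 { etr; [apply mle_l; [left; apply div_pos; lra|exact H3]|].
  right; field; lra. }
 ha C2 : Cmod l*Cmod (g (s + h) - g s - m*h)%C <= eps/2*Cmod h.
 { mid ((Cmod l + 1)*(eps/(2*(Cmod l + 1))*Cmod h)).
  - apply mle; try apply Cmod_ge_0; lra.
  - right; field; lra. }
 lra.
Qed.

Lemma Cd_opp (f : C -> C) (s l : C) : Cd f s l -> Cd (fun z => - f z)%C s (- l)%C.
Proof.
 intros H. eapply Cd_ext; [|eapply Cd_eq; [|apply (Cd_mult (fun _ => (-1)%C) f _ _ _ (Cd_const _ _) H)]].
 - intros z; simpl; ring.
 - ring.
Qed.

Lemma Cd_minus (f g : C -> C) (s l m : C) : Cd f s l -> Cd g s m -> Cd (fun z => f z - g z)%C s (l - m)%C.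
Proof. intros Hf Hg. exact (Cd_plus _ _ _ _ _ Hf (Cd_opp _ _ _ Hg)). Qed.

Lemma Cd_div (f g : C -> C) (s l m : C) : g s <> 0%C -> Cd f s l -> Cd g s m ->
 Cd (fun z => f z/g z)%C s ((l*g s - f s*m)/(g s*g s))%C.
Proof.
 intros Hn Hf Hg. eapply Cd_eq; [|apply (Cd_mult _ _ _ _ _ Hf (Cd_inv _ _ _ Hn Hg))].
 field; auto.
Qed.

Section Hol.
Variable U : C -> Prop.

Lemma hol_const c : hol U (fun _ => c).
Proof. exists (fun _ => 0%C), (fun _ => 0%C); split; intros; apply Cd_const. Qed.

Lemma hol_id : hol U (fun z => z).
Proof. exists (fun _ => 1%C), (fun _ => 0%C); split; intros; [apply Cd_id|apply Cd_const]. Qed.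

Lemma hol_plus (f g : C -> C) : hol U f -> hol U g -> hol U (fun z => f z + g z)%C.
Proof.
 intros (f1&f2&A1&A2) (g1&g2&B1&B2).
 exists (fun z => f1 z + g1 z)%C, (fun z => f2 z + g2 z)%C.
 split; intros; apply Cd_plus; auto.
Qed.

Lemma hol_mult (f g : C -> C) : hol U f -> hol U g -> hol U (fun z => f z*g z)%C.
Proof.
 intros (f1&f2&A1&A2) (g1&g2&B1&B2).
 exists (fun z => f1 z*g z + f z*g1 z)%C.
 exists (fun z => (f2 z*g z + f1 z*g1 z) + (f1 z*g1 z + f z*g2 z))%C.
 split; intros s Hs; [apply Cd_mult; auto|].
 apply Cd_plus; apply Cd_mult; auto.
Qed.

Lemma hol_inv (f : C -> C) : (forall s, U s -> f s <> 0%C) -> hol U f -> hol U (fun z => / f z)%C.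
Proof.
 intros Hn (f1&f2&A1&A2).
 exists (fun z => - f1 z/(f z*f z))%C.
 exists (fun z => (- f2 z*(f z*f z) - - f1 z*(f1 z*f z + f z*f1 z))/((f z*f z)*(f z*f z)))%C.
 split; intros s Hs.
 - apply Cd_inv; auto.
 - apply (Cd_div (fun z => - f1 z)%C (fun z => f z*f z)%C).
  + apply Cmult_nz; auto.
  + apply Cd_opp; auto.
  + apply Cd_mult; auto.
Qed.

Lemma hol_opp (f : C -> C) : hol U f -> hol U (fun z => - f z)%C.
Proof.
 intros (f1&f2&A1&A2). exists (fun z => - f1 z)%C, (fun z => - f2 z)%C.
 split; intros; apply Cd_opp; auto.
Qed.

Lemma hol_minus (f g : C -> C) : hol U f -> hol U g -> hol U (fun z => f z - g z)%C.
Proof. intros; apply hol_plus; [|apply hol_opp]; asm. Qed.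

Lemma hol_div (f g : C -> C) : (forall s, U s -> g s <> 0%C) -> hol U f -> hol U g -> hol U (fun z => f z/g z)%C.
Proof. intros; apply hol_mult; [|apply hol_inv]; asm. Qed.

Lemma hol_pow (f : C -> C) n : hol U f -> hol U (fun z => f z ^ n)%C.
Proof.
 intros H. induction n as [|n IH]; simpl.
 - apply hol_const.
 - apply hol_mult; asm.
Qed.

Lemma hol_affine (V : C -> Prop) (f : C -> C) (c e : C) : (forall s, U s -> V (c + e*s)%C) -> hol V f ->
 hol U (fun z => f (c + e*z))%C.
Proof.
 intros HV (f1&f2&A1&A2).
 ha L : forall s, Cd (fun z => c + e*z)%C s e.
 { intros s. apply (Cd_eq _ _ (0 + (0*s + e*1))%C); [ring|].
  apply (Cd_plus (fun _ => c) (fun z => e*z)%C); [apply Cd_const|].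
  apply (Cd_mult (fun _ => e) (fun z => z)); [apply Cd_const|apply Cd_id]. }
 exists (fun z => f1 (c + e*z)*e)%C, (fun z => f2 (c + e*z)*e*e)%C.
 split; intros s Hs.
 - apply (Cd_comp f (fun z => c + e*z)%C s); auto.
 - eapply Cd_eq; [|apply (Cd_mult (fun z => f1 (c + e*z)%C) (fun _ => e)); [apply (Cd_comp f1 (fun z => c + e*z)%C s); auto|apply Cd_const]].
  ring.
Qed.

End Hol.

Lemma hol_sub (U V : C -> Prop) f : (forall s, U s -> V s) -> hol V f -> hol U f.
Proof. intros H (f1&f2&A1&A2). exists f1, f2; split; auto. Qed.

(** * Calculus of complex-valued functions of a real variable *)

Lemma is_derive_eps (f : R -> R) x l : is_derive f x l <->
 forall eps, 0 < eps -> exists d, 0 < d /\ forall h, Rabs h < d ->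
  Rabs (f (x + h) - f x - l*h) <= eps*Rabs h.
Proof.
 rewrite is_derive_Reals. split.
 - intros H eps He. destruct (H eps He) as [d Hd]. exists d; split; [apply cond_pos|].
  intros h Hh. destruct (Req_dec h 0) as [->|N].
  + rewrite Rplus_0_r, Rabs_R0. replace (f x - f x - l*0) with 0 by ring. rewrite Rabs_R0; lra.
  + specialize (Hd h N Hh).
   replace (f (x + h) - f x - l*h) with (((f (x + h) - f x)/h - l)*h) by (field; exact N).
   rewrite Rabs_mult. apply mle_r; [ar|lra].
 - intros H eps He. destruct (H (eps/2) !!) as [d [Hd Hh]].
  exists (mkposreal d Hd). simpl. intros h N Hm. specialize (Hh h Hm).
  replace ((f (x + h) - f x)/h - l) with ((f (x + h) - f x - l*h)/h) by (field; exact N).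
  assert (0 < Rabs h) by (apply Rabs_pos_lt; exact N).
  rewrite Rabs_div by exact N. apply Rlt_div_l; [lra|]. nra.
Qed.

Definition Rd (g : R -> C) (t : R) (l : C) : Prop :=
 is_derive (fun u => fst (g u)) t (fst l) /\ is_derive (fun u => snd (g u)) t (snd l).

Lemma Rd_eps (g : R -> C) t (l : C) : Rd g t l <->
 forall eps, 0 < eps -> exists d, 0 < d /\ forall h : R, Rabs h < d ->
  Cmod (g (t + h)%R - g t - l*h)%C <= eps*Rabs h.
Proof.
 unfold Rd. rewrite !is_derive_eps. split.
 - intros [H1 H2] eps He. destruct (H1 (eps/2) !!) as [d1 [P1 Q1]].
  destruct (H2 (eps/2) !!) as [d2 [P2 Q2]].
  exists (Rmin d1 d2); split; [apply Rmin_pos; asm|]. intros h Hh. rmins.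
  specialize (Q1 h !!); specialize (Q2 h !!).
  via Cmod_le_sum.
  replace (fst (g (t + h)%R - g t - l*h)%C) with (fst (g (t + h)) - fst (g t) - fst l*h) by (simpl; ring).
  replace (snd (g (t + h)%R - g t - l*h)%C) with (snd (g (t + h)) - snd (g t) - snd l*h) by (simpl; ring).
  lra.
 - intros H; split; intros eps He; destruct (H eps He) as [d [Hd Q]]; exists d; split; try exact Hd;
  intros h Hh; specialize (Q h Hh); etr; try exact Q.
  + replace (fst (g (t + h)) - fst (g t) - fst l*h) with (fst (g (t + h)%R - g t - l*h)%C) by (simpl; ring).
   apply Cmod_fst.
  + replace (snd (g (t + h)) - snd (g t) - snd l*h) with (snd (g (t + h)%R - g t - l*h)%C) by (simpl; ring).
   apply Cmod_snd.
Qed.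

Lemma Rd_comp (f : C -> C) (g : R -> C) (t : R) (l m : C) :
 Cd f (g t) l -> Rd g t m -> Rd (fun u => f (g u)) t (l*m)%C.
Proof.
 rewrite !Rd_eps. intros Hf Hg eps He.
 note (Cmod_ge_0 l) as L0; note (Cmod_ge_0 m) as M0.
 destruct (Hf (eps/(2*(Cmod m + 1))) ltac:(apply div_pos; lra)) as [d1 [Hd1 H1]].
 destruct (Hg (eps/(2*(Cmod l + 1))) ltac:(apply div_pos; lra)) as [d2 [Hd2 H2]].
 destruct (Hg 1 Rlt_0_1) as [d3 [Hd3 H3]].
 exists (Rmin (Rmin d2 d3) (d1/(Cmod m + 2))); split.
 { repeat apply Rmin_pos; try asm. ar. }
 intros h Hm. rmins.
 specialize (H2 h !!); specialize (H3 h !!).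
 set (k := (g (t + h)%R - g t)%C) in *. note (Rabs_pos h) as h0.
 ha Hk : Cmod k <= (Cmod m + 1)*Rabs h.
 { note (Cmod_triangle (k - m*h)%C (m*h)%C) as T.
  replace (k - m*h + m*h)%C with k in T by ring. rewrite Cmod_mult, Cmod_R in T. lra. }
 ha Hk1 : Cmod k < d1.
 { apply Rle_lt_trans with (1 := Hk).
  assert (Rabs h*(Cmod m + 2) < d1).
  { apply Rlt_le_trans with (d1/(Cmod m + 2)*(Cmod m + 2)).
   - apply Rmult_lt_compat_r; lra.
   - right; field; lra. }
  nra. }
 specialize (H1 k Hk1). replace (g t + k)%C with (g (t + h)) in H1 by (unfold k; ring).
 replace (f (g (t + h)%R) - f (g t) - l*m*h)%C
  with ((f (g (t + h)%R) - f (g t) - l*k) + l*(k - m*h))%C by ring.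
 via Cmod_triangle. rewrite Cmod_mult.
 ha C1 : eps/(2*(Cmod m + 1))*Cmod k <= eps/2*Rabs h.
 { etr; [apply mle_l; [left; apply div_pos; lra|exact Hk]|].
  right; field; lra. }
 ha C2 : Cmod l*Cmod (k - m*h)%C <= eps/2*Rabs h.
 { mid ((Cmod l + 1)*(eps/(2*(Cmod l + 1))*Rabs h)).
  - apply mle; try apply Cmod_ge_0; lra.
  - right; field; lra. }
 lra.
Qed.

Lemma Rd_re (t s : R) : Rd (fun u => (u, t)) s 1%C.
Proof. split; simpl; auto_derive; auto. Qed.

Lemma Rd_im (t s : R) : Rd (fun u => (s, u)) t Ci.
Proof. split; simpl; auto_derive; auto. Qed.

Lemma Cd_re (f : C -> C) (s t : R) (l : C) : Cd f (s, t) l -> Rd (fun u => f (u, t)) s l.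
Proof.
 intros H. note (Rd_comp f (fun u => (u, t)) s l 1%C H (Rd_re t s)) as K.
 replace (l*1)%C with l in K by ring. ar.
Qed.

Lemma Cd_im (f : C -> C) (s t : R) (l : C) : Cd f (s, t) l -> Rd (fun u => f (s, u)) t (l*Ci)%C.
Proof. intros H. exact (Rd_comp f (fun u => (s, u)) t l Ci H (Rd_im t s)). Qed.

Lemma dR_mult (f g : R -> R) (x l m : R) : is_derive f x l -> is_derive g x m ->
 is_derive (fun u => f u*g u) x (l*g x + f x*m).
Proof. rewrite !is_derive_Reals. intros A B. exact (derivable_pt_lim_mult _ _ _ _ _ A B). Qed.

Lemma dR_plus (f g : R -> R) (x l m : R) : is_derive f x l -> is_derive g x m ->
 is_derive (fun u => f u + g u) x (l + m).
Proof. rewrite !is_derive_Reals. intros A B. exact (derivable_pt_lim_plus _ _ _ _ _ A B). Qed.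

Lemma dR_minus (f g : R -> R) (x l m : R) : is_derive f x l -> is_derive g x m ->
 is_derive (fun u => f u - g u) x (l - m).
Proof. rewrite !is_derive_Reals. intros A B. exact (derivable_pt_lim_minus _ _ _ _ _ A B). Qed.

Lemma dR_scal (f : R -> R) (k x l : R) : is_derive f x l -> is_derive (fun u => k*f u) x (k*l).
Proof. rewrite !is_derive_Reals. intros A. exact (derivable_pt_lim_scal _ _ _ _ A). Qed.

Lemma dR_comp (f g : R -> R) (x l m : R) : is_derive g x l -> is_derive f (g x) m ->
 is_derive (fun u => f (g u)) x (m*l).
Proof. rewrite !is_derive_Reals. intros A B. exact (derivable_pt_lim_comp _ _ _ _ _ A B). Qed.

Lemma dR_eq (f : R -> R) (x l l' : R) : l = l' -> is_derive f x l -> is_derive f x l'.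
Proof. now intros ->. Qed.

Lemma Rd_mult (f g : R -> C) t (l m : C) : Rd f t l -> Rd g t m ->
 Rd (fun u => f u*g u)%C t (l*g t + f t*m)%C.
Proof.
 intros [F1 F2] [G1 G2]. split; simpl.
 - eapply dR_eq; [|exact (dR_minus _ _ _ _ _ (dR_mult _ _ _ _ _ F1 G1) (dR_mult _ _ _ _ _ F2 G2))]. simpl; ring.
 - eapply dR_eq; [|exact (dR_plus _ _ _ _ _ (dR_mult _ _ _ _ _ F1 G2) (dR_mult _ _ _ _ _ F2 G1))]. ar.
Qed.

Definition Ccont (g : R -> C) (t : R) : Prop :=
 continuous (fun u => fst (g u)) t /\ continuous (fun u => snd (g u)) t.

Lemma Rd_Ccont g t l : Rd g t l -> Ccont g t.
Proof.
 intros [H1 H2]; split; apply @ex_derive_continuous; eexists; eassumption.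
Qed.

Lemma Cd_Ccont_im (f : C -> C) (s t : R) l : Cd f (s, t) l -> Ccont (fun u => f (s, u)) t.
Proof. intros H. eapply Rd_Ccont, Cd_im, H. Qed.

Lemma cR_iff (f : R -> R) x : continuous f x <-> continuity_pt f x.
Proof. symmetry. apply continuity_pt_filterlim. Qed.

Lemma cR_plus (f g : R -> R) x : continuous f x -> continuous g x -> continuous (fun u => f u + g u) x.
Proof. rewrite !cR_iff. exact (continuity_pt_plus f g x). Qed.

Lemma cR_minus (f g : R -> R) x : continuous f x -> continuous g x -> continuous (fun u => f u - g u) x.
Proof. rewrite !cR_iff. exact (continuity_pt_minus f g x). Qed.

Lemma cR_mult (f g : R -> R) x : continuous f x -> continuous g x -> continuous (fun u => f u*g u) x.
Proof. rewrite !cR_iff. exact (continuity_pt_mult f g x). Qed.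

Lemma cR_opp (f : R -> R) x : continuous f x -> continuous (fun u => - f u) x.
Proof. rewrite !cR_iff. exact (continuity_pt_opp f x). Qed.

Lemma cR_inv (f : R -> R) x : continuous f x -> f x <> 0 -> continuous (fun u => / f u) x.
Proof. rewrite !cR_iff. exact (continuity_pt_inv f x). Qed.

Lemma cR_comp (f g : R -> R) x : continuous g x -> continuous f (g x) -> continuous (fun u => f (g u)) x.
Proof. rewrite !cR_iff. exact (continuity_pt_comp g f x). Qed.

Lemma cR_abs (f : R -> R) x : continuous f x -> continuous (fun u => Rabs (f u)) x.
Proof. intros H. apply (cR_comp Rabs f x H). apply cR_iff, Rcontinuity_abs. Qed.

Lemma cR_der (f : R -> R) (x l : R) : is_derive f x l -> continuous f x.
Proof. intros H. apply (ex_derive_continuous (V := RNM)). exists l; exact H. Qed.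

Lemma Ccont_plus f g t : Ccont f t -> Ccont g t -> Ccont (fun u => f u + g u)%C t.
Proof. intros [A B] [A' B']; split; simpl; apply cR_plus; asm. Qed.

Lemma Ccont_opp f t : Ccont f t -> Ccont (fun u => - f u)%C t.
Proof. intros [A B]; split; simpl; apply cR_opp; asm. Qed.

Lemma Ccont_minus f g t : Ccont f t -> Ccont g t -> Ccont (fun u => f u - g u)%C t.
Proof. intros A B. apply Ccont_plus; [|apply Ccont_opp]; asm. Qed.

Lemma Ccont_mult f g t : Ccont f t -> Ccont g t -> Ccont (fun u => f u*g u)%C t.
Proof.
 intros [A B] [A' B']; split; simpl.
 - apply cR_minus; apply cR_mult; asm.
 - apply cR_plus; apply cR_mult; asm.
Qed.

Lemma Ccont_const c t : Ccont (fun _ => c) t.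
Proof. split; apply c_cst. Qed.

Lemma Ccont_ext f g t : (forall u, f u = g u) -> Ccont f t -> Ccont g t.
Proof.
 intros E [A B]; split.
 - apply (continuous_ext (fun u => fst (f u))); [intros; now rewrite E|ar].
 - apply (continuous_ext (fun u => snd (f u))); [intros; now rewrite E|ar].
Qed.

Lemma Ccont_Cmod g t : Ccont g t -> continuous (fun u => Cmod (g u)) t.
Proof.
 intros [A B]. unfold Cmod. apply (cR_comp sqrt (fun u => fst (g u) ^ 2 + snd (g u) ^ 2)).
 - simpl. apply (cR_plus (fun u => fst (g u)*(fst (g u)*1)) (fun u => snd (g u)*(snd (g u)*1)));
   (apply cR_mult; [ar|apply cR_mult; [ar|apply c_cst]]).
 - apply continuous_sqrt.
Qed.

Definition CInt (g : R -> C) (a b : R) : C :=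
 (RInt (fun t => fst (g t)) a b, RInt (fun t => snd (g t)) a b).

Definition exCI (g : R -> C) a b : Prop :=
 ex_RInt (fun t => fst (g t)) a b /\ ex_RInt (fun t => snd (g t)) a b.

Lemma exCI_cont g a b : a <= b -> (forall t, a <= t <= b -> Ccont g t) -> exCI g a b.
Proof.
 intros Hab H; split; apply @ex_RInt_continuous; intros z;
 rewrite Rmin_left, Rmax_right by exact Hab; intros Hz; apply H; exact Hz.
Qed.

Lemma ex_RInt_cont (f : R -> R) a b : a <= b -> (forall t, a <= t <= b -> continuous f t) -> ex_RInt f a b.
Proof.
 intros Hab H; apply @ex_RInt_continuous; intros z; rewrite Rmin_left, Rmax_right by exact Hab; auto.
Qed.

Lemma CInt_ext f g a b : a <= b -> (forall t, a < t < b -> f t = g t) -> CInt f a b = CInt g a b.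
Proof.
 intros Hab H. unfold CInt. f_equal; apply RInt_ext;
 rewrite Rmin_left, Rmax_right by exact Hab; intros; now rewrite H.
Qed.

Lemma CInt_plus f g a b : exCI f a b -> exCI g a b ->
 CInt (fun t => f t + g t)%C a b = (CInt f a b + CInt g a b)%C.
Proof.
 intros [A B] [A' B']. unfold CInt, Cplus; simpl. f_equal.
 - exact (RInt_plus _ _ _ _ A A').
 - exact (RInt_plus _ _ _ _ B B').
Qed.

Lemma CInt_opp f a b : exCI f a b -> CInt (fun t => - f t)%C a b = (- CInt f a b)%C.
Proof.
 intros [A B]. unfold CInt, Copp; simpl. f_equal.
 - exact (RInt_opp _ _ _ A).
 - exact (RInt_opp _ _ _ B).
Qed.

Lemma exCI_plus f g a b : exCI f a b -> exCI g a b -> exCI (fun t => f t + g t)%C a b.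
Proof.
 intros [A B] [A' B']; split; simpl.
 - exact (ex_RInt_plus _ _ _ _ A A').
 - exact (ex_RInt_plus _ _ _ _ B B').
Qed.

Lemma exCI_opp f a b : exCI f a b -> exCI (fun t => - f t)%C a b.
Proof.
 intros [A B]; split; simpl.
 - exact (ex_RInt_opp _ _ _ A).
 - exact (ex_RInt_opp _ _ _ B).
Qed.

Lemma CInt_minus f g a b : exCI f a b -> exCI g a b ->
 CInt (fun t => f t - g t)%C a b = (CInt f a b - CInt g a b)%C.
Proof.
 intros A B. unfold Cminus. rewrite CInt_plus, CInt_opp; auto using exCI_opp.
Qed.

Lemma ex_RInt_scalR (f : R -> R) k a b : ex_RInt f a b -> ex_RInt (fun t => k*f t) a b.
Proof. intros H. exact (ex_RInt_scal _ _ _ k H). Qed.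

Lemma RInt_scalR (f : R -> R) k a b : ex_RInt f a b -> RInt (fun t => k*f t) a b = k*RInt f a b.
Proof. intros H. exact (RInt_scal _ _ _ k H). Qed.

Lemma exCI_scal c f a b : exCI f a b -> exCI (fun t => c*f t)%C a b.
Proof.
 intros [A B]; split; simpl.
 - apply (ex_RInt_minus (V := RNM)); apply ex_RInt_scalR; asm.
 - apply (ex_RInt_plus (V := RNM)); apply ex_RInt_scalR; asm.
Qed.

Lemma CInt_scal c f a b : exCI f a b -> CInt (fun t => c*f t)%C a b = (c*CInt f a b)%C.
Proof.
 intros [A B]. unfold CInt, Cmult; simpl. f_equal.
 - rewrite <- !RInt_scalR by asm.
  apply (RInt_minus (V := RCN)); apply ex_RInt_scalR; asm.
 - rewrite <- !RInt_scalR by asm.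
  apply (RInt_plus (V := RCN)); apply ex_RInt_scalR; asm.
Qed.

Lemma CInt_Chasles f a b c : exCI f a b -> exCI f b c -> (CInt f a b + CInt f b c)%C = CInt f a c.
Proof.
 intros [A B] [A' B']. unfold CInt, Cplus; simpl. f_equal.
 - exact (RInt_Chasles _ _ _ _ A A').
 - exact (RInt_Chasles _ _ _ _ B B').
Qed.

Lemma CInt_norm f (M : R -> R) a b : a <= b -> exCI f a b -> ex_RInt M a b ->
 (forall t, a < t < b -> Cmod (f t) <= M t) -> Cmod (CInt f a b) <= RInt M a b.
Proof.
 intros Hab Hf HM H. apply Cmod_dual. intros w Hw.
 rewrite <- CInt_scal by exact Hf. simpl.
 apply RInt_le; [ar|exact (proj1 (exCI_scal w f a b Hf))|ar|].
 intros t Ht. mid (Cmod (w*f t)%C).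
 - etr; [apply Rle_abs|exact (Cmod_fst (w*f t)%C)].
 - rewrite Cmod_mult, Hw, Rmult_1_l. apply H; exact Ht.
Qed.

Lemma CInt_norm_const f M a b : a <= b -> exCI f a b ->
 (forall t, a < t < b -> Cmod (f t) <= M) -> Cmod (CInt f a b) <= (b - a)*M.
Proof.
 intros Hab Hf H. replace ((b - a)*M) with (RInt (fun _ => M) a b).
 - apply CInt_norm; auto. apply ex_RInt_const.
 - rewrite RInt_const. ar.
Qed.

Lemma Rd_mvi (g g' : R -> C) a b M : a <= b ->
 (forall t, a <= t <= b -> Rd g t (g' t)) -> (forall t, a <= t <= b -> Cmod (g' t) <= M) ->
 Cmod (g b - g a)%C <= (b - a)*M.
Proof.
 intros Hab Hd HM. apply Cmod_dual. intros w Hw.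
 ha D : forall t, a <= t <= b -> is_derive (fun u => fst (w*g u)%C) t (fst (w*g' t)%C).
 { intros t Ht. destruct (Hd t Ht) as [D1 D2]. simpl.
  apply dR_minus; apply dR_scal; asm. }
 destruct (MVT_gen (fun u => fst (w*g u)%C) a b (fun u => fst (w*g' u)%C)) as [c [Hc E]].
 - rewrite Rmin_left, Rmax_right by exact Hab. intros x Hx. apply D; lra.
 - rewrite Rmin_left, Rmax_right by exact Hab. intros x Hx.
  apply continuity_pt_filterlim. apply (ex_derive_continuous (V := RNM)). eexists. apply D; exact Hx.
 - rewrite Rmin_left, Rmax_right in Hc by exact Hab.
  replace (fst (w*(g b - g a))%C) with (fst (w*g b)%C - fst (w*g a)%C) by (simpl; ring).
  rewrite E, Rmult_comm. apply mle_l; [lra|].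
  via Rle_abs. via Cmod_fst.
  rewrite Cmod_mult, Hw, Rmult_1_l. apply HM; exact Hc.
Qed.

Lemma Rd_FTC (g g' : R -> C) a b : a <= b ->
 (forall t, a <= t <= b -> Rd g t (g' t)) -> (forall t, a <= t <= b -> Ccont g' t) ->
 CInt g' a b = (g b - g a)%C.
Proof.
 intros Hab Hd Hc. unfold CInt, Cminus, Cplus, Copp; simpl. f_equal; apply RI_uniq.
 - apply (is_RInt_derive (fun t => fst (g t)) (fun t => fst (g' t)));
  rewrite Rmin_left, Rmax_right by exact Hab; intros; [apply Hd|apply Hc]; asm.
 - apply (is_RInt_derive (fun t => snd (g t)) (fun t => snd (g' t)));
  rewrite Rmin_left, Rmax_right by exact Hab; intros; [apply Hd|apply Hc]; asm.
Qed.

(** The integral is taken in the ordinate t, so the factor i of ds is left out throughout. *)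
Definition VI (f : C -> C) (s c d : R) : C := CInt (fun t => f (s, t)) c d.

Lemma Cd_cont2 (f : C -> C) (s t : R) l : Cd f (s, t) l ->
 continuity_2d_pt (fun u v => fst (f (u, v))) s t /\ continuity_2d_pt (fun u v => snd (f (u, v))) s t.
Proof.
 intros H.
 ha K : forall eps : posreal, exists d : posreal, forall u v, Rabs (u - s) < d -> Rabs (v - t) < d ->
  Cmod (f (u, v) - f (s, t))%C < eps.
 { intros eps. destruct (Cd_cont f (s, t) l H eps (cond_pos eps)) as [d [Hd Hh]].
  exists (mkposreal (d/2) !!). simpl. intros u v Hu Hv.
  specialize (Hh (u - s, v - t)).
  replace ((s, t) + ((u - s)%R, (v - t)%R))%C with ((u, v) : C) in Hh
   by (unfold Cplus; simpl; f_equal; ring).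
  apply Hh. eapply Rle_lt_trans; [apply Cmod_le_sum|]. simpl. lra. }
 split; intros eps; destruct (K eps) as [d Hd]; exists d; intros u v Hu Hv;
 (eapply Rle_lt_trans; [|apply (Hd u v Hu Hv)]).
 - exact (Cmod_fst (f (u, v) - f (s, t))%C).
 - exact (Cmod_snd (f (u, v) - f (s, t))%C).
Qed.

Lemma continuity_2d_pt_ext_open (f g : R -> R -> R) x y e : 0 < e ->
 (forall u v, Rabs (u - x) < e -> Rabs (v - y) < e -> f u v = g u v) ->
 continuity_2d_pt f x y -> continuity_2d_pt g x y.
Proof.
 intros He H. apply continuity_2d_pt_ext_loc. exists (mkposreal e He). ar.
Qed.

Section Rect.
Variables (f f1 f2 : C -> C) (a b c d e : R).
Hypotheses (Hab : a <= b) (Hcd : c <= d) (He : 0 < e).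
Hypothesis H1 : forall s t, a - e < s < b + e -> c - e < t < d + e -> Cd f (s, t) (f1 (s, t)).
Hypothesis H2 : forall s t, a - e < s < b + e -> c - e < t < d + e -> Cd f1 (s, t) (f2 (s, t)).

Lemma VI_Rd s : a <= s <= b -> Rd (fun u => VI f u c d) s (VI f1 s c d).
Proof.
 intros Hs.
 ha Loc : locally s (fun u => a - e < u < b + e).
 { exists (mkposreal e He). intros u Hu. unfold ball in Hu; simpl in Hu.
  unfold AbsRing_ball, abs, minus, plus, opp in Hu; simpl in Hu. apply Rabs_def2 in Hu. lra. }
 ha Der : forall u t, a - e < u < b + e -> c - e < t < d + e ->
  Derive (fun z => fst (f (z, t))) u = fst (f1 (u, t)) /\ Derive (fun z => snd (f (z, t))) u = snd (f1 (u, t)).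
 { intros u t Hu Ht. destruct (Cd_re f u t _ (H1 u t Hu Ht)) as [D1 D2].
  split; apply is_derive_unique; asm. }
 ha exC : forall u, a - e < u < b + e -> exCI (fun t => f (u, t)) c d.
 { intros u Hu. apply exCI_cont; [ar|]. intros t Ht. eapply Cd_Ccont_im. apply H1; lra. }
 split; unfold VI, CInt; simpl.
 - evar_last.
  + apply (is_derive_RInt_param (fun u t => fst (f (u, t)))).
   * revert Loc; apply filter_imp. intros u Hu t; rewrite Rmin_left, Rmax_right by exact Hcd; intros Ht.
    exists (fst (f1 (u, t))). exact (proj1 (Cd_re f u t _ (H1 u t Hu !!))).
   * intros t; rewrite Rmin_left, Rmax_right by exact Hcd; intros Ht.
    apply (continuity_2d_pt_ext_open (fun u v => fst (f1 (u, v))) _ s t e He).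
    { intros u v Hu Hv. apply Rabs_def2 in Hu, Hv. symmetry. apply (proj1 (Der u v !! !!)). }
    exact (proj1 (Cd_cont2 f1 s t (f2 (s, t)) (H2 s t !! !!))).
   * revert Loc; apply filter_imp. intros u Hu. exact (proj1 (exC u Hu)).
  + apply RInt_ext. rewrite Rmin_left, Rmax_right by exact Hcd. intros t Ht. apply (proj1 (Der s t !! !!)).
 - evar_last.
  + apply (is_derive_RInt_param (fun u t => snd (f (u, t)))).
   * revert Loc; apply filter_imp. intros u Hu t; rewrite Rmin_left, Rmax_right by exact Hcd; intros Ht.
    exists (snd (f1 (u, t))). exact (proj2 (Cd_re f u t _ (H1 u t Hu !!))).
   * intros t; rewrite Rmin_left, Rmax_right by exact Hcd; intros Ht.
    apply (continuity_2d_pt_ext_open (fun u v => snd (f1 (u, v))) _ s t e He).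
    { intros u v Hu Hv. apply Rabs_def2 in Hu, Hv. symmetry. apply (proj2 (Der u v !! !!)). }
    exact (proj2 (Cd_cont2 f1 s t (f2 (s, t)) (H2 s t !! !!))).
   * revert Loc; apply filter_imp. intros u Hu. exact (proj2 (exC u Hu)).
  + apply RInt_ext. rewrite Rmin_left, Rmax_right by exact Hcd. intros t Ht. apply (proj2 (Der s t !! !!)).
Qed.

(** Complex differentiability gives d/dt f(s, t) = i f'(s, t), so the integral in t telescopes:
    Cauchy's theorem on a rectangle in differential form. *)
Lemma VI_deriv_sides s : a <= s <= b -> (VI f1 s c d*Ci = f (s, d) - f (s, c))%C.
Proof.
 intros Hs. unfold VI.
 ha Hc : forall t, c <= t <= d -> Ccont (fun u => f1 (s, u)) t.
 { intros t Ht. eapply Cd_Ccont_im. apply H2; lra. }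
 rewrite Cmult_comm, <- CInt_scal by (apply exCI_cont; asm).
 apply (Rd_FTC (fun t => f (s, t))); [ar| |].
 - intros t Ht. note (Cd_im f s t _ (H1 s t !! !!)) as K.
  rewrite Cmult_comm in K. exact K.
 - intros t Ht. apply Ccont_mult; [apply Ccont_const|apply Hc; exact Ht].
Qed.

Lemma Cmod_Ci : Cmod Ci = 1.
Proof. unfold Cmod, Ci; cbn [fst snd]. replace (0 ^ 2 + 1 ^ 2) with 1 by ring. apply sqrt_1. Qed.

(** Cauchy's theorem as an inequality: by [VI_deriv_sides] the rate of change of the vertical
    integral is seen on the two horizontal sides only. *)
Lemma rect_bound M : (forall s, a <= s <= b -> Cmod (f (s, d)) + Cmod (f (s, c)) <= M) ->
 Cmod (VI f b c d - VI f a c d)%C <= (b - a)*M.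
Proof.
 intros HM. apply (Rd_mvi (fun u => VI f u c d) (fun u => VI f1 u c d)); [ar| |].
 - intros t Ht; apply VI_Rd; exact Ht.
 - intros t Ht. specialize (HM t Ht).
  replace (Cmod (VI f1 t c d)) with (Cmod (VI f1 t c d*Ci)%C) by (rewrite Cmod_mult, Cmod_Ci; ring).
  rewrite VI_deriv_sides by exact Ht. note (Cmod_sub_le (f (t, d)) (f (t, c))). lra.
Qed.
End Rect.

Lemma cR_sq (f : R -> R) x : continuous f x -> continuous (fun u => f u ^ 2) x.
Proof. intros H. simpl. apply cR_mult; [exact H|]. apply cR_mult; [exact H|apply c_cst]. Qed.
Create HintDb ana.
#[export] Hint Resolve c_cst continuous_id hol_const hol_id Ccont_const : ana.
Ltac cont := intros; first [asm | solve [auto 4 with ana] | match goal with H : _ |- _ => apply H; first [asm | lra] end | lazymatch goal with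
 | |- continuous (fun t => _*_) _ => apply cR_mult; cont
 | |- continuous (fun t => _ + _) _ => apply cR_plus; cont
 | |- continuous (fun t => _ - _) _ => apply cR_minus; cont
 | |- continuous (fun t => - _) _ => apply cR_opp; cont
 | |- continuous (fun t => _ ^ 2) _ => apply cR_sq; cont
 | |- continuous (fun t => Rabs _) _ => apply cR_abs; cont
 | |- hol _ (fun t => _ + _)%C => apply hol_plus; cont
 | |- hol _ (fun t => _ - _)%C => apply hol_minus; cont
 | |- hol _ (fun t => _*_)%C => apply hol_mult; cont
 | |- hol _ (fun t => - _)%C => apply hol_opp; cont
 | |- ex_RInt _ _ _ => apply ex_RInt_cont; [lra | cont]
 end | eapply cR_der; auto_derive; [first [exact I | lra | repeat split; lra] | refl]].
Ltac ar ::= intros; lazymatch goal with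
 | |- continuous _ _ => cont
 | |- hol _ _ => cont
 | |- ex_RInt _ _ _ => cont
 | |- _ = _ => first [lra | refl | ring | solve [field; pos] | solve [simpl; ring] | solve [apply pair_eq; simpl; ring] | solve [auto]]
 | |- _ /\ _ => split; ar
 | _ => first [lra | solve [pos] | solve [mono] | solve [auto] | solve [simpl; lra] | solve [cont] | nra]
 end.

(** * Cauchy on rectangles and the maximum principle *)

Lemma rect_hol U (f : C -> C) a b c d e M : a <= b -> c <= d -> 0 < e ->
 (forall s t, a - e < s < b + e -> c - e < t < d + e -> U (s, t)) -> hol U f ->
 (forall s, a <= s <= b -> Cmod (f (s, d)) + Cmod (f (s, c)) <= M) ->
 Cmod (VI f b c d - VI f a c d)%C <= (b - a)*M.
Proof.
 intros Hab Hcd He HU (f1&f2&A1&A2) HM.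
 apply (rect_bound f f1 f2 a b c d e); auto.
Qed.

Lemma hol_cont U (f : C -> C) (s t : R) : hol U f -> U (s, t) -> Ccont (fun u => f (s, u)) t.
Proof. intros (f1&f2&A1&A2) H. eapply Cd_Ccont_im, A1, H. Qed.

Lemma hol_exCI U (f : C -> C) (s c d : R) : c <= d -> hol U f -> (forall t, c <= t <= d -> U (s, t)) ->
 exCI (fun t => f (s, t)) c d.
Proof. intros Hcd H HU. apply exCI_cont; [ar|]. intros t Ht. eapply hol_cont; eauto. Qed.

Lemma Cmod_pt (x y x' y' : R) : Cmod ((x, y) - (x', y'))%C <= Rabs (x - x') + Rabs (y - y').
Proof. via Cmod_le_sum. ar. Qed.

Lemma pt_neq (x y x' y' : R) : x <> x' \/ y <> y' -> ((x, y) : C) <> (x', y').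
Proof. intros [H|H] E; injection E; auto. Qed.

(* A bounded isolated singularity (ps, pt) is cut out by a thin vertical slab. *)
Lemma rect_sing U (f : C -> C) a b c d e (ps pt r K M : R) :
 a < ps < b -> c < pt < d -> 0 < e -> 0 < r ->
 (forall s t, a - e < s < b + e -> c - e < t < d + e -> ((s, t) : C) <> (ps, pt) -> U (s, t)) ->
 hol U f ->
 (forall s t, Rabs (s - ps) < r -> Rabs (t - pt) < r -> ((s, t) : C) <> (ps, pt) -> Cmod (f (s, t)) <= K) ->
 (forall s, a <= s <= b -> Cmod (f (s, d)) + Cmod (f (s, c)) <= M) ->
 Cmod (VI f b c d - VI f a c d)%C <= (b - a)*M.
Proof.
 intros Ha Hc He Hr HU Hf HK HM.
 ha K0 : 0 <= K.
 { etr; [apply Cmod_ge_0|apply (HK (ps + r/2) pt)].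
  - replace (ps + r/2 - ps) with (r/2) by ring. rewrite Rabs_pos_eq; lra.
  - replace (pt - pt) with 0 by ring. rewrite Rabs_R0; lra.
  - apply pt_neq. ar. }
 ha M0 : 0 <= M.
 { specialize (HM a !!). note (Cmod_ge_0 (f (a, d))). note (Cmod_ge_0 (f (a, c))). lra. }
 apply le_epsilon. intros eps Heps.
 set (n := Rmin (Rmin (r/2) (eps/(4*M + 8*K + 1))) (Rmin (Rmin ((ps - a)/2) ((b - ps)/2)) (Rmin ((pt - c)/2) ((d - pt)/2)))).
 ha Hn : 0 < n.
 { unfold n. repeat apply Rmin_pos; try lra. ar. }
 assert (n <= r/2 /\ n <= eps/(4*M + 8*K + 1) /\ n <= (ps - a)/2 /\ n <= (b - ps)/2 /\ n <= (pt - c)/2 /\ n <= (d - pt)/2) as (N1&N2&N3&N4&N5&N6).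
 { unfold n. repeat split; repeat (first [apply Rle_refl | (etr; [ar|]; progress (try apply Rle_refl); solve [repeat (first [apply Rle_refl | via Rmin_l | via Rmin_r])]) | idtac]);
  try (etr; [apply Rmin_l|apply Rmin_l]); try (etr; [apply Rmin_l|apply Rmin_r]);
  try (etr; [apply Rmin_r|etr; [apply Rmin_l|apply Rmin_l]]);
  try (etr; [apply Rmin_r|etr; [apply Rmin_l|apply Rmin_r]]);
  try (etr; [apply Rmin_r|etr; [apply Rmin_r|apply Rmin_l]]);
  try (etr; [apply Rmin_r|etr; [apply Rmin_r|apply Rmin_r]]). }
 clearbody n.
 ha EN : n*(4*M + 8*K) <= eps.
 { mid (eps/(4*M + 8*K + 1)*(4*M + 8*K + 1)).
  - apply mle; lra.
  - right; field; lra. }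
 ha Lft : Cmod (VI f (ps - n) c d - VI f a c d)%C <= (ps - n - a)*M.
 { apply (rect_hol U f a (ps - n) c d (Rmin e (n/2))); try lra.
  - apply Rmin_pos; lra.
  - intros s t Hs Ht. note (Rmin_l e (n/2)); note (Rmin_r e (n/2)).
   apply HU; try lra. apply pt_neq; left; lra.
  - exact Hf.
  - ar. }
 ha Rgt : Cmod (VI f b c d - VI f (ps + n) c d)%C <= (b - (ps + n))*M.
 { apply (rect_hol U f (ps + n) b c d (Rmin e (n/2))); try lra.
  - apply Rmin_pos; lra.
  - intros s t Hs Ht. note (Rmin_l e (n/2)); note (Rmin_r e (n/2)).
   apply HU; try lra. apply pt_neq; left; lra.
  - exact Hf.
  - ar. }
 ha HKs : forall s t, ps - n <= s <= ps + n -> pt - n <= t <= pt + n -> ((s, t) : C) <> (ps, pt) -> Cmod (f (s, t)) <= K.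
 { intros s t Hs Ht Hne. apply HK; try exact Hne; apply Rabs_def1; lra. }
 ha Top : Cmod (VI f (ps + n) (pt + n) d - VI f (ps - n) (pt + n) d)%C <= (ps + n - (ps - n))*(M + K).
 { apply (rect_hol U f (ps - n) (ps + n) (pt + n) d (Rmin e (n/2))); try lra.
  - apply Rmin_pos; lra.
  - intros s t Hs Ht. note (Rmin_l e (n/2)); note (Rmin_r e (n/2)).
   apply HU; try lra. apply pt_neq; right; lra.
  - exact Hf.
  - intros s Hs. specialize (HM s !!). note (Cmod_ge_0 (f (s, c))).
   assert (Cmod (f (s, pt + n)) <= K) by (apply HKs; try lra; apply pt_neq; right; lra). lra. }
 ha Bot : Cmod (VI f (ps + n) c (pt - n) - VI f (ps - n) c (pt - n))%C <= (ps + n - (ps - n))*(M + K).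
 { apply (rect_hol U f (ps - n) (ps + n) c (pt - n) (Rmin e (n/2))); try lra.
  - apply Rmin_pos; lra.
  - intros s t Hs Ht. note (Rmin_l e (n/2)); note (Rmin_r e (n/2)).
   apply HU; try lra. apply pt_neq; right; lra.
  - exact Hf.
  - intros s Hs. specialize (HM s !!). note (Cmod_ge_0 (f (s, d))).
   assert (Cmod (f (s, pt - n)) <= K) by (apply HKs; try lra; apply pt_neq; right; lra). lra. }
 ha exI : forall s c' d', s = ps - n \/ s = ps + n -> c <= c' <= d' -> d' <= d -> exCI (fun t => f (s, t)) c' d'.
 { intros s c' d' Hs Hc' Hd'. apply (hol_exCI U); [lra|ar|].
  intros t Ht. apply HU; try lra; destruct Hs; subst s; try lra; apply pt_neq; left; lra. }
 ha Mid : forall s, s = ps - n \/ s = ps + n -> Cmod (VI f s (pt - n) (pt + n)) <= 2*n*K.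
 { intros s Hs. replace (2*n) with (pt + n - (pt - n)) by ring. apply CInt_norm_const; [lra|ar|].
  intros t Ht. apply HKs; destruct Hs; subst s; try lra; apply pt_neq; left; lra. }
 ha Spl : forall s, s = ps - n \/ s = ps + n ->
  VI f s c d = (VI f s c (pt - n) + VI f s (pt - n) (pt + n) + VI f s (pt + n) d)%C.
 { intros s Hs. unfold VI.
  rewrite CInt_Chasles by ar. rewrite CInt_Chasles by ar. ar. }
 note (Mid (ps - n) (or_introl eq_refl)) as M1.
 note (Mid (ps + n) (or_intror eq_refl)) as M2.
 replace (VI f b c d - VI f a c d)%C with
  ((VI f b c d - VI f (ps + n) c d) + ((VI f (ps + n) c d - VI f (ps - n) c d)) + (VI f (ps - n) c d - VI f a c d))%C by ring.
 via Cmod_tri3.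
 ha MM : Cmod (VI f (ps + n) c d - VI f (ps - n) c d)%C <= n*(4*M + 8*K).
 { rewrite (Spl (ps + n)), (Spl (ps - n)) by auto.
  match goal with |- Cmod (?a + ?b' + ?c' - (?a' + ?b'' + ?c''))%C <= _ =>
   replace (a + b' + c' - (a' + b'' + c''))%C with ((a - a') + (b' - b'') + (c' - c''))%C by ring end.
  via Cmod_tri3.
  note (Cmod_sub_le (VI f (ps + n) (pt - n) (pt + n)) (VI f (ps - n) (pt - n) (pt + n))). lra. }
 nra.
Qed.

(** A difference quotient has a removable singularity; boundedness near it is all that [rect_sing]
    asks, so no value has to be filled in. *)
Lemma quot_bounded (g : C -> C) (ps pt : R) l : Cd g (ps, pt) l -> exists r K, 0 < r /\
 forall s t, Rabs (s - ps) < r -> Rabs (t - pt) < r -> ((s, t) : C) <> (ps, pt) ->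
  Cmod ((g (s, t) - g (ps, pt))/((s, t) - (ps, pt)))%C <= K.
Proof.
 intros H. destruct (Cd_lip g (ps, pt) l H) as [d [Hd Hh]].
 exists (d/2), (Cmod l + 1). split; [lra|]. intros s t Hs Ht Hne.
 set (h := ((s, t) - (ps, pt))%C).
 ha hn : h <> 0%C.
 { intros E. apply Hne. replace ((s, t) : C) with (h + (ps, pt))%C by ar. rewrite E. cring. }
 ha Hm : Cmod h < d. { eapply Rle_lt_trans; [apply Cmod_pt|lra]. }
 specialize (Hh h Hm). replace ((ps, pt) + h)%C with ((s, t) : C) in Hh by ar.
 rewrite Cmod_div by exact hn. apply Rle_div_l; [apply Cmod_gt_0; exact hn|ar].
Qed.

Lemma sumsq_pos k y : 0 < k -> 0 < k ^ 2 + y ^ 2.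
Proof. ar. Qed.

Lemma RInt_atan (k t0 a b : R) : 0 < k ->
 is_RInt (fun t => k/(k ^ 2 + (t - t0) ^ 2)) a b (atan ((b - t0)/k) - atan ((a - t0)/k)).
Proof.
 intros Hk. apply (is_RInt_derive (fun t => atan ((t - t0)/k))).
 - intros t _. apply (dR_eq _ _ (/ (1 + ((t - t0)/k) ^ 2)*(1/k))).
  + note (sumsq_pos k (t - t0) Hk). field. split; lra.
  + apply (dR_comp atan (fun t => (t - t0)/k)).
   * auto_derive; [ar|]. field; lra.
   * apply is_derive_Reals. note (derivable_pt_lim_atan ((t - t0)/k)) as D.
    exact D.
 - intros t _. apply cR_mult; [ar|]. apply cR_inv.
  + apply (cR_der _ _ (2*(t - t0))). auto_derive; [ar|ring].
  + ar.
Qed.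

Lemma Cinv_fst (x y : R) : fst (/ (x, y))%C = x/(x ^ 2 + y ^ 2).
Proof. ar. Qed.

Lemma Cpow_sub_hol U (Q : C -> C) n (w : C) : hol U Q -> hol U (fun z => Q z ^ n - w)%C.
Proof. intros. apply hol_minus; [apply hol_pow; asm|ar]. Qed.

Lemma pow_bounded_le1 q K : 0 <= q -> (forall n, q ^ n <= K) -> q <= 1.
Proof.
 intros Hq H. destruct (Rle_dec q 1) as [|N]; [ar|].
 destruct (Pow_x_infinity q ltac:(rewrite Rabs_pos_eq; lra) (K + 1)) as [n Hn].
 specialize (Hn n (le_n n)). rewrite Rabs_pos_eq in Hn by ar.
 specialize (H n). lra.
Qed.

Section MaxRect.
Variables (Q : C -> C) (a b T s0 t0 : R).
Hypotheses (Ha : a < s0 < b) (HT : Rabs t0 + 2*(b - a) + 1 <= T).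
Hypothesis HL : forall t, - T <= t <= T -> Cmod (Q (a, t)) <= 1 /\ Cmod (Q (b, t)) <= 1.
Hypothesis HS : forall s, a <= s <= b -> Cmod (Q (s, T)) <= 1 /\ Cmod (Q (s, - T)) <= 1.
Hypothesis HC : forall t, - T <= t <= T -> Ccont (fun u => Q (a, u)) t /\ Ccont (fun u => Q (b, u)) t.
Let fn n := fun z : C => ((Q z ^ n - Q (s0, t0) ^ n)/(z - (s0, t0)))%C.
Hypothesis HR : forall n M, (forall s, a <= s <= b -> Cmod (fn n (s, T)) + Cmod (fn n (s, - T)) <= M) ->
 Cmod (VI (fn n) b (- T) T - VI (fn n) a (- T) T)%C <= (b - a)*M.

Lemma atan_half_lower y : 1 <= y -> 1/2 <= atan y.
Proof.
 intros H. mid (atan 1).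
 - rewrite atan_1. note PI2_1. lra.
 - destruct H as [H|<-]; [left; apply atan_increasing; exact H|lra].
Qed.

Lemma pow_le_one q n : 0 <= q <= 1 -> q ^ n <= 1.
Proof. intros. rewrite <- (pow1 n). ar. Qed.

(** Landau's power trick. Integrate (Q^n - w)/(z - z0), with w = Q(z0)^n, over both vertical sides.
    By [HR] the difference is at most what the horizontal sides give, which is 1 + |w|. The part
    with w is |w| times a difference of integrals of 1/(z - z0) of modulus at least 2, and the part
    with Q^n is bounded independently of n. Hence |w| <= [K] for every n, which forces |Q(z0)| <=
    1. *)
Lemma max_rect_core : Cmod (Q (s0, t0)) <= 1.
Proof.
 ha T0 : 0 < T by (note (Rabs_pos t0); lra).
 assert (t0 < T /\ - T < t0) as [tT1 tT2].
 { note (Rle_abs t0); note (Rle_abs (- t0)) as X; rewrite Rabs_Ropp in X. lra. }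
 set (K := 2*T * / (b - s0) + 2*T * / (s0 - a) + 1).
 apply (pow_bounded_le1 _ K); [ar|]. intros n.
 set (w := (Q (s0, t0) ^ n)%C). ha Hw : Cmod w = Cmod (Q (s0, t0)) ^ n by apply Cmod_pow.
 rewrite <- Hw. set (q := Cmod w).
 ha q0 : 0 <= q by apply Cmod_ge_0.
 ha zn : forall s t, s <> s0 \/ t <> t0 -> ((s, t) - (s0, t0))%C <> 0%C.
 { intros s t H E. apply (pt_neq s t s0 t0 H).
  replace ((s, t) : C) with (((s, t) - (s0, t0)) + (s0, t0))%C by cring. rewrite E. cring. }
 ha cinv : forall s t, s <> s0 -> Ccont (fun u => / ((s, u) - (s0, t0)))%C t.
 { intros s t H. apply (Cd_Ccont_im (fun z => / (z - (s0, t0)))%C s t (- RtoC 1/(((s, t) - (s0, t0))*((s, t) - (s0, t0))))%C).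
  apply (Cd_inv (fun z => z - (s0, t0))%C); [ar|].
  replace (RtoC 1) with (1 - 0)%C by ring. apply (Cd_minus (fun z => z)); [apply Cd_id|apply Cd_const]. }
 ha cpow : forall (g : R -> C) t m, Ccont g t -> Ccont (fun u => g u ^ m)%C t.
 { intros g t m H. induction m; simpl; [ar|apply Ccont_mult; asm]. }
 ha sides : forall s, s <> s0 -> (forall t', - T <= t' <= T -> Cmod (Q (s, t')) <= 1) ->
  (forall t', - T <= t' <= T -> Ccont (fun u => Q (s, u)) t') ->
  exCI (fun t => Q (s, t) ^ n/((s, t) - (s0, t0)))%C (- T) T /\
  exCI (fun t => / ((s, t) - (s0, t0)))%C (- T) T /\
  VI (fn n) s (- T) T = (CInt (fun t => Q (s, t) ^ n/((s, t) - (s0, t0)))%C (- T)%R T - w*CInt (fun t => / ((s, t) - (s0, t0)))%C (- T)%R T)%C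
  /\ Cmod (CInt (fun t => Q (s, t) ^ n/((s, t) - (s0, t0)))%C (- T) T) <= 2*T * / Rabs (s - s0).
 { intros s Hs HQ HQc.
  ha E1 : exCI (fun t => Q (s, t) ^ n/((s, t) - (s0, t0)))%C (- T) T.
  { apply exCI_cont; [lra|]. intros t Ht. apply Ccont_mult; ar. }
  ha E2 : exCI (fun t => / ((s, t) - (s0, t0)))%C (- T) T.
  { apply exCI_cont; [lra|]. ar. }
  repeat split; try apply E1; try apply E2.
  - unfold VI, fn. rewrite <- CInt_scal by exact E2. rewrite <- (CInt_minus _ _ _ _ E1 (exCI_scal w _ _ _ E2)).
   apply CInt_ext; [lra|]. intros t Ht. fold w. unfold Cdiv. ring.
  - replace (2*T * / Rabs (s - s0)) with ((T - - T) * / Rabs (s - s0)) by ring.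
   apply CInt_norm_const; [lra|ar|]. intros t Ht.
   ha P : 0 < Rabs (s - s0) by (apply Rabs_pos_lt; lra).
   rewrite Cmod_div by ar. rewrite Cmod_pow.
   ha D : Rabs (s - s0) <= Cmod ((s, t) - (s0, t0))%C by exact (Cmod_fst ((s, t) - (s0, t0))%C).
   mid (1 * / Cmod ((s, t) - (s0, t0))%C).
   + apply mle_r; [ar|].
    apply pow_le_one; split; ar.
   + rewrite Rmult_1_l. ar. }
 destruct (sides a !! (fun t H => proj1 (HL t H)) (fun t H => proj1 (HC t H))) as (Ea1&Ea2&Ea3&Ea4).
 destruct (sides b !! (fun t H => proj2 (HL t H)) (fun t H => proj2 (HC t H))) as (Eb1&Eb2&Eb3&Eb4).
 rewrite Rabs_left in Ea4 by lra. rewrite Rabs_pos_eq in Eb4 by lra.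
 replace (- (a - s0)) with (s0 - a) in Ea4 by ring.
 set (Ib := CInt (fun t => / ((b, t) - (s0, t0)))%C (- T) T) in *.
 set (Ia := CInt (fun t => / ((a, t) - (s0, t0)))%C (- T) T) in *.
 (* The integral of Re 1/(z - z0) is a difference of arctangents. By [HT] both ends lie further from
    t0 than b - s0, so each arctangent is at least arctan 1 > 1/2 in absolute value. *)
 ha Fb : 1 <= fst Ib.
 { unfold Ib, CInt; simpl fst at 1.
  rewrite (RInt_ext _ (fun t => (b - s0)/((b - s0) ^ 2 + (t - t0) ^ 2))).
  2:{ ar. }
  rewrite (RI_uniq _ _ _ _ (RInt_atan (b - s0) t0 (- T) T !!)).
  assert (1/2 <= atan ((T - t0)/(b - s0))).
  { apply atan_half_lower. apply Rle_div_r; [lra|]. note (Rle_abs t0). lra. }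
  assert (1/2 <= atan (- ((- T - t0)/(b - s0)))).
  { apply atan_half_lower. replace (- ((- T - t0)/(b - s0))) with ((T + t0)/(b - s0)) by ar.
   apply Rle_div_r; [lra|]. note (Rle_abs (- t0)) as X; rewrite Rabs_Ropp in X. lra. }
  rewrite atan_opp in H0. lra. }
 ha Fa : fst Ia <= - 1.
 { unfold Ia, CInt; simpl fst at 1.
  rewrite (RInt_ext _ (fun t => (-1)*((s0 - a)/((s0 - a) ^ 2 + (t - t0) ^ 2)))).
  2:{ intros t _. transitivity ((a - s0)/((a - s0) ^ 2 + (t - t0) ^ 2)); [ar|].
   replace ((a - s0) ^ 2) with ((s0 - a) ^ 2) by ring. ar. }
  note (RInt_atan (s0 - a) t0 (- T) T !!) as R.
  rewrite RInt_scalR by (eexists; exact R). rewrite (RI_uniq _ _ _ _ R).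
  assert (1/2 <= atan ((T - t0)/(s0 - a))).
  { apply atan_half_lower. apply Rle_div_r; [lra|]. note (Rle_abs t0). lra. }
  assert (1/2 <= atan (- ((- T - t0)/(s0 - a)))).
  { apply atan_half_lower. replace (- ((- T - t0)/(s0 - a))) with ((T + t0)/(s0 - a)) by ar.
   apply Rle_div_r; [lra|]. note (Rle_abs (- t0)) as X; rewrite Rabs_Ropp in X. lra. }
  rewrite atan_opp in H0. lra. }
 ha D2 : 2 <= Cmod (Ib - Ia)%C.
 { note (Cmod_fst (Ib - Ia)%C) as X. change (fst (Ib - Ia)%C) with (fst Ib - fst Ia) in X.
  note (Rle_abs (fst Ib - fst Ia)). lra. }
 ha bT : 0 < b - a by lra.
 specialize (HR n ((1 + q)/(b - a))).
 (* At height T the distance to z0 is at least 2 (b - a); this is where the margin in [HT] is spent.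
    The two horizontal sides together give 1 + q against the 2q gained from [D2]. *)
 ha Sd : forall s t, a <= s <= b -> t = T \/ t = - T -> Cmod (fn n (s, t)) <= (1 + q)/(2*(b - a)).
 { intros s t Hs Ht. unfold fn. fold w.
  ha tn : 2*(b - a) <= Rabs (t - t0).
  { destruct Ht; subst t.
   - rewrite Rabs_pos_eq by lra. note (Rle_abs t0). lra.
   - rewrite Rabs_left by lra. note (Rle_abs (- t0)) as X; rewrite Rabs_Ropp in X. lra. }
  assert (t <> t0) by ar.
  rewrite Cmod_div by ar.
  ha D : Rabs (t - t0) <= Cmod ((s, t) - (s0, t0))%C by exact (Cmod_snd ((s, t) - (s0, t0))%C).
  apply mle; [ar| |  |].
  - left; apply inv_pos; lra.
  - via Cmod_sub_le. fold q. rewrite Cmod_pow. apply add_le_r.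
   apply pow_le_one. split; [ar|]. destruct Ht; subst t; apply HS; exact Hs.
  - ar. }
 specialize (HR ltac:(intros s Hs; note (Sd s T Hs (or_introl eq_refl)); note (Sd s (- T) Hs (or_intror eq_refl));
  replace ((1 + q)/(b - a)) with ((1 + q)/(2*(b - a)) + (1 + q)/(2*(b - a))) by ar; lra)).
 replace ((b - a)*((1 + q)/(b - a))) with (1 + q) in HR by ar.
 rewrite Ea3, Eb3 in HR.
 set (A := CInt (fun t => Q (a, t) ^ n/((a, t) - (s0, t0)))%C (- T) T) in *.
 set (B := CInt (fun t => Q (b, t) ^ n/((b, t) - (s0, t0)))%C (- T) T) in *.
 ha Fin : q*Cmod (Ib - Ia)%C <= 1 + q + Cmod A + Cmod B.
 { unfold q. rewrite <- Cmod_mult.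
  replace (w*(Ib - Ia))%C with ((B - A) - ((B - w*Ib) - (A - w*Ia)))%C by ring.
  via Cmod_sub_le. note (Cmod_sub_le B A). fold q. lra. }
 unfold K. nra.
Qed.
End MaxRect.

Lemma hol_comp (U V : C -> Prop) (f g : C -> C) : (forall s, U s -> V (g s)) -> hol V f -> hol U g ->
 hol U (fun z => f (g z)).
Proof.
 intros HV (f1&f2&A1&A2) (g1&g2&B1&B2).
 exists (fun z => f1 (g z)*g1 z)%C, (fun z => (f2 (g z)*g1 z)*g1 z + f1 (g z)*g2 z)%C.
 split; intros s Hs.
 - apply Cd_comp; auto.
 - apply (Cd_mult (fun z => f1 (g z)) g1); auto. apply (Cd_comp f1 g); auto.
Qed.

(** * The complex exponential *)

Definition cexp (z : C) : C := (exp (fst z)*cos (snd z), exp (fst z)*sin (snd z)).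

Lemma cexp_plus a b : cexp (a + b)%C = (cexp a*cexp b)%C.
Proof.
 unfold cexp, Cmult, Cplus; simpl. rewrite exp_plus, cos_plus, sin_plus. ar.
Qed.

Lemma cexp_0 : cexp 0%C = 1%C.
Proof. unfold cexp; simpl. rewrite exp_0, cos_0, sin_0. ar. Qed.

Lemma Cmod_cexp z : Cmod (cexp z) = exp (fst z).
Proof.
 unfold cexp, Cmod; simpl fst; simpl snd.
 replace ((exp (fst z)*cos (snd z)) ^ 2 + (exp (fst z)*sin (snd z)) ^ 2) with (Rsqr (exp (fst z))).
 - apply sqrt_Rsqr. left; apply exp_pos.
 - note (sin2_cos2 (snd z)). unfold Rsqr in *. nra.
Qed.

Lemma Rd_ext (f g : R -> C) t l : (forall u, f u = g u) -> Rd f t l -> Rd g t l.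
Proof.
 intros E [A B]; split.
 - apply (is_derive_ext (fun u => fst (f u))); [intros; now rewrite E|ar].
 - apply (is_derive_ext (fun u => snd (f u))); [intros; now rewrite E|ar].
Qed.

Lemma Rd_eq (f : R -> C) t (l l' : C) : l = l' -> Rd f t l -> Rd f t l'.
Proof. now intros ->. Qed.

Lemma Cmult_Rl (x p q : R) : (x*(p, q))%C = (x*p, x*q).
Proof. ar. Qed.

Lemma Rd_cexp_ray (h : C) t : Rd (fun x => cexp (x*h)%C) t (h*cexp (t*h))%C.
Proof.
 destruct h as [p q].
 apply (Rd_ext (fun x => cexp (x*p, x*q))); [intros; now rewrite Cmult_Rl|].
 rewrite Cmult_Rl. split; unfold cexp, Cmult; simpl; auto_derive; auto; ring.
Qed.

Lemma Rd_plus (f g : R -> C) t (l m : C) : Rd f t l -> Rd g t m -> Rd (fun u => f u + g u)%C t (l + m)%C.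
Proof. intros [A B] [A' B']; split; simpl; apply dR_plus; asm. Qed.

Lemma Rd_minus (f g : R -> C) t (l m : C) : Rd f t l -> Rd g t m -> Rd (fun u => f u - g u)%C t (l - m)%C.
Proof. intros [A B] [A' B']; split; simpl; apply dR_minus; asm. Qed.

Lemma Rd_const c t : Rd (fun _ => c) t 0%C.
Proof. split; simpl; apply (is_derive_const (K := R_AbsRing) (V := RNM)). Qed.

Lemma Rd_ray (h : C) t : Rd (fun x => x*h)%C t h.
Proof.
 destruct h as [p q]. apply (Rd_ext (fun x => (x*p, x*q))); [ar|].
 split; simpl; auto_derive; auto; ring.
Qed.

Lemma cexp_remainder (h : C) : Cmod (cexp h - 1)%C <= Cmod h*exp (Cmod h) /\
 Cmod (cexp h - 1 - h)%C <= Cmod h ^ 2*exp (Cmod h).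
Proof.
 ha B : forall t, 0 <= t <= 1 -> Cmod (cexp (t*h)%C) <= exp (Cmod h).
 { intros t Ht. rewrite Cmod_cexp.
  replace (fst (t*h)%C) with (t*fst h) by ar.
  note (Rle_abs (fst h)); note (Cmod_fst h); note (Cmod_ge_0 h).
  destruct (Rle_lt_or_eq_dec (t*fst h) (Cmod h)) as [H2|H2]; [nra| |].
  - left; apply exp_increasing; exact H2.
  - ar. }
 ha B1 : forall x, 0 <= x <= 1 -> Cmod (cexp (x*h) - 1)%C <= x*(Cmod h*exp (Cmod h)).
 { intros x Hx.
  note (Rd_mvi (fun u => cexp (u*h)%C) (fun u => h*cexp (u*h))%C 0 x (Cmod h*exp (Cmod h)) !!
   (fun t _ => Rd_cexp_ray h t)) as H. cbv beta in H.
  replace (cexp (0*h)%C) with (RtoC 1) in H.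
  2:{ replace (0*h)%C with (RtoC 0) by ring. symmetry; apply cexp_0. }
  rewrite Rminus_0_r in H. apply H. intros t Ht. rewrite Cmod_mult.
  apply mle_l; ar. }
 split.
 - specialize (B1 1 !!). replace (1*h)%C with h in B1 by ring. lra.
 - note (Rd_mvi (fun u => cexp (u*h) - u*h)%C (fun u => h*(cexp (u*h) - 1))%C 0 1 (Cmod h*(Cmod h*exp (Cmod h))) !!) as H. cbv beta in H.
  replace (cexp (1*h) - 1*h - (cexp (0*h) - 0*h))%C with (cexp h - 1 - h)%C in H.
  2:{ replace (0*h)%C with (RtoC 0) by ring. rewrite cexp_0. replace (1*h)%C with h by ring. ring. }
  replace (Cmod h ^ 2*exp (Cmod h)) with ((1 - 0)*(Cmod h*(Cmod h*exp (Cmod h)))) by ring.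
  apply H.
  + intros t Ht. apply (Rd_eq _ _ (h*cexp (t*h) - h)%C); [ring|]. apply Rd_minus; [apply Rd_cexp_ray|apply Rd_ray].
  + intros t Ht. rewrite Cmod_mult. apply mle_l; [ar|].
   etr; [apply B1; exact Ht|].
   assert (0 <= Cmod h*exp (Cmod h)) by ar.
   nra.
Qed.

Lemma Cd_cexp z : Cd cexp z (cexp z).
Proof.
 intros eps He.
 ha P : 0 < Cmod (cexp z)*exp 1 by (rewrite Cmod_cexp; apply mul_pos; apply exp_pos).
 exists (Rmin 1 (eps/(Cmod (cexp z)*exp 1))). split.
 { apply Rmin_pos; [lra|]. ar. }
 intros h Hh. rmins. rewrite cexp_plus.
 replace (cexp z*cexp h - cexp z - cexp z*h)%C with (cexp z*(cexp h - 1 - h))%C by ring.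
 rewrite Cmod_mult. destruct (cexp_remainder h) as [_ H1].
 note (Cmod_ge_0 h) as h0.
 ha E : exp (Cmod h) <= exp 1 by ar.
 ha Q : Cmod h*(Cmod (cexp z)*exp 1) <= eps.
 { mid (eps/(Cmod (cexp z)*exp 1)*(Cmod (cexp z)*exp 1)).
  - apply mle_r; lra.
  - right; field. ar. }
 mid (Cmod (cexp z)*(Cmod h ^ 2*exp 1)).
 - apply mle_l; [ar|]. via H1.
  apply mle_l; ar.
 - nra.
Qed.

Lemma hol_cexp U : hol U cexp.
Proof. exists cexp, cexp; split; intros; apply Cd_cexp. Qed.

Section MaxRect2.
Variables (U : C -> Prop) (Q : C -> C) (a b T s0 t0 e : R).
Hypotheses (Ha : a < s0 < b) (HT : Rabs t0 + 2*(b - a) + 1 <= T) (He : 0 < e).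
Hypothesis HQ : hol U Q.
Hypothesis HL : forall t, - T <= t <= T -> Cmod (Q (a, t)) <= 1 /\ Cmod (Q (b, t)) <= 1.
Hypothesis HS : forall s, a <= s <= b -> Cmod (Q (s, T)) <= 1 /\ Cmod (Q (s, - T)) <= 1.

Lemma quot_hol n : hol (fun z => U z /\ z <> (s0, t0)) (fun z => (Q z ^ n - Q (s0, t0) ^ n)/(z - (s0, t0)))%C.
Proof.
 apply (hol_div _ (fun z => Q z ^ n - Q (s0, t0) ^ n)%C (fun z => z - (s0, t0))%C).
 - intros s [_ H] E. apply H. replace s with ((s - (s0, t0)) + (s0, t0))%C by cring. rewrite E. cring.
 - apply (hol_sub _ U); [ar|]. apply Cpow_sub_hol, HQ.
 - ar.
Qed.

Lemma quot_bdd n : U (s0, t0) -> exists r K, 0 < r /\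
 forall s t, Rabs (s - s0) < r -> Rabs (t - t0) < r -> ((s, t) : C) <> (s0, t0) ->
  Cmod ((Q (s, t) ^ n - Q (s0, t0) ^ n)/((s, t) - (s0, t0)))%C <= K.
Proof.
 intros H0. destruct (hol_pow U Q n HQ) as (g1&g2&G1&G2).
 exact (quot_bounded (fun z => Q z ^ n)%C s0 t0 _ (G1 _ H0)).
Qed.

Lemma T_bd : - T < t0 < T.
Proof.
 note (Rle_abs t0); note (Rle_abs (- t0)) as X; rewrite Rabs_Ropp in X. lra.
Qed.

(** The rectangle is cut at an abscissa m between s0 and ps. The left half contains only the
    removable singularity of the quotient, the right half only the point (ps, pt), near which Q is
    merely bounded. *)
Lemma max_rect_sing (ps pt r' K' : R) : s0 < ps < b -> - T < pt < T -> 0 < r' ->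
 (forall s t, a - e < s < b + e -> - T - e < t < T + e -> ((s, t) : C) <> (ps, pt) -> U (s, t)) ->
 (forall s t, Rabs (s - ps) < r' -> Rabs (t - pt) < r' -> ((s, t) : C) <> (ps, pt) -> Cmod (Q (s, t)) <= K') ->
 Cmod (Q (s0, t0)) <= 1.
Proof.
 intros Hps Hpt Hr' HU HK'. note T_bd as TB.
 apply (max_rect_core Q a b T s0 t0 Ha HT HL HS).
 - intros t Ht. split; eapply hol_cont; try exact HQ; apply HU; try lra; apply pt_neq; left; lra.
 - intros n M HM. destruct (quot_bdd n) as (r&K&Hr&HK); [apply HU; try lra; apply pt_neq; left; lra|].
  set (m := (s0 + ps)/2).
  set (fn := fun z : C => ((Q z ^ n - Q (s0, t0) ^ n)/(z - (s0, t0)))%C) in *.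
  ha S1 : Cmod (VI fn m (- T) T - VI fn a (- T) T)%C <= (m - a)*M.
  { apply (rect_sing (fun z => U z /\ z <> (s0, t0)) _ a m (- T) T (Rmin e ((ps - s0)/2)) s0 t0 r K M); auto.
   - unfold m; lra.
   - apply Rmin_pos; lra.
   - intros s t Hs Ht Hne. note (Rmin_l e ((ps - s0)/2)); note (Rmin_r e ((ps - s0)/2)).
    split; [|ar]. apply HU; unfold m in *; try lra. apply pt_neq; left; lra.
   - apply quot_hol.
   - intros s Hs. apply HM. unfold m in Hs; lra. }
  ha S2 : Cmod (VI fn b (- T) T - VI fn m (- T) T)%C <= (b - m)*M.
  { apply (rect_sing (fun z => U z /\ z <> (s0, t0)) _ m b (- T) T (Rmin e ((ps - s0)/2)) ps pt (Rmin r' ((ps - s0)/2)) ((K' ^ n + Cmod (Q (s0, t0) ^ n)%C) * / ((ps - s0)/2)) M); auto.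
   - unfold m; lra.
   - apply Rmin_pos; lra.
   - apply Rmin_pos; lra.
   - intros s t Hs Ht Hne. note (Rmin_l e ((ps - s0)/2)); note (Rmin_r e ((ps - s0)/2)).
    split; [apply HU; unfold m in *; try lra; exact Hne|apply pt_neq; left; unfold m in *; lra].
   - apply quot_hol.
   - intros s t Hs Ht Hne. rmins. unfold fn.
    ha D : (ps - s0)/2 <= Cmod ((s, t) - (s0, t0))%C.
    { note (Cmod_fst ((s, t) - (s0, t0))%C) as X. change (fst ((s, t) - (s0, t0))%C) with (s - s0) in X.
     note (Rle_abs (s - s0)). assert (Rabs (s - ps) < (ps - s0)/2) as Y by lra.
     apply Rabs_def2 in Y. lra. }
    rewrite Cmod_div by (apply Cmod_gt_0; lra).
    apply mle; [ar|ar| |ar].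
    via Cmod_sub_le. apply add_le_r. rewrite Cmod_pow.
    apply pow_incr. split; [ar|]. apply HK'; try lra. exact Hne.
   - intros s Hs. apply HM. unfold m in Hs; lra. }
  replace (VI fn b (- T) T - VI fn a (- T) T)%C with ((VI fn b (- T) T - VI fn m (- T) T) + (VI fn m (- T) T - VI fn a (- T) T))%C by ring.
  via Cmod_triangle. lra.
Qed.
End MaxRect2.

(** * Iterated integrals of continuous functions of two variables *)

Definition c2 (f : R -> R -> R) : Prop := forall x y, continuity_2d_pt f x y.

Lemma c2_swap f : c2 f -> c2 (fun x y => f y x).
Proof.
 intros H x y eps. destruct (H y x eps) as [d Hd]. exists d. ar.
Qed.

Lemma c2_1 f x y : c2 f -> continuous (fun v => f x v) y.
Proof.
 intros H. apply cR_iff. apply continuity_pt_locally. intros eps. destruct (H x y eps) as [d Hd].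
 exists d. intros u Hu. apply Hd; [|ar].
 replace (x - x) with 0 by ring. rewrite Rabs_R0. ar.
Qed.

Lemma c2_RInt f a b y : a <= b -> c2 f -> continuous (fun v => RInt (fun x => f x v) a b) y.
Proof.
 intros Hab H. apply cR_iff. apply continuity_pt_locally. intros eps.
 ha P : 0 < eps/(b - a + 1) by (apply div_pos; [ar|lra]).
 destruct (uniform_continuity_2d_1d f a b y (fun x _ => H x y) (mkposreal _ P)) as [d Hd]. simpl in Hd.
 exists d. intros v Hv.
 ha ex : forall w, ex_RInt (fun x => f x w) a b.
 { intros w. apply ex_RInt_cont; [ar|]. intros t _. apply (c2_1 (fun x y => f y x)), c2_swap, H. }
 rewrite <- (RInt_minus (V := RCN)) by apply ex.
 eapply Rle_lt_trans; [apply abs_RInt_le; [ar|apply (ex_RInt_minus (V := RNM)); apply ex]|].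
 apply Rle_lt_trans with (RInt (fun _ => eps/(b - a + 1)) a b).
 - apply RInt_le; [ar| |apply ex_RInt_const|].
  + apply ex_RInt_cont; [ar|]. intros t _. apply cR_abs, cR_minus; apply (c2_1 (fun x y => f y x)), c2_swap, H.
  + intros x Hx. left. change (Rabs (v - y) < d) in Hv.
   note (cond_pos d) as dp. apply Rabs_def2 in Hv. apply (Hd x y x v); try lra.
   * replace (x - x) with 0 by ring. rewrite Rabs_R0. apply cond_pos.
 - rewrite RInt_const. unfold scal; simpl; unfold mult; simpl.
  apply Rlt_le_trans with ((b - a + 1)*(eps/(b - a + 1))).
  + apply Rmult_lt_compat_r; lra.
  + right; field; lra.
Qed.

(** As functions of the upper limit b, both sides vanish at a and have the same derivative. *)
Lemma fubini f a b c d : a <= b -> c <= d -> c2 f ->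
 RInt (fun x => RInt (fun y => f x y) c d) a b = RInt (fun y => RInt (fun x => f x y) a b) c d.
Proof.
 intros Hab Hcd H.
 set (Psi := fun X => RInt (fun x => RInt (fun y => f x y) c d) a X - RInt (fun y => RInt (fun x => f x y) a X) c d).
 ha cg : forall x, continuous (fun x => RInt (fun y => f x y) c d) x.
 { intros x. apply (c2_RInt (fun x y => f y x)); [ar|apply c2_swap, H]. }
 ha exg : forall X Y, ex_RInt (fun x => RInt (fun y => f x y) c d) X Y.
 { intros X Y. apply (ex_RInt_continuous (V := RCN)). ar. }
 ha cx : forall y x, continuous (fun x => f x y) x by (intros; apply (c2_1 (fun x y => f y x)), c2_swap, H).
 ha ex1 : forall X Y y, ex_RInt (fun x => f x y) X Y.
 { intros X Y y. apply (ex_RInt_continuous (V := RCN)). ar. }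
 ha D1 : forall X, is_derive (fun X => RInt (fun x => RInt (fun y => f x y) c d) a X) X (RInt (fun y => f X y) c d).
 { intros X. apply (is_derive_RInt (V := RCN) (fun x => RInt (fun y => f x y) c d) _ a).
  - exists (mkposreal 1 Rlt_0_1). intros z _. apply (RInt_correct (V := RCN)), exg.
  - ar. }
 ha D0 : forall X y, is_derive (fun X => RInt (fun x => f x y) a X) X (f X y).
 { intros X y. apply (is_derive_RInt (V := RCN) (fun x => f x y) _ a).
  - exists (mkposreal 1 Rlt_0_1). intros z _. apply (RInt_correct (V := RCN)), ex1.
  - ar. }
 ha D2 : forall X, a <= X <= b -> is_derive (fun X => RInt (fun y => RInt (fun x => f x y) a X) c d) X (RInt (fun y => f X y) c d).
 { intros X HX.
  ha E : forall X y, Derive (fun X => RInt (fun x => f x y) a X) X = f X y by (intros; apply is_derive_unique, D0).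
  replace (RInt (fun y => f X y) c d) with (RInt (fun y => Derive (fun X => RInt (fun x => f x y) a X) X) c d).
  2:{ apply RInt_ext. ar. }
  apply (is_derive_RInt_param (fun X y => RInt (fun x => f x y) a X)).
  - apply filter_forall. intros X' t _. exists (f X' t). apply D0.
  - intros t _. apply (continuity_2d_pt_ext f); ar.
  - apply filter_forall. intros X'. apply ex_RInt_cont; [ar|]. intros t _.
   (* The parameter rule wants integrability for every X', also for X' below a, where the inner
      integral is reversed. *)
   destruct (Rle_dec a X') as [L|L]; [apply c2_RInt; asm|].
   apply (continuous_ext (fun v => - RInt (fun x => f x v) X' a)).
   + intros v. apply (opp_RInt_swap (V := RCN)), ex1.
   + apply cR_opp, c2_RInt; [lra|ar]. }
 ha DP : forall X, a <= X <= b -> is_derive Psi X 0.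
 { intros X HX. unfold Psi. eapply dR_eq; [|apply dR_minus; [apply D1|apply D2; exact HX]]. ring. }
 ha Z : Psi a = 0.
 { unfold Psi. rewrite RInt_point.
  rewrite (RInt_ext _ (fun _ => 0)).
  - rewrite RInt_const. unfold zero, scal; simpl; unfold mult; simpl. ring.
  - intros y _. apply (RInt_point (V := RCN)). }
 ha Eb : Psi b - Psi a = 0.
 { destruct (MVT_gen Psi a b (fun _ => 0)) as [z [_ Ez]].
  - rewrite Rmin_left, Rmax_right by exact Hab. intros; apply DP; lra.
  - rewrite Rmin_left, Rmax_right by exact Hab. intros x Hx. apply cR_iff. eapply cR_der, DP, Hx.
  - lra. }
 unfold Psi in Eb at 1. lra.
Qed.

#[export] Hint Resolve hol_cexp : ana.

(** * Borel-Caratheodory *)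

Lemma cexp_2PI r : cexp (r, 2*PI) = cexp (r, 0).
Proof. unfold cexp; simpl. rewrite cos_2PI, sin_2PI, cos_0, sin_0. ar. Qed.

Lemma le_exp_limit y K r : (forall r', r' <= r -> y <= K*exp r') -> y <= 0.
Proof.
 intros H. apply le_epsilon. intros eps He. rewrite Rplus_0_l.
 set (r' := Rmin r (ln (eps/(Rabs K + 1)))).
 note (Rabs_pos K).
 ha P : 0 < eps/(Rabs K + 1) by ar.
 specialize (H r' (Rmin_l _ _)). etr; [ar|].
 ha E : exp r' <= eps/(Rabs K + 1).
 { rewrite <- (exp_ln (eps/(Rabs K + 1))) by exact P.
  destruct (Rle_lt_or_eq_dec r' (ln (eps/(Rabs K + 1))) (Rmin_r _ _)) as [Q|Q];
  ar. }
 note (Rle_abs K). note (exp_pos r').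
 mid ((Rabs K + 1)*(eps/(Rabs K + 1))).
 - mid ((Rabs K + 1)*exp r'); [nra|ar].
 - right; field; lra.
Qed.

Lemma Ceq_of_le (a b : C) : Cmod (a - b)%C <= 0 -> a = b.
Proof.
 intros H. ha E : Cmod (a - b)%C = 0 by (note (Cmod_ge_0 (a - b)%C); lra).
 apply Cmod_eq_0 in E. replace a with ((a - b) + b)%C by ring. rewrite E. ring.
Qed.

Section Circle.
Variables (u : C -> R) (L : C -> C) (c : C) (R0 : R).
Hypothesis HR0 : 0 < R0.
Hypothesis HL : hol (fun s => Cmod (s - c)%C < R0) L.
Hypothesis Hu : forall (g : R -> C) t m, Cmod (g t - c)%C < R0 -> Rd g t m ->
 is_derive (fun x => u (g x)) t (fst (L (g t)*m)%C).

Let lam := ln R0.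
(** In the coordinate w = log(s - c) circles around c become vertical segments of length 2 pi, so
    the rectangle calculus applies to them. The map [L] is the derivative of a function with real
    part [u]; [Hu] expresses this along paths, so no primitive has to be constructed. *)
Let W (w : C) : C := (c + cexp w)%C.
Let V (w : C) : Prop := fst w < lam.

Lemma W_in w : V w -> Cmod (W w - c)%C < R0.
Proof.
 intros H. unfold W. replace (c + cexp w - c)%C with (cexp w) by ring. rewrite Cmod_cexp.
 rewrite <- (exp_ln R0) by exact HR0. apply exp_increasing; exact H.
Qed.

Lemma Cd_W w : Cd W w (cexp w).
Proof.
 unfold W. apply (Cd_eq _ _ (0 + cexp w)%C); [ring|].
 apply (Cd_plus (fun _ => c) cexp); [apply Cd_const|apply Cd_cexp].
Qed.

Lemma hol_W X : hol X W.
Proof. exists cexp, cexp; split; intros; [apply Cd_W|apply Cd_cexp]. Qed.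

Lemma hol_LW : hol V (fun w => L (W w)).
Proof. apply (hol_comp V (fun s => Cmod (s - c)%C < R0) L W W_in HL (hol_W V)). Qed.

(** The derivative of the integral in r is the difference of [Psi] at the two ends of the segment,
    which is 0 by periodicity: Cauchy's theorem for an annulus. *)
Lemma circ_const (Psi : C -> C) r1 r2 : hol V Psi -> (forall r, Psi (r, 2*PI) = Psi (r, 0)) ->
 r1 <= r2 -> r2 < lam -> VI Psi r2 0 (2*PI) = VI Psi r1 0 (2*PI).
Proof.
 intros (p1&p2&A1&A2) HP H12 H2. apply Ceq_of_le. note PI_RGT_0.
 replace 0 with ((r2 - r1)*0) at 3 by ring.
 ha K1 : forall s t, r1 - (lam - r2) < s < r2 + (lam - r2) -> 0 - (lam - r2) < t < 2*PI + (lam - r2) -> Cd Psi (s, t) (p1 (s, t)).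
 { intros s t Hs _. apply A1. unfold V; simpl; lra. }
 ha K2 : forall s t, r1 - (lam - r2) < s < r2 + (lam - r2) -> 0 - (lam - r2) < t < 2*PI + (lam - r2) -> Cd p1 (s, t) (p2 (s, t)).
 { intros s t Hs _. apply A2. unfold V; simpl; lra. }
 apply (Rd_mvi (fun r => VI Psi r 0 (2*PI)) (fun r => VI p1 r 0 (2*PI))); [ar| |].
 - intros t Ht. apply (VI_Rd Psi p1 p2 r1 r2 0 (2*PI) (lam - r2)); try asm; lra.
 - intros t Ht.
  note (VI_deriv_sides Psi p1 p2 r1 r2 0 (2*PI) (lam - r2) !! !! K1 K2 t Ht) as E.
  rewrite HP in E. replace (Psi (t, 0) - Psi (t, 0))%C with (RtoC 0) in E by cring.
  ha E2 : Cmod (VI p1 t 0 (2*PI)) = 0.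
  { replace (Cmod (VI p1 t 0 (2*PI))) with (Cmod (VI p1 t 0 (2*PI)*Ci)%C) by (rewrite Cmod_mult, Cmod_Ci; ring).
   rewrite E. apply Cmod_0. }
  lra.
Qed.

Lemma near_center : exists d K, 0 < d < R0 /\ 0 <= K /\ forall h, Cmod h < d -> Cmod (L (c + h)) <= K /\ Cmod (L (c + h) - L c)%C <= K*Cmod h.
Proof.
 destruct HL as (l1&l2&A1&A2).
 ha A : Cd L c (l1 c).
 { apply A1. replace (c - c)%C with (RtoC 0) by ring. rewrite Cmod_0. ar. }
 destruct (Cd_lip L c _ A) as [d [Hd Hh]]. note (Cmod_ge_0 (l1 c)); note (Cmod_ge_0 (L c)).
 exists (Rmin (Rmin d 1) (R0/2)), (Cmod (l1 c) + 1 + Cmod (L c)). split; [|split; [lra|]].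
 { split; [repeat apply Rmin_pos; lra|]. note (Rmin_r (Rmin d 1) (R0/2)). lra. }
 intros h H1. rmins. specialize (Hh h !!). note (Cmod_ge_0 h).
 note (Cmod_triangle (L (c + h) - L c)%C (L c)) as T. replace (L (c + h) - L c + L c)%C with (L (c + h)) in T by ring. ar.
Qed.

(** The circle is shrunk: the integral does not depend on the radius e^r', and the integrand tends
    to l as r' tends to minus infinity. *)
Lemma VI_circle (E : C -> C) (l : C) r : hol V E -> (forall r, E (r, 2*PI) = E (r, 0)) ->
 (exists d K, 0 < d /\ forall w, exp (fst w) < d -> Cmod (L (W w)*E w - l)%C <= K*exp (fst w)) ->
 r < lam -> VI (fun w => L (W w)*E w)%C r 0 (2*PI) = (2*PI*l)%C.
Proof.
 intros HE EP (d&K&Hd&HK) Hr. note PI_RGT_0. ha Hh : hol V (fun w => L (W w)*E w)%C by (apply hol_mult; [apply hol_LW|ar]).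
 apply Ceq_of_le. apply (le_exp_limit _ (2*PI*K) (Rmin r (ln (d/2)))). intros r' Hr'.
 assert (r' <= r /\ r' <= ln (d/2)) as [R1 R2] by (split; etr; try exact Hr'; [apply Rmin_l|apply Rmin_r]).
 ha ed : exp r' < d by (apply exp_le in R2; rewrite exp_ln in R2; lra).
 rewrite (circ_const (fun w => L (W w)*E w)%C r' r Hh); auto.
 2:{ intros x. unfold W. rewrite cexp_2PI, EP. ar. }
 ha ex : exCI (fun t => L (W (r', t))*E (r', t))%C 0 (2*PI) by (apply (hol_exCI V (fun w => L (W w)*E w)%C); [lra|ar|intros; unfold V; simpl; lra]).
 replace (2*PI*l)%C with (CInt (fun _ => l) 0 (2*PI)).
 2:{ unfold CInt. rewrite !RInt_const. unfold scal; simpl; unfold mult; simpl. ar. }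
 unfold VI. rewrite <- CInt_minus; [|ar|split; apply ex_RInt_const].
 replace (2*PI*K*exp r') with ((2*PI - 0)*(K*exp r')) by ring.
 apply CInt_norm_const; [lra| |ar].
 apply (exCI_plus _ _ _ _ ex). apply exCI_opp. split; apply ex_RInt_const.
Qed.

Lemma VI_Lpow r : r < lam -> VI (fun w => L (W w)*1)%C r 0 (2*PI) = (2*PI*L c)%C /\
 VI (fun w => L (W w)*cexp w)%C r 0 (2*PI) = 0%C /\ VI (fun w => L (W w)*(cexp w*cexp w))%C r 0 (2*PI) = 0%C.
Proof.
 intros Hr. destruct near_center as (d&K&Hd&K0&HK). ha Z : (2*PI*0)%C = 0%C by ring. rewrite <- Z.
 ha B : forall w, exp (fst w) < Rmin d 1 -> exp (fst w) <= 1 /\ Cmod (L (W w)) <= K /\ Cmod (L (W w) - L c)%C <= K*exp (fst w).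
 { intros w Hw. rmins. split; [lra|]. note (HK (cexp w)) as Q. rewrite Cmod_cexp in Q. ar. }
 ha D : 0 < Rmin d 1 by (apply Rmin_pos; lra).
 repeat split; apply VI_circle; try exact Hr; try (intros; rewrite ?cexp_2PI; refl); try (exists (Rmin d 1), K; split; [ar|]; intros w Hw; destruct (B w Hw) as (B1&B2&B3)).
 - apply hol_const.
 - replace (L (W w)*1 - L c)%C with (L (W w) - L c)%C by ring. exact B3.
 - apply hol_cexp.
 - replace (L (W w)*cexp w - 0)%C with (L (W w)*cexp w)%C by ring. rewrite Cmod_mult, Cmod_cexp. ar.
 - apply hol_mult; apply hol_cexp.
 - replace (L (W w)*(cexp w*cexp w) - 0)%C with (L (W w)*(cexp w*cexp w))%C by ring. rewrite !Cmod_mult, !Cmod_cexp. note (exp_pos (fst w)).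
  apply mle; [ar|ar|ar|nra].
Qed.

Lemma u_dr r t : r < lam -> is_derive (fun x => u (W (x, t))) r (fst (L (W (r, t))*cexp (r, t))%C).
Proof. intros H. apply (Hu (fun x => W (x, t))); [apply W_in; exact H|]. apply (Cd_re W r t), Cd_W. Qed.

Lemma u_dt r t : r < lam -> is_derive (fun x => u (W (r, x))) t (fst (L (W (r, t))*(cexp (r, t)*Ci))%C).
Proof. intros H. apply (Hu (fun x => W (r, x))); [apply W_in; exact H|]. apply (Cd_im W r t), Cd_W. Qed.

Variables p q : R.
Hypothesis Hpq : p ^ 2 + q ^ 2 = 1.
(** This is 1 + Re ((p + iq) e^{it}), nonnegative because p^2 + q^2 = 1. Integrated against it, u
    yields its mean and one directional component of L(c). *)
Let om t := 1 + (p*cos t - q*sin t).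
Let os t := t + (p*sin t + q*cos t).

Lemma om_cont t : continuous om t.
Proof. apply (cR_der _ _ (- p*sin t - q*cos t)). unfold om. auto_derive; [ar|ring]. Qed.

Lemma om_bd t : 0 <= om t <= 2.
Proof.
 unfold om. note (sin2_cos2 t) as S. unfold Rsqr in S.
 assert ((p*cos t - q*sin t) ^ 2 <= 1).
 { replace 1 with ((p ^ 2 + q ^ 2)*(cos t*cos t + sin t*sin t)) by (rewrite Hpq; lra).
  note (pow2_ge_0 (p*sin t + q*cos t)). nra. }
 ar.
Qed.

Lemma om_int : RInt om 0 (2*PI) = 2*PI.
Proof.
 apply RI_uniq. replace (2*PI) with (os (2*PI) - os 0) at 2 by (unfold os; rewrite sin_2PI, cos_2PI, sin_0, cos_0; ring).
 apply (is_RInt_derive os); intros; [unfold os, om; auto_derive; [ar|ring]|apply om_cont].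
Qed.

Let A (x : R) : R := RInt (fun t => u (W (x, t))*om t) 0 (2*PI).

Lemma mw_cont r t : r < lam -> continuous (fun t => u (W (r, t))*om t) t.
Proof. intros H. apply cR_mult; [eapply cR_der, u_dt, H|apply om_cont]. Qed.

Lemma mw_ex r : r < lam -> ex_RInt (fun t => u (W (r, t))*om t) 0 (2*PI).
Proof. intros H. note PI_RGT_0. apply ex_RInt_cont; [lra|]. intros t _. apply mw_cont, H. Qed.

Lemma mw_der r : r < lam -> is_derive A r
 (RInt (fun t => fst (L (W (r, t))*cexp (r, t))%C*om t) 0 (2*PI)).
Proof.
 intros H. note PI_RGT_0.
 ha Loc : locally r (fun x => x < lam).
 { exists (mkposreal (lam - r) !!). intros x Hx. change (Rabs (x - r) < lam - r) in Hx.
  apply Rabs_def2 in Hx. lra. }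
 ha E : forall x t, x < lam -> is_derive (fun y => u (W (y, t))*om t) x (fst (L (W (x, t))*cexp (x, t))%C*om t).
 { intros x t Hx. eapply dR_eq; [|apply dR_mult; [apply u_dr; exact Hx|apply (is_derive_const (K := R_AbsRing) (V := RNM))]].
  simpl. unfold zero; simpl. ring. }
 eapply dR_eq; [|apply (is_derive_RInt_param (fun x t => u (W (x, t))*om t))].
 - apply RInt_ext. intros t _. apply is_derive_unique, E, H.
 - revert Loc; apply filter_imp. intros x Hx t _. eexists. apply E, Hx.
 - intros t _.
  apply (continuity_2d_pt_ext_open (fun x y => fst (L (W (x, y))*cexp (x, y))%C*om y) _ r t (lam - r)); [lra| |].
  { intros x y Hx _. apply Rabs_def2 in Hx. symmetry. apply is_derive_unique, E. lra. }
  apply continuity_2d_pt_mult.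
  + ha Hh : hol V (fun w => L (W w)*cexp w)%C by (apply hol_mult; [apply hol_LW|ar]).
   destruct Hh as (h1&h2&B1&B2).
   exact (proj1 (Cd_cont2 (fun w => L (W w)*cexp w)%C r t _ (B1 (r, t) H))).
  + apply (continuity_1d_2d_pt_comp om (fun _ y => y)); [apply cR_iff, om_cont|apply continuity_2d_pt_id2].
 - revert Loc; apply filter_imp. intros x Hx. apply mw_ex, Hx.
Qed.

Lemma A_der r : r < lam -> is_derive A r (PI*(p*fst (L c) + q*snd (L c))*exp r).
Proof.
 intros H. eapply dR_eq; [|apply mw_der, H]. destruct (VI_Lpow r H) as (E0&E1&E2).
 ha ex : forall E, hol V E -> exCI (fun t => L (W (r, t))*E (r, t))%C 0 (2*PI).
 { intros E HE. note PI_RGT_0. apply (hol_exCI V (fun w => L (W w)*E w)%C); [lra|apply hol_mult; [apply hol_LW|ar]|ar]. }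
 note (ex (fun _ => 1%C) (hol_const V _)) as x0. note (ex cexp (hol_cexp V)) as x1. note (ex (fun w => cexp w*cexp w)%C (hol_mult V _ _ (hol_cexp V) (hol_cexp V))) as x2. cbv beta in x0, x1, x2.
 (* The identity 2 Re a Re b = Re (a b + a conj b) splits the integrand into the three moments of
    [VI_Lpow]; only the constant one, with weight [k0], survives. *)
 set (k0 := (exp r/2*p, - (exp r/2*q)) : C). set (k2 := (exp (- r)/2*p, exp (- r)/2*q) : C).
 transitivity (fst (CInt (fun t => k0*(L (W (r, t))*1) + (L (W (r, t))*cexp (r, t) + k2*(L (W (r, t))*(cexp (r, t)*cexp (r, t)))))%C 0 (2*PI))).
 - apply RInt_ext. intros t _. unfold om, k0, k2, cexp. cbn [fst snd]. generalize (L (W (r, t))). intros [a b].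
  note (sin2_cos2 t) as S. unfold Rsqr in S. note (exp_pos r). rewrite exp_Ropp. unfold RtoC, Cmult, Cplus. cbn [fst snd]. set (e := exp r) in *.
  req. field_simplify_eq; [|lra]. replace (sin t ^ 2) with (1 - cos t ^ 2) by ar. ring.
 - unfold VI in E0, E1, E2. set (f0 := fun t => (L (W (r, t))*1)%C) in *. set (f1 := fun t => (L (W (r, t))*cexp (r, t))%C) in *. set (f2 := fun t => (L (W (r, t))*(cexp (r, t)*cexp (r, t)))%C) in *.
  note (exCI_scal k2 f2 0 (2*PI) x2) as y2. change (fst (CInt (fun t => k0*f0 t + (f1 t + k2*f2 t))%C 0 (2*PI)) = PI*(p*fst (L c) + q*snd (L c))*exp r).
  rewrite (CInt_plus (fun t => k0*f0 t)%C (fun t => f1 t + k2*f2 t)%C _ _ (exCI_scal k0 f0 _ _ x0) (exCI_plus f1 _ _ _ x1 y2)), (CInt_plus f1 (fun t => k2*f2 t)%C _ _ x1 y2), (CInt_scal k0 f0 _ _ x0), (CInt_scal k2 f2 _ _ x2).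
  rewrite E0, E1, E2. unfold k0. destruct (L c) as [a b]. simpl. field.
Qed.

Lemma u_ray r t d K : (forall h, Cmod h < d -> Cmod (L (c + h)) <= K) -> exp r < d -> d < R0 -> Rabs (u (W (r, t)) - u c) <= K*exp r.
Proof.
 intros HK Hr Hd. set (h := cexp (r, t)). ha hm : Cmod h = exp r by apply Cmod_cexp. note (exp_pos r) as e0.
 ha S : forall x, 0 <= x <= 1 -> Cmod (x*h) < d by (intros x Hx; rewrite Cmod_mult, Cmod_R, hm, Rabs_pos_eq by lra; nra).
 ha D : forall x, 0 <= x <= 1 -> is_derive (fun x : R => u (c + x*h)%C) x (fst (L (c + x*h)*h)%C).
 { intros x Hx. apply (Hu (fun x => c + x*h)%C).
  - replace (c + x*h - c)%C with (x*h)%C by ring. note (S x Hx). lra.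
  - apply (Rd_eq _ _ (0 + h)%C); [ring|]. apply Rd_plus; [apply Rd_const|apply Rd_ray]. }
 destruct (MVT_gen (fun x : R => u (c + x*h)%C) 0 1 (fun x : R => fst (L (c + x*h)*h)%C)) as [z [Hz Ez]];
  try (minmax; intros; try apply cR_iff; try eapply cR_der; apply D; lra).
 minmax in Hz. replace (c + 0*h)%C with c in Ez by ring. replace (c + 1*h)%C with (W (r, t)) in Ez by ar.
 rewrite Ez, Rminus_0_r, Rmult_1_r. via Cmod_fst. rewrite Cmod_mult, hm. apply mle_r; [lra|]. ar.
Qed.

(** By [A_der] the difference of A(r) and its multiple of e^r is constant in r; as the circle
    shrinks it tends to 2 pi u(c). *)
Lemma u_moment r : r < lam -> A r = 2*PI*u c + PI*(p*fst (L c) + q*snd (L c))*exp r.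
Proof.
 intros Hr. note PI_RGT_0 as P0. destruct near_center as (d&K&Hd&K0&HK). set (ka := PI*(p*fst (L c) + q*snd (L c))).
 ha B : Rabs (A r - ka*exp r - 2*PI*u c) <= 0.
 { apply (le_exp_limit _ (4*PI*K + Rabs ka) (Rmin r (ln (d/2)))). intros r' Hr'.
  assert (r' <= r /\ r' <= ln (d/2)) as [R1 R2] by (split; etr; try exact Hr'; [apply Rmin_l|apply Rmin_r]).
  ha ed : exp r' < d by (apply exp_le in R2; rewrite exp_ln in R2; lra). note (exp_pos r') as e0.
  replace (A r - ka*exp r) with (A r' - ka*exp r').
  2: { ha D : forall x, r' <= x <= r -> is_derive (fun x => A x - ka*exp x) x 0 by (intros x Hx; eapply dR_eq; [|apply dR_minus; [apply A_der; lra|apply dR_scal, is_derive_exp]]; unfold ka; ring).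
    destruct (MVT_gen (fun x => A x - ka*exp x) r' r (fun _ => 0)) as [z [_ Ez]]; try (minmax; intros; try apply cR_iff; try eapply cR_der; apply D; lra). lra. }
  ha Q : Rabs (A r' - 2*PI*u c) <= 2*PI*(2*(K*exp r')).
  { ha exo : ex_RInt om 0 (2*PI) by (apply ex_RInt_cont; [lra|]; intros; apply om_cont). ha rl : r' < lam by lra.
   replace (2*PI*u c) with (RInt (fun t => u c*om t) 0 (2*PI)) by (rewrite RInt_scalR by exact exo; rewrite om_int; req; ring).
   unfold A. rewrite <- (RInt_minus (V := RCN)); [|apply mw_ex, rl|apply ex_RInt_scalR, exo].
   replace (2*PI*(2*(K*exp r'))) with ((2*PI - 0)*(2*(K*exp r'))) by ring. apply abs_RInt_le_const; [lra| |].
   - apply (ex_RInt_minus (V := RNM)); [apply mw_ex, rl|apply ex_RInt_scalR, exo].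
   - intros t _. unfold minus, plus, opp; simpl. replace (u (W (r', t))*om t + - (u c*om t)) with (om t*(u (W (r', t)) - u c)) by ring.
    rewrite Rabs_mult. note (om_bd t). rewrite (Rabs_pos_eq (om t)) by lra. apply mle; [lra|ar|lra|]. apply (u_ray r' t d K); [ar|lra|lra]. }
  replace (A r' - ka*exp r' - 2*PI*u c) with ((A r' - 2*PI*u c) + - (ka*exp r')) by ring. via Rabs_triang.
  rewrite Rabs_Ropp, Rabs_mult, (Rabs_pos_eq (exp r')) by lra. lra. }
 note (Rabs_pos (A r - ka*exp r - 2*PI*u c)). ha E : A r - ka*exp r - 2*PI*u c = 0 by (apply Rabs_eq_0; lra). lra.
Qed.
End Circle.

(** The weight is nonnegative with integral 2 pi, so u <= M bounds the moment of u by 2 pi M. The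
    direction (p, q) is free, and choosing it turns [u_moment] into a bound for |L(c)| r; at the end
    r tends to [R0]. *)
Lemma borel_caratheodory (u : C -> R) (L : C -> C) (c : C) (R0 M : R) : 0 < R0 ->
 hol (fun s => Cmod (s - c)%C < R0) L ->
 (forall (g : R -> C) t m, Cmod (g t - c)%C < R0 -> Rd g t m -> is_derive (fun x => u (g x)) t (fst (L (g t)*m)%C)) ->
 (forall s, Cmod (s - c)%C < R0 -> u s <= M) ->
 Cmod (L c) <= 2/R0*(M - u c).
Proof.
 intros HR0 HL Hu HM. note PI_RGT_0 as PI0.
 ha uc : u c <= M by (apply HM; replace (c - c)%C with (RtoC 0) by ring; rewrite Cmod_0; exact HR0).
 ha K : forall r, 0 < r < R0 -> Cmod (L c)*r <= 2*(M - u c).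
 { intros r Hr. ha lr : ln r < ln R0 by (apply ln_increasing; lra).
  replace (Cmod (L c)*r) with (Cmod (r*L c)%C) by (rewrite Cmod_mult, Cmod_R, Rabs_pos_eq by lra; ring).
  apply Cmod_dual. intros [w1 w2] Hw.
  ha N1 : w1 ^ 2 + (- w2) ^ 2 = 1. { note (Cmod_sq (w1, w2)) as S. rewrite Hw in S. simpl in *. lra. }
  note (u_moment u L c R0 HR0 HL Hu w1 (- w2) N1 (ln r) lr) as F. rewrite exp_ln in F by lra.
  note (om_int w1 (- w2)) as O. set (om := fun t => 1 + (w1*cos t - - w2*sin t)) in *.
  ha exo : ex_RInt om 0 (2*PI) by (apply ex_RInt_cont; [lra|]; intros; apply om_cont).
  ha Q : RInt (fun t => u (c + cexp (ln r, t))%C*om t) 0 (2*PI) <= RInt (fun t => M*om t) 0 (2*PI).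
  { apply RInt_le; [lra|apply (mw_ex u L c R0 HR0 Hu), lr|apply ex_RInt_scalR, exo|]. intros t _.
   apply mle_r; [apply om_bd, N1|]. apply HM, (W_in c R0 HR0 (ln r, t)), lr. }
  change (RInt (fun t => u (c + cexp (ln r, t))%C*om t) 0 (2*PI) = 2*PI*u c + PI*(w1*fst (L c) + - w2*snd (L c))*r) in F.
  rewrite F, RInt_scalR in Q by exact exo. change (RInt om 0 (2*PI) = 2*PI) in O. rewrite O in Q. destruct (L c) as [l1 l2]. simpl in *. ar. }
 apply (mle_rr R0); [ar|].
 replace (2/R0*(M - u c)*R0) with (2*(M - u c)) by ar.
 apply Rnot_lt_le. intros N. note (Cmod_ge_0 (L c)).
 ha LP : 0 < Cmod (L c) by ar.
 set (y := 2*(M - u c)/Cmod (L c)).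
 assert (y < R0). { unfold y. apply Rlt_div_l; lra. }
 assert (0 <= y). { unfold y. ar. }
 specialize (K ((y + R0)/2) !!).
 assert (Cmod (L c)*y = 2*(M - u c)) by (unfold y; field; lra). nra.
Qed.

(** * Series and powers *)

Definition CSer (f : nat -> C) : C := (Series (fun n => fst (f n)), Series (fun n => snd (f n))).

Lemma exs_fst (f : nat -> C) : ex_series (fun n => Cmod (f n)) -> ex_series (fun n => fst (f n)).
Proof.
 intros H. apply (ex_series_le (K := R_AbsRing) (V := RCN) _ (fun n => Cmod (f n))); [|ar].
 intros n. apply Cmod_fst.
Qed.

Lemma exs_snd (f : nat -> C) : ex_series (fun n => Cmod (f n)) -> ex_series (fun n => snd (f n)).
Proof.
 intros H. apply (ex_series_le (K := R_AbsRing) (V := RCN) _ (fun n => Cmod (f n))); [|ar].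
 intros n. apply Cmod_snd.
Qed.

Lemma exs_le (a b : nat -> R) : (forall n, 0 <= a n <= b n) -> ex_series b -> ex_series a.
Proof.
 intros H Hb. apply (ex_series_le (K := R_AbsRing) (V := RCN) a b); [|ar].
 intros n. specialize (H n). change (norm (a n)) with (Rabs (a n)). rewrite Rabs_pos_eq; lra.
Qed.

Lemma CSer_ext f g : (forall n, f n = g n) -> CSer f = CSer g.
Proof. intros H. unfold CSer. f_equal; apply Series_ext; intros; now rewrite H. Qed.

Lemma CSer_plus f g : ex_series (fun n => Cmod (f n)) -> ex_series (fun n => Cmod (g n)) ->
 CSer (fun n => f n + g n)%C = (CSer f + CSer g)%C.
Proof.
 intros A B. unfold CSer, Cplus; simpl. f_equal; apply Series_plus; auto using exs_fst, exs_snd.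
Qed.

Lemma CSer_scal c f : ex_series (fun n => Cmod (f n)) -> CSer (fun n => c*f n)%C = (c*CSer f)%C.
Proof.
 intros A. unfold CSer, Cmult; simpl. f_equal.
 - rewrite Series_minus.
  + rewrite !Series_scal_l. refl.
  + apply (exs_sc (V := RNM)), exs_fst, A.
  + apply (exs_sc (V := RNM)), exs_snd, A.
 - rewrite Series_plus.
  + rewrite !Series_scal_l. refl.
  + apply (exs_sc (V := RNM)), exs_snd, A.
  + apply (exs_sc (V := RNM)), exs_fst, A.
Qed.

Lemma exs_scal c (f : nat -> C) : ex_series (fun n => Cmod (f n)) -> ex_series (fun n => Cmod (c*f n)%C).
Proof.
 intros A. apply (ex_series_ext (fun n => Cmod c*Cmod (f n))); [intros; now rewrite Cmod_mult|].
 apply (exs_sc (V := RNM)), A.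
Qed.

Lemma CSer_norm f M : (forall n, Cmod (f n) <= M n) -> ex_series M -> Cmod (CSer f) <= Series M.
Proof.
 intros H HM.
 ha A : ex_series (fun n => Cmod (f n)).
 { apply (exs_le _ M); [|ar]. ar. }
 apply Cmod_dual. intros w Hw. rewrite <- CSer_scal by exact A. simpl fst.
 mid (Rabs (Series (fun n => fst (w*f n)%C))); [apply Rle_abs|].
 ha B : ex_series (fun n => Cmod (w*f n)%C) by apply exs_scal, A.
 via Series_Rabs.
 - apply (exs_le _ (fun n => Cmod (w*f n)%C)); [|ar]. intros n; split; [ar|apply Cmod_fst].
 - apply Series_le; [|ar]. intros n; split; [ar|].
  via Cmod_fst. rewrite Cmod_mult, Hw, Rmult_1_l. ar.
Qed.

Lemma CSer_minus f g : ex_series (fun n => Cmod (f n)) -> ex_series (fun n => Cmod (g n)) ->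
 CSer (fun n => f n - g n)%C = (CSer f - CSer g)%C.
Proof.
 intros A B. unfold Cminus.
 replace (- CSer g)%C with (CSer (fun n => - g n)%C).
 - apply CSer_plus; [ar|]. apply (ex_series_ext (fun n => Cmod (g n))); [intros; now rewrite Cmod_opp|ar].
 - rewrite (CSer_ext _ (fun n => (-1)*g n)%C) by ar. rewrite CSer_scal by exact B. ring.
Qed.

(** Termwise differentiation from a summable majorant of the second-order remainders, which replaces
    uniform convergence. *)
Lemma CSer_Cd (f g : nat -> C -> C) (s : C) (M : nat -> R) r : 0 < r -> ex_series M ->
 ex_series (fun n => Cmod (g n s)) ->
 (forall h, Cmod h < r -> ex_series (fun n => Cmod (f n (s + h)%C))) ->
 (forall n h, Cmod h < r -> Cmod (f n (s + h)%C - f n s - h*g n s)%C <= Cmod h ^ 2*M n) ->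
 Cd (fun z => CSer (fun n => f n z)) s (CSer (fun n => g n s)).
Proof.
 intros Hr HM Hg Hf H eps He.
 set (S := Series M).
 ha E0 : ex_series (fun n => Cmod (f n s)).
 { specialize (Hf 0%C). rewrite Cmod_0 in Hf. specialize (Hf Hr).
  apply (ex_series_ext (fun n => Cmod (f n (s + 0)%C))); [|ar]. intros n. now rewrite Cplus_0_r. }
 exists (Rmin r (eps/(Rabs S + 1))). note (Rabs_pos S).
 split; [apply Rmin_pos; ar|].
 intros h Hh. rmins.
 assert (h0 := Cmod_ge_0 h).
 specialize (Hf h !!).
 ha Eq : (CSer (fun n => f n (s + h)%C) - CSer (fun n => f n s) - CSer (fun n => g n s)*h)%C
  = CSer (fun n => f n (s + h)%C - f n s - h*g n s)%C.
 { rewrite (Cmult_comm _ h), <- CSer_scal by exact Hg. rewrite <- CSer_minus by asm.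
  symmetry. apply CSer_minus.
  - apply (exs_le _ (fun n => Cmod (f n (s + h)%C) + Cmod (f n s))).
   + intros n; split; [ar|apply Cmod_sub_le].
   + apply (ex_series_plus (V := RNM)); asm.
  - apply exs_scal, Hg. }
 rewrite Eq.
 via (CSer_norm _ (fun n => Cmod h ^ 2*M n)).
 - intros n. apply H. lra.
 - apply (exs_sc (V := RNM)), HM.
 - rewrite Series_scal_l. fold S.
  assert (Cmod h*(Rabs S + 1) <= eps).
  { mid (eps/(Rabs S + 1)*(Rabs S + 1)).
   - apply mle_r; lra.
   - right; field; lra. }
  note (Rle_abs S). nra.
Qed.

Lemma exs_bounded (a : nat -> R) B : (forall n, 0 <= a n) -> (forall N, sum_n a N <= B) ->
 ex_series a /\ Series a <= B.
Proof.
 intros Ha HB.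
 ha E : ex_finite_lim_seq (sum_n a).
 { apply (ex_finite_lim_seq_incr _ B); [|ar]. intros n. rewrite sum_Sn. unfold plus; simpl. specialize (Ha (S n)). lra. }
 destruct E as [l Hl]. split.
 - exists l. exact Hl.
 - rewrite (is_series_unique a l Hl).
  apply (is_lim_seq_le (sum_n a) (fun _ => B) l B); [ar|ar|apply is_lim_seq_const].
Qed.

Lemma Series_shift_bound (a : nat -> R) (F : nat -> R) : (forall n, 0 <= a n) -> (forall n, 0 <= F n) ->
 (forall n, a n <= F n - F (S n)) -> ex_series a /\ Series a <= F O.
Proof.
 intros Ha HF H. apply exs_bounded; [ar|]. intros N.
 mid (F O - F (S N)).
 - induction N as [|N IH].
  + rewrite sum_O. apply H.
  + rewrite sum_Sn. unfold plus; simpl. specialize (H (S N)). lra.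
 - specialize (HF (S N)). lra.
Qed.

(** The power y^(-a), written through exp so that comparisons of powers become comparisons of
    exponents; [npw] is its complex counterpart. *)
Definition rpw (y a : R) : R := exp (- a*ln y).

Lemma rpw_pos y a : 0 < rpw y a.
Proof. apply exp_pos. Qed.

Lemma rpw_anti y y' a : 0 <= a -> 0 < y <= y' -> rpw y' a <= rpw y a.
Proof.
 intros Ha Hy. unfold rpw. apply exp_le.
 assert (ln y <= ln y') by ar. nra.
Qed.

Lemma rpw_exp_anti y a a' : 1 <= y -> a <= a' -> rpw y a' <= rpw y a.
Proof.
 intros Hy Ha. unfold rpw. apply exp_le.
 assert (0 <= ln y) by (rewrite <- ln_1; apply ln_le; lra). nra.
Qed.

Lemma rpw_step y a : 0 < y -> 1 < a -> rpw (y + 1) a <= (rpw y (a - 1) - rpw (y + 1) (a - 1))/(a - 1).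
Proof.
 intros Hy Ha.
 destruct (MVT_gen (fun x => rpw x (a - 1)) y (y + 1) (fun x => - (a - 1)*rpw x a)) as [z [Hz Ez]].
 - minmax. intros x Hx. unfold rpw.
  auto_derive; [lra|].
  replace (- a*ln x) with (- (a - 1)*ln x + - ln x) by ring.
  rewrite exp_plus, exp_Ropp, exp_ln by lra. field; lra.
 - minmax. intros x Hx. unfold rpw. apply cR_iff.
  apply (cR_der _ _ (- (a - 1) * / x*exp (- (a - 1)*ln x))). auto_derive; [lra|]. field; lra.
 - minmax in Hz.
  apply Rle_div_r; [lra|].
  assert (rpw (y + 1) a <= rpw z a) by (apply rpw_anti; lra). nra.
Qed.

Lemma rpw_sum N a : (1 <= N)%nat -> 1 < a ->
 ex_series (fun n => rpw (INR (N + n) + 1) a) /\ Series (fun n => rpw (INR (N + n) + 1) a) <= rpw (INR N) (a - 1)/(a - 1).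
Proof.
 intros HN Ha.
 ha P : forall n, 0 < INR (N + n) by (intros n; apply lt_0_INR; lia).
 destruct (Series_shift_bound (fun n => rpw (INR (N + n) + 1) a) (fun n => rpw (INR (N + n)) (a - 1)/(a - 1))) as [A B].
 - intros; left; apply rpw_pos.
 - intros n. apply Rle_div_r; [lra|]. note (rpw_pos (INR (N + n)) (a - 1)). lra.
 - intros n. rewrite Nat.add_succ_r, S_INR. note (rpw_step (INR (N + n)) a (P n) Ha).
  unfold Rdiv in *. lra.
 - split; [ar|]. rewrite Nat.add_0_r in B. ar.
Qed.

Lemma rpw_1 a : rpw 1 a = 1.
Proof. unfold rpw. rewrite ln_1, Rmult_0_r. apply exp_0. Qed.

Lemma rpw_sum_all a : 1 < a ->
 ex_series (fun n => rpw (INR (S n)) a) /\ Series (fun n => rpw (INR (S n)) a) <= a/(a - 1).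
Proof.
 intros Ha. destruct (rpw_sum 1 a (le_n 1) Ha) as [A B].
 ha A' : ex_series (fun n => rpw (INR (S (S n))) a).
 { ar. }
 ha E : ex_series (fun n => rpw (INR (S n)) a) by (apply ex_series_incr_1; exact A').
 split; [ar|]. rewrite Series_incr_1 by exact E.
 rewrite (Series_ext _ (fun n => rpw (INR (1 + n) + 1) a)) by ar.
 change (INR 1) with 1 in B |- *. rewrite rpw_1 in *.
 replace (a/(a - 1)) with (1 + 1/(a - 1)) by ar. lra.
Qed.

Lemma ln_pow_bound l e k : 0 <= l -> 0 < e -> l ^ k <= / e ^ k*exp (INR k*e*l).
Proof.
 intros Hl He.
 ha B : l <= / e*exp (e*l).
 { apply (mle_rl e); [ar|]. rewrite <- Rmult_assoc, Rinv_r, Rmult_1_l by lra.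
  note (exp_ineq1_le (e*l)). lra. }
 replace (/ e ^ k*exp (INR k*e*l)) with ((/ e*exp (e*l)) ^ k).
 - apply pow_incr; lra.
 - rewrite Rpow_mult_distr. f_equal; [rewrite pow_inv by lra; refl|].
  induction k as [|k IH].
  + simpl. rewrite !Rmult_0_l, exp_0. refl.
  + simpl pow. rewrite IH, <- exp_plus, S_INR. f_equal. ring.
Qed.

(** * The powers n^(-s) and the remainders of the trapezoidal rule *)

Definition npw (y : R) (s : C) : C := cexp (- (ln y)*s)%C.

Lemma Cmod_npw y s : Cmod (npw y s) = rpw y (fst s).
Proof.
 unfold npw, rpw. rewrite Cmod_cexp. f_equal. ar.
Qed.

Lemma npw_mult y y' s : 0 < y -> 0 < y' -> npw (y*y') s = (npw y s*npw y' s)%C.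
Proof.
 intros Hy Hy'. unfold npw. rewrite <- cexp_plus, ln_mult by asm. f_equal.
 ar.
Qed.

Lemma npw_1 s : npw 1 s = 1%C.
Proof. unfold npw. rewrite ln_1. replace (- 0*s)%C with (RtoC 0) by ring. apply cexp_0. Qed.

Lemma npw_plus y a b : npw y (a + b)%C = (npw y a*npw y b)%C.
Proof. unfold npw. rewrite <- cexp_plus. f_equal. ring. Qed.

Lemma Cd_npw y s : Cd (npw y) s (- (ln y)*npw y s)%C.
Proof.
 unfold npw. apply (Cd_eq _ _ (cexp (- (ln y)*s)*(0*s + - (ln y)*1))%C); [ring|].
 apply (Cd_comp cexp (fun z => - (ln y)*z)%C); [apply Cd_cexp|].
 apply (Cd_mult (fun _ => (- (ln y))%C) (fun z => z)); [apply Cd_const|apply Cd_id].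
Qed.

Lemma hol_npw U y : hol U (npw y).
Proof.
 exists (fun s => - (ln y)*npw y s)%C, (fun s => - (ln y)*(- (ln y)*npw y s))%C.
 split; intros s _; [apply Cd_npw|].
 apply (Cd_eq _ _ (0*npw y s + - (ln y)*(- (ln y)*npw y s))%C); [ring|].
 apply (Cd_mult (fun _ => (- (ln y))%C) (npw y)); [apply Cd_const|apply Cd_npw].
Qed.

Lemma npw_remainder y s h : 1 <= y ->
 Cmod (npw y (s + h) - npw y s - h*(- (ln y)*npw y s))%C <= Cmod h ^ 2*(ln y ^ 2*exp (Cmod h*ln y)*rpw y (fst s)).
Proof.
 intros Hy. ha l0 : 0 <= ln y by (rewrite <- ln_1; apply ln_le; lra).
 rewrite npw_plus.
 replace (npw y s*npw y h - npw y s - h*(- (ln y)*npw y s))%C with (npw y s*(npw y h - 1 - (- (ln y)*h)))%C by ring.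
 rewrite Cmod_mult, Cmod_npw. destruct (cexp_remainder (- (ln y)*h)%C) as [_ B].
 fold (npw y h) in B. rewrite Cmod_mult, Cmod_opp, Cmod_R, Rabs_pos_eq in B by exact l0.
 note (rpw_pos y (fst s)).
 rewrite (Rmult_comm (ln y) (Cmod h)) in B.
 ar.
Qed.

(** The Peano kernel of the trapezoidal rule on a unit interval. Its integral 1/12 is the constant
    in the bounds for [Tt] and [hk]. *)
Definition wt (x : R) : R := x*(1 - x)/2.

Lemma wt_cont x : continuous wt x.
Proof. apply (cR_der _ _ ((1 - 2*x)/2)). unfold wt. auto_derive; [ar|field]. Qed.

Lemma wt_pos x : 0 <= x <= 1 -> 0 <= wt x.
Proof. intros H. unfold wt. nra. Qed.

Lemma wt_int : is_RInt wt 0 1 (/ 12).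
Proof.
 replace (/12) with ((1 ^ 2/4 - 1 ^ 3/6) - (0 ^ 2/4 - 0 ^ 3/6)) by field.
 apply (is_RInt_derive (fun x => x ^ 2/4 - x ^ 3/6)).
 - intros x _. unfold wt. auto_derive; [ar|field].
 - intros x _. apply wt_cont.
Qed.

(* k-th derivative in s of the n-th trapezoidal remainder. *)
Definition Tt (k n : nat) (s : C) : C :=
 CInt (fun x => wt x*(- ln (INR n + x)) ^ k*npw (INR n + x) (s + 2))%C 0 1.

Section Tn.
Variables (k n : nat).
Hypothesis Hn : (1 <= n)%nat.

Lemma n_ge1 : 1 <= INR n.
Proof. change 1 with (INR 1). apply le_INR, Hn. Qed.

Lemma lnx_cont x : 0 <= x -> continuous (fun u => ln (INR n + u)) x.
Proof.
 intros Hx. note n_ge1. ar.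
Qed.

Lemma npwx_cont s x : 0 <= x -> Ccont (fun u => npw (INR n + u) s) x.
Proof.
 intros Hx. unfold npw.
 apply (Rd_Ccont _ _ (cexp (- (ln (INR n + x))*s)*(- RtoC (/ (INR n + x))*s))%C).
 apply (Rd_comp cexp (fun u => - (ln (INR n + u))*s)%C); [apply Cd_cexp|].
 note n_ge1. destruct s as [p q].
 apply (Rd_ext (fun u => (- ln (INR n + u)*p, - ln (INR n + u)*q))).
 { ar. }
 split; simpl; auto_derive; try lra; field; lra.
Qed.

Lemma lnpow_cont x : 0 <= x -> Ccont (fun u => ((- ln (INR n + u)) ^ k)%C) x.
Proof.
 intros Hx. ha A : Ccont (fun u => (- RtoC (ln (INR n + u)))%C) x.
 { apply Ccont_opp. split; simpl; [apply lnx_cont; exact Hx|ar]. }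
 induction k as [|j IH]; simpl; [ar|apply Ccont_mult; asm].
Qed.

Lemma wtC_cont x : Ccont (fun u => RtoC (wt u)) x.
Proof. split; simpl; [apply wt_cont|ar]. Qed.

Lemma Tt_ex s : exCI (fun x => wt x*(- ln (INR n + x)) ^ k*npw (INR n + x) (s + 2))%C 0 1.
Proof.
 apply exCI_cont; [lra|]. intros x Hx.
 apply Ccont_mult; [apply Ccont_mult; [apply wtC_cont|apply lnpow_cont; lra]|apply npwx_cont; lra].
Qed.

Lemma lnx_bd x : 0 <= x <= 1 -> 0 <= ln (INR n + x) <= ln (INR (S n)).
Proof.
 intros Hx. note n_ge1. rewrite S_INR. split.
 - rewrite <- ln_1. apply ln_le; lra.
 - ar.
Qed.

Lemma int_bound (f : R -> C) M : exCI f 0 1 -> (forall x, 0 <= x <= 1 -> Cmod (f x) <= wt x*M) ->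
 Cmod (CInt f 0 1) <= / 12*M.
Proof.
 intros Hf H. rewrite <- (RI_uniq _ _ _ _ wt_int), Rmult_comm, <- RInt_scalR by (eexists; exact wt_int).
 apply CInt_norm; [lra|ar|apply ex_RInt_scalR; eexists; exact wt_int|].
 intros x Hx. rewrite Rmult_comm. ar.
Qed.

Lemma Tt_bound s : -2 <= fst s -> Cmod (Tt k n s) <= / 12*(ln (INR (S n)) ^ k*rpw (INR n) (fst s + 2)).
Proof.
 intros Hs. apply int_bound; [apply Tt_ex|]. intros x Hx. note n_ge1 as N1.
 destruct (lnx_bd x Hx) as [L1 L2].
 rewrite !Cmod_mult, Cmod_pow, Cmod_opp, !Cmod_R, Cmod_npw.
 rewrite (Rabs_pos_eq (wt x)) by (apply wt_pos; lra). rewrite (Rabs_pos_eq (ln _)) by exact L1.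
 rewrite Rmult_assoc. apply mle_l; [apply wt_pos; lra|].
 apply mle; [ar|left; apply rpw_pos| |].
 - apply pow_incr; lra.
 - replace (fst (s + 2)%C) with (fst s + 2) by ar. apply rpw_anti; lra.
Qed.

End Tn.

Lemma Tt_remainder k n s h : (1 <= n)%nat -> -2 <= fst s ->
 Cmod (Tt k n (s + h) - Tt k n s - h*Tt (S k) n s)%C
 <= Cmod h ^ 2*(/ 12*(ln (INR (S n)) ^ (k + 2)*exp (Cmod h*ln (INR (S n)))*rpw (INR n) (fst s + 2))).
Proof.
 intros Hn Hs. note (n_ge1 n Hn) as N1.
 ha Eq : (Tt k n (s + h) - Tt k n s - h*Tt (S k) n s)%C =
  CInt (fun x => wt x*(- ln (INR n + x)) ^ k*(npw (INR n + x) ((s + 2) + h) - npw (INR n + x) (s + 2) - h*(- (ln (INR n + x))*npw (INR n + x) (s + 2))))%C 0 1.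
 { unfold Tt. rewrite <- (CInt_scal h) by (apply Tt_ex; exact Hn).
  rewrite <- (CInt_minus _ _ _ _ (Tt_ex k n Hn (s + h)%C) (Tt_ex k n Hn s)).
  rewrite <- CInt_minus.
  - apply CInt_ext; [lra|]. intros x Hx. replace (s + h + 2)%C with (s + 2 + h)%C by ring. simpl. ring.
  - apply (exCI_plus _ _ _ _ (Tt_ex k n Hn (s + h)%C)), exCI_opp, (Tt_ex k n Hn s).
  - apply exCI_scal, (Tt_ex (S k) n Hn s). }
 rewrite Eq.
 replace (Cmod h ^ 2*(/ 12*(ln (INR (S n)) ^ (k + 2)*exp (Cmod h*ln (INR (S n)))*rpw (INR n) (fst s + 2))))
 with (/ 12*(Cmod h ^ 2*(ln (INR (S n)) ^ (k + 2)*exp (Cmod h*ln (INR (S n)))*rpw (INR n) (fst s + 2)))) by ring.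
 apply int_bound.
 - apply exCI_cont; [lra|]. intros x Hx.
  apply Ccont_mult; [apply Ccont_mult; [apply wtC_cont|apply lnpow_cont; [ar|lra]]|].
  apply Ccont_minus; [apply Ccont_minus; apply npwx_cont; try exact Hn; lra|].
  apply Ccont_mult; [ar|]. apply Ccont_mult; [|apply npwx_cont; [ar|lra]].
  apply Ccont_opp. split; simpl; ar.
 - intros x Hx. destruct (lnx_bd n Hn x Hx) as [L1 L2].
  note (npw_remainder (INR n + x) (s + 2)%C h !!) as B.
  rewrite !Cmod_mult, Cmod_pow, Cmod_opp, !Cmod_R.
  rewrite (Rabs_pos_eq (wt x)) by (apply wt_pos; lra). rewrite (Rabs_pos_eq (ln _)) by exact L1.
  rewrite Rmult_assoc. apply mle_l; [apply wt_pos; lra|].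
  set (l := ln (INR n + x)) in *. set (l' := ln (INR (S n))) in *.
  ha A1 : rpw (INR n + x) (fst (s + 2)%C) <= rpw (INR n) (fst s + 2).
  { replace (fst (s + 2)%C) with (fst s + 2) by ar. apply rpw_anti; lra. }
  ha A2 : exp (Cmod h*l) <= exp (Cmod h*l').
  { ar. }
  ha A3 : l ^ 2 <= l' ^ 2 by ar.
  ha A4 : l ^ k <= l' ^ k by ar.
  note (exp_pos (Cmod h*l)); note (rpw_pos (INR n + x) (fst (s + 2)%C)).
  note (pow_le l k L1); note (pow2_ge_0 l).
  mid (l ^ k*(Cmod h ^ 2*(l ^ 2*exp (Cmod h*l)*rpw (INR n + x) (fst (s + 2)%C)))).
  { ar. }
  replace (l' ^ (k + 2)) with (l' ^ k*l' ^ 2) by (rewrite pow_add; refl).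
  replace (Cmod h ^ 2*(l' ^ k*l' ^ 2*exp (Cmod h*l')*rpw (INR n) (fst s + 2)))
   with (l' ^ k*(Cmod h ^ 2*(l' ^ 2*exp (Cmod h*l')*rpw (INR n) (fst s + 2)))) by ring.
  ar.
Qed.

(* ln^k weights are absorbed by an arbitrarily small power of n. *)
Lemma ln_sum k a : 1 < a -> ex_series (fun n => ln (INR (S (S n))) ^ k*rpw (INR (S n)) a).
Proof.
 intros Ha. set (e := (a - 1)/(2*(INR k + 1))).
 note (pos_INR k) as k0.
 ha He : 0 < e by (unfold e; apply div_pos; lra).
 ha Hke : INR k*e <= (a - 1)/2.
 { mid ((INR k + 1)*e).
  - apply mle_r; lra.
  - right; unfold e; field; lra. }
 destruct (rpw_sum_all ((1 + a)/2) !!) as [E _].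
 apply (exs_le _ (fun n => (/ e ^ k*exp (INR k*e*ln 2))*rpw (INR (S n)) ((1 + a)/2))).
 2:{ apply (exs_sc (V := RNM)), E. }
 intros n. ha N1 : 1 <= INR (S n) by (rewrite S_INR; note (pos_INR n); lra).
 ha L0 : 0 <= ln (INR (S n)) by (rewrite <- ln_1; apply ln_le; lra).
 ha L1 : 0 <= ln (INR (S (S n))) <= ln 2 + ln (INR (S n)).
 { rewrite S_INR. split; [rewrite <- ln_1; apply ln_le; lra|]. rewrite <- ln_mult by lra. ar. }
 split; [apply mul_nn; [ar|left; apply rpw_pos]|].
 etr; [apply mle_r; [left; apply rpw_pos|apply (ln_pow_bound _ e k (proj1 L1) He)]|].
 rewrite !Rmult_assoc. apply mle_l; [ar|].
 unfold rpw. rewrite <- !exp_plus. apply exp_le.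
 assert (0 <= INR k*e) by ar. nra.
Qed.

(** [hk 0] collects the trapezoidal remainders of all intervals [n, n+1], n >= 1, and [hk k] is its
    k-th derivative. The terms are of size n^(-Re s - 2) up to logarithms, so the series live on Re
    s > -1. *)
Definition hk (k : nat) (s : C) : C := CSer (fun n => Tt k (S n) s).

Lemma hk_ex k s : -1 < fst s -> ex_series (fun n => Cmod (Tt k (S n) s)).
Proof.
 intros Hs. apply (exs_le _ (fun n => / 12*(ln (INR (S (S n))) ^ k*rpw (INR (S n)) (fst s + 2)))).
 - intros n; split; [ar|]. apply Tt_bound; [lia|lra].
 - apply (exs_sc (V := RNM)), ln_sum. lra.
Qed.

Lemma hk_Cd k s : -1 < fst s -> Cd (hk k) s (hk (S k) s).
Proof.
 intros Hs. set (r := (fst s + 1)/2). unfold hk.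
 apply (CSer_Cd (fun n z => Tt k (S n) z) (fun n z => Tt (S k) (S n) z) s
  (fun n => / 12*exp (r*ln 2)*(ln (INR (S (S n))) ^ (k + 2)*rpw (INR (S n)) (fst s + 2 - r))) r).
 - unfold r; lra.
 - apply (exs_sc (V := RNM)), ln_sum. unfold r; lra.
 - apply hk_ex; exact Hs.
 - intros h Hh. apply hk_ex. simpl. note (Cmod_fst h) as F. apply abs_btw in F. unfold r in Hh; lra.
 - intros n h Hh. etr; [apply Tt_remainder; [lia|lra]|].
  apply mle_l; [ar|].
  rewrite !Rmult_assoc. apply mle_l; [lra|].
  ha N1 : 1 <= INR (S n) by (rewrite S_INR; note (pos_INR n); lra).
  ha L0 : 0 <= ln (INR (S n)) by (rewrite <- ln_1; apply ln_le; lra).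
  ha L1 : 0 <= ln (INR (S (S n))) <= ln 2 + ln (INR (S n)).
  { rewrite (S_INR (S n)). split; [rewrite <- ln_1; apply ln_le; lra|]. rewrite <- ln_mult by lra. ar. }
  rewrite (Rmult_comm (exp (r*ln 2))), Rmult_assoc.
  apply mle_l; [ar|].
  unfold rpw. rewrite <- !exp_plus. apply exp_le. note (Cmod_ge_0 h). nra.
Qed.

Lemma h0_bound s : -1 < fst s -> Cmod (hk 0 s) <= / 12*((fst s + 2)/(fst s + 1)).
Proof.
 intros Hs. destruct (rpw_sum_all (fst s + 2) !!) as [E B].
 via (CSer_norm _ (fun n => / 12*rpw (INR (S n)) (fst s + 2))).
 - intros n. etr; [apply Tt_bound; [lia|lra]|]. simpl pow. right; ring.
 - apply (exs_sc (V := RNM)), E.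
 - rewrite Series_scal_l. apply mle_l; [lra|].
  replace (fst s + 2 - 1) with (fst s + 1) in B by ring. ar.
Qed.

(** * The function (s - 1) zeta(s) *)

(* (s - 1) zeta(s) for Re s > -1, by the trapezoidal Euler-Maclaurin formula. *)
Definition Zf (s : C) : C := (1 + (s - 1)/2 + (s*s*s - s)*hk 0 s)%C.
(** Successive derivatives of [Zf]. Three are needed at this point because [hol] for [Z1] asks for
    two more. *)
Definition Z1 (s : C) : C := (/ 2 + ((3*s*s - 1)*hk 0 s + (s*s*s - s)*hk 1 s))%C.
Definition Z2 (s : C) : C := (6*s*hk 0 s + 2*(3*s*s - 1)*hk 1 s + (s*s*s - s)*hk 2 s)%C.
Definition Z3 (s : C) : C :=
 (6*hk 0 s + 18*s*hk 1 s + 3*(3*s*s - 1)*hk 2 s + (s*s*s - s)*hk 3 s)%C.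

Lemma C2_nz : RtoC 2 <> 0%C.
Proof. intros E. injection E. lra. Qed.

Ltac cd := repeat first
 [ apply hk_Cd; asm
 | apply Cd_const | apply Cd_id
 | match goal with
  | |- Cd (fun z => @?f z + @?g z)%C _ _ => apply (Cd_plus f g)
  | |- Cd (fun z => @?f z - @?g z)%C _ _ => apply (Cd_minus f g)
  | |- Cd (fun z => @?f z * @?g z)%C _ _ => apply (Cd_mult f g)
  end ].

Lemma Zf_Cd s : -1 < fst s -> Cd Zf s (Z1 s).
Proof.
 intros H. unfold Zf, Z1, Cdiv. eapply Cd_eq; [|cd]. ar.
Qed.

Lemma Z1_Cd s : -1 < fst s -> Cd Z1 s (Z2 s).
Proof. intros H. unfold Z1, Z2. eapply Cd_eq; [|cd]. ar. Qed.

Lemma Z2_Cd s : -1 < fst s -> Cd Z2 s (Z3 s).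
Proof. intros H. unfold Z2, Z3. eapply Cd_eq; [|cd]. ar. Qed.

Definition RH1 (s : C) : Prop := -1 < fst s.

Lemma Zf_hol : hol RH1 Zf.
Proof. exists Z1, Z2. split; [apply Zf_Cd|apply Z1_Cd]. Qed.

Lemma Z1_hol : hol RH1 Z1.
Proof. exists Z2, Z3. split; [apply Z1_Cd|apply Z2_Cd]. Qed.

Lemma npw_conj y s : npw y (Cconj s) = Cconj (npw y s).
Proof.
 unfold npw, cexp, Cconj; simpl.
 replace (- ln y*fst s - - 0 * - snd s) with (- ln y*fst s - - 0*snd s) by ring.
 replace (- ln y * - snd s + - 0*fst s) with (- (- ln y*snd s + - 0*fst s)) by ring.
 rewrite cos_neg, sin_neg. ar.
Qed.

Lemma Cconj_RtoC (x : R) : Cconj x = x.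
Proof. ar. Qed.

Lemma CInt_conj f a b : exCI f a b -> CInt (fun t => Cconj (f t)) a b = Cconj (CInt f a b).
Proof.
 intros [A B]. unfold CInt, Cconj; simpl. f_equal. exact (RInt_opp _ _ _ B).
Qed.

Lemma hk0_conj s : -1 < fst s -> hk 0 (Cconj s) = Cconj (hk 0 s).
Proof.
 intros Hs. unfold hk. rewrite (CSer_ext _ (fun n => Cconj (Tt 0 (S n) s))).
 - unfold CSer, Cconj; simpl. f_equal. rewrite Series_opp. refl.
 - intros n. unfold Tt. rewrite <- CInt_conj by (apply Tt_ex; lia). apply CInt_ext; [lra|].
  intros x Hx. rewrite !Cmult_conj. replace (Cconj s + 2)%C with (Cconj (s + 2)%C).
  + rewrite npw_conj, Cconj_RtoC. simpl. f_equal. f_equal. unfold Cconj, RtoC; simpl. f_equal; ring.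
  + ar.
Qed.

Lemma Cdiv2_conj a : Cconj (a/2)%C = (Cconj a/2)%C.
Proof.
 replace (Cconj a/2)%C with (/ 2*Cconj a)%C by ar.
 replace (a/2)%C with (RtoC (/ 2)*a)%C.
 - rewrite Cmult_conj, Cconj_RtoC. f_equal. rewrite RtoC_inv; [ar|lra].
 - rewrite RtoC_inv by lra. ar.
Qed.

Lemma Zf_conj s : -1 < fst s -> Zf (Cconj s) = Cconj (Zf s).
Proof.
 intros Hs. unfold Zf. rewrite hk0_conj by exact Hs.
 rewrite !Cplus_conj, Cdiv2_conj, !Cmult_conj, !Cminus_conj, !Cmult_conj, !Cconj_RtoC. ar.
Qed.

(** * Partial sums of zeta and eta by the Euler-Maclaurin formula *)

Fixpoint csum (f : nat -> C) (N : nat) : C :=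
 match N with O => 0%C | S N => (csum f N + f N)%C end.

Lemma csum_ext f g N : (forall n, (n < N)%nat -> f n = g n) -> csum f N = csum g N.
Proof.
 induction N as [|N IH]; intros H; simpl; [ar|].
 rewrite IH, H; auto.
Qed.

Lemma csum_comp f N : csum f N = match N with O => 0%C | S M => (sum_n (fun n => fst (f n)) M, sum_n (fun n => snd (f n)) M) end.
Proof.
 induction N as [|N IH]; [ar|]. simpl csum. rewrite IH. destruct N as [|M].
 - rewrite !sum_O, Cplus_0_l. destruct (f O); refl.
 - rewrite !sum_Sn. ar.
Qed.

Lemma CSer_split f N : ex_series (fun n => Cmod (f n)) ->
 ex_series (fun n => Cmod (f (N + n)%nat)) /\ CSer f = (csum f N + CSer (fun n => f (N + n)%nat))%C.
Proof.
 intros H. split.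
 - apply (ex_series_incr_n (fun n => Cmod (f n)) N). exact H.
 - rewrite csum_comp. destruct N as [|M].
  + rewrite Cplus_0_l. refl.
  + unfold CSer, Cplus; simpl fst; simpl snd. f_equal.
   * rewrite (Series_incr_n (fun n => fst (f n)) (S M)); [|lia|apply exs_fst, H]. simpl pred. rewrite sum_n_Reals. refl.
   * rewrite (Series_incr_n (fun n => snd (f n)) (S M)); [|lia|apply exs_snd, H]. simpl pred. rewrite sum_n_Reals. ar.
Qed.

Lemma INRS_pos n : 0 < INR (S n).
Proof. apply lt_0_INR. lia. Qed.

Lemma Rd_npw_x (n : nat) a x : (1 <= n)%nat -> 0 <= x ->
 Rd (fun u => npw (INR n + u) a) x (- a*npw (INR n + x) (a + 1))%C.
Proof.
 intros Hn Hx. note (n_ge1 n Hn) as N1. unfold npw.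
 apply (Rd_eq _ _ (cexp (- (ln (INR n + x))*a)*(- RtoC (/ (INR n + x))*a))%C).
 - replace (- ln (INR n + x)*(a + 1))%C with (- ln (INR n + x)*a + RtoC (- ln (INR n + x)))%C.
  + rewrite cexp_plus. replace (cexp (RtoC (- ln (INR n + x)))) with (RtoC (/ (INR n + x))); [ring|].
   unfold cexp, RtoC; simpl. rewrite exp_Ropp, exp_ln, cos_0, sin_0 by lra. f_equal; ring.
  + rewrite RtoC_opp. ring.
 - apply (Rd_comp cexp (fun u => - (ln (INR n + u))*a)%C); [apply Cd_cexp|].
  destruct a as [p q].
  apply (Rd_ext (fun u => (- ln (INR n + u)*p, - ln (INR n + u)*q))).
  { ar. }
  split; simpl; auto_derive; try lra; field; lra.
Qed.

(** Two integrations by parts, packed into the antiderivative [A]: the second derivative of x^(-s)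
    brings s (s + 1), and the remaining factor s - 1 clears the denominator of the integral of
    x^(-s). *)
Lemma trapezoid n s : (1 <= n)%nat ->
 ((s*s*s - s)*Tt 0 n s = (s - 1)*(npw (INR n) s + npw (INR (S n)) s)/2
  + npw (INR (S n)) (s - 1) - npw (INR n) (s - 1))%C.
Proof.
 intros Hn. note (n_ge1 n Hn) as N1. unfold Tt. rewrite <- CInt_scal by (apply (Tt_ex 0); exact Hn).
 set (A := fun x : R => ((s - 1)*(- (RtoC (wt x))*(s*npw (INR n + x) (s + 1)) - RtoC (1/2 - x)*npw (INR n + x) s) + npw (INR n + x) (s - 1))%C).
 rewrite (CInt_ext _ (fun x => (s*s*s - s)*(RtoC (wt x)*npw (INR n + x) (s + 2)))%C 0 1); [|lra|ar].
 rewrite (Rd_FTC A).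
 - unfold A. rewrite Rplus_0_r, <- S_INR.
  replace (wt 1) with 0 by (unfold wt; field). replace (wt 0) with 0 by (unfold wt; field).
  replace (1/2 - 1) with (- / 2) by field. replace (1/2 - 0) with (/ 2) by field.
  rewrite RtoC_opp, RtoC_inv by lra. field; try apply C2_nz.
 - lra.
 - intros x Hx. unfold A.
  ha Dw : Rd (fun u => - RtoC (wt u))%C x (- RtoC (1/2 - x))%C.
  { split; unfold wt; simpl; auto_derive; auto; field. }
  ha Dw2 : Rd (fun u => RtoC (1/2 - u))%C x (RtoC (-1))%C.
  { split; simpl; auto_derive; auto; ring. }
  eapply Rd_eq; [|apply Rd_plus; [apply Rd_mult; [apply Rd_const|apply Rd_minus; [apply (Rd_mult (fun u => - RtoC (wt u))%C (fun u => s*npw (INR n + u) (s + 1))%C); [exact Dw|apply Rd_mult; [apply Rd_const|apply Rd_npw_x; [ar|lra]]]|apply Rd_mult; [exact Dw2|apply Rd_npw_x; [ar|lra]]]]|apply Rd_npw_x; [ar|lra]]].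
  cbv beta. replace (s + 1 + 1)%C with (s + 2)%C by ring. replace (s - 1 + 1)%C with s by ring.
  replace (RtoC (1/2 - x)) with (RtoC (1/2) - RtoC x)%C by ar. ring.
 - intros x Hx. apply Ccont_mult; [ar|apply Ccont_mult; [apply wtC_cont|apply npwx_cont; [ar|lra]]].
Qed.

Definition psum (N : nat) (s : C) : C := csum (fun k => npw (INR (S k)) s) N.

Lemma csum_trapezoid N s :
 ((s*s*s - s)*csum (fun k => Tt 0 (S k) s) N =
 (s - 1)*(psum (S N) s - / 2 - npw (INR (S N)) s/2) + npw (INR (S N)) (s - 1) - 1)%C.
Proof.
 induction N as [|N IH].
 - unfold psum. simpl csum. change (INR 1) with 1. rewrite !npw_1. field; try apply C2_nz.
 - simpl csum. rewrite Cmult_plus_distr_l, IH, trapezoid by lia.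
  change (psum (S (S N)) s) with (psum (S N) s + npw (INR (S (S N))) s)%C. ar.
Qed.

Lemma Z_partial s N : -1 < fst s -> (1 <= N)%nat ->
 Cmod (Zf s - ((s - 1)*psum (S N) s - (s - 1)/2*npw (INR (S N)) s + npw (INR (S N)) (s - 1)))%C
 <= Cmod (s*s*s - s)%C*(/ 12*(rpw (INR N) (fst s + 1)/(fst s + 1))).
Proof.
 intros Hs HN.
 destruct (CSer_split (fun n => Tt 0 (S n) s) N (hk_ex 0 s Hs)) as [E1 E2].
 ha Eq : (Zf s - ((s - 1)*psum (S N) s - (s - 1)/2*npw (INR (S N)) s + npw (INR (S N)) (s - 1)))%C
  = ((s*s*s - s)*CSer (fun n => Tt 0 (S (N + n)) s))%C.
 { unfold Zf. change (hk 0 s) with (CSer (fun n => Tt 0 (S n) s)). rewrite E2, Cmult_plus_distr_l, csum_trapezoid.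
  ar. }
 rewrite Eq, Cmod_mult. apply mle_l; [ar|].
 destruct (rpw_sum N (fst s + 2) HN !!) as [A B].
 via (CSer_norm _ (fun n => / 12*rpw (INR (N + n) + 1) (fst s + 2))).
 - intros n. etr; [apply Tt_bound; [lia|lra]|]. simpl pow. rewrite (S_INR (N + n)). right; ring.
 - apply (exs_sc (V := RNM)), A.
 - rewrite Series_scal_l. apply mle_l; [lra|].
  replace (fst s + 2 - 1) with (fst s + 1) in B by ring. ar.
Qed.

Lemma le_rpw_limit y K a : 0 < a -> (forall N, (1 <= N)%nat -> y <= K*rpw (INR N) a) -> y <= 0.
Proof.
 intros Ha H. apply le_epsilon. intros eps He. rewrite Rplus_0_l.
 note (Rabs_pos K) as K0.
 set (d := eps/(Rabs K + 1)). ha Hd : 0 < d by (unfold d; apply div_pos; lra).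
 destruct (INR_unbounded (exp (- ln d/a))) as [N HN].
 ha N1 : (1 <= N)%nat.
 { destruct N; [|lia]. exfalso. note (exp_pos (- ln d/a)). simpl in HN. lra. }
 specialize (H N N1). etr; [ar|].
 ha B : rpw (INR N) a <= d.
 { unfold rpw. rewrite <- (exp_ln d) by exact Hd. apply exp_le.
  assert (- ln d/a <= ln (INR N)).
  { rewrite <- (ln_exp (- ln d/a)). ar. }
  assert (- ln d/a*a = - ln d) by ar. nra. }
 note (rpw_pos (INR N) a). note (Rle_abs K).
 assert (Rabs K*d + d = eps) by (unfold d; field; lra). nra.
Qed.

Definition zeta (s : C) : C := CSer (fun k => npw (INR (S k)) s).

Lemma zeta_ex s : 1 < fst s -> ex_series (fun k => Cmod (npw (INR (S k)) s)).
Proof.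
 intros Hs. destruct (rpw_sum_all (fst s) Hs) as [E _].
 apply (ex_series_ext (fun n => rpw (INR (S n)) (fst s))); [|ar]. intros n. now rewrite Cmod_npw.
Qed.

Lemma zeta_tail s N : 1 < fst s -> (1 <= N)%nat ->
 Cmod (zeta s - psum N s)%C <= rpw (INR N) (fst s - 1)/(fst s - 1).
Proof.
 intros Hs HN. destruct (CSer_split _ N (zeta_ex s Hs)) as [E1 E2].
 unfold zeta. rewrite E2. unfold psum.
 match goal with |- Cmod (?a + ?b - ?a)%C <= _ => replace (a + b - a)%C with b by ring end.
 destruct (rpw_sum N (fst s) HN Hs) as [A B]. etr; [|exact B].
 apply CSer_norm; [|ar]. intros n. rewrite Cmod_npw, (S_INR (N + n)). lra.
Qed.

(** Let N grow in [Z_partial]: for Re s > 1 all boundary terms are O(N^(1 - Re s)), and so is the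
    tail of the series. *)
Lemma Zf_zeta s : 1 < fst s -> Zf s = ((s - 1)*zeta s)%C.
Proof.
 intros Hs.
 ha H : Cmod (Zf s - (s - 1)*zeta s)%C <= 0.
 { apply (le_rpw_limit _ (Cmod (s*s*s - s)%C*(/ 12/(fst s + 1)) + Cmod ((s - 1)/2)%C + 1 + Cmod (s - 1)%C/(fst s - 1)) (fst s - 1)); [lra|].
  intros N HN. note (Z_partial s N !! HN) as ZP. note (zeta_tail s (S N) Hs ltac:(lia)) as ZT.
  ha N1 : 1 <= INR N by (change 1 with (INR 1); apply le_INR, HN).
  ha SN : INR N <= INR (S N) by (rewrite S_INR; lra).
  set (x := rpw (INR N) (fst s - 1)).
  ha X1 : rpw (INR N) (fst s + 1) <= x by (apply rpw_exp_anti; lra).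
  ha X2 : rpw (INR (S N)) (fst s - 1) <= x by (apply rpw_anti; lra).
  ha X3 : rpw (INR (S N)) (fst s) <= x.
  { etr; [|exact X2]. apply rpw_exp_anti; lra. }
  set (B := ((s - 1)*psum (S N) s - (s - 1)/2*npw (INR (S N)) s + npw (INR (S N)) (s - 1))%C) in *.
  replace (Zf s - (s - 1)*zeta s)%C with ((Zf s - B) + ((- ((s - 1)/2))*npw (INR (S N)) s + npw (INR (S N)) (s - 1)) + (- (s - 1))*(zeta s - psum (S N) s))%C by ar.
  via Cmod_tri3.
  ha T2 : Cmod (- ((s - 1)/2)*npw (INR (S N)) s + npw (INR (S N)) (s - 1))%C <= Cmod ((s - 1)/2)%C*x + x.
  { via Cmod_triangle. rewrite Cmod_mult, Cmod_opp, !Cmod_npw.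
   ar. }
  ha T3 : Cmod (- (s - 1)*(zeta s - psum (S N) s))%C <= Cmod (s - 1)%C/(fst s - 1)*x.
  { rewrite Cmod_mult, Cmod_opp. unfold Rdiv. rewrite Rmult_assoc. apply mle_l; [ar|].
   via ZT. unfold Rdiv. rewrite Rmult_comm. ar. }
  ha T1 : Cmod (s*s*s - s)%C*(/ 12*(rpw (INR N) (fst s + 1)/(fst s + 1))) <= Cmod (s*s*s - s)%C*(/ 12/(fst s + 1))*x.
  { rewrite Rmult_assoc. apply mle_l; [ar|]. unfold Rdiv.
   rewrite Rmult_assoc. apply mle_l; [lra|]. rewrite Rmult_comm. ar. }
  lra. }
 ha E : Cmod (Zf s - (s - 1)*zeta s)%C = 0 by (note (Cmod_ge_0 (Zf s - (s - 1)*zeta s)%C); lra).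
 apply Cmod_eq_0 in E. replace (Zf s) with ((Zf s - (s - 1)*zeta s) + (s - 1)*zeta s)%C by ring. rewrite E. ring.
Qed.

Lemma npw_nat_mult m n s : npw (INR (S m)*INR (S n)) s = (npw (INR (S m)) s*npw (INR (S n)) s)%C.
Proof. apply npw_mult; apply INRS_pos. Qed.

Definition alt (k : nat) (s : C) : C := ((-1) ^ k*npw (INR (S k)) s)%C.

Lemma Cm1_even k : ((-1) ^ (2*k))%C = 1%C.
Proof.
 induction k as [|k IH]; [ar|]. replace (2*S k)%nat with (S (S (2*k))) by lia.
 change ((-1)*((-1)*(-1) ^ (2*k)) = 1)%C. rewrite IH. ring.
Qed.

Lemma alt_even N s : csum (fun k => alt k s) (2*N) = (psum (2*N) s - 2*npw 2 s*psum N s)%C.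
Proof.
 induction N as [|N IH].
 - unfold psum; simpl. ring.
 - replace (2*S N)%nat with (S (S (2*N))) by lia. unfold psum in *.
  ha cS : forall f n, csum f (S n) = (csum f n + f n)%C by refl.
  rewrite !cS, IH. unfold alt.
  change ((-1) ^ S (2*N))%C with ((-1)*(-1) ^ (2*N))%C. rewrite Cm1_even.
  replace (npw (INR (S (S (2*N)))) s) with (npw 2 s*npw (INR (S N)) s)%C.
  + ring.
  + change 2 with (INR 2). rewrite <- (npw_nat_mult 1 N). f_equal. rewrite <- mult_INR. f_equal. lia.
Qed.

Lemma psum_asym (s : C) N : 0 < fst s -> s <> 1%C -> (1 <= N)%nat ->
 Cmod (psum (S N) s - (Zf s/(s - 1) - npw (INR (S N)) (s - 1)/(s - 1)))%C
 <= (/ 2 + Cmod (s*s*s - s)%C/Cmod (s - 1)%C)*rpw (INR N) (fst s).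
Proof.
 intros Hs H1 HN. note (Z_partial s N !! HN) as ZP.
 ha Hn : (s - 1)%C <> 0%C.
 { intros E. apply H1. replace s with ((s - 1) + 1)%C by ring. rewrite E. ring. }
 ha Hm : 0 < Cmod (s - 1)%C by (apply Cmod_gt_0; exact Hn).
 set (B := ((s - 1)*psum (S N) s - (s - 1)/2*npw (INR (S N)) s + npw (INR (S N)) (s - 1))%C) in *.
 replace (psum (S N) s - (Zf s/(s - 1) - npw (INR (S N)) (s - 1)/(s - 1)))%C
  with (/ 2*npw (INR (S N)) s + (- (Zf s - B))/(s - 1))%C by (unfold B; field; auto).
 via Cmod_triangle.
 rewrite Cmod_mult, Cmod_div, Cmod_opp, Cmod_npw by exact Hn.
 replace (Cmod (/ 2)%C) with (/ 2) by (rewrite <- RtoC_inv, Cmod_R, Rabs_pos_eq; lra).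
 ha N1 : 1 <= INR N by (change 1 with (INR 1); apply le_INR, HN).
 ha X1 : rpw (INR (S N)) (fst s) <= rpw (INR N) (fst s) by (apply rpw_anti; [lra|rewrite S_INR; lra]).
 ha X2 : rpw (INR N) (fst s + 1) <= rpw (INR N) (fst s) by (apply rpw_exp_anti; lra).
 ha X3 : Cmod (Zf s - B)%C <= Cmod (s*s*s - s)%C*rpw (INR N) (fst s).
 { via ZP. apply mle_l; [ar|].
  note (rpw_pos (INR N) (fst s + 1)).
  mid (rpw (INR N) (fst s + 1)); [|ar].
  mid (1*(rpw (INR N) (fst s + 1)/(fst s + 1))).
  - apply mle_r; [|lra]. apply Rle_div_r; lra.
  - rewrite Rmult_1_l. apply Rle_div_l; [lra|]. nra. }
 mid (/ 2*rpw (INR N) (fst s) + Cmod (s*s*s - s)%C*rpw (INR N) (fst s)/Cmod (s - 1)%C).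
 - apply add_le; [lra|]. apply mle_r; ar.
 - ar.
Qed.

Lemma INR_2S N : INR (2*S N) = 2*INR (S N).
Proof. rewrite mult_INR. ar. Qed.

(** Since (2N)^(1-s) = 2 * 2^(-s) N^(1-s), the growing terms of the two partial sums in [alt_even]
    cancel. At a zero of [Zf] the constant terms are gone as well, and only O(N^(-Re s)) is left. *)
Lemma alt_partial (s : C) N : 0 < fst s -> s <> 1%C -> Zf s = 0%C -> (1 <= N)%nat ->
 Cmod (csum (fun k => alt k s) (2*S N)) <= (1 + 2*Cmod (npw 2 s))*(/ 2 + Cmod (s*s*s - s)%C/Cmod (s - 1)%C)*rpw (INR N) (fst s).
Proof.
 intros Hs H1 HZ HN. rewrite alt_even.
 ha Hn : (s - 1)%C <> 0%C.
 { intros E. apply H1. replace s with ((s - 1) + 1)%C by ring. rewrite E. ring. }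
 note (psum_asym s N Hs H1 HN) as A.
 ha E2 : (2*S N = S (2*N + 1))%nat by lia.
 note (psum_asym s (2*N + 1) Hs H1 ltac:(lia)) as B. rewrite <- E2 in B.
 rewrite HZ in A, B. set (K := / 2 + Cmod (s*s*s - s)%C/Cmod (s - 1)%C) in *.
 ha X : rpw (INR (2*N + 1)) (fst s) <= rpw (INR N) (fst s).
 { apply rpw_anti; [lra|]. split; [apply lt_0_INR; lia|apply le_INR; lia]. }
 ha K0 : 0 <= K.
 { unfold K. assert (0 < Cmod (s - 1)%C) by (apply Cmod_gt_0; exact Hn).
  ar. }
 ha Q : npw (INR (2*S N)) (s - 1)%C = (2*npw 2 s*npw (INR (S N)) (s - 1))%C.
 { rewrite INR_2S, npw_mult by (try apply INRS_pos; lra). f_equal.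
  unfold Cminus. rewrite npw_plus, Cmult_comm. f_equal. unfold npw.
  replace (- ln 2 * - (1))%C with (RtoC (ln 2)) by ring.
  unfold cexp, RtoC; simpl. rewrite exp_ln, cos_0, sin_0 by lra. ar. }
 replace (psum (2*S N) s - 2*npw 2 s*psum (S N) s)%C with
  ((psum (2*S N) s - (0/(s - 1) - npw (INR (2*S N)) (s - 1)/(s - 1)))
   + (- (2*npw 2 s))*(psum (S N) s - (0/(s - 1) - npw (INR (S N)) (s - 1)/(s - 1))))%C.
 2:{ rewrite Q. ar. }
 via Cmod_triangle. rewrite Cmod_mult, Cmod_opp, Cmod_mult, Cmod_R, (Rabs_pos_eq 2) by lra.
 note (Cmod_ge_0 (npw 2 s)) as P.
 ar.
Qed.

Lemma rpw_cv0 a : 0 < a -> is_lim_seq (fun N => rpw (INR N) a) 0.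
Proof.
 intros Ha. apply is_lim_seq_spec. intros eps.
 destruct (INR_unbounded (exp (- ln eps/a))) as [N0 HN]. exists N0. intros N HN'.
 note (exp_pos (- ln eps/a)) as E. ha I : INR N0 <= INR N by (apply le_INR; exact HN').
 rewrite Rminus_0_r, Rabs_pos_eq by (left; apply rpw_pos).
 unfold rpw. rewrite <- (exp_ln eps) by apply cond_pos. apply exp_increasing.
 assert (- ln eps/a < ln (INR N)).
 { rewrite <- (ln_exp (- ln eps/a)). apply ln_increasing; lra. }
 assert (- ln eps/a*a = - ln eps) by ar. nra.
Qed.

Lemma cpow_neg_npw n s : 0 < n -> cpow_neg n s = npw n s.
Proof.
 intros Hn. unfold cpow_neg, npw, cexp, Rpower; simpl.
 replace (- fst s*ln n) with (- ln n*fst s - - 0*snd s) by ring.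
 replace (- ln n*snd s + - 0*fst s) with (- (snd s*ln n)) by ring.
 rewrite cos_neg, sin_neg. ar.
Qed.

Lemma sum_even_odd_cv0 (u : nat -> R) (v w : nat -> R) : is_lim_seq v 0 -> is_lim_seq w 0 ->
 (forall N, (1 <= N)%nat -> Rabs (u (2*S N)%nat) <= v N) -> (forall n, Rabs (u (S n) - u n) <= w n) ->
 is_lim_seq u 0.
Proof.
 intros Hv Hw H1 H2. apply is_lim_seq_spec. intros eps.
 apply is_lim_seq_spec in Hv. apply is_lim_seq_spec in Hw.
 destruct (Hv (mkposreal (eps/2) ltac:(note (cond_pos eps); lra))) as [N1 P1].
 destruct (Hw (mkposreal (eps/2) ltac:(note (cond_pos eps); lra))) as [N2 P2].
 exists (2*(N1 + N2 + 3))%nat. intros n Hn. rewrite Rminus_0_r. simpl in P1, P2.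
 note (cond_pos eps).
 destruct (Nat.Even_or_Odd n) as [[m Em]|[m Em]].
 - assert (exists k, m = S k /\ (N1 + N2 + 2 <= k)%nat) as [k [Ek Lk]] by (exists (m - 1)%nat; lia).
  subst m n. specialize (H1 k ltac:(lia)). specialize (P1 k ltac:(lia)). rewrite Rminus_0_r in P1.
  note (Rle_abs (v k)). lra.
 - assert (exists k, m = S k /\ (N1 + N2 + 1 <= k)%nat) as [k [Ek Lk]] by (exists (m - 1)%nat; lia).
  subst m. subst n. specialize (H1 k ltac:(lia)). specialize (P1 k ltac:(lia)). rewrite Rminus_0_r in P1.
  specialize (H2 (2*S k)%nat). specialize (P2 (2*S k)%nat ltac:(lia)). rewrite Rminus_0_r in P2.
  replace (2*S k + 1)%nat with (S (2*S k)) by lia.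
  note (Rle_abs (v k)). note (Rle_abs (w (2*S k)%nat)).
  replace (u (S (2*S k))) with ((u (S (2*S k)) - u (2*S k)%nat) + u (2*S k)%nat) by ring.
  eapply Rle_lt_trans; [apply Rabs_triang|]. lra.
Qed.

(** Ties [Zf] to the zeta function of the statement. In the critical strip the eta series converges
    only conditionally, so sums of even length are estimated first; those of odd length differ from
    them by one small term. *)
Lemma Zf_zero_eta (s : C) : 0 < fst s -> s <> 1%C -> Zf s = 0%C -> eta s = 0%C.
Proof.
 intros Hs H1 HZ.
 set (K := (1 + 2*Cmod (npw 2 s))*(/ 2 + Cmod (s*s*s - s)%C/Cmod (s - 1)%C)).
 ha L1 : is_lim_seq (fun N => K*rpw (INR N) (fst s)) 0.
 { replace (Finite 0) with (Rbar_mult K 0) by (simpl; f_equal; ring). apply is_lim_seq_scal_l, rpw_cv0, Hs. }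
 ha L2 : is_lim_seq (fun N => rpw (INR (S N)) (fst s)) 0.
 { apply (is_lim_seq_incr_1 (fun N => rpw (INR N) (fst s))), rpw_cv0, Hs. }
 ha altm : forall n, Cmod (alt n s) = rpw (INR (S n)) (fst s).
 { intros n. unfold alt. rewrite Cmod_mult, Cmod_npw, Cmod_pow.
  replace (Cmod (-1)%C) with 1; [rewrite pow1; ring|]. rewrite Cmod_R, Rabs_left; lra. }
 ha U : forall pr : C -> R, (forall z, Rabs (pr z) <= Cmod z) -> (forall a b, pr (a + b)%C = pr a + pr b) ->
  is_lim_seq (fun N => pr (csum (fun k => alt k s) N)) 0.
 { intros pr P1 P2. apply (sum_even_odd_cv0 _ _ _ L1 L2).
  - intros N HN. via P1. apply alt_partial; asm.
  - intros n. rewrite <- altm. simpl csum. rewrite P2.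
   replace (pr (csum (fun k => alt k s) n) + pr (alt n s) - pr (csum (fun k => alt k s) n)) with (pr (alt n s)) by ring.
   ar. }
 ha rp : forall k, ((-1) ^ k)%C = RtoC ((-1) ^ k) by (intros k; rewrite RtoC_pow; refl).
 unfold eta. unfold RtoC. f_equal.
 - apply is_series_unique.
  note (U fst Cmod_fst (fun a b => eq_refl)) as V. apply is_lim_seq_incr_1 in V.
  change (is_lim_seq (sum_n (fun k => (-1) ^ k*fst (cpow_neg (INR (S k)) s))) 0).
  refine (is_lim_seq_ext _ _ _ _ V). intros n. cbv beta. rewrite csum_comp. cbn [fst snd].
  apply sum_n_ext. intros k. rewrite cpow_neg_npw by apply INRS_pos. unfold alt. rewrite rp. simpl. ring.
 - apply is_series_unique.
  note (U snd Cmod_snd (fun a b => eq_refl)) as V. apply is_lim_seq_incr_1 in V.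
  change (is_lim_seq (sum_n (fun k => (-1) ^ k*snd (cpow_neg (INR (S k)) s))) 0).
  refine (is_lim_seq_ext _ _ _ _ V). intros n. cbv beta. rewrite csum_comp. cbn [fst snd].
  apply sum_n_ext. intros k. rewrite cpow_neg_npw by apply INRS_pos. unfold alt. rewrite rp. ar.
Qed.

Lemma Zf_zero_nontrivial (s : C) : 0 < fst s < 1 -> Zf s = 0%C -> nontrivial_zero s.
Proof.
 intros Hs HZ. split; [ar|]. unfold riemann_zeta. rewrite Zf_zero_eta; [|lra| |ar].
 (* The numerator is 0, and 0 times an inverse is 0 whatever the denominator. *)
 - unfold Cdiv. ring.
 - intros E. rewrite E in Hs. simpl in Hs. lra.
Qed.

Lemma Zf_zero_le_B1 (s : C) : 0 < fst s < 1 -> Zf s = 0%C -> fst s <= Defs.B1.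
Proof.
 intros Hs HZ. note (Zf_zero_nontrivial s Hs HZ) as NZ.
 unfold Defs.B1. set (E := fun r => exists rho, nontrivial_zero rho /\ r = fst rho).
 note (Lub_Rbar_correct E) as [U L].
 ha A : Rbar_le (fst s) (Lub_Rbar E) by (apply U; exists s; auto).
 ha B : Rbar_le (Lub_Rbar E) 1.
 { apply L. intros r [rho [[Hr _] ->]]. ar. }
 (* [real] would read an infinite supremum as 0. The zero s and the upper bound 1 exclude both
    infinities. *)
 destruct (Lub_Rbar E); simpl in *; try contradiction; exact A.
Qed.

Fixpoint rsum (f : nat -> R) (N : nat) : R :=
 match N with O => 0 | S N => rsum f N + f N end.

(** * The von Mangoldt function *)

Lemma rsum_ext f g N : (forall n, (n < N)%nat -> f n = g n) -> rsum f N = rsum g N.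
Proof. induction N as [|N IH]; intros H; simpl; [ar|]. rewrite IH, H; auto. Qed.

Lemma rsum_plus f g N : rsum (fun n => f n + g n) N = rsum f N + rsum g N.
Proof. induction N as [|N IH]; simpl; [ring|ar]. Qed.

Lemma rsum_zero f N : (forall n, (n < N)%nat -> f n = 0) -> rsum f N = 0.
Proof. induction N as [|N IH]; intros H; simpl; [ar|]. rewrite IH, H; auto; ring. Qed.

Lemma rsum_delta (a : R) j N : (j < N)%nat -> rsum (fun n => if Nat.eqb n j then a else 0) N = a.
Proof.
 induction N as [|N IH]; intros H; [lia|]. simpl. destruct (Nat.eqb_spec N j) as [E|E].
 - rewrite rsum_zero; [ring|]. intros n Hn. destruct (Nat.eqb_spec n j); [lia|ar].
 - rewrite IH by lia. ring.
Qed.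

Module LambdaArith.
Import ssreflect ssrbool eqtype ssrnat div prime.

Lemma Lambda_cases n : (exists q e, [/\ prime q, n = expn q (S e) & vonMangoldt n = ln (INR q)]) \/
 ((forall q e, prime q -> n <> expn q (S e)) /\ vonMangoldt n = 0).
Proof.
 rewrite /vonMangoldt. case: (boolP (_ && _)) => [/andP [n2 /eqP En]|H].
 - left. exists (pdiv n), (logn (pdiv n) n).-1. have pp := pdiv_prime n2. split => //.
  rewrite prednK; first exact: En.
  rewrite logn_gt0 mem_primes pp /= pdiv_dvd andbT. by apply: (ltn_trans _ n2).
 - right. split => // q e pq En. move/negP: H; apply. rewrite En pdiv_pfactor // pfactorK // eqxx andbT.
  have q2 := prime_gt1 pq. apply: (leq_trans q2). by rewrite expnS leq_pmulr // expn_gt0 prime_gt0.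
Qed.

(** A prime power that divides p m but not m can only be the power of p just beyond the one
    contained in m. *)
Lemma Lambda_step p m d : prime p -> (0 < m)%N ->
 (if dvdn d (muln p m) then vonMangoldt d else 0) =
 (if dvdn d m then vonMangoldt d else 0) + (if Nat.eqb d (expn p (S (logn p m))) then ln (INR p) else 0).
Proof.
 move=> pp m0. set v := logn p m.
 have lpm : logn p (muln p m) = S v by rewrite (lognM p (prime_gt0 pp) m0) logn_prime // eqxx add1n.
 have pm0 : (0 < p*m)%N by rewrite muln_gt0 prime_gt0.
 have Hd : Nat.eqb d (expn p (S v)) -> (d = expn p (S v)) by move/PeanoNat.Nat.eqb_spec.
 case: (boolP (dvdn d m)) => dm.
 - rewrite (dvdn_mull p dm). case E: (Nat.eqb d _); last by rewrite Rplus_0_r.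
  move: dm; rewrite (Hd E) pfactor_dvdn // -/v => H. by rewrite ltnn in H.
 - case: (boolP (dvdn d (muln p m))) => dpm.
  + case: (Lambda_cases d) => [[q [e [pq Ed ->]]]|[H ->]].
   * have Eq : q = p.
    { apply/eqP. apply/negPn/negP => qp. move/negP: dm; apply. move: dpm; rewrite Ed Gauss_dvdr //.
     rewrite coprimeXl // prime_coprime // dvdn_prime2 //. }
    subst q. have E1 : S e = S v.
    { apply/eqP. rewrite eqn_leq. apply/andP; split.
     - move: dpm; by rewrite Ed pfactor_dvdn // lpm.
     - rewrite ltnNge. apply/negP => Hle. move/negP: dm; apply. by rewrite Ed pfactor_dvdn. }
    rewrite Ed E1 PeanoNat.Nat.eqb_refl. by rewrite Rplus_0_l.
   * case E: (Nat.eqb d _); last by rewrite Rplus_0_l. by case: (H p v pp); apply: Hd.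
  + case E: (Nat.eqb d _); last by rewrite Rplus_0_l.
   move/negP: dpm; case. by rewrite (Hd E) pfactor_dvdn // lpm.
Qed.

(** Strong induction on n = p m with p the least prime factor: by [Lambda_step] the sum grows by log
    p. The number k only bounds n for the induction, and N is any cut-off beyond n. *)
Lemma log_Lambda_aux k : forall n N, (n <= k)%coq_nat -> (1 <= n)%coq_nat -> (n <= N)%coq_nat ->
 ln (INR n) = rsum (fun j => if dvdn (S j) n then vonMangoldt (S j) else 0) N.
Proof.
 elim: k => [|k IH] n N Hk H1 HN; first lia.
 case: (PeanoNat.Nat.eq_dec n 1) => [E|n1].
 - subst n. rewrite rsum_zero; first by rewrite ln_1.
  move=> j _. case: (boolP (dvdn _ _)) => //. by rewrite dvdn1 => /eqP ->.
 - have n2 : (1 < n)%N by apply/ltP; lia.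
  set p := pdiv n. have pp : prime p by apply: pdiv_prime.
  have [m Em] : exists m, n = muln p m.
  { have /dvdnP [m ->] := pdiv_dvd n. exists m. by rewrite mulnC. }
  have m0 : (0 < m)%N by case: m Em => // E; move: H1; rewrite E muln0; lia.
  have p2 := prime_gt1 pp.
  have mn : (m < n)%N by rewrite Em -[X in (X < _)%N]mul1n ltn_pmul2r.
  rewrite Em. rewrite (rsum_ext _ (fun j => (if dvdn (S j) m then vonMangoldt (S j) else 0) +
   (if Nat.eqb j (expn p (S (logn p m))).-1 then ln (INR p) else 0))).
  + rewrite rsum_plus -IH; [|move/ltP: mn; lia|by apply/ltP|move/ltP: mn; lia].
   rewrite rsum_delta.
   * change (muln p m) with (p*m)%coq_nat. rewrite mult_INR ln_mult; first lra.
    -- apply: lt_0_INR. apply/ltP. by apply: prime_gt0.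
    -- apply: lt_0_INR. by apply/ltP.
   * have : (expn p (S (logn p m)) <= muln p m)%N.
    { rewrite expnS leq_pmul2l ?prime_gt0 //. apply: dvdn_leq => //. by rewrite pfactor_dvdn. }
    have : (0 < expn p (S (logn p m)))%N by rewrite expn_gt0 prime_gt0.
    rewrite -Em. move=> /ltP A /leP B. lia.
  + move=> j _. rewrite (Lambda_step p m (S j)) //. congr (_ + _).
   have : (0 < expn p (S (logn p m)))%N by rewrite expn_gt0 prime_gt0.
   by case: (expn p _).
Qed.

Lemma log_Lambda n N : (1 <= n)%coq_nat -> (n <= N)%coq_nat ->
 ln (INR n) = rsum (fun j => if dvdn (S j) n then vonMangoldt (S j) else 0) N.
Proof. move=> A B. by apply: (log_Lambda_aux n). Qed.

Lemma Lambda_bounds n : (1 <= n)%coq_nat -> 0 <= vonMangoldt n <= ln (INR n).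
Proof.
 move=> n1. case: (Lambda_cases n) => [[q [e [pq En ->]]]|[_ ->]].
 - have q1 : (1 <= q)%coq_nat by apply/leP; apply: prime_gt0.
  have qn : (q <= n)%coq_nat by apply/leP; rewrite En expnS leq_pmulr // expn_gt0 prime_gt0.
  have Q1 : 1 <= INR q by change 1 with (INR 1); apply: le_INR.
  split; [rewrite -ln_1|]; apply: ln_le; try lra. by apply: le_INR.
 - split; first lra. rewrite -ln_1. apply: ln_le; first lra. change 1 with (INR 1). by apply: le_INR.
Qed.

Lemma dvd_sum (f : nat -> C) d N : (1 <= d)%coq_nat ->
 csum (fun j => if dvdn d (S j) then f (S j) else 0%C) N = csum (fun j => f (d*S j)%coq_nat) (Nat.div N d).
Proof.
 move=> d1. elim: N => [|N IH]; first by rewrite PeanoNat.Nat.div_0_l //; lia.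
 rewrite [LHS]/= IH.
 case: (boolP (dvdn d (S N))) => [/dvdnP [q Eq]|H].
 - case: q Eq => [|q] Eq; first by [].
  have Eq' : S N = (S q*d)%coq_nat by exact: Eq.
  have -> : (Nat.div (S N) d) = S q by rewrite Eq' PeanoNat.Nat.div_mul //; lia.
  have -> : (Nat.div N d) = q.
  { symmetry. apply: (PeanoNat.Nat.div_unique _ _ _ (d - 1)%coq_nat); nia. }
  rewrite /=. congr (_ + f _)%C. nia.
 - rewrite Cplus_0_r. congr (csum _ _).
  have E := PeanoNat.Nat.div_mod N d ltac:(lia). have L := PeanoNat.Nat.mod_upper_bound N d ltac:(lia).
  apply: (PeanoNat.Nat.div_unique _ _ _ (S (Nat.modulo N d))); last lia.
  case: (PeanoNat.Nat.eq_dec (S (Nat.modulo N d)) d) => [E2|]; last lia.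
  move/negP: H; case. apply/dvdnP. exists (S (Nat.div N d)).
  change (S N = (S (Nat.div N d)*d)%coq_nat). simpl. lia.
Qed.
End LambdaArith.
Import LambdaArith.

(** * Dirichlet series of the von Mangoldt function and lower bounds for zeta *)

Definition Lam (k : nat) : R := vonMangoldt (S k).

Lemma Lam_bd k : 0 <= Lam k <= ln (INR (S k)).
Proof. apply Lambda_bounds. lia. Qed.

Lemma INR_ge1 k : 1 <= INR (S k).
Proof. rewrite S_INR. note (pos_INR k). lra. Qed.

Lemma lnS_pos k : 0 <= ln (INR (S k)).
Proof. rewrite <- ln_1. apply ln_le; [lra|apply INR_ge1]. Qed.

(** The Dirichlet series of -zeta'/zeta; [Lser] is that of -zeta', and [Dr] is [Dser] on the real
    axis. Indices are shifted: k stands for the integer k + 1. *)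
Definition Dser (s : C) : C := CSer (fun k => Lam k*npw (INR (S k)) s)%C.
Definition Lser (s : C) : C := CSer (fun k => ln (INR (S k))*npw (INR (S k)) s)%C.
Definition Dr (a : R) : R := Series (fun k => Lam k*rpw (INR (S k)) a).

Lemma lnrpw_bound k a e : 0 < e -> ln (INR (S k))*rpw (INR (S k)) a <= / e*rpw (INR (S k)) (a - e).
Proof.
 intros He. note (ln_pow_bound (ln (INR (S k))) e 1 (lnS_pos k) He) as B. rewrite !pow_1 in B.
 change (INR 1) with 1 in B. rewrite Rmult_1_l in B. note (rpw_pos (INR (S k)) a).
 etr; [apply mle_r; [lra|exact B]|].
 rewrite Rmult_assoc. apply mle_l; [ar|].
 unfold rpw. rewrite <- exp_plus. ar.
Qed.

Lemma coef_ex (c : nat -> R) s : 1 < fst s -> (forall k, 0 <= c k <= ln (INR (S k))) ->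
 ex_series (fun k => Cmod (c k*npw (INR (S k)) s)%C).
Proof.
 intros Hs Hc. set (e := (fst s - 1)/2).
 destruct (rpw_sum_all (fst s - e) ltac:(unfold e; lra)) as [E _].
 apply (exs_le _ (fun k => / e*rpw (INR (S k)) (fst s - e))).
 - intros k. split; [ar|]. rewrite Cmod_mult, Cmod_R, Cmod_npw, Rabs_pos_eq by apply Hc.
  etr; [apply mle_r; [left; apply rpw_pos|apply Hc]|]. apply lnrpw_bound. unfold e; lra.
 - apply (exs_sc (V := RNM)), E.
Qed.

Lemma coef_tail (c : nat -> R) s N : 1 < fst s -> (forall k, 0 <= c k <= ln (INR (S k))) -> (1 <= N)%nat ->
 Cmod (CSer (fun k => c k*npw (INR (S k)) s)%C - csum (fun k => c k*npw (INR (S k)) s)%C N)%C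
 <= / ((fst s - 1)/2)/((fst s - 1)/2)*rpw (INR N) ((fst s - 1)/2).
Proof.
 intros Hs Hc HN. destruct (CSer_split _ N (coef_ex c s Hs Hc)) as [E1 E2]. rewrite E2.
 match goal with |- Cmod (?a + ?b - ?a)%C <= _ => replace (a + b - a)%C with b by ring end.
 set (e := (fst s - 1)/2).
 destruct (rpw_sum N (fst s - e) HN ltac:(unfold e; lra)) as [A B].
 via (CSer_norm _ (fun n => / e*rpw (INR (N + n) + 1) (fst s - e))).
 - intros n. rewrite Cmod_mult, Cmod_R, Cmod_npw, Rabs_pos_eq by apply Hc. rewrite <- (S_INR (N + n)).
  etr; [apply mle_r; [left; apply rpw_pos|apply Hc]|]. apply lnrpw_bound. unfold e; lra.
 - apply (exs_sc (V := RNM)), A.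
 - rewrite Series_scal_l. unfold Rdiv at 1. rewrite Rmult_assoc. apply mle_l; [left; apply inv_pos; unfold e; lra|].
  replace (fst s - e - 1) with e in B by (unfold e; field). ar.
Qed.

Lemma csum_plus f g N : csum (fun k => f k + g k)%C N = (csum f N + csum g N)%C.
Proof. induction N as [|N IH]; simpl; [ring|rewrite IH; ring]. Qed.

Lemma csum_scal c f N : csum (fun k => c*f k)%C N = (c*csum f N)%C.
Proof. induction N as [|N IH]; simpl; [ring|rewrite IH; ring]. Qed.

Lemma csum_swap (f : nat -> nat -> C) N M : csum (fun j => csum (fun k => f j k) M) N = csum (fun k => csum (fun j => f j k) N) M.
Proof.
 induction N as [|N IH]; simpl.
 - induction M as [|M IHM]; simpl; [ar|rewrite <- IHM; ring].
 - rewrite IH, <- csum_plus. ar.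
Qed.

Lemma csum_norm f (M : nat -> R) N : (forall k, (k < N)%nat -> Cmod (f k) <= M k) -> Cmod (csum f N) <= rsum M N.
Proof.
 induction N as [|N IH]; intros H; simpl; [rewrite Cmod_0; lra|].
 via Cmod_triangle. apply add_le; auto.
Qed.

Lemma csum_RtoC (f : nat -> R) N : csum (fun k => RtoC (f k)) N = RtoC (rsum f N).
Proof. induction N as [|N IH]; simpl; [ar|rewrite IH, RtoC_plus; refl]. Qed.

Lemma rsum_le_Series (f : nat -> R) N : (forall k, 0 <= f k) -> ex_series f -> rsum f N <= Series f.
Proof.
 intros H E. destruct N as [|M].
 - simpl. mid (Series (fun _ => 0)).
  + right. symmetry. apply is_series_unique. apply is_series_Reals.
   intros eps He. exists O. intros n _. rewrite sum_cte, Rmult_0_l. unfold Rdist. rewrite Rminus_0_r, Rabs_R0. exact He.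
  + apply Series_le; ar.
 - rewrite (Series_incr_n f (S M)) by (lia || exact E). simpl pred.
  ha R : rsum f (S M) = sum_f_R0 f M.
  { clear E. induction M as [|M IH]; simpl in *; [ring|]. ar. }
  rewrite R. assert (0 <= Series (fun k => f (S M + k)%nat)); [|lra].
  mid (Series (fun _ => 0)).
  + right. symmetry. apply is_series_unique. apply is_series_Reals.
   intros eps He. exists O. intros n _. rewrite sum_cte, Rmult_0_l. unfold Rdist. rewrite Rminus_0_r, Rabs_R0. exact He.
  + apply Series_le; [ar|]. apply (ex_series_incr_n f (S M)). ar.
Qed.

Lemma log_sum_finite N s : csum (fun j => ln (INR (S j))*npw (INR (S j)) s)%C N =
 csum (fun k => Lam k*npw (INR (S k)) s*psum (N/S k)%nat s)%C N.
Proof.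
 transitivity (csum (fun j => csum (fun k => (if div.dvdn (S k) (S j) then RtoC (Lam k)*npw (INR (S j)) s else 0))%C N) N).
 - apply csum_ext. intros j Hj.
  rewrite (log_Lambda (S j) N) by lia. rewrite <- csum_RtoC, Cmult_comm, <- csum_scal.
  apply csum_ext. intros k Hk. fold (Lam k). destruct (div.dvdn (S k) (S j)); ring.
 - rewrite csum_swap. apply csum_ext. intros k Hk.
  rewrite (dvd_sum (fun n => RtoC (Lam k)*npw (INR n) s)%C (S k) N) by lia. unfold psum. rewrite <- csum_scal. apply csum_ext. intros j _.
  rewrite mult_INR, npw_nat_mult. ring.
Qed.

(** For d <= N the integer quotient loses at most a factor 2 against N/d. *)
Lemma floor_rpw N d a : 0 <= a -> (1 <= d <= N)%nat -> rpw (INR (N/d)) a <= exp (a*ln 2)*(/ rpw (INR d) a)*rpw (INR N) a.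
Proof.
 intros Ha Hd.
 ha q1 : (1 <= N/d)%nat by (apply Nat.div_le_lower_bound; lia).
 ha D0 : 0 < INR d by (apply lt_0_INR; lia). ha N0 : 0 < INR N by (apply lt_0_INR; lia).
 ha Q0 : 0 < INR (N/d) by (apply lt_0_INR; lia).
 ha H : INR N <= 2*INR d*INR (N/d).
 { change 2 with (INR 2). rewrite <- !mult_INR. apply le_INR.
  note (Nat.div_mod N d ltac:(lia)). note (Nat.mod_upper_bound N d ltac:(lia)). nia. }
 unfold rpw. rewrite <- exp_Ropp, <- !exp_plus. apply exp_le.
 ha L : ln (INR N) <= ln 2 + ln (INR d) + ln (INR (N/d)).
 { rewrite <- !ln_mult by ar. ar. }
 nra.
Qed.

(** The convolution identity log = Lambda * 1 on sums cut off at N: the inner sum stops at N/(k+1)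
    and misses zeta by about (N/(k+1))^(-a). [floor_rpw] trades this for (k+1)^a N^(-a); as a is
    half the distance from Re s to 1, the weighted series [cf] still converges. *)
Lemma zeta_D s : 1 < fst s -> (zeta s*Dser s)%C = Lser s.
Proof.
 intros Hs. set (a := (fst s - 1)/2). ha a0 : 0 < a by (unfold a; lra).
 destruct (rpw_sum_all (fst s - a) ltac:(unfold a; lra)) as [E _].
 set (cf := fun k => Lam k*rpw (INR (S k)) (fst s - a)).
 ha Ecf : ex_series cf.
 { apply (ex_series_ext (fun k => Cmod (Lam k*npw (INR (S k)) ((fst s - a)%R, 0%R))%C)).
  - intros k. rewrite Cmod_mult, Cmod_R, Cmod_npw, Rabs_pos_eq by apply Lam_bd. refl.
  - apply coef_ex; [simpl; unfold a; lra|apply Lam_bd]. }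
 ha cf0 : forall k, 0 <= cf k by (intros; apply mul_nn; [apply Lam_bd|left; apply rpw_pos]).
 ha H : Cmod (zeta s*Dser s - Lser s)%C <= 0.
 { apply (le_rpw_limit _ ((Cmod (zeta s) + 1)*(/ a/a) + Series cf*(exp (a*ln 2)/(fst s - 1))) a a0).
  intros N HN.
  note (coef_tail Lam s N Hs Lam_bd HN) as T1.
  note (coef_tail (fun k => ln (INR (S k))) s N Hs (fun k => conj (lnS_pos k) (Rle_refl _)) HN) as T2.
  cbv beta in T2. fold (Dser s) in T1. fold (Lser s) in T2. fold a in T1, T2.
  set (DN := csum (fun k => Lam k*npw (INR (S k)) s)%C N) in *.
  set (LN := csum (fun k => ln (INR (S k))*npw (INR (S k)) s)%C N) in *.
  ha T3 : Cmod (zeta s*DN - LN)%C <= Series cf*(exp (a*ln 2)/(fst s - 1))*rpw (INR N) a.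
  { unfold LN. rewrite log_sum_finite. unfold DN.
   replace (zeta s*csum (fun k => Lam k*npw (INR (S k)) s) N - csum (fun k => Lam k*npw (INR (S k)) s*psum (N/S k) s) N)%C
    with (csum (fun k => Lam k*npw (INR (S k)) s*(zeta s - psum (N/S k) s))%C N).
   2:{ rewrite <- csum_scal. symmetry.
     rewrite (csum_ext (fun k => Lam k*npw (INR (S k)) s*(zeta s - psum (N/S k) s))%C
      (fun k => zeta s*(Lam k*npw (INR (S k)) s) + (-1)*(Lam k*npw (INR (S k)) s*psum (N/S k) s))%C) by ar.
     rewrite csum_plus, (csum_scal (-1)). ring. }
   set (K := exp (a*ln 2)/(fst s - 1)*rpw (INR N) a).
   ha K0 : 0 <= K.
   { unfold K. apply mul_nn; [|left; apply rpw_pos]. ar. }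
   mid (rsum (fun k => K*cf k) N).
   - apply csum_norm. intros k Hk. rewrite !Cmod_mult, Cmod_R, Cmod_npw, Rabs_pos_eq by apply Lam_bd.
    ha q1 : (1 <= N/S k)%nat by (apply Nat.div_le_lower_bound; lia).
    note (zeta_tail s (N/S k) Hs q1) as Zt.
    ha Z2 : rpw (INR (N/S k)) (fst s - 1) <= rpw (INR (N/S k)) a.
    { apply rpw_exp_anti; [change 1 with (INR 1); apply le_INR, q1|unfold a; lra]. }
    note (floor_rpw N (S k) a !! ltac:(lia)) as Fl.
    note (rpw_pos (INR (S k)) (fst s)) as P1. note (rpw_pos (INR (S k)) a) as P2.
    note (proj1 (Lam_bd k)) as P3.
    unfold cf. ha Sp : rpw (INR (S k)) (fst s - a) = rpw (INR (S k)) (fst s) * / rpw (INR (S k)) a.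
    { unfold rpw. rewrite <- exp_Ropp, <- exp_plus. f_equal. ring. }
    rewrite Sp.
    replace (K*(Lam k*(rpw (INR (S k)) (fst s) * / rpw (INR (S k)) a)))
     with (Lam k*rpw (INR (S k)) (fst s)*(K * / rpw (INR (S k)) a)) by ring.
    apply mle_l; [ar|].
    via Zt. apply Rle_div_l; [lra|].
    via Z2. via Fl. unfold K. right. field. split; lra.
   - ha R : forall M, rsum (fun k => K*cf k) M = K*rsum cf M.
    { intros M. induction M as [|M IH]; simpl; [ring|ar]. }
    rewrite R. replace (Series cf*(exp (a*ln 2)/(fst s - 1))*rpw (INR N) a) with (K*Series cf) by (unfold K; ring).
    apply mle_l; [ar|]. apply rsum_le_Series; asm. }
  replace (zeta s*Dser s - Lser s)%C with (zeta s*(Dser s - DN) + (zeta s*DN - LN) + (- (Lser s - LN)))%C by ring.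
  via Cmod_tri3. rewrite Cmod_opp, Cmod_mult.
  note (Cmod_ge_0 (zeta s)).
  ar. }
 ha E0 : Cmod (zeta s*Dser s - Lser s)%C = 0 by (note (Cmod_ge_0 (zeta s*Dser s - Lser s)%C); lra).
 apply Cmod_eq_0 in E0. replace (Lser s) with (zeta s*Dser s - (zeta s*Dser s - Lser s))%C by ring. rewrite E0. ring.
Qed.

Lemma zeta_Cd s : 1 < fst s -> Cd zeta s (- (zeta s*Dser s))%C.
Proof.
 intros Hs. rewrite zeta_D by exact Hs.
 set (r := (fst s - 1)/4).
 ha Eq : (- Lser s)%C = CSer (fun n => - (ln (INR (S n)))*npw (INR (S n)) s)%C.
 { unfold Lser. rewrite (CSer_ext (fun n => - (ln (INR (S n)))*npw (INR (S n)) s)%C (fun n => (-1)*(ln (INR (S n))*npw (INR (S n)) s))%C) by ar.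
  rewrite CSer_scal; [ring|]. apply coef_ex; [ar|]. intros k; split; [apply lnS_pos|lra]. }
 rewrite Eq. unfold zeta.
 apply (CSer_Cd (fun n z => npw (INR (S n)) z) (fun n z => - (ln (INR (S n)))*npw (INR (S n)) z)%C s
  (fun n => ln (INR (S (S n))) ^ 2*rpw (INR (S n)) (fst s - r)) r).
 - unfold r; lra.
 - apply ln_sum. unfold r; lra.
 - apply (ex_series_ext (fun k => Cmod (ln (INR (S k))*npw (INR (S k)) s)%C)).
  + intros k. rewrite !Cmod_mult, Cmod_opp. refl.
  + apply coef_ex; [ar|]. intros k; split; [apply lnS_pos|lra].
 - intros h Hh. apply zeta_ex. simpl. note (Cmod_fst h) as Fh. apply abs_btw in Fh. unfold r in Hh; lra.
 - intros n h Hh. etr; [apply npw_remainder, INR_ge1|]. apply mle_l; [ar|].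
  rewrite Rmult_assoc. note (lnS_pos n) as L0.
  apply mle; [ar|apply mul_nn; left; [ar|apply rpw_pos]| |].
  + apply pow_incr. split; [ar|]. apply ln_le; [apply INRS_pos|]. rewrite (S_INR (S n)); lra.
  + unfold rpw. rewrite <- exp_plus. apply exp_le. nra.
Qed.

Lemma Cd_unique (f : C -> C) (s l m : C) : Cd f s l -> Cd f s m -> l = m.
Proof.
 intros H1 H2. note (Cd_minus f f s l m H1 H2) as H.
 ha Z : Cmod (l - m)%C <= 0.
 { apply le_epsilon. intros eps He. rewrite Rplus_0_l. destruct (H eps He) as [d [Hd Hh]].
  specialize (Hh (RtoC (d/2))). rewrite Cmod_R, Rabs_pos_eq in Hh by lra. specialize (Hh !!).
  replace (f (s + RtoC (d/2))%C - f (s + RtoC (d/2))%C - (f s - f s) - (l - m)*RtoC (d/2))%C with (- ((l - m)*RtoC (d/2)))%C in Hh by ring.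
  rewrite Cmod_opp, Cmod_mult, Cmod_R, Rabs_pos_eq in Hh by lra. nra. }
 ha E : Cmod (l - m)%C = 0 by (note (Cmod_ge_0 (l - m)%C); lra).
 apply Cmod_eq_0 in E. replace l with ((l - m) + m)%C by ring. rewrite E. ring.
Qed.

Lemma Z1_D s : 1 < fst s -> Z1 s = (Zf s*(/ (s - 1) - Dser s))%C.
Proof.
 intros Hs.
 ha Hn : (s - 1)%C <> 0%C.
 { intros E. assert (fst (s - 1)%C = 0) by (rewrite E; refl). simpl in H. lra. }
 ha A : Cd Zf s (zeta s + (s - 1)*(- (zeta s*Dser s)))%C.
 { apply (Cd_ext_loc (fun z => (z - 1)*zeta z)%C Zf s _ (fst s - 1)); [lra| |].
  - intros z Hz. symmetry. apply Zf_zeta. note (Cmod_fst (z - s)%C) as Fz. simpl in Fz.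
   assert (Rabs (fst z + - fst s) < fst s - 1) as Q by lra. apply Rabs_def2 in Q. lra.
  - apply (Cd_eq _ _ ((1 - 0)*zeta s + (s - 1) * - (zeta s*Dser s))%C); [ring|].
   apply (Cd_mult (fun z => z - 1)%C zeta); [|apply zeta_Cd, Hs].
   apply (Cd_minus (fun z => z) (fun _ => 1%C)); [apply Cd_id|apply Cd_const]. }
 rewrite (Cd_unique _ _ _ _ (Zf_Cd s !!) A), Zf_zeta by exact Hs. field. ar.
Qed.

Lemma Dser_ex s : 1 < fst s -> ex_series (fun k => Cmod (Lam k*npw (INR (S k)) s)%C).
Proof. intros Hs. apply coef_ex; [ar|apply Lam_bd]. Qed.

Lemma Dr_ex a : 1 < a -> ex_series (fun k => Lam k*rpw (INR (S k)) a).
Proof.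
 intros Ha. apply (ex_series_ext (fun k => Cmod (Lam k*npw (INR (S k)) (a, 0%R))%C)).
 - intros k. rewrite Cmod_mult, Cmod_R, Cmod_npw, Rabs_pos_eq by apply Lam_bd. refl.
 - apply Dser_ex. ar.
Qed.

Lemma Dser_norm s : 1 < fst s -> Cmod (Dser s) <= Dr (fst s).
Proof.
 intros Hs. apply CSer_norm; [|apply Dr_ex, Hs]. intros k.
 rewrite Cmod_mult, Cmod_R, Cmod_npw, Rabs_pos_eq by apply Lam_bd. lra.
Qed.

Lemma npw_real y a : npw y (a, 0) = RtoC (rpw y a).
Proof.
 unfold npw, cexp, rpw, RtoC; simpl. replace (- ln y*0 + - 0*a) with 0 by ring.
 replace (- ln y*a - - 0*0) with (- a*ln y) by ring. rewrite cos_0, sin_0. ar.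
Qed.

Lemma Dser_real a : 1 < a -> Dser (a, 0) = RtoC (Dr a).
Proof.
 intros Ha. unfold Dser, Dr, CSer, RtoC. f_equal.
 - apply Series_ext. intros k. rewrite npw_real. simpl. ring.
 - rewrite (Series_ext _ (fun k => 0*Lam k)).
  + rewrite Series_scal_l. ring.
  + intros k. rewrite npw_real. ar.
Qed.

Lemma zeta_1 s : 1 < fst s -> Cmod (zeta s - 1)%C <= / (fst s - 1).
Proof.
 intros Hs. note (zeta_tail s 1 Hs (le_n 1)) as Zt.
 replace (psum 1 s) with (RtoC 1) in Zt.
 - change (INR 1) with 1 in Zt. rewrite rpw_1 in Zt. unfold Rdiv in Zt. lra.
 - unfold psum; simpl. rewrite npw_1. ring.
Qed.

Lemma zeta_bound s : 1 < fst s -> Cmod (zeta s) <= fst s/(fst s - 1).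
Proof.
 intros Hs. destruct (rpw_sum_all (fst s) Hs) as [E B]. etr; [|exact B].
 apply CSer_norm; [|ar]. intros k. rewrite Cmod_npw. lra.
Qed.

Lemma Rd_sq (g : R -> C) t (l : C) : Rd g t l ->
 is_derive (fun u => Cmod (g u) ^ 2) t (2*(fst (g t)*fst l + snd (g t)*snd l)).
Proof.
 intros [A B]. apply (is_derive_ext (fun u => fst (g u)*fst (g u) + snd (g u)*snd (g u))).
 - intros u. rewrite Cmod_sq. req; ring.
 - eapply dR_eq; [|exact (dR_plus _ _ _ _ _ (dR_mult _ _ _ _ _ A A) (dR_mult _ _ _ _ _ B B))]. ar.
Qed.

(* |zeta(s)|^2 zeta(Re s)^2 decreases in Re s since |Re D(s)| <= D(Re s), and it tends to 1. *)
Lemma zeta_lower s : 1 < fst s -> (fst s - 1)/fst s <= Cmod (zeta s).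
Proof.
 intros Hs. destruct s as [a t]. simpl in Hs |- *.
 set (phi := fun x => Cmod (zeta (x, t)) ^ 2*Cmod (zeta (x, 0)) ^ 2).
 ha D : forall x, 1 < x -> is_derive phi x (- 2*(fst (Dser (x, t)) + Dr x)*phi x).
 { intros x Hx. unfold phi.
  note (Rd_sq _ _ _ (Cd_re zeta x t _ (zeta_Cd (x, t) Hx))) as D1.
  note (Rd_sq _ _ _ (Cd_re zeta x 0 _ (zeta_Cd (x, 0) Hx))) as D2.
  eapply dR_eq; [|apply dR_mult; [exact D1|exact D2]].
  rewrite (Dser_real x Hx), !Cmod_sq.
  ar. }
 ha phi0 : forall x, 0 <= phi x by (intros; apply mul_nn; apply pow2_ge_0).
 ha Dec : forall x y, 1 < x -> x <= y -> phi y <= phi x.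
 { intros x y Hx Hy.
  destruct (MVT_gen phi x y (fun x => - 2*(fst (Dser (x, t)) + Dr x)*phi x)) as [z [Hz Ez]].
  - rewrite Rmin_left, Rmax_right by exact Hy. intros; apply D; lra.
  - rewrite Rmin_left, Rmax_right by exact Hy. intros; apply cR_iff; eapply cR_der; apply D; lra.
  - rewrite Rmin_left, Rmax_right in Hz by exact Hy.
   assert (0 <= fst (Dser (z, t)) + Dr z).
   { note (Dser_norm (z, t) ltac:(simpl; lra)) as N. simpl in N. note (Cmod_fst (Dser (z, t))) as Fz.
    apply abs_btw in Fz. lra. }
   specialize (phi0 z).
   assert (0 <= (fst (Dser (z, t)) + Dr z)*phi z) by ar. nra. }
 ha One : 1 <= phi a.
 { apply Rnot_lt_le. intros N. set (d := (1 - phi a)/8).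
  ha d0 : 0 < d <= 1/8 by (unfold d; specialize (phi0 a); lra).
  set (y := Rmax (a + 1) (1 + / d)).
  ha Y1 : a + 1 <= y by apply Rmax_l. ha Y2 : 1 + / d <= y by apply Rmax_r.
  ha id : 0 < / d by ar.
  ha B : forall t', 1 - d <= Cmod (zeta (y, t')).
  { intros t'. note (zeta_1 (y, t') ltac:(simpl; lra)) as Z. simpl in Z.
   assert (/ (y - 1) <= d).
   { rewrite <- (Rinv_inv d). ar. }
   note (Cmod_sub_ge 1%C (1 - zeta (y, t'))%C) as T. rewrite Cmod_1 in T.
   replace (1 - (1 - zeta (y, t')))%C with (zeta (y, t')) in T by ring.
   rewrite Cmod_sym in Z. lra. }
  note (Dec a y Hs !!) as Q. unfold phi in Q at 1.
  note (B t) as B1. note (B 0) as B2.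
  ha S1 : (1 - d) ^ 2 <= Cmod (zeta (y, t)) ^ 2 by ar.
  ha S2 : (1 - d) ^ 2 <= Cmod (zeta (y, 0)) ^ 2 by ar.
  ha S3 : 1 - 2*d <= (1 - d) ^ 2 by nra.
  assert (phi a = 1 - 8*d) by (unfold d; field). nra. }
 note (zeta_bound (a, 0) Hs) as ZB. simpl in ZB.
 note (Cmod_ge_0 (zeta (a, t))) as P1. note (Cmod_ge_0 (zeta (a, 0))) as P2.
 ha O2 : 1 <= Cmod (zeta (a, t))*Cmod (zeta (a, 0)).
 { unfold phi in One. apply Rnot_lt_le. intros N.
  assert (0 <= Cmod (zeta (a, t))*Cmod (zeta (a, 0))) by ar. nra. }
 apply Rle_div_l; [lra|].
 ha Q : 1 <= Cmod (zeta (a, t))*(a/(a - 1)).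
 { ar. }
 apply (mle_r (a - 1)) in Q; [|lra].
 replace (Cmod (zeta (a, t))*(a/(a - 1))*(a - 1)) with (Cmod (zeta (a, t))*a) in Q by ar. lra.
Qed.

Lemma Zf_lower s : 1 < fst s -> Cmod (s - 1)%C*((fst s - 1)/fst s) <= Cmod (Zf s).
Proof.
 intros Hs. rewrite Zf_zeta, Cmod_mult by exact Hs. apply mle_l; [ar|apply zeta_lower, Hs].
Qed.

Lemma Zf_nz s : 1 < fst s -> Zf s <> 0%C.
Proof.
 intros Hs. apply Cmod_gt_0. eapply Rlt_le_trans; [|apply Zf_lower, Hs].
 apply mul_pos; [|ar].
 note (Cmod_fst (s - 1)%C) as Fs. simpl in Fs. rewrite Rabs_pos_eq in Fs by lra. lra.
Qed.

(** This is -Z'/Z = -zeta'/zeta - 1/(s - 1). The pole at 1 is removed, so the function is regular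
    wherever [Zf] does not vanish. *)
Definition Ff (s : C) : C := (- (Z1 s/Zf s))%C.

Lemma Ff_D s : 1 < fst s -> Ff s = (Dser s - / (s - 1))%C.
Proof.
 intros Hs. unfold Ff. rewrite Z1_D by exact Hs.
 ha Hn : (s - 1)%C <> 0%C.
 { intros E. assert (fst (s - 1)%C = 0) by (rewrite E; refl). simpl in H. lra. }
 field. split; [ar|apply Zf_nz, Hs].
Qed.

Lemma Dr_mono a b : 1 < a -> a <= b -> Dr b <= Dr a.
Proof.
 intros Ha Hb. apply Series_le; [|apply Dr_ex, Ha]. intros k. note (Lam_bd k) as [L0 _]. split.
 - apply mul_nn; [ar|left; apply rpw_pos].
 - apply mle_l; [ar|]. apply rpw_exp_anti; [apply INR_ge1|ar].
Qed.

(* 3 + 4 cos x + cos 2x >= 0 *)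
Lemma D_341 a t : 1 < a -> 0 <= 3*Dr a + 4*fst (Dser (a, t)) + fst (Dser (a, 2*t)).
Proof.
 intros Ha.
 ha E1 : ex_series (fun k => fst (Lam k*npw (INR (S k)) (a, t))%C) by (apply exs_fst, Dser_ex; exact Ha).
 ha E2 : ex_series (fun k => fst (Lam k*npw (INR (S k)) (a, (2*t)%R))%C) by (apply exs_fst, Dser_ex; exact Ha).
 note (Dr_ex a Ha) as E0. unfold Dr, Dser, CSer; cbn [fst].
 rewrite <- !Series_scal_l, <- Series_plus, <- Series_plus.
 1: mid (Series (fun k => 0*Lam k)).
  + rewrite Series_scal_l. lra.
  + apply Series_le.
   * intros k. rewrite Rmult_0_l. split; [lra|].
    unfold npw, cexp, rpw; simpl. set (l := ln _). note (proj1 (Lam_bd k)).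
    replace (- l*a - - 0*t) with (- a*l) by ring. replace (- l*a - - 0*(2*t)) with (- a*l) by ring.
    replace (- l*t + - 0*a) with (- (l*t)) by ring. replace (- l*(2*t) + - 0*a) with (- (2*(l*t))) by ring.
    rewrite !cos_neg, cos_2a_cos. set (c := cos (l*t)). note (exp_pos (- a*l)).
    replace (3*(Lam k*exp (- a*l)) + 4*(Lam k*(exp (- a*l)*c) - 0*(exp (- a*l)*sin (- (l*t))))
     + (Lam k*(exp (- a*l)*(2*c*c - 1)) - 0*(exp (- a*l)*sin (- (2*(l*t))))))
     with (Lam k*exp (- a*l)*(2*(1 + c) ^ 2)) by ring.
    apply mul_nn; [ar|]. note (pow2_ge_0 (1 + c)). lra.
   * apply (ex_series_plus (V := RNM)); [apply (ex_series_plus (V := RNM))|ar]; apply (exs_sc (V := RNM)); asm.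
 all: first [exact E2 | apply (exs_sc (V := RNM)); asm
  | apply (ex_series_plus (V := RNM)); apply (exs_sc (V := RNM)); asm].
Qed.

Lemma h0_bound' s r : -1 < fst s -> (fst s + 2)/(fst s + 1) <= r -> Cmod (hk 0 s) <= r/12.
Proof. intros H1 H2. note (h0_bound s H1). lra. Qed.

Lemma Zf_upper s : -6/10 <= fst s <= 4 -> Cmod (Zf s) <= (5 + Rabs (snd s)) ^ 3.
Proof.
 intros Hs. set (y := 5 + Rabs (snd s)). note (Rabs_pos (snd s)) as A0.
 ha Y : 5 <= y by (unfold y; lra).
 ha S1 : Cmod s <= y.
 { via Cmod_le_sum. assert (Rabs (fst s) <= 4) by (apply Rabs_le; lra). unfold y. lra. }
 ha Hh : Cmod (hk 0 s) <= (35/10)/12.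
 { apply h0_bound'; [lra|]. apply Rle_div_l; lra. }
 unfold Zf. via Cmod_tri3.
 rewrite Cmod_1, Cmod_mult.
 ha T1 : Cmod ((s - 1)/2)%C <= (y + 1)/2.
 { rewrite Cmod_div by apply C2_nz. rewrite Cmod_R, (Rabs_pos_eq 2) by lra.
  note (Cmod_sub_le s 1%C) as T. rewrite Cmod_1 in T. lra. }
 ha T2 : Cmod (s*s*s - s)%C <= y ^ 3 + y.
 { via Cmod_sub_le. rewrite !Cmod_mult. note (Cmod_ge_0 s).
  assert (Cmod s*Cmod s <= y*y) by nra. nra. }
 ha T3 : Cmod (s*s*s - s)%C*Cmod (hk 0 s) <= (y ^ 3 + y)*(35/10/12).
 { ar. }
 nra.
Qed.

(** * Growth and reflection *)

(** This is log |Z|, written through the squared modulus, which is a polynomial in the components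
    and hence easy to differentiate along a path. *)
Definition uZ (s : C) : R := / 2*ln (Cmod (Zf s) ^ 2).

Lemma uZ_ln s : Zf s <> 0%C -> uZ s = ln (Cmod (Zf s)).
Proof.
 intros H. unfold uZ. assert (0 < Cmod (Zf s)) by (apply Cmod_gt_0; exact H).
 simpl. rewrite Rmult_1_r, ln_mult by asm. field.
Qed.

Lemma Rd_lnmod (f : R -> C) t (l : C) : f t <> 0%C -> Rd f t l ->
 is_derive (fun x => / 2*ln (Cmod (f x) ^ 2)) t (fst (l/f t)%C).
Proof.
 intros Hn Hd. note (Rd_sq f t l Hd) as D.
 ha P : 0 < Cmod (f t) ^ 2 by (apply pow_lt, Cmod_gt_0, Hn).
 eapply dR_eq; [|apply dR_scal; apply (dR_comp ln (fun x => Cmod (f x) ^ 2)); [exact D|]].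
 2:{ apply is_derive_Reals. apply derivable_pt_lim_ln. ar. }
 rewrite Cmod_sq in *. destruct (f t) as [p q]; destruct l as [p' q']. simpl in *.
 ar.
Qed.

Lemma uZ_path (g : R -> C) t m : -1 < fst (g t) -> Zf (g t) <> 0%C -> Rd g t m ->
 is_derive (fun x => uZ (g x)) t (fst (Z1 (g t)/Zf (g t)*m)%C).
Proof.
 intros H1 H2 H3. eapply dR_eq; [|apply (Rd_lnmod (fun x => Zf (g x)) t (Z1 (g t)*m)%C H2)].
 - f_equal. field. exact H2.
 - apply Rd_comp; [apply Zf_Cd; exact H1|ar].
Qed.

Lemma hol_L U : (forall s, U s -> -1 < fst s /\ Zf s <> 0%C) -> hol U (fun s => Z1 s/Zf s)%C.
Proof.
 intros H. apply hol_div.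
 - intros s Hs. apply H, Hs.
 - apply (hol_sub U RH1); [ar|apply Z1_hol].
 - apply (hol_sub U RH1); [ar|apply Zf_hol].
Qed.

Lemma hol_Ff U : (forall s, U s -> -1 < fst s /\ Zf s <> 0%C) -> hol U Ff.
Proof. intros H. apply hol_opp, hol_L, H. Qed.

Section Growth.
Variables (b t0 : R).
Hypothesis Hb : 0 <= b < 2.
Hypothesis HZ : forall s, b < fst s -> Rabs (snd s - t0) < 2 -> Zf s <> 0%C.
Let M := 3*ln (8 + Rabs t0).

Lemma M_pos : 0 < M.
Proof.
 unfold M. note (Rabs_pos t0). assert (0 < ln (8 + Rabs t0)); [|lra]. rewrite <- ln_1. apply ln_increasing; lra.
Qed.

Lemma uZ_le s : b < fst s <= 4 -> Rabs (snd s - t0) < 2 -> uZ s <= M.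
Proof.
 intros H1 H2. ha Hn : Zf s <> 0%C by ar. rewrite uZ_ln by exact Hn.
 ha P : 0 < Cmod (Zf s) by (apply Cmod_gt_0; exact Hn). note (Rabs_pos t0).
 unfold M. replace (3*ln (8 + Rabs t0)) with (ln ((8 + Rabs t0) ^ 3)) by (rewrite ln_pow by lra; simpl; ring).
 apply ln_le; [ar|]. etr; [apply Zf_upper; lra|].
 apply pow_incr. note (Rabs_pos (snd s)). split; [lra|].
 note (Rabs_triang (snd s - t0) t0). replace (snd s - t0 + t0) with (snd s) in H3 by ring. lra.
Qed.

Lemma L_bound x : b < x <= 2 -> Cmod (Z1 (x, t0)/Zf (x, t0))%C <= 2/(x - b)*(M - uZ (x, t0)).
Proof.
 intros Hx.
 ha In : forall s : C, Cmod (s - (x, t0))%C < x - b -> b < fst s < 4 /\ Rabs (snd s - t0) < 2.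
 { intros s Hs. note (Cmod_fst (s - (x, t0))%C) as F1. note (Cmod_snd (s - (x, t0))%C) as F2. simpl in F1, F2.
  assert (Rabs (fst s + - x) < x - b) as Q by lra. apply Rabs_def2 in Q. unfold Rminus. ar. }
 apply (borel_caratheodory uZ (fun s => Z1 s/Zf s)%C (x, t0) (x - b) M); [lra| | |].
 - apply hol_L. intros s Hs. destruct (In s Hs). split; [lra|ar].
 - intros g t m Hg Hd. destruct (In _ Hg). apply uZ_path; [lra|ar|ar].
 - intros s Hs. destruct (In s Hs). apply uZ_le; lra.
Qed.

Lemma uZ_dx x : b < x -> is_derive (fun y => uZ (y, t0)) x (fst (Z1 (x, t0)/Zf (x, t0))%C).
Proof.
 intros Hx. eapply dR_eq; [|apply (uZ_path (fun y => (y, t0)) x 1%C)].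
 - f_equal. cbv beta. ring.
 - simpl. lra.
 - apply HZ; simpl; [lra|]. replace (t0 - t0) with 0 by ring. rewrite Rabs_R0; lra.
 - apply Rd_re.
Qed.

(** [L_bound] says |u'| <= 2 (M - u)/(x - b) for u = log |Z|. Hence (M - u)(x - b)^2 does not
    decrease in x and may be compared with its value at 2, where |Z| >= 1/2. *)
Lemma V_growth x : b < x <= 2 -> (M - uZ (x, t0))*(x - b) ^ 2 <= (M + 1)*(2 - b) ^ 2.
Proof.
 intros Hx.
 set (g := fun y => (M - uZ (y, t0))*(y - b) ^ 2).
 ha D : forall y, b < y <= 2 -> is_derive g y ((0 - fst (Z1 (y, t0)/Zf (y, t0))%C)*(y - b) ^ 2 + (M - uZ (y, t0))*(2*(y - b))).
 { intros y Hy. unfold g. apply (dR_mult (fun y => M - uZ (y, t0)) (fun y => (y - b) ^ 2)).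
  - apply (dR_minus (fun _ => M) (fun y => uZ (y, t0))); [apply (is_derive_const (K := R_AbsRing) (V := RNM))|apply uZ_dx; lra].
  - auto_derive; [ar|ring]. }
 ha G2 : g 2 <= (M + 1)*(2 - b) ^ 2.
 { unfold g. apply mle_r; [ar|].
  assert (-1 <= uZ (2, t0)); [|lra].
  ha Hn : Zf (2, t0) <> 0%C by (apply Zf_nz; simpl; lra). rewrite uZ_ln by exact Hn.
  note (Zf_lower (2, t0) ltac:(simpl; lra)) as ZL. simpl fst in ZL.
  note (Cmod_fst ((2, t0) - 1)%C) as F1. simpl in F1. rewrite Rabs_pos_eq in F1 by lra.
  ha L : / 2 <= Cmod (Zf (2, t0)) by lra.
  mid (ln (/ 2)); [|ar].
  rewrite ln_Rinv by lra. assert (ln 2 < 1); [|lra]. note ln_lt_2. 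
  rewrite <- (ln_exp 1). apply ln_increasing; [lra|]. note (exp_ineq1 1 !!). lra. }
 etr; [|exact G2]. fold (g x).
 destruct (MVT_gen g x 2 (fun y => (0 - fst (Z1 (y, t0)/Zf (y, t0))%C)*(y - b) ^ 2 + (M - uZ (y, t0))*(2*(y - b)))) as [z [Hz Ez]].
 - minmax. intros; apply D; lra.
 - minmax. intros; apply cR_iff; eapply cR_der; apply D; lra.
 - minmax in Hz.
  note (L_bound z !!) as LB. note (Cmod_fst (Z1 (z, t0)/Zf (z, t0))%C) as F1.
  apply abs_btw in F1.
  set (l := fst (Z1 (z, t0)/Zf (z, t0))%C) in *. set (V := M - uZ (z, t0)) in *. set (d := z - b) in *.
  ha dp : 0 < d by (unfold d; lra).
  ha B : l <= 2/d*V by lra.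
  ha B2 : l*d ^ 2 <= V*(2*d).
  { replace (V*(2*d)) with (2/d*V*d ^ 2) by ar. ar. }
  nra.
Qed.

(** A local bound: zeros are excluded only within distance 2 of the height t0. It therefore applies
    under a mere zero-free region, up to a bounded height. *)
Lemma F_growth x : b < x <= 2 -> Cmod (Ff (x, t0)) <= 8*(M + 1)/(x - b) ^ 3.
Proof.
 intros Hx. unfold Ff. rewrite Cmod_opp. etr; [apply L_bound, Hx|].
 note (V_growth x Hx) as VG. note M_pos as Mp.
 set (V := M - uZ (x, t0)) in *. set (d := x - b) in *. ha dp : 0 < d by (unfold d; lra).
 assert (V*d ^ 2 <= 4*(M + 1)).
 { via VG. assert ((2 - b) ^ 2 <= 4) by nra. nra. }
 apply (mle_rr (d ^ 3)); [ar|].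
 replace (2/d*V*d ^ 3) with (2*(V*d ^ 2)) by ar.
 replace (8*(M + 1)/d ^ 3*d ^ 3) with (8*(M + 1)) by ar. lra.
Qed.

(** At a fixed distance from the line Re s = b, 1/Z grows at most like a power of |t|; this is the
    growth condition needed for the maximum principle in an infinite strip. *)
Lemma Zinv_growth x : b < x <= 2 -> / Cmod (Zf (x, t0)) <= exp (4*(M + 1)/(x - b) ^ 2).
Proof.
 intros Hx. note (V_growth x Hx) as VG. note M_pos as Mp.
 ha Hn : Zf (x, t0) <> 0%C.
 { apply HZ; simpl; [lra|]. replace (t0 - t0) with 0 by ring. rewrite Rabs_R0; lra. }
 ha P : 0 < Cmod (Zf (x, t0)) by (apply Cmod_gt_0; exact Hn).
 rewrite uZ_ln in VG by exact Hn.
 rewrite <- (exp_ln (Cmod (Zf (x, t0)))) at 1 by exact P. rewrite <- exp_Ropp. apply exp_le.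
 set (d := x - b) in *. ha dp : 0 < d ^ 2 by (apply pow_lt; unfold d; lra).
 apply Rle_div_r; [ar|]. assert ((2 - b) ^ 2 <= 4) by nra. nra.
Qed.
End Growth.

Section Reflect.
Variables (U : C -> Prop) (q : C -> C) (B kap k t0 Cg Kg T1 : R).
Hypotheses (Hkap : 0 < kap) (Hk : 0 < k) (HCg : 0 < Cg) (HKg : 0 <= Kg).
Hypothesis Hq : hol U q.
Hypothesis HL : forall t, Cmod (q (B, t)) <= 1.
Hypothesis HR : forall t, Cmod (q (B + 1, t)) <= kap*(t ^ 2 + k).
Hypothesis HG : forall s t, B <= s <= B + 1 -> T1 <= Rabs t -> Cmod (q (s, t)) <= Cg*exp (Kg*Rabs t).

(** Coefficients of the comparison function G. On the left side Re G = bb (t - t0)^2 >= 0. On the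
    right side Re G = log (kap (t0^2 + k)) + bb (t^2 - t0^2), which dominates log (kap (t^2 + k))
    because 1 + y <= e^y. The quadratic growth of Re G in t also beats the exponential growth
    allowed by [HG]. *)
Let bb := / (t0 ^ 2 + k).
Let aa := ln (kap*(t0 ^ 2 + k)) + bb.
Let cc := 2*t0*bb.
Let G (s : C) : C := (aa*(s - (B, t0)) - (bb, (cc/2)%R)*((s - (B, t0))*(s - (B, t0))))%C.
Let Q (s : C) : C := (q s*cexp (- G s))%C.

Lemma tk_pos : 0 < t0 ^ 2 + k.
Proof. ar. Qed.

Lemma bb_pos : 0 < bb.
Proof. apply inv_pos, tk_pos. Qed.

Lemma G_fst s t : fst (G (s, t)) = aa*(s - B) + cc*(s - B)*(t - t0) + bb*((t - t0) ^ 2 - (s - B) ^ 2).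
Proof. unfold G; simpl. field. Qed.

Lemma Q_mod s t : Cmod (Q (s, t)) = Cmod (q (s, t))*exp (- fst (G (s, t))).
Proof. unfold Q. rewrite Cmod_mult, Cmod_cexp. ar. Qed.

Lemma Q_hol : hol U Q.
Proof.
 apply hol_mult; [ar|]. apply (hol_comp U (fun _ => True) cexp); [auto|ar|].
 unfold G. ar.
Qed.

Lemma Q_left t : Cmod (Q (B, t)) <= 1.
Proof.
 rewrite Q_mod, G_fst. replace (aa*(B - B) + cc*(B - B)*(t - t0) + bb*((t - t0) ^ 2 - (B - B) ^ 2)) with (bb*(t - t0) ^ 2) by ring.
 assert (exp (- (bb*(t - t0) ^ 2)) <= 1).
 { rewrite <- exp_0. apply exp_le. note bb_pos. note (pow2_ge_0 (t - t0)). nra. }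
 note (HL t). note (Cmod_ge_0 (q (B, t))). ar.
Qed.

Lemma Q_right t : Cmod (Q (B + 1, t)) <= 1.
Proof.
 rewrite Q_mod, G_fst. note tk_pos as Tk. note bb_pos as Bp.
 ha Tt : 0 < t ^ 2 + k by ar.
 replace (aa*(B + 1 - B) + cc*(B + 1 - B)*(t - t0) + bb*((t - t0) ^ 2 - (B + 1 - B) ^ 2))
  with (ln (kap*(t0 ^ 2 + k)) + bb*(t ^ 2 - t0 ^ 2)) by (unfold aa, cc; ring).
 ha E : kap*(t ^ 2 + k) <= exp (ln (kap*(t0 ^ 2 + k)) + bb*(t ^ 2 - t0 ^ 2)).
 { rewrite exp_plus, exp_ln by ar.
  note (exp_ineq1_le (bb*(t ^ 2 - t0 ^ 2))) as X.
  ha Y : t ^ 2 + k = (t0 ^ 2 + k)*(1 + bb*(t ^ 2 - t0 ^ 2)) by (unfold bb; field; lra).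
  rewrite Y, <- Rmult_assoc. ar. }
 set (x := ln (kap*(t0 ^ 2 + k)) + bb*(t ^ 2 - t0 ^ 2)) in *.
 note (HR t) as H. mid (exp x*exp (- x)).
 - apply mle_r; [ar|lra].
 - rewrite <- exp_plus, Rplus_opp_r, exp_0. lra.
Qed.

Lemma Q_sides : exists T2, forall T, T2 <= T -> forall s t, B <= s <= B + 1 -> Rabs t = T -> Cmod (Q (s, t)) <= 1.
Proof.
 note bb_pos as Bp.
 set (K2 := Rabs aa + Rabs cc + bb + Kg + Rabs (ln Cg) + Rabs cc*Rabs t0 + 1).
 exists (Rmax (Rmax T1 1) (2*Rabs t0 + 4*K2/bb + 1)).
 intros T HT s t Hs Ht.
 assert (T1 <= T /\ 1 <= T /\ 2*Rabs t0 + 4*K2/bb + 1 <= T) as (A1&A2&A3).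
 { repeat split; etr; try exact HT; [etr; [apply Rmax_l|apply Rmax_l]|etr; [apply Rmax_r|apply Rmax_l]|apply Rmax_r]. }
 rewrite Q_mod, G_fst. specialize (HG s t Hs !!). rewrite Ht in HG.
 mid (Cg*exp (Kg*T)*exp (- (aa*(s - B) + cc*(s - B)*(t - t0) + bb*((t - t0) ^ 2 - (s - B) ^ 2)))).
 { ar. }
 rewrite <- (exp_ln Cg) at 1 by exact HCg. rewrite <- !exp_plus, <- exp_0. apply exp_le.
 set (x := s - B). ha Hx : 0 <= x <= 1 by (unfold x; lra).
 note (Rabs_pos t0) as P0. note (Rabs_pos aa) as P1; note (Rabs_pos cc) as P2; note (Rabs_pos (ln Cg)) as P3.
 note (Rle_abs (ln Cg)) as Q1. note (Rle_abs (- aa)) as Q2. rewrite Rabs_Ropp in Q2.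
 ha K2p : 1 <= K2 by (unfold K2; nra).
 ha Y : T/2 <= Rabs (t - t0).
 { note (Rabs_triang (t - t0) t0) as Tr. replace (t - t0 + t0) with t in Tr by ring.
  assert (0 < 4*K2/bb) by ar. lra. }
 ha Y2 : bb*(t - t0) ^ 2 >= bb*(T/2) ^ 2.
 { apply Rle_ge, mle_l; [lra|]. rewrite <- (pow2_abs (t - t0)). ar. }
 ha Y3 : - (cc*x*(t - t0)) <= Rabs cc*(T + Rabs t0).
 { via Rle_abs. rewrite Rabs_Ropp, !Rabs_mult, (Rabs_pos_eq x) by lra.
  assert (Rabs (t - t0) <= T + Rabs t0).
  { unfold Rminus. via Rabs_triang. rewrite Rabs_Ropp. lra. }
  note (Rabs_pos (t - t0)).
  assert (Rabs cc*x <= Rabs cc) by nra. ar. }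
 ha Y4 : - (aa*x) <= Rabs aa by nra.
 ha Y5 : bb*x ^ 2 <= bb.
 { assert (x ^ 2 <= 1) by nra. ar. }
 ha Y6 : K2*T <= bb*(T/2) ^ 2.
 { assert (4*K2 <= bb*T).
  { mid (bb*(4*K2/bb)); [right; field; lra|]. ar. }
  ar. }
 ha Y7 : Rabs aa + Rabs cc*(T + Rabs t0) + bb + Kg*T + Rabs (ln Cg) <= K2*T.
 { unfold K2. assert (Rabs cc*Rabs t0 <= Rabs cc*Rabs t0*T) by (rewrite <- (Rmult_1_r (Rabs cc*Rabs t0)) at 1; apply mle_l; ar).
  ar. }
 lra.
Qed.

(** A three-lines argument adapted to the single height t0, for a q that may have one isolated point
    where it is merely bounded; the mirror image of a zero in [refl_zero] is such a point. *)
Lemma reflect_core_sing e (ps pt r' K' : R) : 0 < e -> B < ps < B + 1 -> 0 < r' ->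
 (forall s t, B - e < s < B + 1 + e -> ((s, t) : C) <> (ps, pt) -> U (s, t)) ->
 (forall s t, Rabs (s - ps) < r' -> Rabs (t - pt) < r' -> ((s, t) : C) <> (ps, pt) -> Cmod (q (s, t)) <= K') ->
 forall y, 0 < y < 1 -> B + y < ps -> Cmod (q (B + y, t0)) <= exp (aa*y).
Proof.
 intros He Hps Hr' HU HK' y Hy Hyp. destruct Q_sides as [T2 HT2].
 set (T := Rmax (Rmax T2 (Rabs pt + 1)) (Rabs t0 + 2*(B + 1 - B) + 1)).
 assert (T >= 0) by (unfold T; note (Rmax_r (Rmax T2 (Rabs pt + 1)) (Rabs t0 + 2*(B + 1 - B) + 1)); note (Rabs_pos t0); lra).
 assert (T2 <= T /\ Rabs pt + 1 <= T) as [TA TB].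
 { split; (etr; [|apply Rmax_l]); [apply Rmax_l|apply Rmax_r]. }
 ha M : Cmod (Q (B + y, t0)) <= 1.
 { destruct (Q_hol) as (Q1&Q2&QA&QB).
  set (rr := Rmin r' 1).
  (* the exponential factor is bounded near the singular point *)
  apply (max_rect_sing U Q B (B + 1) T (B + y) t0 e !! (Rmax_r _ _) He Q_hol) with (ps := ps) (pt := pt) (r' := rr)
   (K' := Rmax K' 0*exp (Rabs aa*2 + Rabs cc*2*(Rabs pt + 1 + Rabs t0) + bb*4)); try lra.
  - intros t _. split; [apply Q_left|apply Q_right].
  - intros s Hs. split; apply (HT2 T TA); try asm; [|rewrite Rabs_Ropp]; apply Rabs_pos_eq; lra.
  - ha X : Rabs pt < T by lra. apply Rabs_def2 in X. lra.
  - unfold rr. apply Rmin_pos; lra.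
  - intros s t Hs _ Hne. apply HU; [lra|ar].
  - intros s t Hs Ht Hne. unfold rr in Hs, Ht. rmins.
   rewrite Q_mod. apply mle; [ar|ar| |].
   + etr; [apply HK'; asm|apply Rmax_l].
   + apply exp_le. rewrite G_fst. note bb_pos as Bp.
    assert (Rabs (s - ps) < 1) as S1 by asm. apply Rabs_def2 in S1.
    assert (Rabs (t - pt) < 1) as S2 by asm.
    ha xb : Rabs (s - B) <= 2 by (apply Rabs_le; lra).
    ha tb : Rabs (t - t0) <= Rabs pt + 1 + Rabs t0.
    { replace (t - t0) with ((t - pt) + pt + - t0) by ring. via Rabs_triang. rewrite Rabs_Ropp.
     note (Rabs_triang (t - pt) pt). lra. }
    set (x := s - B) in *. set (v := t - t0) in *.
    ha Z1 : - (aa*x) <= Rabs aa*2.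
    { via Rle_abs. rewrite Rabs_Ropp, Rabs_mult. ar. }
    ha Z2 : - (cc*x*v) <= Rabs cc*2*(Rabs pt + 1 + Rabs t0).
    { via Rle_abs. rewrite Rabs_Ropp, !Rabs_mult.
     ar. }
    ha Z3 : - (bb*(v ^ 2 - x ^ 2)) <= bb*4.
    { assert (x ^ 2 <= 4) by (rewrite <- pow2_abs; note (Rabs_pos x); nra). ar. }
    lra. }
 rewrite Q_mod, G_fst in M.
 replace (aa*(B + y - B) + cc*(B + y - B)*(t0 - t0) + bb*((t0 - t0) ^ 2 - (B + y - B) ^ 2)) with (aa*y - bb*y ^ 2) in M by ring.
 ha M2 : Cmod (q (B + y, t0)) <= exp (aa*y - bb*y ^ 2).
 { set (w := aa*y - bb*y ^ 2) in *. apply (mle_rr (exp (- w))); [ar|].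
  rewrite <- (exp_plus w), Rplus_opp_r, exp_0. ar. }
 via M2. apply exp_le. note bb_pos. nra.
Qed.

(** The regular case, obtained by declaring an ordinary point to the right of B + y exceptional. *)
Lemma reflect_core e : 0 < e -> (forall s t, B - e < s < B + 1 + e -> U (s, t)) ->
 forall y, 0 < y < 1 -> Cmod (q (B + y, t0)) <= exp (aa*y).
Proof.
 intros He HU y Hy. destruct (Hq) as (q1&q2&A1&A2). set (ps := B + (1 + y)/2). ha Hps : B + y < ps < B + 1 by (unfold ps; lra).
 destruct (Cd_lip q (ps, 0) _ (A1 _ (HU ps 0 !!))) as [d [Hd Hh]]. note (Cmod_ge_0 (q1 (ps, 0))) as p0.
 apply (reflect_core_sing e ps 0 (d/2) (Cmod (q (ps, 0)) + (Cmod (q1 (ps, 0)) + 1)*d)); try lra; [intros; apply HU; lra|].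
 intros s t Hs Ht _. set (h := (s - ps, t - 0) : C). note (Cmod_le_sum h) as hm. cbn [fst snd h] in hm. specialize (Hh h !!).
 replace ((ps, 0) + h)%C with ((s, t) : C) in Hh by (unfold h; ar). note (Cmod_sub_ge (q (s, t)) (q (ps, 0))). note (Cmod_ge_0 h). nra.
Qed.
End Reflect.

Lemma le_div a b c : 0 < c -> a*c <= b -> a <= b/c.
Proof. intros H1 H2. apply (mle_rr c); [ar|]. unfold Rdiv. rewrite Rmult_assoc, Rinv_l; lra. Qed.

Lemma div_le a b c : 0 < c -> a <= b*c -> a/c <= b.
Proof. intros H1 H2. apply (mle_rr c); [ar|]. unfold Rdiv. rewrite Rmult_assoc, Rinv_l; lra. Qed.

Lemma exp_ge1 y : 0 <= y -> 1 <= exp y.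
Proof. intros H. note (exp_ineq1_le y). lra. Qed.

Lemma ln_le_sub1 y : 0 < y -> ln y <= y - 1.
Proof. intros H. note (exp_ineq1_le (ln y)) as E. rewrite exp_ln in E by exact H. lra. Qed.

Lemma ln_le256 y a : 0 < y -> 0 <= a -> y <= (1 + a) ^ 256 -> ln y <= 256*a.
Proof.
 intros H1 H2 H3. mid (ln ((1 + a) ^ 256)); [apply ln_le; asm|]. rewrite ln_pow, INR_IZR_INZ by lra. simpl. note (ln_le_sub1 (1 + a) !!). lra.
Qed.

Lemma ln_ge_frac y : 0 < y -> 1 - / y <= ln y.
Proof.
 intros H. note (ln_le_sub1 (/ y) ltac:(apply inv_pos, H)) as E. rewrite ln_Rinv in E by exact H. lra.
Qed.

Lemma deriv_le (f : R -> R) d a r : is_derive f 0 d -> f 0 = 0 -> 0 < r ->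
 (forall y, 0 < y < r -> f y <= a*y) -> d <= a.
Proof.
 intros D F0 Hr H. apply le_epsilon. intros eps He.
 destruct (proj1 (is_derive_eps f 0 d) D eps He) as [e [He' Q]].
 set (y := Rmin (r/2) (e/2)). assert (0 < y) by (apply Rmin_pos; lra).
 assert (y <= r/2) by apply Rmin_l. assert (y <= e/2) by apply Rmin_r.
 specialize (Q y). rewrite Rabs_pos_eq in Q by lra. specialize (Q !!).
 rewrite Rplus_0_l, F0 in Q. apply abs_btw in Q. specialize (H y !!). nra.
Qed.

Lemma Zf_factor s : Zf s = ((s + 1)*(/ 2 + (s - 1)*s*hk 0 s))%C.
Proof. unfold Zf. field. Qed.

Lemma AMGM_s (l t : R) : Cmod (((l, t) - 1)*(l, t))%C <= t ^ 2 + (l ^ 2 + (1 - l) ^ 2)/2.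
Proof.
 rewrite Cmod_mult. note (Cmod_sq ((l, t) - 1)%C) as S1. note (Cmod_sq (l, t)) as S2. simpl in S1, S2.
 set (x := Cmod ((l, t) - 1)%C) in *. set (y := Cmod (l, t)) in *. note (pow2_ge_0 (x - y)). nra.
Qed.

Lemma Cinv2_mod : Cmod (/ 2)%C = / 2.
Proof. rewrite <- RtoC_inv by lra. rewrite Cmod_R, Rabs_pos_eq; lra. Qed.

(** The substitute for the functional equation. By [Zf_factor] the left side carries the factor |B +
    it|, which is |s - 1| at s = B + 1 + it and so is also present in [Zf_lower]. With r = (B + 1)/B
    there remains r (1/2 + |(s - 1) s| r/12) at s = B - 1 + it, and B >= 0.45 keeps r below
    3.223. *)
Lemma refl_ratio B t : 45/100 <= B <= 5/2 ->
 Cmod (Zf (B - 1, t)) <= 9/10*(t ^ 2 + 13/4)*Cmod (Zf (B + 1, t)).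
Proof.
 intros HB. set (r := (B + 1)/B).
 ha r0 : 0 < r <= 3223/1000.
 { unfold r. split; [ar|]. apply div_le; lra. }
 note (Zf_lower (B + 1, t) ltac:(simpl; lra)) as ZL. simpl fst in ZL.
 replace ((((B + 1)%R, t) : C) - 1)%C with ((B, t) : C) in ZL by ar.
 replace ((B + 1 - 1)/(B + 1)) with (/ r) in ZL by (unfold r; field; lra).
 ha Hh : Cmod (hk 0 (B - 1, t)) <= r/12.
 { apply h0_bound'; simpl; [lra|]. replace (B - 1 + 2) with (B + 1) by ring. replace (B - 1 + 1) with B by ring. ar. }
 rewrite Zf_factor. rewrite Cmod_mult.
 replace ((((B - 1)%R, t) : C) + 1)%C with ((B, t) : C) by ar.
 ha Q : Cmod (/ 2 + (((B - 1)%R, t) - 1)*((B - 1)%R, t)*hk 0 ((B - 1)%R, t))%C <= / 2 + (t ^ 2 + 13525/10000)*(r/12).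
 { via Cmod_triangle. rewrite Cinv2_mod. apply add_le_l. rewrite Cmod_mult.
  apply mle; try apply Cmod_ge_0; [|ar].
  via AMGM_s. nra. }
 note (Cmod_ge_0 (B, t)) as P0.
 mid (Cmod (B, t)*(/ 2 + (t ^ 2 + 13525/10000)*(r/12))).
 { ar. }
 mid (9/10*(t ^ 2 + 13/4)*(Cmod (B, t) * / r)).
 - replace (9/10*(t ^ 2 + 13/4)*(Cmod (B, t) * / r)) with (Cmod (B, t)*(9/10*(t ^ 2 + 13/4) * / r)) by ring.
  apply mle_l; [ar|]. apply (mle_rr r); [lra|].
  replace (9/10*(t ^ 2 + 13/4) * / r*r) with (9/10*(t ^ 2 + 13/4)) by ar.
  note (pow2_ge_0 t). assert (r*r <= 1039/100) by nra.
  assert ((t ^ 2 + 13525/10000)*(r/12)*r <= (t ^ 2 + 13525/10000)*(1039/1200)).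
  { ar. }
  lra.
 - ar.
Qed.

Lemma Zf_conj_mod (x y : R) : -1 < x -> Cmod (Zf (x, - y)) = Cmod (Zf (x, y)).
Proof. intros H. change ((x, - y) : C) with (Cconj (x, y)). rewrite Zf_conj by exact H. apply Cmod_conj. Qed.

Lemma Zf_lower_strip (s t : R) : 1 < s -> (s - 1) ^ 2/s <= Cmod (Zf (s, t)).
Proof.
 intros Hs. etr; [|apply Zf_lower; simpl; exact Hs]. simpl fst.
 note (Cmod_fst ((s, t) - 1)%C) as F1. simpl in F1. rewrite Rabs_pos_eq in F1 by lra.
 replace ((s - 1) ^ 2/s) with ((s - 1)*((s - 1)/s)) by ar.
 ar.
Qed.

Lemma pow3_exp y : 0 <= y -> (5 + y) ^ 3 <= exp (3*(4 + y)).
Proof.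
 intros Hy. replace (exp (3*(4 + y))) with (exp (4 + y) ^ 3).
 - apply pow_incr. note (exp_ineq1_le (4 + y)). lra.
 - simpl. rewrite Rmult_1_r, <- !exp_plus. f_equal. ring.
Qed.

Section RefZ.
Variable b : R.
Hypothesis Hb : 0 <= b < 2.
Hypothesis HZ : forall s, b < fst s -> Zf s <> 0%C.

(** For q(z) = Z(2B - z)/Z(z) one has |q| = 1 on Re z = B, because Z commutes with conjugation, and
    2 Re F(B + i t0) is the derivative of log |q(B + y + i t0)| at y = 0. The bound for this
    logarithm that is linear in y passes to the derivative by [deriv_le]. *)
Lemma refl_F B t0 : b < B -> 45/100 <= B <= 5/2 ->
 2*fst (Ff (B, t0)) <= ln (9/10*(t0 ^ 2 + 13/4)) + / (t0 ^ 2 + 13/4).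
Proof.
 intros HbB HB.
 set (q := fun z : C => (Zf (RtoC (2*B) + (-1)*z)/Zf z)%C).
 set (e := Rmin ((B - b)/2) (2/5)).
 ha He : 0 < e /\ e <= (B - b)/2 /\ e <= 2/5 by (unfold e; repeat split; [apply Rmin_pos; lra|apply Rmin_l|apply Rmin_r]).
 set (U := fun z : C => b < fst z < 2*B + 1).
 ha arg : forall s t : R, (RtoC (2*B) + (-1)*(s, t))%C = (2*B - s, - t).
 { ar. }
 ha qm : forall s t, b < s -> s < 2*B + 1 -> Cmod (q (s, t)) = Cmod (Zf (2*B - s, t))/Cmod (Zf (s, t)).
 { intros s t H1 H2. unfold q. rewrite arg, Cmod_div by ar. rewrite Zf_conj_mod by lra. ar. }
 ha Hq : hol U q.
 { apply hol_div.
  - intros s [H1 _]. apply HZ, H1.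
  - apply (hol_affine U RH1 Zf); [|apply Zf_hol]. intros [s t] [H1 H2]. unfold RH1. rewrite arg. simpl in *. lra.
  - apply (hol_sub U RH1); [|apply Zf_hol]. intros s [H1 _]. unfold RH1. lra. }
 set (d2 := (B - b) ^ 2). ha Hd2 : 0 < d2 by (unfold d2; apply pow_lt; lra).
 assert (RC := reflect_core U q B (9/10) (13/4) t0 (2*exp (12 + 88/d2)) (3 + 12/d2) 0 !! !!
  ltac:(apply mul_pos; [lra|ar]) ltac:(assert (0 < 12/d2) by ar; lra) Hq).
 ha Core : forall y, 0 < y < 1 -> Cmod (q (B + y, t0)) <= exp ((ln (9/10*(t0 ^ 2 + 13/4)) + / (t0 ^ 2 + 13/4))*y).
 { apply (RC) with (e := e); clear RC; try tauto.
  - intros t. rewrite qm by lra. replace (2*B - B) with B by ring.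
   assert (0 < Cmod (Zf (B, t))) by (apply Cmod_gt_0, HZ; exact HbB). right. field. lra.
  - intros t. rewrite qm by lra. replace (2*B - (B + 1)) with (B - 1) by ring.
   assert (0 < Cmod (Zf (B + 1, t))) by (apply Cmod_gt_0, HZ; simpl; lra).
   apply div_le; [ar|]. apply refl_ratio, HB.
  - intros s t Hs _. rewrite qm by lra.
   note (Rabs_pos t) as T0.
   ha N1 : Cmod (Zf (2*B - s, t)) <= exp (3*(4 + Rabs t)).
   { etr; [apply Zf_upper; simpl; lra|]. simpl snd. apply pow3_exp, T0. }
   ha N2 : / Cmod (Zf (s, t)) <= 2*exp (4*(3*(7 + Rabs t) + 1)/d2).
   { ha E1 : 1 <= exp (4*(3*(7 + Rabs t) + 1)/d2).
    { apply exp_ge1, div_ge0; lra. }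
    destruct (Rle_dec s 2) as [L|L].
    - etr; [apply (Zinv_growth b t Hb (fun z H _ => HZ z H) s); lra|].
     etr; [|apply (mle_r _ 1 2); [left; apply exp_pos|lra]]. rewrite Rmult_1_l.
     apply exp_le. assert (0 < 8 + Rabs t) by lra. note (ln_le_sub1 (8 + Rabs t) !!) as LL.
     ha D : d2 <= (s - b) ^ 2 by (unfold d2; apply pow_incr; lra).
     mid (4*(3*(7 + Rabs t) + 1)/(s - b) ^ 2).
     + apply mle_r; [ar|lra].
     + apply mle_l; [lra|]. apply inv_le; lra.
    - note (Zf_lower_strip s t !!) as ZL.
     assert (/ 2 <= (s - 1) ^ 2/s). { apply le_div; [lra|]. nra. }
     ha I2 : / Cmod (Zf (s, t)) <= / / 2 by ar. ar. }
   mid (exp (3*(4 + Rabs t))*(2*exp (4*(3*(7 + Rabs t) + 1)/d2))).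
   + apply mle; [ar|left; apply inv_pos, Cmod_gt_0, HZ; simpl; lra|ar|ar].
   + right. replace (2*exp (12 + 88/d2)*exp ((3 + 12/d2)*Rabs t)) with (2*(exp (12 + 88/d2)*exp ((3 + 12/d2)*Rabs t))) by ring.
    replace (exp (3*(4 + Rabs t))*(2*exp (4*(3*(7 + Rabs t) + 1)/d2))) with (2*(exp (3*(4 + Rabs t))*exp (4*(3*(7 + Rabs t) + 1)/d2))) by ring.
    rewrite <- !exp_plus. f_equal. f_equal. field. lra.
  - intros s t Hs. split; simpl; lra. }
 set (a := ln (9/10*(t0 ^ 2 + 13/4)) + / (t0 ^ 2 + 13/4)) in *.
 ha D1 : is_derive (fun y => uZ (B - y, t0)) 0 (fst (Z1 (B, t0)/Zf (B, t0) * -1)%C).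
 { eapply dR_eq; [|apply (uZ_path (fun y => (B - y, t0)) 0 (-1)%C)].
  - cbv beta. rewrite Rminus_0_r. refl.
  - simpl. lra.
  - apply HZ. simpl. lra.
  - split; simpl; auto_derive; auto; ring. }
 ha D2 : is_derive (fun y => uZ (B + y, t0)) 0 (fst (Z1 (B, t0)/Zf (B, t0)*1)%C).
 { eapply dR_eq; [|apply (uZ_path (fun y => (B + y, t0)) 0 1%C)].
  - cbv beta. rewrite Rplus_0_r. refl.
  - simpl. lra.
  - apply HZ. simpl. lra.
  - split; simpl; auto_derive; auto; ring. }
 apply (deriv_le (fun y => uZ (B - y, t0) - uZ (B + y, t0)) _ a (Rmin 1 (B - b))).
 - eapply dR_eq; [|apply dR_minus; [exact D1|exact D2]]. unfold Ff. set (w := (Z1 (B, t0)/Zf (B, t0))%C).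
  simpl. ring.
 - cbv beta. rewrite Rminus_0_r, Rplus_0_r. ring.
 - apply Rmin_pos; lra.
 - intros y [Hy1 Hy2]. rmins.
  rewrite !uZ_ln by (apply HZ; simpl; lra). specialize (Core y !!). rewrite qm in Core by lra.
  replace (2*B - (B + y)) with (B - y) in Core by ring.
  ha P1 : 0 < Cmod (Zf (B - y, t0)) by (apply Cmod_gt_0, HZ; simpl; lra).
  ha P2 : 0 < Cmod (Zf (B + y, t0)) by (apply Cmod_gt_0, HZ; simpl; lra).
  rewrite <- ln_div by asm. rewrite <- (ln_exp (a*y)). ar.
Qed.

(** The bound is brought into the shape log |s + 2| because this is the real part of a holomorphic
    function, from which F can be subtracted. *)
Lemma log_cmp (x t : R) : 45/100 <= x -> ln (9/10*(t ^ 2 + 13/4)) + / (t ^ 2 + 13/4) <= 2*ln (Cmod ((x, t) + 2)%C).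
Proof.
 intros Hx. set (Y := t ^ 2 + 13/4). ha HY : 13/4 <= Y by (unfold Y; note (pow2_ge_0 t); lra).
 ha C6 : Y + 11/4 <= Cmod ((x, t) + 2)%C ^ 2.
 { rewrite Cmod_sq. simpl. unfold Y. nra. }
 ha Cp : 0 < Cmod ((x, t) + 2)%C.
 { note (Cmod_ge_0 ((x, t) + 2)%C). ar. }
 replace (2*ln (Cmod ((x, t) + 2)%C)) with (ln (Cmod ((x, t) + 2)%C ^ 2)) by (rewrite ln_pow by exact Cp; simpl; ring).
 mid (ln (Y + 11/4)); [|ar].
 replace (Y + 11/4) with (9/10*Y*((Y + 11/4)/(9/10*Y))) by ar.
 rewrite (ln_mult (9/10*Y) ((Y + 11/4)/(9/10*Y))) by ar. apply add_le_l.
 etr; [|apply ln_ge_frac; apply div_pos; lra].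
 replace (1 - / ((Y + 11/4)/(9/10*Y))) with ((Y/10 + 11/4)/(Y + 11/4)) by ar.
 apply le_div; [lra|]. apply (mle_rl Y); [lra|].
 replace (Y*(/ Y*(Y + 11/4))) with (Y + 11/4) by ar. nra.
Qed.

Lemma Re_inv_pos (x t : R) : 0 < x -> 0 <= fst (/ (x, t))%C <= x/(x ^ 2 + t ^ 2).
Proof.
 intros H. rewrite Cinv_fst. ar.
Qed.

Lemma sub1_pt (x t : R) : ((x, t) - 1)%C = (x - 1, t).
Proof. ar. Qed.

(** Read off from the reflection bound itself at height 0, where F = D - 2/3; no sum over primes is
    evaluated. *)
Lemma Dr_bound : Dr (5/2) <= 14/10.
Proof.
 ha Hb5 : b < 5/2 by lra.
 note (refl_F (5/2) 0 Hb5 !!) as R.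
 rewrite Ff_D in R by ar. rewrite Dser_real in R by lra. rewrite sub1_pt in R.
 replace (fst (Dr (5/2) - / ((5/2 - 1)%R, 0))%C) with (Dr (5/2) - 2/3) in R by (simpl; field).
 ha LL : ln (9/10*(0 ^ 2 + 13/4)) <= 8*(1437/10000).
 { mid (ln ((11437/10000) ^ 8)); [ar|]. rewrite ln_pow by lra. simpl INR.
  note (ln_le_sub1 (11437/10000) !!). lra. }
 ar.
Qed.

Lemma ReF_le_log s : 45/100 <= fst s -> b < fst s -> fst (Ff s) <= ln (Cmod (s + 2)%C).
Proof.
 intros H1 H2. destruct s as [x t]. simpl in H1, H2.
 destruct (Rle_dec x (5/2)) as [L|L].
 - note (refl_F x t H2 !!). note (log_cmp x t H1). lra.
 - rewrite Ff_D by ar. rewrite sub1_pt.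
  note (Re_inv_pos (x - 1) t !!) as [I1 _].
  note (Dser_norm (x, t) ltac:(simpl; lra)) as N. simpl fst in N. note (Cmod_fst (Dser (x, t))) as F1.
  apply abs_btw in F1. note (Dr_mono (5/2) x !! !!). note Dr_bound.
  replace (fst (Dser (x, t) - / ((x - 1)%R, t))%C) with (fst (Dser (x, t)) - fst (/ ((x - 1)%R, t))%C) by ar.
  assert (14/10 <= ln (Cmod ((x, t) + 2)%C)); [|lra].
  ha C4 : 9/2 <= Cmod ((x, t) + 2)%C.
  { note (Cmod_fst ((x, t) + 2)%C) as F2. simpl in F2. rewrite Rabs_pos_eq in F2 by lra. lra. }
  mid (ln (9/2)); [|ar].
  mid (ln ((1098/1000) ^ 16)); [|ar]. rewrite ln_pow by lra. simpl INR.
  note (ln_ge_frac (1098/1000) !!). lra.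
Qed.
End RefZ.

Lemma Zf_nz1 (s : C) : 1 < fst s -> Zf s <> 0%C.
Proof. exact (Zf_nz s). Qed.

(** * The zero-free region *)

Section ZeroTerm.
Variables (be ga B : R).
Hypothesis Hbe : 9/10 <= be <= 1.
Hypothesis HB : 1 < B <= 11/10.
Hypothesis Hz : Zf (be, ga) = 0%C.
Let p : C := (2*B - be, ga).
Let g (s : C) : C := Zf (RtoC (2*B) + (-1)*s)%C.
(** The quotient of [refl_F] times (s - rho)/(p - s), where p is the mirror image of the zero rho in
    Re s = B. The extra factor has modulus 1 on that line, and at p, where its denominator vanishes,
    g vanishes too. *)
Let q (s : C) : C := (g s/(p - s)*((s - (be, ga))/Zf s))%C.

Lemma g_arg (s t : R) : (RtoC (2*B) + (-1)*(s, t))%C = (2*B - s, - t).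
Proof. ar. Qed.

Lemma ps_nz (s t : R) : ((s, t) : C) <> p -> (p - (s, t))%C <> 0%C.
Proof. intros H E. apply H. replace ((s, t) : C) with (p - (p - (s, t)))%C by cring. rewrite E. cring. Qed.

Lemma q_mod (s t : R) : 1 < s -> s < 2*B + 1 -> ((s, t) : C) <> p -> Cmod (q (s, t)) =
 Cmod (Zf (2*B - s, t))/Cmod (p - (s, t))%C*(Cmod ((s, t) - (be, ga))%C/Cmod (Zf (s, t))).
Proof.
 intros H1 H2 H3. unfold q, g. rewrite Cmod_mult, !Cmod_div by (try apply Zf_nz1, H1; apply ps_nz, H3).
 rewrite g_arg, Zf_conj_mod by lra. ar.
Qed.

Lemma Cmod_pair_le (a c d : R) : Rabs a <= c -> Cmod (a, d) <= Cmod (c, d).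
Proof.
 intros H. apply Rsqr_incr_0; try apply Cmod_ge_0. rewrite !Rsqr_pow2, !Cmod_sq. simpl.
 note (Rabs_pos a). assert (Rabs a ^ 2 <= c ^ 2) by ar. rewrite pow2_abs in H1. lra.
Qed.

(** The extra factor contributes 2/(B - be) to the derivative at y = 0. The price is the constant
    135/100 in place of 9/10. *)
Lemma refl_zero : 2*fst (Ff (B, ga)) + 2/(B - be) <= ln (135/100*(ga ^ 2 + 13/4)) + / (ga ^ 2 + 13/4).
Proof.
 set (e := (B - 1)/2). set (U := fun z : C => B - e < fst z < B + 1 + e /\ z <> p).
 ha Hq : hol U q.
 { unfold q. apply hol_mult.
  - apply hol_div.
   + intros [s t] [_ H]. apply ps_nz, H.
   + unfold g. apply (hol_affine U RH1 Zf); [|apply Zf_hol]. intros [s t] [[H1 H2] _]. unfold RH1. rewrite g_arg. unfold e in *. simpl in *. lra.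
   + apply hol_minus; ar.
  - apply hol_div.
   + intros s [[H1 _] _]. apply Zf_nz1. unfold e in H1. lra.
   + apply hol_minus; ar.
   + apply (hol_sub U RH1); [|apply Zf_hol]. intros s [[H1 _] _]. unfold RH1, e in *. lra. }
 ha Low : forall s t, B - e < s < B + 2 -> (B - 1) ^ 2/16 <= Cmod (Zf (s, t)).
 { intros s t [H1 H2]. unfold e in H1. etr; [|apply Zf_lower_strip; lra]. apply le_div; [lra|].
  assert ((B - 1) ^ 2/4 <= (s - 1) ^ 2). { ar. }
  note (pow2_ge_0 (B - 1)). nra. }
 ha Hd : 0 < (B - 1) ^ 2 by ar.
 ha pd : forall s t, (p - (s, t))%C = ((2*B - be - s)%R, (ga - t)%R) by ar.
 ha rd : forall s t : R, ((s, t) - (be, ga))%C = ((s - be)%R, (t - ga)%R) by ar.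
 ha nes : forall s t : R, s <> 2*B - be -> ((s, t) : C) <> p by (intros s t H E; apply H; unfold p in E; congruence).
 destruct (quot_bounded g (2*B - be) ga (-1*Z1 (be, (- ga)%R))%C) as [r [K [Hr HK]]].
 { unfold g. eapply Cd_eq; [|apply (Cd_comp Zf (fun z => RtoC (2*B) + (-1)*z)%C); [apply Zf_Cd|apply Cd_plus; [apply Cd_const|apply Cd_mult; [apply Cd_const|apply Cd_id]]]].
  - rewrite g_arg. replace (2*B - (2*B - be)) with be by ring. cring.
  - ar. }
 ha gp : g (2*B - be, ga) = 0%C.
 { unfold g. rewrite g_arg. replace (2*B - (2*B - be)) with be by ring. change ((be, - ga) : C) with (Cconj (be, ga)).
  rewrite Zf_conj by ar. rewrite Hz. ar. }
 rewrite gp in HK.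
 ha K0 : 0 <= K.
 { etr; [apply Cmod_ge_0|apply (HK (2*B - be + r/2) ga)].
  - replace (2*B - be + r/2 - (2*B - be)) with (r/2) by ring. rewrite Rabs_pos_eq; lra.
  - rewrite Rminus_diag, Rabs_R0. exact Hr.
  - ar. }
 assert (RC := reflect_core_sing U q B (135/100) (13/4) ga (2*exp 12*(16/(B - 1) ^ 2)) 3 (Rabs ga + 3) !! !!
  ltac:(apply mul_pos; ar) !! Hq).
 ha Core : forall y, 0 < y < 1 -> B + y < 2*B - be ->
  Cmod (q (B + y, ga)) <= exp ((ln (135/100*(ga ^ 2 + 13/4)) + / (ga ^ 2 + 13/4))*y).
 { apply RC with (e := e) (pt := ga) (r' := Rmin r e) (K' := K*(4*(16/(B - 1) ^ 2))); clear RC.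
  - intros t. ha N : ((B, t) : C) <> p by ar. rewrite q_mod by ar.
   replace (2*B - B) with B by ring.
   assert (0 < Cmod (Zf (B, t))) by (apply Cmod_gt_0, Zf_nz1; simpl; lra).
   replace (Cmod ((B, t) - (be, ga))%C) with (Cmod (p - (B, t))%C).
   + assert (0 < Cmod (p - (B, t))%C) by (apply Cmod_gt_0, ps_nz, N). right. field. lra.
   + rewrite pd, rd. apply Rsqr_inj; try apply Cmod_ge_0. rewrite !Rsqr_pow2, !Cmod_sq. simpl. ring.
  - intros t. ha N : ((B + 1, t) : C) <> p by ar. rewrite q_mod by ar.
   replace (2*B - (B + 1)) with (B - 1) by ring.
   ha P1 : 0 < Cmod (Zf (B + 1, t)) by (apply Cmod_gt_0, Zf_nz1; simpl; lra).
   ha P2 : 0 < Cmod (p - ((B + 1)%R, t))%C by (apply Cmod_gt_0, ps_nz, N).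
   note (refl_ratio B t !!) as RR.
   (* On the right side the extra factor is at most (6/5)/(4/5) = 3/2, whence 135/100. *)
   ha Q : Cmod (((B + 1)%R, t) - (be, ga))%C <= 3/2*Cmod (p - ((B + 1)%R, t))%C.
   { apply Rsqr_incr_0; [|ar|ar].
    rewrite Rsqr_mult, !Rsqr_pow2, pd, rd, !Cmod_sq. simpl.
    assert (4/5 <= 1 - B + be) by lra. assert (B + 1 - be <= 6/5) by lra. note (pow2_ge_0 (t - ga)). nra. }
   set (n1 := Cmod (Zf (B - 1, t))) in *. set (n2 := Cmod (Zf (B + 1, t))) in *. set (n3 := Cmod (p - ((B + 1)%R, t))%C) in *.
   set (n4 := Cmod (((B + 1)%R, t) - (be, ga))%C) in *. assert (0 <= n1) by apply Cmod_ge_0. assert (0 <= n4) by apply Cmod_ge_0.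
   replace (n1/n3*(n4/n2)) with ((n1/n2)*(n4/n3)) by ar.
   replace (135/100*(t ^ 2 + 13/4)) with (9/10*(t ^ 2 + 13/4)*(3/2)) by field.
   apply mle; [ar|ar|apply div_le; lra|apply div_le; lra].
  - intros s t Hs Ht.
   ha T3 : 3 <= Rabs (t - ga) by (note (Rabs_triang_inv t ga); lra).
   ha N : ((s, t) : C) <> p. { intros E. unfold p in E. injection E as _ E. rewrite E, Rminus_diag, Rabs_R0 in T3. lra. }
   rewrite q_mod by ar.
   ha N1 : Cmod (Zf (2*B - s, t)) <= exp (3*(4 + Rabs t)).
   { etr; [apply Zf_upper; simpl; lra|]. simpl snd. apply pow3_exp, Rabs_pos. }
   note (Low s t ltac:(unfold e; lra)) as LL.
   ha N2 : / Cmod (Zf (s, t)) <= 16/(B - 1) ^ 2.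
   { replace (16/(B - 1) ^ 2) with (/ ((B - 1) ^ 2/16)) by ar. ar. }
   ha P2 : Rabs (t - ga) <= Cmod (p - (s, t))%C.
   { rewrite pd. etr; [|apply Cmod_snd]. simpl. rewrite Rabs_minus_sym. lra. }
   ha P4 : Cmod ((s, t) - (be, ga))%C <= 2*Rabs (t - ga).
   { rewrite rd. via Cmod_le_sum. simpl. rewrite Rabs_pos_eq by lra. lra. }
   set (n1 := Cmod (Zf (2*B - s, t))) in *. set (n2 := Cmod (Zf (s, t))) in *. set (n3 := Cmod (p - (s, t))%C) in *.
   set (n4 := Cmod ((s, t) - (be, ga))%C) in *. assert (0 <= n1) by apply Cmod_ge_0. assert (0 <= n4) by apply Cmod_ge_0.
   assert (0 < n2) by lra. replace (n1/n3*(n4/n2)) with (n1*((n4/n3) * / n2)) by ar.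
   replace (2*exp 12*(16/(B - 1) ^ 2)*exp (3*Rabs t)) with (exp (3*(4 + Rabs t))*(2*(16/(B - 1) ^ 2))).
   + apply mle; [lra| |ar|].
    * apply mul_nn; ar.
    * apply mle; [ar|ar|apply div_le; lra|ar].
   + replace (3*(4 + Rabs t)) with (12 + 3*Rabs t) by ring. rewrite exp_plus. ring.
  - unfold e; lra.
  - lra.
  - apply Rmin_pos; [ar|unfold e; lra].
  - intros s t Hs Hne. split; ar.
  - intros s t H1 H2 Hne. rmins. unfold q. rewrite Cmod_mult.
   ha Hs : B - e < s < B + 2. { ha H1e : Rabs (s - (2*B - be)) < e by lra. apply Rabs_lt_between' in H1e. unfold e in *. lra. }
   note (Low s t Hs) as LL.
   apply mle; try apply Cmod_ge_0.
   + replace (Cmod (g (s, t)/(p - (s, t)))%C) with (Cmod ((g (s, t) - 0)/((s, t) - ((2*B - be)%R, ga)))%C); [ar|].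
    rewrite <- (Cmod_opp (g (s, t)/(p - (s, t)))%C). f_equal. note (ps_nz s t Hne) as NZ.
    change ((2*B - be)%R, ga) with p. set (z := ((s, t) : C)) in *. field. split; [ar|].
    intros E. apply NZ. replace (p - z)%C with (- (z - p))%C by ring. rewrite E. ring.
   + rewrite Cmod_div by (apply Zf_nz1; simpl; unfold e in *; lra). 
    apply mle; [ar|ar| |].
    * rewrite rd. via Cmod_le_sum. simpl.
     rewrite (Rabs_pos_eq (s - be)) by (unfold e in *; lra). unfold e in *. lra.
    * replace (16/(B - 1) ^ 2) with (/ ((B - 1) ^ 2/16)) by ar. ar. }
 set (a := ln (135/100*(ga ^ 2 + 13/4)) + / (ga ^ 2 + 13/4)) in *.
 ha D1 : is_derive (fun y => uZ (B - y, ga)) 0 (fst (Z1 (B, ga)/Zf (B, ga) * -1)%C).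
 { eapply dR_eq; [|apply (uZ_path (fun y => (B - y, ga)) 0 (-1)%C)].
  - cbv beta. rewrite Rminus_0_r. refl.
  - simpl. lra.
  - apply Zf_nz1. simpl. lra.
  - split; simpl; auto_derive; auto; ring. }
 ha D2 : is_derive (fun y => uZ (B + y, ga)) 0 (fst (Z1 (B, ga)/Zf (B, ga)*1)%C).
 { eapply dR_eq; [|apply (uZ_path (fun y => (B + y, ga)) 0 1%C)].
  - cbv beta. rewrite Rplus_0_r. refl.
  - simpl. lra.
  - apply Zf_nz1. simpl. lra.
  - split; simpl; auto_derive; auto; ring. }
 apply (deriv_le (fun y => uZ (B - y, ga) - uZ (B + y, ga) + (ln (B - be + y) - ln (B - be - y))) _ a (Rmin (B - be) (B - 1))).
 - eapply dR_eq; [|apply dR_plus; [apply dR_minus; [exact D1|exact D2]|]].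
  2: { auto_derive; ar. }
  unfold Ff. generalize (Z1 (B, ga)/Zf (B, ga))%C. intros w. simpl. field. lra.
 - cbv beta. rewrite Rminus_0_r, !Rplus_0_r, Rminus_0_r. ring.
 - apply Rmin_pos; lra.
 - intros y [Hy1 Hy2]. rmins.
  rewrite !uZ_ln by (apply Zf_nz1; simpl; lra). specialize (Core y !! !!).
  rewrite q_mod in Core by ar.
  replace (2*B - (B + y)) with (B - y) in Core by ring.
  rewrite pd, rd in Core. replace (2*B - be - (B + y)) with (B - be - y) in Core by ring. replace (B + y - be) with (B - be + y) in Core by ring.
  rewrite Rminus_diag in Core. change ((B - be - y)%R, 0) with (RtoC (B - be - y)) in Core. change ((B - be + y)%R, 0) with (RtoC (B - be + y)) in Core.
  rewrite !Cmod_R, !Rabs_pos_eq in Core by lra.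
  ha P1 : 0 < Cmod (Zf (B - y, ga)) by (apply Cmod_gt_0, Zf_nz1; simpl; lra).
  ha P2 : 0 < Cmod (Zf (B + y, ga)) by (apply Cmod_gt_0, Zf_nz1; simpl; lra).
  apply ln_le in Core.
  + rewrite ln_exp, ln_mult, !ln_div in Core by ar. lra.
  + ar.
Qed.
End ZeroTerm.

Lemma ln45 : 14/10 <= ln (9/2).
Proof.
 mid (ln ((1098/1000) ^ 16)); [|ar]. rewrite ln_pow by lra. simpl INR.
 note (ln_ge_frac (1098/1000) !!). lra.
Qed.

Lemma fst_sub_inv (z : C) (x t : R) : fst (z - / ((x, t) - 1))%C = fst z - fst (/ ((x - 1)%R, t))%C.
Proof. rewrite sub1_pt. ar. Qed.

Lemma ln2925 : ln (9/10*(0 ^ 2 + 13/4)) <= 115/100.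
Proof.
 mid (ln ((11437/10000) ^ 8)); [ar|]. rewrite ln_pow by lra. simpl INR.
 note (ln_le_sub1 (11437/10000) !!). lra.
Qed.

(** De la Vallee Poussin's argument. With tau = 1/(27 l) the pole gives 3/tau = 81 l and the growth
    of F about 5 l more, whereas a zero inside the region would contribute at least 90 l with the
    opposite sign. *)
Theorem zero_free s : 1 - / (135*ln (Rabs (snd s) + 4)) < fst s -> Zf s <> 0%C.
Proof.
 destruct s as [be ga]. simpl. intros Hs Hz.
 note (Rabs_pos ga) as G0. set (l := ln (Rabs ga + 4)) in *.
 ha Hl0 : 1 <= l.
 { unfold l. mid (ln (2 ^ 2)); [|ar]. rewrite ln_pow by lra. simpl INR. 
  note ln_lt_2. lra. }
 ha Hin : / (135*l) <= / 135 by ar.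
 ha Hbe1 : be <= 1. { destruct (Rle_dec be 1); [ar|]. exfalso. apply (Zf_nz1 (be, ga)); ar. }
 (* At small height the bracket 1/2 + (s - 1) s [hk 0 s] of [Zf_factor] cannot vanish, as its second
    term stays below 1/2. *)
 destruct (Rlt_dec (Rabs ga) (18/10)) as [Hg|Hg].
 - ha Hg2 : ga ^ 2 <= 324/100. { rewrite <- pow2_abs. ar. }
  ha Hh : Cmod (hk 0 (be, ga)) <= (1504/1000)/12. { apply h0_bound'; simpl; [lra|]. apply div_le; lra. }
  rewrite Zf_factor in Hz. revert Hz. apply Cmult_nz.
  + intros E. apply (f_equal fst) in E. simpl in E. lra.
  + intros E. ha E2 : Cmod (/ 2)%C = Cmod (((be, ga) - 1)*(be, ga)*hk 0 (be, ga))%C.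
   { rewrite <- (Cmod_opp (((be, ga) - 1)*(be, ga)*hk 0 (be, ga))%C). f_equal.
    match goal with |- _ = (- ?x)%C => replace (/ 2)%C with ((/ 2 + x) - x)%C by ring end. rewrite E. ring. }
   rewrite Cinv2_mod, Cmod_mult in E2. note (AMGM_s be ga) as A.
   ha A2 : Cmod (((be, ga) - 1)*(be, ga))%C <= 374/100 by nra.
   note (Cmod_ge_0 (hk 0 (be, ga))). note (Cmod_ge_0 (((be, ga) - 1)*(be, ga))%C). nra.
 - ha Hl : 14/10 <= l by (etr; [apply ln45|unfold l; apply ln_le; lra]).
  set (tau := / (27*l)). ha Ht : 0 < tau <= / 27 by (unfold tau; split; ar).
  assert (Z9 := refl_zero be ga (1 + tau) !! !! Hz).
  assert (Z1' := refl_F 1 !! Zf_nz1 (1 + tau) 0 !! !!).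
  assert (Z2' := refl_F 1 !! Zf_nz1 (1 + tau) (2*ga) !! !!).
  assert (T := D_341 (1 + tau) ga !!).
  rewrite Ff_D in Z9, Z1', Z2' by ar. rewrite fst_sub_inv in Z9, Z1', Z2'. rewrite Dser_real in Z1' by lra.
  replace (1 + tau - 1) with tau in*by ring. simpl fst in Z1'.
  replace (tau/(tau*(tau*1) + 0*(0*1))) with (/ tau) in Z1' by ar.
  note (Re_inv_pos tau ga !!) as [_ I1]. note (Re_inv_pos tau (2*ga) !!) as [_ I2].
  ha G2 : 324/100 <= ga ^ 2. { rewrite <- pow2_abs. ar. }
  ha J1 : tau/(tau ^ 2 + ga ^ 2) <= 2/100 by (apply div_le; ar).
  ha J2 : tau/(tau ^ 2 + (2*ga) ^ 2) <= 1/100 by (apply div_le; ar).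
  ha K1 : / (ga ^ 2 + 13/4) <= 16/100. { replace (16/100) with (/ (100/16)) by field. ar. }
  ha K2 : / ((2*ga) ^ 2 + 13/4) <= 16/100. { replace (16/100) with (/ (100/16)) by field. ar. }
  ha S1 : ln (ga ^ 2 + 13/4) <= 2*l.
  { unfold l. replace (2*ln (Rabs ga + 4)) with (ln ((Rabs ga + 4) ^ 2)) by (rewrite ln_pow by lra; simpl; ring).
   apply ln_le; [nra|]. rewrite <- (pow2_abs ga). nra. }
  ha S2 : ln (135/100*(ga ^ 2 + 13/4)) <= 35/100 + 2*l.
  { rewrite ln_mult by lra. note (ln_le_sub1 (135/100) !!). lra. }
  ha S3 : ln (9/10*((2*ga) ^ 2 + 13/4)) <= 14/10 + 2*l.
  { mid (ln (36/10*(ga ^ 2 + 13/4))); [ar|]. rewrite ln_mult by lra.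
   assert (ln (36/10) <= 14/10); [|lra].
   mid (ln ((1174/1000) ^ 8)); [ar|]. rewrite ln_pow by lra. simpl INR.
   note (ln_le_sub1 (1174/1000) !!). lra. }
  note ln2925 as L3. ha Q2 : / (0 ^ 2 + 13/4) <= 31/100 by ar.
  replace (1 + tau - be) with (tau + (1 - be)) in Z9 by ring.
  ha X : 0 < tau + (1 - be) by lra.
  ha X2 : tau + (1 - be) < 6/(135*l).
  { replace (6/(135*l)) with (tau + / (135*l)) by (unfold tau; field; lra). lra. }
  ha X3 : 90*l/4 <= / (tau + (1 - be)).
  { replace (90*l/4) with (/ (6/(135*l))) by ar. ar. }
  ha X4 : 89*l/4 < / (tau + (1 - be)) by lra.
  unfold Rdiv in Z9. set (w := / (tau + (1 - be))) in *.
  ha IT : / tau = 27*l by (unfold tau; field; lra).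
  lra.
Qed.

(** * Schwarz-Pick for the logarithmic derivative *)

(** The principal branch on Re s > 0, where the argument is this arctangent. *)
Definition Clog (s : C) : C := (/ 2*ln (fst s ^ 2 + snd s ^ 2), atan (snd s/fst s)).

Lemma re_pos_nz (s : C) : 0 < fst s -> s <> 0%C.
Proof. intros H E. rewrite E in H. simpl in H. lra. Qed.

Lemma Clog_ray (s h : C) (u : R) : 0 < fst (s + u*h)%C -> Rd (fun v => Clog (s + v*h)%C) u (h/(s + u*h))%C.
Proof.
 destruct s as [x y], h as [p q]. intros H.
 apply (Rd_ext (fun v => Clog (x + v*p, y + v*q))).
 { intros v. rewrite Cmult_Rl. ar. }
 rewrite Cmult_Rl in H |- *. unfold Cplus, fst, snd in H |- *.
 ha Hn : (x + u*p) ^ 2 + (y + u*q) ^ 2 <> 0 by ar.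
 split; unfold Clog, fst, snd, Cdiv, Cmult, Cinv.
 - auto_derive; [note (sumsq_pos (x + u*p) (y + u*q) H); nra|]. cbv [fst snd]. field; auto.
 - auto_derive; [lra|].
  cbv [fst snd]. ar.
Qed.

Lemma Cd_Clog (s : C) : 0 < fst s -> Cd Clog s (/ s)%C.
Proof.
 intros Hs eps He. set (x := fst s) in *.
 exists (Rmin (x/2) (eps*x ^ 2/2)). assert (0 < x ^ 2) by ar.
 split; [apply Rmin_pos; [lra|ar]|].
 intros h Hh. rmins. note (Cmod_ge_0 h) as h0.
 ha Lo : forall u : R, 0 <= u <= 1 -> x/2 <= fst (s + u*h)%C.
 { intros u Hu. destruct s as [a b], h as [p q]. rewrite Cmult_Rl. simpl. simpl in x. note (Cmod_fst (p, q)) as F. simpl in F.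
  assert (- x/2 <= u*p); [|unfold x in *; lra]. apply abs_btw in F. ar. }
 ha M : Cmod ((Clog (s + 1*h) - 1*(h/s)) - (Clog (s + 0*h) - 0*(h/s)))%C <= (1 - 0)*(2*Cmod h ^ 2/x ^ 2).
 { apply (Rd_mvi (fun u : R => (Clog (s + u*h) - u*(h/s))%C) (fun u => (h/(s + u*h) - h/s)%C)); [lra| |].
  - intros u Hu. apply Rd_minus; [apply Clog_ray|apply Rd_ray]. specialize (Lo u Hu). lra.
  - intros u Hu. specialize (Lo u Hu).
   ha N1 : s <> 0%C by (apply re_pos_nz; exact Hs). ha N2 : (s + u*h)%C <> 0%C by (apply re_pos_nz; lra).
   replace (h/(s + u*h) - h/s)%C with ((- u)*(h*h)/(s*(s + u*h)))%C by (field; auto).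
   rewrite Cmod_div by (apply Cmult_nz; asm). rewrite !Cmod_mult, Cmod_opp, Cmod_R, Rabs_pos_eq by lra.
   assert (x <= Cmod s) by (note (Cmod_fst s); note (Rle_abs (fst s)); unfold x; lra).
   assert (x/2 <= Cmod (s + u*h)%C) by (note (Cmod_fst (s + u*h)%C); note (Rle_abs (fst (s + u*h)%C)); lra).
   apply div_le; [ar|].
   mid (2*Cmod h ^ 2/x ^ 2*(x*(x/2))).
   + replace (2*Cmod h ^ 2/x ^ 2*(x*(x/2))) with (Cmod h ^ 2) by ar. simpl. nra.
   + ar. }
 replace ((Clog (s + 1*h) - 1*(h/s)) - (Clog (s + 0*h) - 0*(h/s)))%C with (Clog (s + h) - Clog s - / s*h)%C in M.
 - via M. replace ((1 - 0)*(2*Cmod h ^ 2/x ^ 2)) with (2*Cmod h/x ^ 2*Cmod h) by ar.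
  apply mle_r; [ar|]. apply div_le; lra.
 - replace (s + 1*h)%C with (s + h)%C by ring. replace (s + 0*h)%C with s by ring. ar.
Qed.

Lemma hol_Clog : hol (fun s => 0 < fst s) Clog.
Proof.
 exists (fun s => / s)%C, (fun s => - (RtoC 1)/(s*s))%C. split; intros s Hs; [apply Cd_Clog, Hs|].
 apply (Cd_inv (fun z => z)); [apply re_pos_nz, Hs|apply Cd_id].
Qed.

Lemma Clog_fst s : 0 < fst s -> fst (Clog s) = ln (Cmod s).
Proof.
 intros H. change (fst (Clog s)) with (/ 2*ln (fst s ^ 2 + snd s ^ 2)). rewrite <- Cmod_sq.
 assert (0 < Cmod s) by (apply Cmod_gt_0, re_pos_nz, H). rewrite ln_pow by asm. simpl INR. lra.
Qed.

Lemma Clog_bound s : 1 <= fst s -> Cmod (Clog s) <= ln (fst s + Rabs (snd s)) + 2.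
Proof.
 intros H. via Cmod_le_sum. rewrite Clog_fst by lra.
 assert (1 <= Cmod s) by (note (Cmod_fst s); note (Rle_abs (fst s)); lra).
 assert (0 <= ln (Cmod s)) by (rewrite <- ln_1; apply ln_le; lra).
 rewrite Rabs_pos_eq by asm. apply add_le.
 - apply ln_le; [lra|]. via Cmod_le_sum. rewrite (Rabs_pos_eq (fst s)); lra.
 - simpl. note (atan_bound (snd s/fst s)). note PI_4. apply Rabs_le. lra.
Qed.

Lemma incr_deriv (f f' : R -> R) a b : a <= b -> (forall x, a <= x <= b -> is_derive f x (f' x)) ->
 (forall x, a <= x <= b -> 0 <= f' x) -> f a <= f b.
Proof.
 intros Hab Hd Hp. destruct (MVT_gen f a b f') as [c [Hc E]].
 - intros x Hx. rewrite Rmin_left, Rmax_right in Hx by exact Hab. apply Hd. lra.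
 - intros x Hx. rewrite Rmin_left, Rmax_right in Hx by exact Hab. apply cR_iff. eapply cR_der, Hd. lra.
 - rewrite Rmin_left, Rmax_right in Hc by exact Hab. specialize (Hp c Hc). nra.
Qed.

Definition Z4 (s : C) : C :=
 (24*hk 1 s + 36*s*hk 2 s + 4*(3*s*s - 1)*hk 3 s + (s*s*s - s)*hk 4 s)%C.

Lemma Z3_Cd s : -1 < fst s -> Cd Z3 s (Z4 s).
Proof. intros H. unfold Z3, Z4. eapply Cd_eq; [|cd]. ar. Qed.

Lemma Z2_hol : hol RH1 Z2.
Proof. exists Z3, Z4. split; [apply Z2_Cd|apply Z3_Cd]. Qed.

(** As [Ff] is -Z'/Z, this is log(s + 2) + Z'/Z. [ReF_le_log] makes its real part nonnegative, and
    [Pd] is its derivative. *)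
Definition Pp (s : C) : C := (Clog (s + 2) - Ff s)%C.
Definition Pd (s : C) : C := (/ (s + 2) + (Z2 s*Zf s - Z1 s*Z1 s)/(Zf s*Zf s))%C.

Lemma Pd_Cd s : -1 < fst s -> Zf s <> 0%C -> Cd Pp s (Pd s).
Proof.
 intros H1 H2. unfold Pp, Pd, Ff. eapply Cd_eq; [|apply Cd_minus; [apply (Cd_comp Clog (fun z => z + 2)%C); [apply Cd_Clog; simpl; lra|apply Cd_plus; [apply Cd_id|apply Cd_const]]|
  apply Cd_opp, Cd_div; [exact H2|apply Z1_Cd, H1|apply Zf_Cd, H1]]].
 ar.
Qed.

Lemma F_far (x t : R) : 5/2 <= x -> Cmod (Ff (x, t)) <= 207/100.
Proof.
 intros Hx. rewrite Ff_D by ar. via Cmod_sub_le.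
 note (Dser_norm (x, t) ltac:(simpl; lra)) as N. simpl fst in N.
 note (Dr_mono (5/2) x !! !!). note (Dr_bound 1 !! Zf_nz1).
 ha N1 : 3/2 <= Cmod ((x, t) - 1)%C.
 { note (Cmod_fst ((x, t) - 1)%C) as F. rewrite sub1_pt in *. simpl in F. rewrite Rabs_pos_eq in F by lra. lra. }
 rewrite Cmod_inv by (apply Cmod_gt_0; lra).
 assert (/ Cmod ((x, t) - 1)%C <= 2/3). { replace (2/3) with (/ (3/2)) by field. ar. }
 lra.
Qed.

Section Harnack.
Variable b : R.
Hypothesis Hb : 45/100 <= b <= 1.
Hypothesis HZ : forall s, b < fst s -> Zf s <> 0%C.
Let U (s : C) := b < fst s.

Lemma hol_Pp : hol U Pp.
Proof.
 unfold Pp. apply hol_minus.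
 - apply (hol_comp U (fun s => 0 < fst s) Clog (fun z => z + 2)%C); [intros s Hs; unfold U in Hs; simpl; lra|apply hol_Clog|ar].
 - apply hol_Ff. intros s Hs. unfold U in Hs. ar.
Qed.

Lemma hol_Pd : hol U Pd.
Proof.
 ha R : forall f, hol RH1 f -> hol U f by (intros f; apply hol_sub; intros s Hs; unfold U, RH1 in *; lra).
 unfold Pd. apply hol_plus.
 - apply hol_inv; [intros s Hs; unfold U in Hs; apply re_pos_nz; simpl; lra|ar].
 - apply hol_div; [intros s Hs; apply Cmult_nz; apply HZ, Hs|apply hol_minus|]; apply hol_mult; apply R; (apply Zf_hol || apply Z1_hol || apply Z2_hol).
Qed.

Lemma Pp_Cd s : b < fst s -> Cd Pp s (Pd s).
Proof. intros H. apply Pd_Cd; [lra|ar]. Qed.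

Lemma ReP_pos s : b < fst s -> 0 <= fst (Pp s).
Proof.
 intros H. unfold Pp. note (ReF_le_log b !! HZ s !! H) as E.
 note (Clog_fst (s + 2)%C ltac:(simpl; lra)) as E2. rewrite <- E2 in E.
 change (fst (Clog (s + 2) - Ff s)%C) with (fst (Clog (s + 2)%C) - fst (Ff s)). lra.
Qed.

(* Schwarz-Pick for a map of the half-plane into the right half-plane: a Moebius map moves [s] to the centre of a disc. *)
Lemma schwarz_pick (x t : R) : b < x -> Cmod (Pd (x, t)) <= fst (Pp (x, t))/(x - b).
Proof.
 intros Hx. set (a := x - b). ha Ha : 0 < a by (unfold a; lra).
 set (mu := fun w : C => ((b, t) + a*((1 + w)/(1 - w)))%C).
 set (mu' := fun w : C => (2*a/((1 - w)*(1 - w)))%C).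
 ha Nz : forall w : C, Cmod (w - 0)%C < 1 -> (1 - w)%C <> 0%C.
 { intros w Hw E. replace (w - 0)%C with (1 - (1 - w))%C in Hw by ring. rewrite E in Hw. replace (RtoC 1 - RtoC 0)%C with (RtoC 1) in Hw by ring. rewrite Cmod_1 in Hw. lra. }
 ha Hmu : forall w : C, Cmod (w - 0)%C < 1 -> b < fst (mu w).
 { intros w Hw. note (Nz w Hw) as N. unfold mu. destruct w as [p q].
  ha S : p ^ 2 + q ^ 2 < 1.
  { replace ((p, q) - 0)%C with ((p, q) : C) in Hw by cring. note (Cmod_sq (p, q)) as Q. simpl fst in Q. simpl snd in Q.
   note (Cmod_ge_0 (p, q)). ar. }
  ha D : 0 < (1 - p) ^ 2 + q ^ 2.
  { ar. }
  replace (fst ((b, t) + a*((1 + (p, q))/(1 - (p, q))))%C) with (b + a*((1 - (p ^ 2 + q ^ 2))/((1 - p) ^ 2 + q ^ 2))).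
  - assert (0 < (1 - (p ^ 2 + q ^ 2))/((1 - p) ^ 2 + q ^ 2)) by ar. nra.
  - simpl. ar. }
 ha Dmu : forall w : C, Cmod (w - 0)%C < 1 -> Cd mu w (mu' w).
 { intros w Hw. unfold mu, mu'. eapply Cd_eq; [|apply Cd_plus; [apply Cd_const|apply Cd_mult; [apply Cd_const|apply Cd_div; [apply Nz, Hw|apply Cd_plus; [apply Cd_const|apply Cd_id]|apply Cd_minus; [apply Cd_const|apply Cd_id]]]]].
  ar. }
 set (V := fun w : C => Cmod (w - 0)%C < 1).
 ha Hol : hol V (fun w => - (Pd (mu w)*mu' w))%C.
 { apply hol_opp, hol_mult.
  - apply (hol_comp V U Pd mu); [ar|apply hol_Pd|]. unfold mu.
   apply hol_plus; [ar|apply hol_mult; [ar|]].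
   apply hol_div; [ar| |]; [apply hol_plus|apply hol_minus]; try apply hol_const; apply hol_id.
  - unfold mu'. apply hol_div; [intros w Hw; apply Cmult_nz; apply Nz, Hw|ar|].
   apply hol_mult; apply hol_minus; try apply hol_const; apply hol_id. }
 note (borel_caratheodory (fun w => - fst (Pp (mu w))) (fun w => - (Pd (mu w)*mu' w))%C 0%C 1 0 !! Hol) as BC.
 ha m0 : mu 0%C = (x, t). { unfold mu, a. replace ((1 + 0)/(1 - 0))%C with (RtoC 1) by ar. ar. }
 ha m1 : mu' 0%C = (2*a)%C by (unfold mu'; field; intros E; injection E; lra).
 cbv beta in BC. rewrite m0, m1, Cmod_opp, Cmod_mult in BC. replace (2*a)%C with (RtoC (2*a)) in BC by ar.
 rewrite Cmod_R, Rabs_pos_eq in BC by lra.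
 apply le_div; [ar|]. apply (mle_rl 2); [lra|]. replace (2*fst (Pp (x, t))) with (2/1*(0 - - fst (Pp (x, t)))) by field.
 replace (2*(Cmod (Pd (x, t))*a)) with (Cmod (Pd (x, t))*(2*a)) by ring. apply BC.
 - intros g u m Hg HR. 
  note (Rd_comp mu g u (mu' (g u)) m (Dmu _ Hg) HR) as R1.
  note (Rd_comp Pp (fun v => mu (g v)) u (Pd (mu (g u))) _ (Pp_Cd _ (Hmu _ Hg)) R1) as [R2 _].
  eapply dR_eq; [|apply (dR_scal _ (-1)) in R2; eapply is_derive_ext; [|exact R2]].
  + generalize (Pd (mu (g u))) (mu' (g u)). intros A B. simpl. ring.
  + intros v. cbv beta. req. ring.
 - intros w Hw. note (ReP_pos (mu w) (Hmu w Hw)). lra.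
Qed.

(** Schwarz-Pick gives |P'| (x - b) <= Re P, so (x - b) Re P has a nonnegative derivative in x. *)
Lemma ReP_mono (x a t : R) : b < x <= a -> fst (Pp (x, t))*(x - b) <= fst (Pp (a, t))*(a - b).
Proof.
 intros [H1 H2]. apply (incr_deriv (fun u => fst (Pp (u, t))*(u - b)) (fun u => fst (Pd (u, t))*(u - b) + fst (Pp (u, t))*1)); [ar| |].
 - intros u Hu. apply (dR_mult (fun u => fst (Pp (u, t))) (fun u => u - b)); [apply (Cd_re Pp u t (Pd (u, t))), Pp_Cd; simpl; lra|auto_derive; auto; ring].
 - intros u Hu. note (schwarz_pick u t !!) as S. note (Cmod_fst (Pd (u, t))) as F. apply abs_btw in F.
  assert (Cmod (Pd (u, t))*(u - b) <= fst (Pp (u, t))).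
  { apply mle_r with (r := u - b) in S; [|lra]. replace (fst (Pp (u, t))/(u - b)*(u - b)) with (fst (Pp (u, t))) in S by ar. ar. }
  nra.
Qed.

(** Integrate |P'| <= Re P/(x - b) <= c/(x - b)^2 from x to a. *)
Lemma P_growth (x a t : R) : b < x <= a -> Cmod (Pp (x, t)) <= Cmod (Pp (a, t)) + fst (Pp (a, t))*(a - b)/(x - b).
Proof.
 intros [H1 H2]. set (c := fst (Pp (a, t))*(a - b)).
 ha c0 : 0 <= c by (apply mul_nn; [apply ReP_pos; simpl; lra|lra]).
 apply Cmod_dual. intros w Hw.
 ha M : fst (w*Pp (x, t))%C - c/(x - b) <= fst (w*Pp (a, t))%C - c/(a - b).
 { apply (incr_deriv (fun u => fst (w*Pp (u, t))%C - c/(u - b)) (fun u => fst (w*Pd (u, t))%C - c*(- 1/(u - b) ^ 2))); [ar| |].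
  - intros u Hu. apply dR_minus.
   + apply (Rd_comp (fun z => w*z)%C (fun u => Pp (u, t)) u w (Pd (u, t))); [|apply Cd_re, Pp_Cd; simpl; lra].
    eapply Cd_eq; [|apply Cd_mult; [apply Cd_const|apply Cd_id]]. cbv beta. ring.
   + auto_derive; [lra|ar].
  - intros u Hu. note (schwarz_pick u t !!) as S. note (ReP_mono u a t !!) as M. fold c in M.
   note (Cmod_fst (w*Pd (u, t))%C) as F. rewrite Cmod_mult, Hw, Rmult_1_l in F. apply abs_btw in F.
   assert (fst (Pp (u, t))/(u - b) <= c/(u - b) ^ 2).
   { apply le_div; [ar|]. replace (fst (Pp (u, t))/(u - b)*(u - b) ^ 2) with (fst (Pp (u, t))*(u - b)) by ar. ar. }
   ar. }
 note (Cmod_fst (w*Pp (a, t))%C) as F. rewrite Cmod_mult, Hw, Rmult_1_l in F. apply abs_btw in F.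
 assert (0 <= c/(a - b)) by ar. lra.
Qed.

(** Compared with [F_growth], the cube of 1/(x - b) has become a first power, which matters at x - b
    of order 1/L. The comparison point is a = 5/2, where [F_far] controls F, and 205/100 is the
    largest value of 5/2 - b. *)
Lemma F_bd (x t : R) : b < x -> Cmod (Ff (x, t)) <= (205/100/(x - b) + 2)*(ln (5 + Rabs t) + 31/10).
Proof.
 intros Hx. note (Rabs_pos t) as t0. set (l := ln (5 + Rabs t)).
 ha l0 : 0 <= l by (unfold l; rewrite <- ln_1; apply ln_le; lra).
 assert (0 < 205/100/(x - b)) by ar.
 destruct (Rle_dec (5/2) x) as [L|L]; [note (F_far x t L); nra|].
 note (P_growth x (5/2) t !!) as G.
 ha C1 : forall y, 0 <= y <= 5/2 -> Cmod (Clog ((y, t) + 2)%C) <= l + 2.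
 { intros y Hy. etr; [apply Clog_bound; simpl; lra|]. simpl. rewrite Rplus_0_r. apply add_le_r. unfold l. ar. }
 ha PA : Cmod (Pp (5/2, t)) <= l + 2 + 207/100.
 { unfold Pp. via Cmod_sub_le. apply add_le; [ar|apply F_far; lra]. }
 ha RA : fst (Pp (5/2, t)) <= l + 207/100.
 { unfold Pp. change (fst (Clog (((5/2)%R, t) + 2) - Ff ((5/2)%R, t))%C) with (fst (Clog (((5/2)%R, t) + 2)%C) - fst (Ff (5/2, t))).
  note (F_far (5/2) t !!). note (Cmod_fst (Ff (5/2, t))) as F. apply abs_btw in F.
  rewrite Clog_fst by ar. assert (ln (Cmod (((5/2)%R, t) + 2)%C) <= l); [|lra].
  unfold l. apply ln_le; [apply Cmod_gt_0, re_pos_nz; simpl; lra|]. via Cmod_le_sum. simpl. rewrite Rplus_0_r, (Rabs_pos_eq (5/2 + 2)); lra. }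
 ha G2 : fst (Pp (5/2, t))*(5/2 - b)/(x - b) <= (l + 207/100)*(205/100/(x - b)).
 { replace ((l + 207/100)*(205/100/(x - b))) with ((l + 207/100)*(205/100)/(x - b)) by ar.
  apply mle_r; [ar|]. ar. }
 replace (Ff (x, t)) with (Clog ((x, t) + 2) - Pp (x, t))%C by ar.
 via Cmod_sub_le. note (C1 x !!). nra.
Qed.
End Harnack.

Definition C2 (g : R -> R -> C) : Prop := c2 (fun x y => fst (g x y)) /\ c2 (fun x y => snd (g x y)).

(** * Inversion of the smoothed Chebyshev function *)

Lemma c2_plus f g : c2 f -> c2 g -> c2 (fun x y => f x y + g x y).
Proof. intros A B x y. apply (continuity_2d_pt_plus f g); auto. Qed.

Lemma c2_minus f g : c2 f -> c2 g -> c2 (fun x y => f x y - g x y).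
Proof. intros A B x y. apply (continuity_2d_pt_minus f g); auto. Qed.

Lemma c2_mult f g : c2 f -> c2 g -> c2 (fun x y => f x y*g x y).
Proof. intros A B x y. apply (continuity_2d_pt_mult f g); auto. Qed.

Lemma c2_comp1 (h : R -> R) f : (forall x, continuous h x) -> c2 f -> c2 (fun x y => h (f x y)).
Proof. intros A B x y. apply (continuity_1d_2d_pt_comp h f); [apply cR_iff, A|ar]. Qed.

Lemma c2_x (h : R -> R) : (forall x, continuous h x) -> c2 (fun x _ => h x).
Proof. intros A. apply (c2_comp1 h (fun x _ => x) A). intros x y. apply continuity_2d_pt_id1. Qed.

Lemma c2_y (h : R -> R) : (forall x, continuous h x) -> c2 (fun _ y => h y).
Proof. intros A. apply (c2_comp1 h (fun _ y => y) A). intros x y. apply continuity_2d_pt_id2. Qed.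

Lemma C2_x (g : R -> C) : (forall x, Ccont g x) -> C2 (fun x _ => g x).
Proof. intros A. split; apply c2_x; intros x; apply A. Qed.

Lemma C2_y (g : R -> C) : (forall x, Ccont g x) -> C2 (fun _ y => g y).
Proof. intros A. split; apply c2_y; intros x; apply A. Qed.

Lemma C2_mult f g : C2 f -> C2 g -> C2 (fun x y => f x y*g x y)%C.
Proof.
 intros [A B] [A' B']. split; simpl.
 - apply c2_minus; apply c2_mult; asm.
 - apply c2_plus; apply c2_mult; asm.
Qed.

Lemma cont_cos x : continuous cos x.
Proof. ar. Qed.
Lemma cont_sin x : continuous sin x.
Proof. ar. Qed.
Lemma cont_exp x : continuous exp x.
Proof. ar. Qed.

Lemma C2_cexp f : C2 f -> C2 (fun x y => cexp (f x y)).
Proof.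
 intros [A B]. unfold cexp. split; simpl; apply c2_mult; apply c2_comp1; auto using cont_cos, cont_sin, cont_exp.
Qed.

Lemma CInt_fubini g a b c d : a <= b -> c <= d -> C2 g ->
 CInt (fun x => CInt (fun y => g x y) c d) a b = CInt (fun y => CInt (fun x => g x y) a b) c d.
Proof.
 intros H1 H2 [A B]. unfold CInt; simpl. f_equal; apply (fubini (fun x y => _)); asm.
Qed.

Lemma C2_1 g x y : C2 g -> Ccont (fun v => g x v) y.
Proof. intros [A B]. split; [exact (c2_1 _ x y A)|exact (c2_1 _ x y B)]. Qed.

Lemma C2_CInt g a b y : a <= b -> C2 g -> Ccont (fun v => CInt (fun x => g x v) a b) y.
Proof. intros H [A B]. split; [exact (c2_RInt _ a b y H A)|exact (c2_RInt _ a b y H B)]. Qed.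

Lemma Ccont_Im (c : R) t : Ccont (fun u => (c, u)) t.
Proof. eapply Rd_Ccont, Rd_im. Qed.

Lemma Ccont_R (f : R -> R) t : continuous f t -> Ccont (fun u => RtoC (f u)) t.
Proof. intros H. split; simpl; ar. Qed.

Lemma cont_id (x : R) : continuous (fun u : R => u) x.
Proof. ar. Qed.

Lemma Ccont_inv (g : R -> C) t : Ccont g t -> g t <> 0%C -> Ccont (fun u => / g u)%C t.
Proof.
 intros [A B] H. ha N : fst (g t) ^ 2 + snd (g t) ^ 2 <> 0.
 { intros E. apply H. apply Cmod_eq_0. note (Cmod_sq (g t)). note (Cmod_ge_0 (g t)). nra. }
 split; simpl; unfold Rdiv; apply cR_mult; try asm; try (apply cR_opp; asm); apply (cR_inv (fun u => fst (g u)*(fst (g u)*1) + snd (g u)*(snd (g u)*1)));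
 try exact N; apply cR_plus; apply cR_mult; auto; apply cR_mult; auto; apply c_cst.
Qed.

(** The kernel of an integrated Perron formula: its integral over Re s = c tends to 2 pi max(0, z),
    and the square in the denominator makes it absolutely convergent. *)
Definition Kz (z : R) (s : C) : C := (cexp (z*s)/(s*s))%C.

Lemma cexp_zs_mod (z : R) (s : C) : Cmod (cexp (z*s)%C) = exp (z*fst s).
Proof. rewrite Cmod_cexp. destruct s as [a b]. rewrite Cmult_Rl. ar. Qed.

Lemma Kz_mod z (s : C) : s <> 0%C -> Cmod (Kz z s) = exp (z*fst s)/Cmod s ^ 2.
Proof.
 intros H. unfold Kz. rewrite Cmod_div by (apply Cmult_nz; exact H). rewrite cexp_zs_mod, Cmod_mult. f_equal. ring.
Qed.

Lemma hol_cexpz (U : C -> Prop) (z : R) : hol U (fun s => cexp (z*s)%C).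
Proof.
 apply (hol_comp U (fun _ => True) cexp (fun s => z*s)%C); [auto|ar|].
 ar.
Qed.

Lemma hol_Kz (U : C -> Prop) z : (forall s, U s -> s <> 0%C) -> hol U (Kz z).
Proof.
 intros H. unfold Kz. apply hol_div; [intros s Hs; apply Cmult_nz; apply H, Hs|apply hol_cexpz|ar].
Qed.

Lemma fst_nz (s : C) : fst s <> 0 -> s <> 0%C.
Proof. intros H E. apply H. rewrite E. ar. Qed.

Lemma Cmod_ge_im (s t : R) T : Rabs t = T -> T <= Cmod (s, t).
Proof. intros H. note (Cmod_snd (s, t)) as S. simpl in S. lra. Qed.

Lemma Cmod_ge_re (s t : R) : Rabs s <= Cmod (s, t).
Proof. exact (Cmod_fst (s, t)). Qed.

Lemma inv_sq_le T n : 0 < T -> T <= n -> / n ^ 2 <= / T ^ 2.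
Proof. ar. Qed.

(* The line is pushed away from the origin, in the direction in which [cexp (z*s)] does not grow. *)
Lemma Kz_far z c T : 0 < T -> c <> 0 -> z*c <= 0 -> Cmod (VI (Kz z) c (- T) T) <= 4*exp (z*c)/T.
Proof.
 intros HT Hc Hz.
 ha Bd : forall s t : R, (c > 0 -> c <= s) -> (c < 0 -> s <= c) -> T <= Cmod (s, t) -> Cmod (Kz z (s, t)) <= exp (z*c)/T ^ 2.
 { intros s t H1 H2 H3. ha N : ((s, t) : C) <> 0%C by (apply Cmod_gt_0; lra).
  rewrite Kz_mod by exact N. simpl fst. unfold Rdiv. apply mle; [ar|ar| |ar].
  apply exp_le. ar. }
 ha PT : forall t : R, Rabs T = T /\ Rabs (- T) = T by (intros; rewrite Rabs_Ropp, Rabs_pos_eq; lra).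
 destruct (PT 0) as [PT1 PT2].
 set (d := if Rlt_dec 0 c then c + T else c - T).
 ha V2 : Cmod (VI (Kz z) d (- T) T) <= (T - - T)*(exp (z*c)/T ^ 2).
 { apply CInt_norm_const; [lra| |].
  - apply (hol_exCI (fun s => fst s <> 0) (Kz z)); [lra|apply hol_Kz, fst_nz|]. intros t Ht. simpl. unfold d; destruct (Rlt_dec 0 c); lra.
  - intros t Ht. apply Bd; unfold d; destruct (Rlt_dec 0 c); try lra; etr; try apply Cmod_ge_re; [rewrite Rabs_pos_eq|rewrite Rabs_left]; lra. }
 ha V1 : Cmod (VI (Kz z) d (- T) T - VI (Kz z) c (- T) T)%C <= T*(2*(exp (z*c)/T ^ 2)).
 { unfold d. destruct (Rlt_dec 0 c).
  - replace (T*(2*(exp (z*c)/T ^ 2))) with ((c + T - c)*(2*(exp (z*c)/T ^ 2))) by ring.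
   apply (rect_hol (fun s => fst s <> 0) (Kz z) c (c + T) (- T) T (c/2)); try lra.
   + intros s t Hs _. simpl. lra.
   + apply hol_Kz, fst_nz.
   + intros s Hs. note (Bd s T !! !! (Cmod_ge_im s T T PT1)). note (Bd s (- T) !! !! (Cmod_ge_im s (- T) T PT2)). lra.
  - rewrite Cmod_sym. replace (T*(2*(exp (z*c)/T ^ 2))) with ((c - (c - T))*(2*(exp (z*c)/T ^ 2))) by ring.
   apply (rect_hol (fun s => fst s <> 0) (Kz z) (c - T) c (- T) T (- c/2)); try lra.
   + intros s t Hs _. simpl. lra.
   + apply hol_Kz, fst_nz.
   + intros s Hs. note (Bd s T !! !! (Cmod_ge_im s T T PT1)). note (Bd s (- T) !! !! (Cmod_ge_im s (- T) T PT2)). lra. }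
 replace (VI (Kz z) c (- T) T) with (VI (Kz z) d (- T) T - (VI (Kz z) d (- T) T - VI (Kz z) c (- T) T))%C by ring.
 via Cmod_sub_le. etr; [apply add_le; eassumption|].
 right. ar.
Qed.

Lemma atan_le_id y : 0 <= y -> atan y <= y.
Proof.
 intros H. assert (0 - atan 0 <= y - atan y); [|rewrite atan_0 in *; lra].
 apply (incr_deriv (fun u => u - atan u) (fun u => 1 - / (1 + u ^ 2))); [ar| |].
 - intros u Hu. auto_derive; [ar|]. field. note (pow2_ge_0 u). simpl in *. lra.
 - intros u Hu. note (pow2_ge_0 u). assert (/ (1 + u ^ 2) <= / 1) by ar. lra.
Qed.

Lemma VI_inv (c T : R) : 0 < c -> 0 < T -> (VI (fun s => / s)%C c (- T) T = RtoC (2*atan (T/c)) /\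
 VI (fun s => / s)%C (- c) (- T) T = RtoC (- (2*atan (T/c)))).
Proof.
 intros Hc HT.
 ha R1 : forall t, Rd (fun u => Clog (c, u)) t (/ (c, t)*Ci)%C by (intros t; apply Cd_im, Cd_Clog; simpl; lra).
 ha CI : forall c' t : R, c' <> 0 -> Ccont (fun u => / (c', u))%C t.
 { intros c' t H. apply (hol_cont (fun s => fst s <> 0) (fun s => / s)%C c' t); [|ar]. apply hol_inv; [apply fst_nz|ar]. }
 ha E0 : (- T)/c = - (T/c) by ar.
 split.
 - ha E : CInt (fun t => Ci * / (c, t))%C (- T) T = (Clog (c, T) - Clog (c, (- T)%R))%C.
  { apply (Rd_FTC (fun u => Clog (c, u))); [lra| |].
   - intros t _. eapply Rd_eq; [|apply R1]. ring.
   - intros t _. apply Ccont_mult; ar. }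
  rewrite CInt_scal in E by (apply exCI_cont; [lra|ar]). fold (VI (fun s => / s)%C c (- T) T) in E.
  set (w := VI (fun s => / s)%C c (- T) T) in *. destruct w as [w1 w2]. unfold Clog in E. simpl in E. injection E as E1 E2.
  replace (- T*(- T*1)) with (T*(T*1)) in E1 by ring. rewrite E0, atan_opp in E2. apply pair_eq; simpl; lra.
 - ha E : CInt (fun t => Ci * / ((- c)%R, t))%C (- T) T = (Clog (c, (- T)%R) - Clog (c, (- - T)%R))%C.
  { apply (Rd_FTC (fun u => Clog (c, - u))); [lra| |].
   - intros t _. assert (R2 := Rd_comp Clog (fun u => (c, - u)) t (/ (c, (- t)%R))%C (- Ci)%C (Cd_Clog (c, - t) ltac:(simpl; lra)) ltac:(split; simpl; auto_derive; auto; ring)).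
    eapply Rd_eq; [|exact R2]. ha N : c ^ 2 + t ^ 2 <> 0 by ar.
    apply pair_eq; simpl; field; simpl in N; repeat split; intro; apply N; nra.
   - intros t _. apply Ccont_mult; ar. }
  rewrite CInt_scal in E by (apply exCI_cont; [lra|ar]). fold (VI (fun s => / s)%C (- c) (- T) T) in E.
  set (w := VI (fun s => / s)%C (- c) (- T) T) in *. destruct w as [w1 w2]. unfold Clog in E. simpl in E. injection E as E1 E2.
  rewrite E0, !Ropp_involutive, atan_opp in E2. apply pair_eq; simpl; [lra|]. 
  replace (- T*(- T*1)) with (T*(T*1)) in E1 by ring. rewrite !Ropp_involutive in E1. lra.
Qed.

#[export] Hint Resolve cont_cos cont_sin cont_exp cont_id : ana.

Lemma VI_plus U (f g : C -> C) c T : 0 <= T -> (forall t, - T <= t <= T -> U (c, t)) -> hol U f -> hol U g ->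
 VI (fun s => f s + g s)%C c (- T) T = (VI f c (- T) T + VI g c (- T) T)%C.
Proof. intros H HU A B. apply CInt_plus; eapply hol_exCI; eauto; lra. Qed.

Lemma VI_scal U (f : C -> C) (k : C) c T : 0 <= T -> (forall t, - T <= t <= T -> U (c, t)) -> hol U f ->
 VI (fun s => k*f s)%C c (- T) T = (k*VI f c (- T) T)%C.
Proof. intros H HU A. apply (CInt_scal k (fun t => f (c, t))). eapply hol_exCI; eauto; lra. Qed.

Lemma VI_ext (f g : C -> C) c T : 0 <= T -> (forall t, f (c, t) = g (c, t)) -> VI f c (- T) T = VI g c (- T) T.
Proof. intros H E. apply CInt_ext; [lra|]. ar. Qed.

(** Split off the polar part: e^{zs}/s^2 = f + 1/s^2 + z/s with f bounded near 0. Moving f from the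
    line c to -c costs only horizontal sides. The term z/s contributes 4 z arctan(T/c), which is
    close to 2 pi z, and at -c the kernel itself is small by [Kz_far]. *)
Lemma Kz_near z c T : 1 <= c -> 1 <= T -> 0 <= z ->
 Cmod (VI (Kz z) c (- T) T - RtoC (2*PI*z))%C <= (12 + 16*c)*exp (z*c)/T.
Proof.
 intros Hc HT Hz. set (NZ := fun s : C => s <> 0%C). set (f := fun s : C => ((cexp (z*s) - 1 - z*s)/(s*s))%C).
 ha hf : hol NZ f.
 { unfold f. apply hol_div; [intros s Hs; apply Cmult_nz; exact Hs| |ar].
  apply hol_minus; [apply hol_minus; [apply hol_cexpz|ar]|apply hol_mult; ar]. }
 ha hK0 : hol NZ (Kz 0) by (apply hol_Kz; auto).
 ha hi : hol NZ (fun s => / s)%C by (apply hol_inv; [auto|ar]).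
 ha Sp : forall c' : R, c' <> 0 -> VI (Kz z) c' (- T) T = (VI f c' (- T) T + VI (Kz 0) c' (- T) T + z*VI (fun s => / s)%C c' (- T) T)%C.
 { intros c' Hc'. ha HU : forall t, - T <= t <= T -> NZ (c', t) by (intros; apply fst_nz; simpl; exact Hc').
  rewrite <- (VI_scal NZ), <- (VI_plus NZ f), <- (VI_plus NZ); try asm; try lra.
  - apply VI_ext; [lra|]. intros t. ha N : NZ (c', t) by (apply fst_nz; exact Hc'). unfold NZ in N. set (s := ((c', t) : C)) in *.
   unfold f, Kz. replace (0*s)%C with (RtoC 0) by ring. replace (cexp (RtoC 0)) with (RtoC 1).
   + field. exact N.
   + unfold cexp. simpl. rewrite exp_0, cos_0, sin_0. apply pair_eq; simpl; ring.
  - apply hol_plus; asm.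
  - ar. }
 destruct (VI_inv c T !! !!) as [I1 I2].
 note (exp_pos (z*c)) as Ep. ha E1 : 1 + z <= exp (z*c) by (note (exp_ineq1_le (z*c)); nra).
 ha F1 : Cmod (VI f c (- T) T - VI f (- c) (- T) T)%C <= (c - - c)*(2*((exp (z*c) + 1)/T ^ 2 + z/T)).
 { ha Side : forall s t : R, - c <= s <= c -> Rabs t = T -> Cmod (f (s, t)) <= (exp (z*c) + 1)/T ^ 2 + z/T.
  { intros s t Hs Ht. note (Cmod_ge_im s t T Ht) as M. ha N : ((s, t) : C) <> 0%C by (apply Cmod_gt_0; lra).
   unfold f. rewrite Cmod_div by (apply Cmult_nz; exact N). rewrite Cmod_mult.
   mid ((exp (z*c) + 1 + z*Cmod (s, t))/(Cmod (s, t)*Cmod (s, t))).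
   - apply mle_r; [ar|].
    via Cmod_sub_le. apply add_le; [|rewrite Cmod_mult, Cmod_R, Rabs_pos_eq; lra].
    via Cmod_sub_le. rewrite cexp_zs_mod, Cmod_1. apply add_le_r, exp_le. simpl. nra.
   - replace ((exp (z*c) + 1 + z*Cmod (s, t))/(Cmod (s, t)*Cmod (s, t))) with ((exp (z*c) + 1) * / Cmod (s, t) ^ 2 + z * / Cmod (s, t)) by ar.
    unfold Rdiv. ar. }
  apply (rect_sing NZ f (- c) c (- T) T 1 0 0 1 (z ^ 2*exp (z*2))); try lra; try asm.
  - intros s t _ _ H. exact H.
  - intros s t H1 H2 N. rewrite Rminus_0_r in H1, H2. unfold f. change (((s, t) : C) <> 0%C) in N.
   rewrite Cmod_div by (apply Cmult_nz; exact N). note (proj2 (cexp_remainder (z*(s, t))%C)) as R.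
   ha P : 0 < Cmod (s, t) by (apply Cmod_gt_0, N). rewrite !Cmod_mult, !Cmod_R, (Rabs_pos_eq z) in*by lra.
   apply div_le; [nra|]. via R. assert (Cmod (s, t) <= 2) by (etr; [apply Cmod_le_sum|simpl; lra]).
   replace ((z*Cmod (s, t)) ^ 2) with (z ^ 2*Cmod (s, t) ^ 2) by ring.
   replace (z ^ 2*exp (z*2)*(Cmod (s, t)*Cmod (s, t))) with (z ^ 2*Cmod (s, t) ^ 2*exp (z*2)) by ring.
   apply mle_l; ar.
  - intros s Hs. note (Side s T Hs ltac:(apply Rabs_pos_eq; lra)). note (Side s (- T) Hs ltac:(rewrite Rabs_Ropp; apply Rabs_pos_eq; lra)). lra. }
 note (Kz_far z (- c) T !! !! ltac:(nra)) as F2.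
 note (Kz_far 0 c T !! !! !!) as F3. note (Kz_far 0 (- c) T !! !! !!) as F4.
 rewrite !Rmult_0_l, exp_0 in F3, F4.
 ha A : 0 <= PI/2 - atan (T/c) <= c/T.
 { note (atan_bound (T/c)). split; [lra|]. rewrite <- atan_inv by ar.
  replace (/ (T/c)) with (c/T) by ar. apply atan_le_id, div_ge0; lra. }
 replace (VI (Kz z) c (- T) T - RtoC (2*PI*z))%C with (VI (Kz z) (- c) (- T) T + (VI f c (- T) T - VI f (- c) (- T) T) + (VI (Kz 0) c (- T) T - VI (Kz 0) (- c) (- T) T)
  + RtoC (- (4*z*(PI/2 - atan (T/c)))))%C.
 2: { rewrite (Sp c), (Sp (- c)) by lra. rewrite I1, I2. generalize (VI f c (- T) T) (VI f (- c) (- T) T) (VI (Kz 0) c (- T) T) (VI (Kz 0) (- c) (- T) T).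
  intros. apply pair_eq; simpl; field. }
 via Cmod_triangle. etr; [apply add_le_r, Cmod_tri3|].
 etr; [apply add_le; [apply add_le; [apply add_le; [exact F2|exact F1]|etr; [apply Cmod_sub_le|apply add_le; [exact F3|exact F4]]]|]|].
 - rewrite Cmod_R, Rabs_Ropp, Rabs_pos_eq by ar. apply mle_l; [lra|]. exact (proj2 A).
 - set (E := exp (z*c)) in *. ha e2 : exp (z * - c) <= 1. { replace 1 with (exp 0) by apply exp_0. apply exp_le. nra. }
  ha T2 : / T ^ 2 <= / T. { apply inv_le; [lra|]. ar. }
  apply (mle_rr T); [lra|].
  ha iT : (E + 1)/T ^ 2 <= 2*E/T. { ar. }
  mid ((4*exp (z * - c)/T + (c - - c)*(2*(2*E/T + z/T)) + (4*1/T + 4*1/T) + 4*z*(c/T))*T).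
  + apply mle_r; [lra|]. apply add_le_r. apply add_le_r. apply add_le_l. apply mle_l; lra.
  + replace ((4*exp (z * - c)/T + (c - - c)*(2*(2*E/T + z/T)) + (4*1/T + 4*1/T) + 4*z*(c/T))*T) with (4*exp (z * - c) + 2*c*(2*(2*E + z)) + 8 + 4*z*c) by ar.
   replace ((12 + 16*c)*E/T*T) with ((12 + 16*c)*E) by ar. nra.
Qed.

Lemma Kz_lim z c T : 1 <= c -> 1 <= T ->
 Cmod (VI (Kz z) c (- T) T - RtoC (2*PI*Rmax 0 z))%C <= (12 + 16*c)*exp (z*c)/T.
Proof.
 intros Hc HT. destruct (Rle_dec 0 z) as [H|H].
 - rewrite Rmax_right by exact H. apply Kz_near; asm.
 - rewrite Rmax_left by lra. rewrite Rmult_0_r. replace (VI (Kz z) c (- T) T - RtoC 0)%C with (VI (Kz z) c (- T) T) by ring.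
  etr; [apply Kz_far; [lra|lra|nra]|]. ar.
Qed.

Definition K2z (z : R) (s : C) : C := (cexp (z*s)/(s*s*(s - 1)))%C.

Lemma VI_tail0 c T : 1 < c -> 1 <= T -> Cmod (VI (K2z 0) c (- T) T) <= 4/T.
Proof.
 intros Hc HT. set (U := fun s : C => 1 < fst s).
 ha U1 : forall s, U s -> (s*s*(s - 1))%C <> 0%C.
 { intros s Hs. unfold U in Hs. apply Cmult_nz; [apply Cmult_nz|]; apply fst_nz; simpl; lra. }
 ha hK : hol U (K2z 0).
 { unfold K2z. apply hol_div; [ar|apply hol_cexpz|].
  ar. }
 ha Bd : forall s t : R, 1 < s -> T <= Cmod (s, t) -> T <= Cmod ((s - 1)%R, t) -> Cmod (K2z 0 (s, t)) <= / T ^ 2.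
 { intros s t H1 H2 H3. unfold K2z. rewrite Cmod_div by ar. rewrite cexp_zs_mod, Rmult_0_l, exp_0, !Cmod_mult, sub1_pt.
  unfold Rdiv. rewrite Rmult_1_l. apply inv_le; [ar|].
  ar. }
 ha PT1 : Rabs T = T by (apply Rabs_pos_eq; lra). ha PT2 : Rabs (- T) = T by (rewrite Rabs_Ropp; exact PT1).
 ha V1 : Cmod (VI (K2z 0) (c + T) (- T) T - VI (K2z 0) c (- T) T)%C <= (c + T - c)*(2 * / T ^ 2).
 { apply (rect_hol U (K2z 0) c (c + T) (- T) T ((c - 1)/2)); try lra; try asm.
  - intros s t Hs _. unfold U. simpl. lra.
  - intros s Hs. note (Bd s T !! (Cmod_ge_im _ _ _ PT1) (Cmod_ge_im _ _ _ PT1)). note (Bd s (- T) !! (Cmod_ge_im _ _ _ PT2) (Cmod_ge_im _ _ _ PT2)). lra. }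
 ha V2 : Cmod (VI (K2z 0) (c + T) (- T) T) <= (T - - T) * / T ^ 2.
 { apply CInt_norm_const; [lra| |].
  - apply (hol_exCI U (K2z 0)); [lra|ar|]. intros t Ht. unfold U. simpl. lra.
  - intros t Ht. apply Bd; [lra| |]; (etr; [|apply Cmod_ge_re]); rewrite Rabs_pos_eq; lra. }
 replace (VI (K2z 0) c (- T) T) with (VI (K2z 0) (c + T) (- T) T - (VI (K2z 0) (c + T) (- T) T - VI (K2z 0) c (- T) T))%C by ring.
 via Cmod_sub_le. etr; [apply add_le; [exact V2|exact V1]|]. right. ar.
Qed.

Lemma cexp_RtoC (y : R) : cexp (RtoC y) = RtoC (exp y).
Proof. unfold cexp, RtoC. simpl. rewrite cos_0, sin_0. ar. Qed.

(** The factor 1/(s - 1) is expressed through an integral of e^{-y} [Kz y], so that [Kz_near] can be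
    integrated in y instead of computing a residue at 1. *)
Lemma K2z_split z (s : C) : 0 <= z -> 1 < fst s ->
 K2z z s = (RtoC (exp z)*(K2z 0 s + CInt (fun y => RtoC (exp (- y))*Kz y s) 0 z))%C.
Proof.
 intros Hz Hs. ha N1 : s <> 0%C by (apply fst_nz; lra). ha N2 : (s - 1)%C <> 0%C by (apply fst_nz; simpl; lra).
 ha Ed : forall y : R, (RtoC (exp (- y))*Kz y s)%C = (cexp (y*(s - 1))/(s*s))%C.
 { intros y. unfold Kz. rewrite <- cexp_RtoC. unfold Cdiv. rewrite Cmult_assoc, <- cexp_plus. f_equal. f_equal.
  ar. }
 rewrite (Rd_FTC (fun y : R => cexp (y*(s - 1))/(s*s*(s - 1)))%C).
 - unfold K2z. replace (cexp (z*s)) with (RtoC (exp z)*cexp (z*(s - 1)))%C.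
  2: { rewrite <- cexp_RtoC, <- cexp_plus. f_equal. ar. }
  replace (cexp (0*s)) with (RtoC 1). 2: { replace (0*s)%C with (RtoC 0) by ring. rewrite cexp_RtoC, exp_0. ar. }
  replace (cexp (0*(s - 1))) with (RtoC 1). 2: { replace (0*(s - 1))%C with (RtoC 0) by ring. rewrite cexp_RtoC, exp_0. ar. }
  field. auto.
 - exact Hz.
 - intros y _. rewrite Ed. unfold Cdiv. eapply Rd_eq; [|apply Rd_mult; [apply (Rd_comp cexp (fun y => y*(s - 1))%C y); [apply Cd_cexp|apply Rd_ray]|apply Rd_const]].
  cbv beta. field. auto.
 - intros y _. apply Ccont_mult.
  + apply Ccont_R. apply (cR_comp exp (fun u => - u)); ar.
  + unfold Kz, Cdiv. apply Ccont_mult; [|ar]. eapply Rd_Ccont. apply (Rd_comp cexp (fun y => y*s)%C y); [apply Cd_cexp|apply Rd_ray].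
Qed.

Lemma C2_Kz (c : R) : c <> 0 -> C2 (fun t y => RtoC (exp (- y))*Kz y (c, t))%C.
Proof.
 intros Hc. apply C2_mult.
 - apply (C2_y (fun y => RtoC (exp (- y)))). intros y. apply Ccont_R. apply (cR_comp exp (fun u => - u)); ar.
 - unfold Kz, Cdiv. apply C2_mult.
  + apply (C2_cexp (fun t y => RtoC y*(c, t))%C). apply (C2_mult (fun t y => RtoC y) (fun t y => (c, t))); [apply C2_y; intros; apply Ccont_R, cont_id|apply C2_x; intros; apply Ccont_Im].
  + apply (C2_x (fun t => / ((c, t)*(c, t)))%C). intros t. apply Ccont_inv; [apply Ccont_mult; apply Ccont_Im|]. apply Cmult_nz; apply fst_nz; exact Hc.
Qed.

Lemma int_yexp z : 0 <= z -> RInt (fun y => exp (- y)*(2*PI*y)) 0 z = 2*PI*(1 - (1 + z)*exp (- z)).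
Proof.
 intros Hz. replace (2*PI*(1 - (1 + z)*exp (- z))) with ((fun y => - (2*PI*((1 + y)*exp (- y)))) z - (fun y => - (2*PI*((1 + y)*exp (- y)))) 0).
 - apply RI_uniq, (is_RInt_derive (fun y => - (2*PI*((1 + y)*exp (- y))))).
  + intros y _. auto_derive; [ar|]. ring.
  + intros y _. apply cR_mult; ar.
 - cbv beta. rewrite Ropp_0, exp_0. ring.
Qed.

Lemma K2z_lim z X c T : 1 < c -> 1 <= T -> 0 <= z <= X ->
 Cmod (VI (K2z z) c (- T) T - RtoC (2*PI*(exp z - 1 - z)))%C <= exp X*(4 + X*((12 + 16*c)*exp (X*c)))/T.
Proof.
 intros Hc HT Hz.
 ha HK2 : exCI (fun t => K2z 0 (c, t)) (- T) T.
 { apply (hol_exCI (fun s => 1 < fst s) (K2z 0)); [lra| |ar].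
  unfold K2z. apply hol_div; [intros s Hs; apply Cmult_nz; [apply Cmult_nz|]; apply fst_nz; simpl; lra|apply hol_cexpz|].
  ar. }
 set (g := fun t y : R => (RtoC (exp (- y))*Kz y (c, t))%C).
 ha Hg : C2 g by (apply C2_Kz; lra).
 ha Hs : C2 (fun y t => g t y) by (destruct Hg as [A B]; split; [exact (c2_swap _ A)|exact (c2_swap _ B)]).
 ha E : VI (K2z z) c (- T) T = (RtoC (exp z)*(VI (K2z 0) c (- T) T + CInt (fun y => RtoC (exp (- y))*VI (Kz y) c (- T) T) 0 z))%C.
 { unfold VI at 1. rewrite (CInt_ext _ (fun t => RtoC (exp z)*(K2z 0 (c, t) + CInt (fun y => g t y) 0 z))%C) by (try lra; intros t _; apply K2z_split; simpl; lra).
  ha X1 : exCI (fun t => CInt (fun y => g t y) 0 z) (- T) T.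
  { apply exCI_cont; [lra|]. intros t _. apply (C2_CInt (fun y t => g t y)); [lra|ar]. }
  rewrite CInt_scal by (apply exCI_plus; asm). rewrite CInt_plus by asm. f_equal. f_equal.
  rewrite CInt_fubini by ar. apply CInt_ext; [lra|]. intros y Hy. unfold g, VI.
  rewrite CInt_scal; [ar|]. apply (hol_exCI (fun s => fst s <> 0) (Kz y)); [lra|apply hol_Kz, fst_nz|ar]. }
 ha Cv : forall y, Ccont (fun y => RtoC (exp (- y))*VI (Kz y) c (- T) T)%C y.
 { intros y. apply (Ccont_ext (fun v => CInt (fun t => g t v) (- T) T)).
  - intros v. unfold g, VI. rewrite CInt_scal; [ar|]. apply (hol_exCI (fun s => fst s <> 0) (Kz v)); [lra|apply hol_Kz, fst_nz|ar].
  - apply C2_CInt; [lra|ar]. }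
 ha Cm : forall y, Ccont (fun y => RtoC (exp (- y)*(2*PI*y))) y.
 { intros y. apply Ccont_R. apply cR_mult; [apply (cR_comp exp (fun u => - u)); [apply cR_opp, cont_id|ar]|ar]. }
 ha M : CInt (fun y => RtoC (exp (- y)*(2*PI*y))) 0 z = RtoC (2*PI*(1 - (1 + z)*exp (- z))).
 { unfold CInt, RtoC; simpl. f_equal; [apply int_yexp; lra|]. rewrite RInt_const. apply Rmult_0_r. }
 replace (VI (K2z z) c (- T) T - RtoC (2*PI*(exp z - 1 - z)))%C with
  (RtoC (exp z)*(VI (K2z 0) c (- T) T + CInt (fun y => RtoC (exp (- y))*VI (Kz y) c (- T) T - RtoC (exp (- y)*(2*PI*y)))%C 0 z))%C.
 2: { rewrite E, CInt_minus, M by (apply exCI_cont; [lra|auto]).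
  ha E1 : exp z*exp (- z) = 1 by (rewrite <- exp_plus, Rplus_opp_r; apply exp_0).
  generalize (VI (K2z 0) c (- T) T) (CInt (fun y => RtoC (exp (- y))*VI (Kz y) c (- T) T)%C 0 z). intros A B.
  replace (2*PI*(exp z - 1 - z)) with (exp z*(2*PI*(1 - (1 + z)*exp (- z)))).
  - rewrite (RtoC_mult (exp z)). ring.
  - replace (exp z*(2*PI*(1 - (1 + z)*exp (- z)))) with (2*PI*(exp z - (1 + z)*(exp z*exp (- z)))) by ring. rewrite E1. ring. }
 rewrite Cmod_mult, Cmod_R, Rabs_pos_eq by ar.
 unfold Rdiv. rewrite Rmult_assoc. apply mle; [ar|ar|ar|].
 via Cmod_triangle.
 ha I : Cmod (CInt (fun y => RtoC (exp (- y))*VI (Kz y) c (- T) T - RtoC (exp (- y)*(2*PI*y)))%C 0 z) <= (z - 0)*((12 + 16*c)*exp (X*c)/T).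
 { apply CInt_norm_const; [lra|apply exCI_cont; [lra|intros y _; apply Ccont_minus; auto]|].
  intros y Hy. note (Kz_near y c T !! HT !!) as Q. rewrite (RtoC_mult (exp (- y))). match goal with |- Cmod ?e <= _ => replace e with (RtoC (exp (- y))*(VI (Kz y) c (- T) T - RtoC (2*PI*y)))%C by ring end. rewrite Cmod_mult, Cmod_R, Rabs_pos_eq by ar.
  assert (exp (- y) <= 1) by (rewrite <- exp_0; apply exp_le; lra). note (exp_pos (- y)).
  mid (1*((12 + 16*c)*exp (y*c)/T)); [ar|].
  rewrite Rmult_1_l. ar. }
 note (VI_tail0 c T Hc HT) as V0. rewrite Rmult_plus_distr_r. apply add_le; [ar|].
 via I. rewrite Rminus_0_r. unfold Rdiv. rewrite <- Rmult_assoc. ar.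
Qed.

(** A ramp from 0 at -[th] to 1 at 0. Thus [psz th N z] is the mean of psi(e^v) over z <= v <= z +
    [th], with psi cut off at N. *)
Definition k1 (th z : R) : R := (Rmax 0 (z + th) - Rmax 0 z)/th.
Definition psz (th : R) (N : nat) (z : R) : R := rsum (fun k => Lam k*k1 th (z - ln (INR (S k)))) N.
(** The subtracted quantity e^z (e^th - 1)/th - 1 is what 1/(s - 1) yields under the same inversion,
    by [K2z_lim]; so [Rz] is what [Ff] yields. *)
Definition Rz (th : R) (N : nat) (z : R) : R := psz th N z - (exp th - 1)/th*exp z + 1.
Definition Hk (th z : R) (s : C) : C := (RtoC (/ th)*(Kz (z + th) s - Kz z s))%C.

Lemma VI_minus U (f g : C -> C) c T : 0 <= T -> (forall t, - T <= t <= T -> U (c, t)) -> hol U f -> hol U g ->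
 VI (fun s => f s - g s)%C c (- T) T = (VI f c (- T) T - VI g c (- T) T)%C.
Proof. intros H HU A B. apply CInt_minus; eapply hol_exCI; eauto; lra. Qed.

Lemma VI_norm_const U (f : C -> C) c T M : 0 <= T -> (forall t, - T <= t <= T -> U (c, t)) -> hol U f ->
 (forall t, - T < t < T -> Cmod (f (c, t)) <= M) -> Cmod (VI f c (- T) T) <= (T - - T)*M.
Proof. intros H HU A B. apply CInt_norm_const; [lra|eapply hol_exCI; eauto; lra|exact B]. Qed.

Lemma hol_csum U (f : nat -> C -> C) N : (forall k, hol U (f k)) -> hol U (fun s => csum (fun k => f k s) N).
Proof. intros H. induction N as [|N IH]; simpl; ar. Qed.

Lemma VI_csum U (f : nat -> C -> C) c T N : 0 <= T -> (forall t, - T <= t <= T -> U (c, t)) -> (forall k, hol U (f k)) ->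
 VI (fun s => csum (fun k => f k s) N) c (- T) T = csum (fun k => VI (f k) c (- T) T) N.
Proof.
 intros HT HU H. induction N as [|N IH]; simpl csum.
 - unfold VI, CInt, RtoC; simpl. f_equal; rewrite RInt_const; apply Rmult_0_r.
 - rewrite (VI_plus U); auto using hol_csum. rewrite IH. ar.
Qed.

Lemma csum_minus f g N : csum (fun k => f k - g k)%C N = (csum f N - csum g N)%C.
Proof. induction N as [|N IH]; simpl; [ring|rewrite IH; ring]. Qed.

Lemma csum_mulr f (c : C) N : (csum f N*c)%C = csum (fun k => f k*c)%C N.
Proof. induction N as [|N IH]; simpl; [ring|rewrite <- IH; ring]. Qed.

Lemma rsum_scal (c : R) f N : rsum (fun k => c*f k) N = c*rsum f N.
Proof. induction N as [|N IH]; simpl; [ring|ar]. Qed.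

Lemma rsum_S f N : rsum f (S N) = rsum f N + f N.
Proof. ar. Qed.

Lemma npw_Kz y z s : (npw y s*Kz z s)%C = Kz (z - ln y) s.
Proof.
 unfold npw, Kz, Cdiv. rewrite Cmult_assoc, <- cexp_plus. f_equal. f_equal. ar.
Qed.

Lemma k1_zero th z : 0 < th -> z + th <= 0 -> k1 th z = 0.
Proof. intros H1 H2. unfold k1. rewrite !Rmax_left by lra. ar. Qed.

(** The ramp of the integer m starts at log m - [th], so all terms beyond N still vanish at z. *)
Lemma psz_stable th N M z : 0 < th -> z + th <= ln (INR (S N)) -> (N <= M)%nat -> psz th M z = psz th N z.
Proof.
 intros Hth Hz HM. unfold psz. induction HM as [|M HM IH]; [ar|]. rewrite rsum_S, IH, k1_zero; [ring|ar|].
 assert (ln (INR (S N)) <= ln (INR (S M))); [|lra]. apply ln_le; [apply lt_0_INR; lia|apply le_INR; lia].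
Qed.

Lemma Hk_bound th z c t : 0 < th -> 0 < c -> Cmod (Hk th z (c, t)) <= / th*(2*exp ((Rabs z + th)*c)/c ^ 2).
Proof.
 intros Hth Hc. unfold Hk. rewrite Cmod_mult, Cmod_R, Rabs_pos_eq by ar.
 apply mle_l; [ar|]. via Cmod_sub_le.
 ha N : ((c, t) : C) <> 0%C by (apply fst_nz; simpl; lra). rewrite !Kz_mod by exact N. simpl fst.
 ha I : / Cmod (c, t) ^ 2 <= / c ^ 2. { apply inv_sq_le; [lra|]. note (Cmod_ge_re c t). rewrite Rabs_pos_eq in H; lra. }
 note (Rle_abs z).
 assert (forall y, y <= Rabs z + th -> exp (y*c)/Cmod (c, t) ^ 2 <= exp ((Rabs z + th)*c)/c ^ 2).
 { intros y Hy. unfold Rdiv. apply mle; [ar|left; apply inv_pos, pow_lt, Cmod_gt_0, N|ar|ar]. }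
 note (H0 (z + th) !!). note (H0 z !!). lra.
Qed.

Lemma hol_K2z (U : C -> Prop) z : (forall s, U s -> 1 < fst s) -> hol U (K2z z).
Proof.
 intros H. unfold K2z. apply hol_div; [intros s Hs; specialize (H s Hs); apply Cmult_nz; [apply Cmult_nz|]; apply fst_nz; simpl; lra|apply hol_cexpz|].
 ar.
Qed.

Section Inversion.
Variables (th c X : R) (N : nat).
Hypotheses (Hth : 0 < th) (Hc : 1 < c) (HX : 0 <= X) (HN : X + th <= ln (INR (S N))).
Let U (s : C) := 1 < fst s.
Let KK := 2*((12 + 16*c)*exp ((X + th)*c))*Dr c + 2*(exp (X + th)*(4 + (X + th)*((12 + 16*c)*exp ((X + th)*c)))).

Lemma inversion_fin M z T : 1 <= T -> 0 <= z <= X -> (N <= M)%nat ->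
 Cmod (VI (fun s => (csum (fun k => Lam k*npw (INR (S k)) s) M - / (s - 1))*Hk th z s)%C c (- T) T - RtoC (2*PI*Rz th N z))%C <= / th*(KK/T).
Proof.
 intros HT Hz HM.
 set (A := fun k s => (Lam k*(Kz (z + th - ln (INR (S k))) s - Kz (z - ln (INR (S k))) s))%C).
 ha hKz : forall y, hol U (Kz y) by (intros; apply hol_Kz; intros s Hs; unfold U in Hs; apply fst_nz; lra).
 ha hK2 : forall y, hol U (K2z y) by (intros; apply hol_K2z; auto).
 ha hA : forall k, hol U (A k) by (intros; unfold A; apply hol_mult; ar).
 ha HU : forall t, - T <= t <= T -> U (c, t) by ar.
 ha E : VI (fun s => (csum (fun k => Lam k*npw (INR (S k)) s) M - / (s - 1))*Hk th z s)%C c (- T) T =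
  (RtoC (/ th)*(csum (fun k => Lam k*(VI (Kz (z + th - ln (INR (S k)))) c (- T) T - VI (Kz (z - ln (INR (S k)))) c (- T) T)) M - (VI (K2z (z + th)) c (- T) T - VI (K2z z) c (- T) T)))%C.
 { transitivity (VI (fun s => RtoC (/ th)*(csum (fun k => A k s) M + ((-1)*K2z (z + th) s + K2z z s)))%C c (- T) T).
  - apply VI_ext; [lra|]. intros t. set (s := ((c, t) : C)). ha Ns : s <> 0%C by (apply fst_nz; simpl; lra).
   ha N1 : (s - 1)%C <> 0%C by (apply fst_nz; simpl; lra).
   replace (csum (fun k => A k s) M) with (csum (fun k => Lam k*npw (INR (S k)) s)%C M*(Kz (z + th) s - Kz z s))%C.
   + unfold Hk, K2z, Kz. field. auto.
   + rewrite csum_mulr. apply csum_ext. intros k _. unfold A. rewrite <- !npw_Kz. ring.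
  - rewrite (VI_scal U); try lra; auto.
   2: { apply hol_plus; [apply hol_csum, hA|ar]. }
   f_equal. rewrite (VI_plus U); try lra; auto using hol_csum.
   2: { ar. }
   rewrite (VI_plus U); try lra; auto. 2: { ar. }
   rewrite (VI_scal U); try lra; auto. rewrite (VI_csum U); try lra; auto.
   replace (csum (fun k => VI (A k) c (- T) T) M) with (csum (fun k => Lam k*(VI (Kz (z + th - ln (INR (S k)))) c (- T) T - VI (Kz (z - ln (INR (S k)))) c (- T) T))%C M).
   + generalize (VI (K2z (z + th)) c (- T) T) (VI (K2z z) c (- T) T). intros. ring.
   + apply csum_ext. intros k _. unfold A. rewrite (VI_scal U); try lra; auto. 2: { ar. }
    f_equal. unfold VI. rewrite <- CInt_minus; [ar| |]; apply (hol_exCI U (Kz _)); auto; lra. }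
 rewrite E.
 ha E2 : RtoC (2*PI*Rz th N z) = (RtoC (/ th)*(csum (fun k => Lam k*(RtoC (2*PI*Rmax 0 (z + th - ln (INR (S k)))) - RtoC (2*PI*Rmax 0 (z - ln (INR (S k)))))) M
  - (RtoC (2*PI*(exp (z + th) - 1 - (z + th))) - RtoC (2*PI*(exp z - 1 - z)))))%C.
 { rewrite (csum_ext _ (fun k => RtoC (2*PI*th*(Lam k*k1 th (z - ln (INR (S k))))))).
  - rewrite csum_RtoC, rsum_scal. fold (psz th M z). rewrite (psz_stable th N M z) by ar.
   unfold Rz. rewrite <- !RtoC_minus, <- RtoC_mult. f_equal. rewrite exp_plus. field. lra.
  - intros k _. rewrite <- RtoC_minus, <- RtoC_mult. f_equal. unfold k1. replace (z - ln (INR (S k)) + th) with (z + th - ln (INR (S k))) by ring. ar. }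
 rewrite E2.
 set (S1 := csum (fun k => Lam k*(VI (Kz (z + th - ln (INR (S k)))) c (- T) T - VI (Kz (z - ln (INR (S k)))) c (- T) T))%C M).
 set (S2 := csum (fun k => Lam k*(RtoC (2*PI*Rmax 0 (z + th - ln (INR (S k)))) - RtoC (2*PI*Rmax 0 (z - ln (INR (S k))))))%C M).
 set (c1 := RtoC (2*PI*(exp (z + th) - 1 - (z + th)))). set (c0 := RtoC (2*PI*(exp z - 1 - z))).
 replace (RtoC (/ th)*(S1 - (VI (K2z (z + th)) c (- T) T - VI (K2z z) c (- T) T)) - RtoC (/ th)*(S2 - (c1 - c0)))%C with
  (RtoC (/ th)*((S1 - S2) + ((VI (K2z z) c (- T) T - c0) - (VI (K2z (z + th)) c (- T) T - c1))))%C by ring.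
 rewrite Cmod_mult, Cmod_R, Rabs_pos_eq by ar.
 apply mle_l; [ar|].
 via Cmod_triangle. unfold KK, Rdiv. rewrite Rmult_plus_distr_r. apply add_le.
 - unfold S1, S2. rewrite <- csum_minus.
  set (B := 2*((12 + 16*c)*exp ((X + th)*c)) * / T).
  ha iT : 0 < / T by ar.
  mid (rsum (fun k => B*(Lam k*rpw (INR (S k)) c)) M).
  + apply csum_norm. intros k _.
   match goal with |- Cmod ?e <= _ => replace e with (Lam k*((VI (Kz (z + th - ln (INR (S k)))) c (- T) T - RtoC (2*PI*Rmax 0 (z + th - ln (INR (S k))))) -
    (VI (Kz (z - ln (INR (S k)))) c (- T) T - RtoC (2*PI*Rmax 0 (z - ln (INR (S k)))))))%C by ring end.
   rewrite Cmod_mult, Cmod_R, Rabs_pos_eq by apply Lam_bd. 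
   replace (B*(Lam k*rpw (INR (S k)) c)) with (Lam k*(B*rpw (INR (S k)) c)) by ring. apply mle_l; [apply Lam_bd|].
   via Cmod_sub_le.
   ha Q : forall y, y <= X + th -> Cmod (VI (Kz (y - ln (INR (S k)))) c (- T) T - RtoC (2*PI*Rmax 0 (y - ln (INR (S k)))))%C <= (12 + 16*c)*exp ((X + th)*c) * / T*rpw (INR (S k)) c.
   { intros y Hy. etr; [apply Kz_lim; lra|].
    replace ((12 + 16*c)*exp ((y - ln (INR (S k)))*c)/T) with ((12 + 16*c)*(exp (y*c)*rpw (INR (S k)) c) * / T).
    - replace ((12 + 16*c)*exp ((X + th)*c) * / T*rpw (INR (S k)) c) with ((12 + 16*c)*(exp ((X + th)*c)*rpw (INR (S k)) c) * / T) by ring.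
     apply mle_r; [lra|]. apply mle_l; [lra|]. apply mle_r; [left; apply rpw_pos|]. apply exp_le. nra.
    - unfold rpw. rewrite <- exp_plus. unfold Rdiv. f_equal. f_equal. f_equal. ring. }
   note (Q (z + th) !!). note (Q z !!). unfold B. lra.
  + rewrite rsum_scal. replace (2*((12 + 16*c)*exp ((X + th)*c))*Dr c * / T) with (B*Dr c) by (unfold B; ring).
   apply mle_l; [unfold B; note (exp_pos ((X + th)*c)); apply mul_nn; [nra|lra]|].
   apply rsum_le_Series; [intros k; apply mul_nn; [apply Lam_bd|left; apply rpw_pos]|apply Dr_ex, Hc].
 - via Cmod_sub_le.
  note (K2z_lim z (X + th) c T Hc HT !!) as Q1. note (K2z_lim (z + th) (X + th) c T Hc HT !!) as Q2.
  unfold Rdiv in Q1, Q2. unfold c1, c0. lra.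
Qed.

(** The constant [KK] of [inversion_fin] does not depend on the length M of the Dirichlet
    polynomial, so M tends to infinity at fixed T, while N stays fixed because z lies in the range
    of [psz_stable]. *)
Lemma inversion z T : 1 <= T -> 0 <= z <= X ->
 Cmod (VI (fun s => Ff s*Hk th z s)%C c (- T) T - RtoC (2*PI*Rz th N z))%C <= / th*(KK/T).
Proof.
 intros HT Hz. set (a := (c - 1)/2). set (HB := / th*(2*exp ((Rabs z + th)*c)/c ^ 2)).
 enough (Q : Cmod (VI (fun s => Ff s*Hk th z s)%C c (- T) T - RtoC (2*PI*Rz th N z))%C - / th*(KK/T) <= 0) by lra.
 apply (le_rpw_limit _ ((T - - T)*(/ a/a*HB)) a); [unfold a; lra|]. intros M HM.
 note (inversion_fin (N + M) z T HT Hz ltac:(lia)) as F.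
 ha hH : hol U (Hk th z).
 { unfold Hk. apply hol_mult; [ar|]. apply hol_minus; apply hol_Kz; intros s Hs; unfold U in Hs; apply fst_nz; lra. }
 ha hF : hol U Ff by (apply hol_Ff; intros s Hs; unfold U in Hs; split; [lra|apply Zf_nz1, Hs]).
 ha hS : hol U (fun s => csum (fun k => Lam k*npw (INR (S k)) s)%C (N + M) - / (s - 1))%C.
 { apply hol_minus; [apply (hol_csum U (fun k s => Lam k*npw (INR (S k)) s)%C); intros k; apply hol_mult; [ar|apply hol_npw]|].
  apply hol_inv; [intros s Hs; unfold U in Hs; apply fst_nz; simpl; lra|ar]. }
 set (VN := VI (fun s => (csum (fun k => Lam k*npw (INR (S k)) s) (N + M) - / (s - 1))*Hk th z s)%C c (- T) T) in *.
 ha D : Cmod (VI (fun s => Ff s*Hk th z s)%C c (- T) T - VN)%C <= (T - - T)*(/ a/a*rpw (INR M) a*HB).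
 { set (f1 := fun s : C => (Ff s*Hk th z s)%C). set (f2 := fun s : C => ((csum (fun k => Lam k*npw (INR (S k)) s) (N + M) - / (s - 1))*Hk th z s)%C) in VN.
  ha h1 : hol U f1 by (apply hol_mult; asm). ha h2 : hol U f2 by (apply (hol_mult U (fun s => csum (fun k => Lam k*npw (INR (S k)) s)%C (N + M) - / (s - 1))%C); asm).
  unfold VN. rewrite <- (VI_minus U f1 f2); [|lra|ar|ar|ar].
  apply (VI_norm_const U (fun s => f1 s - f2 s)%C); [lra|ar|ar|].
  intros t _. unfold f1, f2. rewrite Ff_D by exact Hc.
   match goal with |- Cmod ?e <= _ => replace e with ((Dser (c, t) - csum (fun k => Lam k*npw (INR (S k)) (c, t)) (N + M))*Hk th z (c, t))%C by ring end.
   rewrite Cmod_mult. apply mle; try apply Cmod_ge_0; [|apply Hk_bound; lra].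
   etr; [apply (coef_tail Lam (c, t) (N + M) Hc Lam_bd); lia|]. simpl fst. fold a.
   apply mle_l; [ar|].
   unfold rpw. apply exp_le. assert (ln (INR M) <= ln (INR (N + M))) by (apply ln_le; [apply lt_0_INR; lia|apply le_INR; lia]).
   assert (0 < a) by (unfold a; lra). nra. }
 replace (VI (fun s => Ff s*Hk th z s)%C c (- T) T - RtoC (2*PI*Rz th N z))%C with
  ((VI (fun s => Ff s*Hk th z s)%C c (- T) T - VN) + (VN - RtoC (2*PI*Rz th N z)))%C by ring.
 note (Cmod_triangle (VI (fun s => Ff s*Hk th z s)%C c (- T) T - VN)%C (VN - RtoC (2*PI*Rz th N z))%C). lra.
Qed.
End Inversion.

Lemma exR (f : R -> R) a b : a <= b -> (forall t, continuous f t) -> ex_RInt f a b.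
Proof. ar. Qed.

Lemma RInt_mono (f g : R -> R) a b : a <= b -> (forall t, continuous f t) -> (forall t, continuous g t) ->
 (forall t, a <= t <= b -> f t <= g t) -> RInt f a b <= RInt g a b.
Proof. intros H A B L. apply RInt_le; auto using exR. ar. Qed.

Lemma RInt_pos (f : R -> R) a b : a <= b -> (forall t, continuous f t) -> (forall t, a <= t <= b -> 0 <= f t) -> 0 <= RInt f a b.
Proof. intros H A L. apply RInt_ge_0; auto using exR. ar. Qed.

Lemma RInt_add (f g : R -> R) a b : a <= b -> (forall t, continuous f t) -> (forall t, continuous g t) ->
 RInt (fun t => f t + g t) a b = RInt f a b + RInt g a b.
Proof. intros H A B. apply (RInt_plus (V := RCN)); auto using exR. Qed.

Lemma RInt_eq (f g : R -> R) a b : (forall t, f t = g t) -> RInt f a b = RInt g a b.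
Proof. intros H. apply RInt_ext. ar. Qed.

Lemma RInt_chas (f : R -> R) a b c : a <= b -> b <= c -> (forall t, continuous f t) -> RInt f a b + RInt f b c = RInt f a c.
Proof. intros H1 H2 H. apply (RInt_Chasles (V := RCN)); auto using exR. Qed.

(** * A Plancherel inequality *)

Lemma c2_id_x : c2 (fun x _ => x).
Proof. apply (c2_x (fun x => x)), cont_id. Qed.
Lemma c2_id_y : c2 (fun _ y => y).
Proof. apply (c2_y (fun x => x)), cont_id. Qed.
Lemma c2_const (k : R) : c2 (fun _ _ => k).
Proof. apply (c2_x (fun _ => k)). ar. Qed.

Ltac c2t := repeat first [apply c2_id_x | apply c2_id_y | apply c2_const
 | match goal with
  | H : c2 ?f |- c2 ?f => exact H
  | |- c2 (fun x y => @?f x y + @?g x y) => apply (c2_plus f g)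
  | |- c2 (fun x y => @?f x y - @?g x y) => apply (c2_minus f g)
  | |- c2 (fun x y => @?f x y * @?g x y) => apply (c2_mult f g)
  | |- c2 (fun x y => cos (@?f x y)) => apply (c2_comp1 cos f cont_cos)
  | |- c2 (fun x y => sin (@?f x y)) => apply (c2_comp1 sin f cont_sin)
  | |- c2 (fun x y => exp (@?f x y)) => apply (c2_comp1 exp f cont_exp)
  end ].

Lemma c2_diag_y f x : c2 f -> forall y, continuous (fun v => f x v) y.
Proof. intros H y. apply c2_1, H. Qed.
Lemma c2_diag_x f y : c2 f -> forall x, continuous (fun u => f u y) x.
Proof. intros H x. apply (c2_1 (fun a b => f b a)), c2_swap, H. Qed.

Section L2.
Variables (p : R -> R) (T Lam0 : R).
Hypothesis Hp : forall t, continuous p t.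
Hypothesis HT : 0 <= T.
Hypothesis HL : 0 < Lam0.
Let ka := / Lam0.
Let Cc z := RInt (fun t => p t*cos (t*z)) (- T) T.
Let Ss z := RInt (fun t => p t*sin (t*z)) (- T) T.
Let W Z u := RInt (fun z => exp (- (ka*z))*cos (u*z)) 0 Z.
Let I2 := RInt (fun t => p t*p t) (- T) T.

Lemma ka_pos : 0 < ka.
Proof. apply inv_pos, HL. Qed.

Lemma px : c2 (fun x _ => p x).
Proof. apply c2_x, Hp. Qed.
Lemma py : c2 (fun _ y => p y).
Proof. apply c2_y, Hp. Qed.

Lemma Cc_cont z : continuous Cc z.
Proof. apply (c2_RInt (fun t z => p t*cos (t*z))); [lra|]. note px. c2t. Qed.
Lemma Ss_cont z : continuous Ss z.
Proof. apply (c2_RInt (fun t z => p t*sin (t*z))); [lra|]. note px. c2t. Qed.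

Lemma W_val Z u : 0 <= Z -> W Z u = (ka - exp (- (ka*Z))*(ka*cos (u*Z) - u*sin (u*Z)))/(ka ^ 2 + u ^ 2).
Proof.
 intros HZ. note ka_pos as K. note (sumsq_pos ka u K) as Q. unfold W.
 set (g := fun z => - exp (- (ka*z))*(ka*cos (u*z) - u*sin (u*z))/(ka ^ 2 + u ^ 2)).
 replace (_/_) with (g Z - g 0).
 - apply RI_uniq, (is_RInt_derive g).
  + intros z _. unfold g. auto_derive; [ar|]. field. simpl in *. lra.
  + intros z _. apply (c2_diag_y (fun _ z => exp (- (ka*z))*cos (u*z)) 0). apply c2_mult.
   * apply (c2_comp1 exp (fun _ z => - (ka*z)) cont_exp). apply (c2_comp1 Ropp (fun _ z => ka*z)); [ar|c2t].
   * c2t.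
 - unfold g. rewrite !Rmult_0_r, Ropp_0, exp_0, cos_0, sin_0. ar.
Qed.

Lemma W_bound Z u : 0 <= Z -> Rabs (W Z u) <= ka/(ka ^ 2 + u ^ 2) + 2/ka*exp (- (ka*Z)).
Proof.
 intros HZ. rewrite W_val by exact HZ. note ka_pos as K. note (sumsq_pos ka u K) as Q.
 set (E := exp (- (ka*Z))). assert (0 < E) by apply exp_pos.
 ha S : Rabs (ka*cos (u*Z) - u*sin (u*Z)) <= ka + Rabs u.
 { unfold Rminus. via Rabs_triang. rewrite Rabs_Ropp, !Rabs_mult, (Rabs_pos_eq ka) by lra.
  assert (Rabs (cos (u*Z)) <= 1) by (apply Rabs_le, COS_bound). assert (Rabs (sin (u*Z)) <= 1) by (apply Rabs_le, SIN_bound).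
  note (Rabs_pos u). nra. }
 unfold Rdiv. rewrite Rabs_mult, (Rabs_pos_eq (/ _)) by ar.
 apply (mle_rr (ka ^ 2 + u ^ 2)); [ar|]. rewrite Rmult_assoc, Rinv_l, Rmult_1_r by lra.
 rewrite Rmult_plus_distr_r, Rmult_assoc, Rinv_l, Rmult_1_r by lra.
 via Rabs_triang. rewrite Rabs_Ropp, Rabs_mult, (Rabs_pos_eq ka), (Rabs_pos_eq E) by lra. apply add_le_l.
 replace (2 * / ka*E*(ka ^ 2 + u ^ 2)) with (E*(2 * / ka*(ka ^ 2 + u ^ 2))) by ring. apply mle_l; [lra|].
 via S. apply (mle_rl ka); [ar|].
 replace (ka*(2 * / ka*(ka ^ 2 + u ^ 2))) with (2*(ka ^ 2 + u ^ 2)) by ar.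
 rewrite <- (pow2_abs u). ar.
Qed.

Lemma I2_pos : 0 <= I2.
Proof. apply RInt_pos; [lra|ar|ar]. Qed.

(** Schur's test. Under the weight e^{-z/Lam0} the kernel in t - t' is dominated by a Poisson kernel
    of mass at most pi plus a term that dies as Z grows, and p(t) p(t') is at most half the sum of
    the squares. *)
Lemma L2_weighted Z : 0 <= Z -> RInt (fun z => exp (- (ka*z))*(Cc z ^ 2 + Ss z ^ 2)) 0 Z <= (PI + 2*T*(2/ka*exp (- (ka*Z))))*I2.
Proof.
 intros HZ. note ka_pos as K. note px as Px. note py as Py.
 ha ex : c2 (fun x _ => exp (- (ka*x))).
 { apply (c2_x (fun x => exp (- (ka*x)))). ar. }
 ha Ccx : c2 (fun x _ => Cc x) by (apply c2_x, Cc_cont). ha Ssx : c2 (fun x _ => Ss x) by (apply c2_x, Ss_cont).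
 set (eps := 2/ka*exp (- (ka*Z))). set (Wb := fun u => ka/(ka ^ 2 + u ^ 2) + eps).
 ha eps0 : 0 <= eps by (apply mul_nn; ar).
 ha Wbc : forall u, continuous Wb u.
 { intros u. unfold Wb. eapply cR_der. auto_derive; ar. }
 ha Wb2 : c2 (fun x y => Wb (x - y)) by (apply (c2_comp1 Wb (fun x y => x - y) Wbc); c2t).
 (* diagonalise: the weighted integral equals the double integral of p(t) p(t') W(t - t') *)
 ha E1 : RInt (fun z => exp (- (ka*z))*(Cc z ^ 2 + Ss z ^ 2)) 0 Z =
  RInt (fun t => p t*RInt (fun z => exp (- (ka*z))*(cos (t*z)*Cc z + sin (t*z)*Ss z)) 0 Z) (- T) T.
 { transitivity (RInt (fun z => RInt (fun t => p t*(exp (- (ka*z))*(cos (t*z)*Cc z + sin (t*z)*Ss z))) (- T) T) 0 Z).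
  - apply RInt_eq. intros z.
   transitivity (RInt (fun t => exp (- (ka*z))*Cc z*(p t*cos (t*z)) + exp (- (ka*z))*Ss z*(p t*sin (t*z))) (- T) T).
   + ha c1 : forall t, continuous (fun t => p t*cos (t*z)) t by (apply (c2_diag_x (fun t z => p t*cos (t*z)) z); c2t).
    ha c3 : forall t, continuous (fun t => p t*sin (t*z)) t by (apply (c2_diag_x (fun t z => p t*sin (t*z)) z); c2t).
    rewrite RInt_add by (try lra; intros; apply cR_mult; auto; apply c_cst).
    rewrite !RInt_scalR by ar. fold (Cc z) (Ss z). ring.
   + apply RInt_eq. intros t. ring.
  - rewrite (fubini (fun z t => p t*(exp (- (ka*z))*(cos (t*z)*Cc z + sin (t*z)*Ss z)))); try lra.
   + apply RInt_eq. intros t. apply RInt_scalR, exR; [lra|]. apply (c2_diag_x (fun z t => exp (- (ka*z))*(cos (t*z)*Cc z + sin (t*z)*Ss z)) t). c2t.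
   + c2t. }
 ha E2 : forall t, RInt (fun z => exp (- (ka*z))*(cos (t*z)*Cc z + sin (t*z)*Ss z)) 0 Z = RInt (fun t' => p t'*W Z (t - t')) (- T) T.
 { intros t. transitivity (RInt (fun z => RInt (fun t' => p t'*(exp (- (ka*z))*cos ((t - t')*z))) (- T) T) 0 Z).
  - apply RInt_eq. intros z.
   transitivity (RInt (fun t' => exp (- (ka*z))*cos (t*z)*(p t'*cos (t'*z)) + exp (- (ka*z))*sin (t*z)*(p t'*sin (t'*z))) (- T) T).
   + ha c1 : forall t, continuous (fun t => p t*cos (t*z)) t by (apply (c2_diag_x (fun t z => p t*cos (t*z)) z); c2t).
    ha c3 : forall t, continuous (fun t => p t*sin (t*z)) t by (apply (c2_diag_x (fun t z => p t*sin (t*z)) z); c2t).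
    rewrite RInt_add by (try lra; intros; apply cR_mult; auto; apply c_cst).
    rewrite !RInt_scalR by ar. fold (Cc z) (Ss z). ring.
   + apply RInt_eq. intros t'. rewrite Rmult_minus_distr_r, cos_minus. ring.
  - rewrite (fubini (fun z t' => p t'*(exp (- (ka*z))*cos ((t - t')*z)))); try lra.
   + apply RInt_eq. intros t'. apply RInt_scalR, exR; [lra|]. apply (c2_diag_x (fun z t' => exp (- (ka*z))*cos ((t - t')*z)) t'). c2t.
   + c2t. }
 ha Wc : c2 (fun x y => W Z (x - y)).
 { apply (c2_comp1 (W Z) (fun x y => x - y)); [|c2t]. intros u. apply (c2_RInt (fun z u => exp (- (ka*z))*cos (u*z))); [lra|]. c2t. }
 rewrite E1.
 mid (RInt (fun t => RInt (fun t' => (/ 2*(p t*p t))*Wb (t - t')) (- T) T + RInt (fun t' => (/ 2*(p t'*p t'))*Wb (t - t')) (- T) T) (- T) T).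
 { apply RInt_mono; [lra| | |].
  - intros t. apply cR_mult; [ar|]. apply (c2_RInt (fun z t => exp (- (ka*z))*(cos (t*z)*Cc z + sin (t*z)*Ss z))); [lra|]. c2t.
  - intros t. apply cR_plus.
   + apply (c2_RInt (fun t' t => (/ 2*(p t*p t))*Wb (t - t'))); [lra|]. assert (c2 (fun y x => Wb (x - y))) by exact (c2_swap _ Wb2). c2t.
   + apply (c2_RInt (fun t' t => (/ 2*(p t'*p t'))*Wb (t - t'))); [lra|]. assert (c2 (fun y x => Wb (x - y))) by exact (c2_swap _ Wb2). c2t.
  - intros t _. rewrite E2.
   ha ct : forall t', continuous (fun t' => Wb (t - t')) t' by (apply (c2_diag_y (fun x y => Wb (x - y))), Wb2).
   ha cw : forall t', continuous (fun t' => W Z (t - t')) t' by (apply (c2_diag_y (fun x y => W Z (x - y))), Wc).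
   rewrite <- RInt_add; [|lra| |].
   2: { intros; apply cR_mult; ar. }
   2: { intros; apply cR_mult; [apply cR_mult; [ar|apply cR_mult; apply Hp]|ar]. }
   rewrite <- RInt_scalR by (apply exR; [lra|intros; apply cR_mult; auto]).
   apply RInt_mono; [lra| | |].
   + intros; apply cR_mult; [ar|apply cR_mult; auto].
   + intros; apply cR_plus; apply cR_mult; auto; [ar|apply cR_mult; [ar|apply cR_mult; auto]].
   + intros t' _. note (W_bound Z (t - t') HZ) as B. fold eps in B. fold (Wb (t - t')) in B. set (w := W Z (t - t')) in *. set (wb := Wb (t - t')) in *.
    apply abs_btw in B. set (x := p t). set (y := p t').
    replace (x*(y*w)) with (x*y*w) by ring.
    replace (/ 2*(x*x)*wb + / 2*(y*y)*wb) with ((x*x + y*y)/2*wb) by field.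
    note (pow2_ge_0 (x - y)). note (pow2_ge_0 (x + y)). ar. }
 ha WI : forall t, RInt (fun t' => Wb (t - t')) (- T) T <= PI + 2*T*eps /\ RInt (fun t' => Wb (t' - t)) (- T) T <= PI + 2*T*eps.
 { intros t. ha Q : RInt (fun t' => Wb (t' - t)) (- T) T <= PI + 2*T*eps.
  { unfold Wb. rewrite RInt_add; [|lra| |ar].
   2: { intros t'. eapply cR_der. auto_derive; [note (sumsq_pos ka (t' - t) K); simpl in *; lra|ar]. }
   apply add_le.
   - rewrite (RI_uniq _ _ _ _ (RInt_atan ka t (- T) T K)). note (atan_bound ((T - t)/ka)). note (atan_bound ((- T - t)/ka)). lra.
   - rewrite RInt_const. change (scal (T - - T) eps) with ((T - - T)*eps). lra. }
  split; [|ar]. etr; [|exact Q]. right. apply RInt_eq. intros t'. unfold Wb. ar. }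
 ha p2 : forall t, continuous (fun t => / 2*(p t*p t)) t by (intros; apply cR_mult; ar).
 ha Half : forall g : R -> R -> R, c2 g -> (forall t, RInt (fun t' => g t t') (- T) T <= PI + 2*T*eps) ->
  RInt (fun t => RInt (fun t' => / 2*(p t*p t)*g t t') (- T) T) (- T) T <= / 2*((PI + 2*T*eps)*I2).
 { intros g Hg HI. ha gc : forall t t', continuous (fun t' => g t t') t' by (intros t; apply (c2_diag_y g), Hg).
  mid (RInt (fun t => (PI + 2*T*eps)*(/ 2*(p t*p t))) (- T) T).
  - apply RInt_mono; [lra| | |].
   + intros t. apply (c2_RInt (fun t' t => / 2*(p t*p t)*g t t')); [lra|]. assert (c2 (fun y x => g x y)) by exact (c2_swap _ Hg). c2t.
   + intros. apply cR_mult; ar.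
   + intros t _. rewrite RInt_scalR by ar. rewrite Rmult_comm. apply mle_r; [nra|ar].
  - rewrite RInt_scalR by ar. rewrite RInt_scalR by (apply exR; [lra|intros; apply cR_mult; auto]). fold I2. ar. }
 rewrite RInt_add.
 - replace ((PI + 2*T*eps)*I2) with (/ 2*((PI + 2*T*eps)*I2) + / 2*((PI + 2*T*eps)*I2)) by field. apply add_le.
  + exact (Half (fun t t' => Wb (t - t')) Wb2 (fun t => proj1 (WI t))).
  + rewrite (fubini (fun t t' => / 2*(p t'*p t')*Wb (t - t'))); try lra; [|c2t].
   exact (Half (fun t t' => Wb (t' - t)) (c2_swap _ Wb2) (fun t => proj2 (WI t))).
 - lra.
 - intros t. apply (c2_RInt (fun t' t => (/ 2*(p t*p t))*Wb (t - t'))); [lra|]. assert (c2 (fun y x => Wb (x - y))) by exact (c2_swap _ Wb2). c2t.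
 - intros t. apply (c2_RInt (fun t' t => (/ 2*(p t'*p t'))*Wb (t - t'))); [lra|]. assert (c2 (fun y x => Wb (x - y))) by exact (c2_swap _ Wb2). c2t.
Qed.

(** The weight is at least 1/e on [0, Lam0], which costs the factor e; then Z tends to infinity. *)
Lemma L2_real : RInt (fun z => Cc z ^ 2 + Ss z ^ 2) 0 Lam0 <= exp 1*PI*I2.
Proof.
 note ka_pos as K. set (A := RInt (fun z => Cc z ^ 2 + Ss z ^ 2) 0 Lam0).
 ha sc : forall z, continuous (fun z => Cc z ^ 2 + Ss z ^ 2) z.
 { intros z. apply (cR_plus (fun z => Cc z ^ 2) (fun z => Ss z ^ 2)); [apply (cR_sq Cc), Cc_cont|apply (cR_sq Ss), Ss_cont]. }
 ha ec : forall z, continuous (fun z => exp (- (ka*z))) z by ar.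
 note I2_pos as I0.
 ha Q : A - exp 1*PI*I2 <= 0.
 { apply (le_exp_limit _ (exp 1*(2*T*(2/ka))*I2) (- 1)). intros r Hr.
  set (Z := - r/ka). ha HZ : Lam0 <= Z. { unfold Z, ka. replace (- r / / Lam0) with (- r*Lam0) by ar. nra. }
  note (L2_weighted Z !!) as L. replace (- (ka*Z)) with r in L by (unfold Z; field; lra).
  ha H1 : RInt (fun z => exp (- (ka*z))*(Cc z ^ 2 + Ss z ^ 2)) 0 Lam0 <= RInt (fun z => exp (- (ka*z))*(Cc z ^ 2 + Ss z ^ 2)) 0 Z.
  { rewrite <- (RInt_chas (fun z => exp (- (ka*z))*(Cc z ^ 2 + Ss z ^ 2)) 0 Lam0 Z); [|lra|lra|intros; apply (cR_mult (fun z => exp (- (ka*z)))); auto].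
   assert (0 <= RInt (fun z => exp (- (ka*z))*(Cc z ^ 2 + Ss z ^ 2)) Lam0 Z).
   { apply RInt_pos; [lra|intros; apply (cR_mult (fun z => exp (- (ka*z)))); auto|].
    ar. }
   lra. }
  ha H2 : exp (- 1)*A <= RInt (fun z => exp (- (ka*z))*(Cc z ^ 2 + Ss z ^ 2)) 0 Lam0.
  { unfold A. rewrite <- RInt_scalR by ar. apply RInt_mono; [lra|intros; apply cR_mult; ar|intros; apply (cR_mult (fun z => exp (- (ka*z)))); auto|].
   intros z Hz. apply mle_r; [ar|]. apply exp_le.
   assert (ka*z <= 1); [|lra]. unfold ka. replace 1 with (/ Lam0*Lam0) by ar. ar. }
  ha H3 : A = exp 1*(exp (- 1)*A). { rewrite <- Rmult_assoc, <- exp_plus. replace (1 + - 1) with 0 by ring. rewrite exp_0, Rmult_1_l. ar. }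
  note (exp_pos 1) as e0. ar. }
 lra.
Qed.
End L2.

(** Treating the real and the imaginary part of [Phi] separately costs the factor 2. *)
Lemma L2_complex (Phi : R -> C) T L0 : 0 <= T -> 0 < L0 -> (forall t, Ccont Phi t) ->
 RInt (fun z => Cmod (CInt (fun t => Phi t*cexp (0, (t*z)%R)) (- T) T)%C ^ 2) 0 L0 <= 2*(exp 1*PI)*RInt (fun t => Cmod (Phi t) ^ 2) (- T) T.
Proof.
 intros HT HL HP. set (p := fun t => fst (Phi t)). set (q := fun t => snd (Phi t)).
 ha Hp : forall t, continuous p t by ar. ha Hq : forall t, continuous q t by ar.
 note (px p Hp) as Px. note (px q Hq) as Qx.
 ha cc : forall r, (forall t, continuous r t) -> c2 (fun t z => r t*cos (t*z)) /\ c2 (fun t z => r t*sin (t*z)) by (intros r Hr; note (px r Hr); split; c2t).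
 destruct (cc p Hp) as [c1 c3]. destruct (cc q Hq) as [c4 c5].
 set (A := fun z => RInt (fun t => p t*cos (t*z)) (- T) T). set (B := fun z => RInt (fun t => p t*sin (t*z)) (- T) T).
 set (D := fun z => RInt (fun t => q t*cos (t*z)) (- T) T). set (E := fun z => RInt (fun t => q t*sin (t*z)) (- T) T).
 ha cA : forall z, continuous A z by (intros; apply (c2_RInt _ (- T) T z !! c1)). ha cB : forall z, continuous B z by (intros; apply (c2_RInt _ (- T) T z !! c3)).
 ha cD : forall z, continuous D z by (intros; apply (c2_RInt _ (- T) T z !! c4)). ha cE : forall z, continuous E z by (intros; apply (c2_RInt _ (- T) T z !! c5)).
 ha V : forall z, CInt (fun t => Phi t*cexp (0, (t*z)%R))%C (- T) T = (A z - E z, B z + D z).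
 { intros z. unfold CInt, cexp; simpl. rewrite exp_0. f_equal.
  - unfold A, E. rewrite <- (RInt_minus (V := RCN)).
   + apply RInt_eq. intros t. unfold p, q, minus, plus, opp; simpl. ring.
   + apply exR; [lra|apply (c2_diag_x _ z c1)].
   + apply exR; [lra|apply (c2_diag_x _ z c5)].
  - unfold B, D. rewrite <- RInt_add; [|lra|apply (c2_diag_x _ z c3)|apply (c2_diag_x _ z c4)]. apply RInt_eq. intros t. unfold p, q. ring. }
 ha sq : forall f : R -> R, (forall z, continuous f z) -> forall z, continuous (fun z => f z ^ 2) z by (intros f Hf z; apply cR_sq, Hf).
 ha S1 : forall z, continuous (fun z => A z ^ 2 + B z ^ 2) z by (intros; apply cR_plus; apply cR_sq; auto).
 ha S2 : forall z, continuous (fun z => D z ^ 2 + E z ^ 2) z by (intros; apply cR_plus; apply cR_sq; auto).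
 mid (RInt (fun z => 2*((A z ^ 2 + B z ^ 2) + (D z ^ 2 + E z ^ 2))) 0 L0).
 - apply RInt_mono; [lra| |intros; apply cR_mult; [ar|apply cR_plus; auto]|].
  + intros z. apply (continuous_ext (fun z => (A z - E z) ^ 2 + (B z + D z) ^ 2)).
   * intros y. rewrite V, Cmod_sq. refl.
   * apply cR_plus; apply cR_sq; [apply cR_minus|apply cR_plus]; auto.
  + intros z _. rewrite V, Cmod_sq. simpl fst. simpl snd. note (pow2_ge_0 (A z + E z)). note (pow2_ge_0 (B z - D z)). nra.
 - rewrite RInt_scalR by (apply exR; [lra|intros; apply cR_plus; auto]). rewrite RInt_add by ar.
  note (L2_real p T L0 Hp HT HL) as L1. note (L2_real q T L0 Hq HT HL) as L2. fold A B in L1. fold D E in L2.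
  ha EI : RInt (fun t => Cmod (Phi t) ^ 2) (- T) T = RInt (fun t => p t*p t) (- T) T + RInt (fun t => q t*q t) (- T) T.
  { rewrite <- RInt_add by (try lra; intros; apply cR_mult; auto). apply RInt_eq. intros t. rewrite Cmod_sq. unfold p, q. ring. }
  ar.
Qed.

#[export] Hint Resolve cR_sq : ana.

Lemma le_inv_limit y A B : (forall T, 1 <= T -> y <= A + B/T) -> y <= A.
Proof.
 intros H. apply le_epsilon. intros eps He. set (T := Rmax 1 (Rabs B/eps)).
 assert (1 <= T) by apply Rmax_l. assert (Rabs B/eps <= T) by apply Rmax_r. specialize (H T H0).
 assert (B/T <= eps); [|lra]. apply div_le; [lra|]. note (Rle_abs B).
 assert (Rabs B <= eps*T); [|lra]. apply (mle_l eps) in H1; [|lra]. replace (eps*(Rabs B/eps)) with (Rabs B) in H1 by ar. ar.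
Qed.

Lemma cont_max (f : R -> R) x : continuous f x -> continuous (fun u => Rmax 0 (f u)) x.
Proof.
 intros H. apply (continuous_ext (fun u => / 2*(f u + Rabs (f u)))).
 - intros u. unfold Rmax. destruct (Rle_dec 0 (f u)); [rewrite Rabs_pos_eq|rewrite Rabs_left]; lra.
 - ar.
Qed.

Lemma cont_k1 th z : continuous (k1 th) z.
Proof.
 unfold k1, Rdiv. apply cR_mult; [|ar]. apply cR_minus; apply cont_max; ar.
Qed.

Lemma cont_rsum (f : nat -> R -> R) N z : (forall k, continuous (f k) z) -> continuous (fun z => rsum (fun k => f k z) N) z.
Proof. intros H. induction N as [|N IH]; simpl; [ar|]. ar. Qed.

Lemma cont_psz th N z : continuous (psz th N) z.
Proof.
 unfold psz. apply (cont_rsum (fun k z => Lam k*k1 th (z - ln (INR (S k))))). intros k. apply cR_mult; [ar|].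
 apply (cR_comp (k1 th) (fun z => z - ln (INR (S k)))); [ar|apply cont_k1].
Qed.

Lemma cont_Rz th N z : continuous (Rz th N) z.
Proof.
 unfold Rz. apply cR_plus; [|ar]. apply cR_minus; [apply cont_psz|]. ar.
Qed.

(** Joins an inversion formula with error K/T to [L2_complex]. As T grows the error disappears, so
    the value of K does not enter the bound. *)
Lemma L2_transfer (h : R -> R) (Phi : R -> C) sg X K I : 0 < X -> 0 <= K -> (forall t, Ccont Phi t) -> (forall z, continuous h z) ->
 0 <= sg -> (forall T, 1 <= T -> RInt (fun t => Cmod (Phi t) ^ 2) (- T) T <= I) ->
 (forall T z, 1 <= T -> 0 <= z <= X -> Cmod (RtoC (exp (sg*z))*CInt (fun t => Phi t*cexp (0, (t*z)%R))%C (- T) T - RtoC (2*PI*h z))%C <= K/T) ->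
 RInt (fun z => h z ^ 2*exp (- 2*sg*z)) 0 X <= exp 1/(2*PI)*I.
Proof.
 intros HX HK HP Hh Hsg HI HT. note PI_RGT_0 as P0. note (exp_pos 1) as e0.
 ha ec : forall z, continuous (fun z => exp (- 2*sg*z)) z by (intros z; eapply cR_der; auto_derive; [exact Logic.I|refl]).
 ha hc : forall z, continuous (fun z => h z ^ 2*exp (- 2*sg*z)) z by (intros; apply (cR_mult (fun z => h z ^ 2)); ar).
 set (J := RInt (fun z => h z ^ 2*exp (- 2*sg*z)) 0 X).
 ha I0 : 0 <= I. { etr; [|apply (HI 1); lra]. apply RInt_pos; [lra|intros; apply cR_sq, Ccont_Cmod, HP|ar]. }
 ha Q : (2*PI) ^ 2*J <= 2*(exp 1*PI)*I.
 { apply (le_inv_limit _ _ (K*(2*(exp 1*PI)*I) + X*(K + K*K))). intros T H1.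
  set (g := fun z => Cmod (CInt (fun t => Phi t*cexp (0, (t*z)%R))%C (- T) T)).
  ha gc : forall z, continuous (fun z => g z ^ 2) z.
  { intros z. apply cR_sq. unfold g. apply Ccont_Cmod. apply (C2_CInt (fun t z => Phi t*cexp (0, (t*z)%R))%C); [lra|].
   apply (C2_mult (fun t z => Phi t)); [apply C2_x, HP|]. apply (C2_cexp (fun t z => (0, (t*z)%R))). split; simpl; c2t. }
  assert (L := L2_complex Phi T X !! HX HP). fold (RInt (fun z => g z ^ 2) 0 X) in L. specialize (HI T H1). specialize (HT T).
  set (d := K/T). ha d0 : 0 <= d by (apply div_ge0; lra). ha dK : d <= K. { apply div_le; [lra|]. nra. }
  ha B : (2*PI) ^ 2*J <= (1 + d)*RInt (fun z => g z ^ 2) 0 X + X*(d + d ^ 2).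
  { unfold J. rewrite <- RInt_scalR by ar.
   replace (X*(d + d ^ 2)) with (RInt (fun _ => d + d ^ 2) 0 X) by (rewrite RInt_const; unfold scal; simpl; unfold mult; simpl; ring).
   rewrite <- RInt_scalR by ar.
   rewrite <- RInt_add; [|lra|intros; apply cR_mult; ar|ar].
   apply RInt_mono; [lra|intros; apply cR_mult; ar|intros; apply cR_plus; [apply cR_mult; ar|ar]|].
   intros z Hz. specialize (HT z H1 Hz). fold d in HT. unfold g.
   set (w := CInt (fun t => Phi t*cexp (0, (t*z)%R))%C (- T) T) in *.
   ha A1 : 2*PI*Rabs (h z)*exp (- (sg*z)) <= Cmod w + d.
   { note (Cmod_sub_ge (RtoC (2*PI*h z)) (RtoC (exp (sg*z))*w)%C) as S. rewrite Cmod_sym in HT.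
    rewrite Cmod_mult, !Cmod_R, !Rabs_mult, (Rabs_pos_eq (exp _)), (Rabs_pos_eq 2), (Rabs_pos_eq PI) in S by ar.
    ha S2 : 2*PI*Rabs (h z) <= exp (sg*z)*Cmod w + d by lra.
    note (exp_pos (- (sg*z))) as ep. ha ee : exp (sg*z)*exp (- (sg*z)) = 1 by (rewrite <- exp_plus, Rplus_opp_r; apply exp_0).
    ha el : exp (- (sg*z)) <= 1 by (rewrite <- exp_0; apply exp_le; nra).
    apply (mle_r (exp (- (sg*z)))) in S2; [|lra].
    replace ((exp (sg*z)*Cmod w + d)*exp (- (sg*z))) with (exp (sg*z)*exp (- (sg*z))*Cmod w + d*exp (- (sg*z))) in S2 by ring. rewrite ee in S2. nra. }
   replace ((2*PI) ^ 2*(h z ^ 2*exp (- 2*sg*z))) with ((2*PI*Rabs (h z)*exp (- (sg*z))) ^ 2).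
   - mid ((Cmod w + d) ^ 2).
    + apply pow_incr. split; [|ar]. apply mul_nn; [|ar]. apply mul_nn; [lra|ar].
    (* With m = |w|: (m + d)^2 <= (1 + d) m^2 + d + d^2, since 2 d m <= d m^2 + d. *)
    + note (Cmod_ge_0 w). assert (0 <= d*(Cmod w - 1) ^ 2) by ar. nra.
   - replace (- 2*sg*z) with (- (sg*z) + - (sg*z)) by ring. rewrite exp_plus. rewrite <- (pow2_abs (h z)). ring. }
  via B.
  mid ((1 + d)*(2*(exp 1*PI)*I) + X*(d + d*K)).
  - apply add_le.
   + apply mle_l; [lra|]. via L. apply mle_l; [|ar]. assert (0 < exp 1*PI) by ar. lra.
   + apply mle_l; [lra|]. simpl. nra.
  - right. unfold d. ar. }
 apply (mle_rl ((2*PI) ^ 2)); [ar|]. via Q. right. ar.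
Qed.

(** * Mean squares of the smoothed error and of its difference quotient *)

Lemma E1_bound th (s : C) : 0 < th -> 0 < fst s -> Cmod ((cexp (th*s) - 1)/(th*s))%C <= exp (th*fst s) /\
 Cmod ((cexp (th*s) - 1)/(th*s))%C <= 2*exp (th*fst s)/(th*Cmod s).
Proof.
 intros Hth Hs. ha N : s <> 0%C by (apply re_pos_nz, Hs). ha Ns : 0 < Cmod s by (apply Cmod_gt_0, N).
 ha Nt : (th*s)%C <> 0%C by (apply Cmult_nz; [intros E; injection E; lra|ar]).
 rewrite Cmod_div, Cmod_mult, Cmod_R, (Rabs_pos_eq th) by ar.
 ha P : 0 < th*Cmod s by ar. split.
 - apply div_le; [ar|]. note (Rd_mvi (fun u : R => cexp (u*s)) (fun u : R => (cexp (u*s)*s)%C) 0 th (exp (th*fst s)*Cmod s) !!) as M.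
  ha E0 : cexp (RtoC 0*s)%C = RtoC 1 by (replace (RtoC 0*s)%C with (RtoC 0) by ring; rewrite cexp_RtoC, exp_0; refl). cbv beta in M. rewrite E0 in M.
  rewrite Rminus_0_r in M. replace (exp (th*fst s)*(th*Cmod s)) with (th*(exp (th*fst s)*Cmod s)) by ring. apply M.
  + intros u _. apply (Rd_comp cexp (fun y => y*s)%C u); [apply Cd_cexp|apply Rd_ray].
  + intros u Hu. rewrite Cmod_mult, cexp_zs_mod. apply mle_r; [lra|]. apply exp_le. nra.
 - apply mle_r; [ar|]. via Cmod_sub_le. rewrite cexp_zs_mod, Cmod_1.
  assert (1 <= exp (th*fst s)) by (apply exp_ge1; nra). lra.
Qed.

(** The dependence on the height in [F_bd]. *)
Definition lw (t : R) : R := ln (5 + Rabs t) + 31/10.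

Lemma lw_pos t : 0 < lw t.
Proof. unfold lw. note (Rabs_pos t). assert (0 <= ln (5 + Rabs t)) by (rewrite <- ln_1; apply ln_le; lra). lra. Qed.

Lemma lw_cont t : continuous lw t.
Proof.
 unfold lw. apply cR_plus; [|ar]. apply (cR_comp ln (fun t => 5 + Rabs t)).
 - apply cR_plus; [ar|apply cR_abs, cont_id].
 - eapply cR_der. auto_derive; ar.
Qed.

Lemma inv5_cont t : continuous (fun t => / (5 + Rabs t) ^ 2) t.
Proof.
 apply cR_inv; [apply cR_sq, cR_plus; [ar|apply cR_abs, cont_id]|]. ar.
Qed.

Lemma lw_int T : 0 <= T -> RInt (fun t => lw t ^ 2 * / (5 + Rabs t) ^ 2) (- T) T <= 136/10.
Proof.
 intros HT. set (h := fun t => lw t ^ 2 * / (5 + Rabs t) ^ 2).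
 ha hc : forall t, continuous h t by (intros; apply (cR_mult (fun t => lw t ^ 2)); [apply cR_sq, lw_cont|apply inv5_cont]).
 set (l := fun t => ln (5 + t) + 31/10). set (G := fun t => - ((l t ^ 2 + 2*l t + 2)/(5 + t))).
 ha GD : forall t, 0 <= t -> is_derive G t (l t ^ 2 * / (5 + t) ^ 2).
 { intros t Ht. unfold G, l. auto_derive; [lra|]. ar. }
 ha G0 : - G 0 <= 68/10.
 { unfold G, l. rewrite Rplus_0_r, Ropp_involutive.
  note (ln_le256 5 (633/100000) !! !! !!).
  assert (0 <= ln 5) by (rewrite <- ln_1; apply ln_le; lra). ar. }
 ha Gn : forall t, 0 <= t -> G t <= 0.
 { intros t Ht. unfold G. assert (0 <= l t) by (unfold l; assert (0 <= ln (5 + t)) by (rewrite <- ln_1; apply ln_le; lra); lra).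
  assert (0 <= (l t ^ 2 + 2*l t + 2)/(5 + t)) by ar. lra. }
 ha E1 : RInt h 0 T = G T - G 0.
 { apply RI_uniq, (is_RInt_derive G); intros t Ht; minmax in Ht; [|ar].
  eapply dR_eq; [|apply GD; lra]. unfold h, lw, l. rewrite Rabs_pos_eq by lra. ar. }
 ha E2 : RInt h (- T) 0 = -1*G (- 0) - -1*G (- - T).
 { apply RI_uniq, (is_RInt_derive (fun t => -1*G (- t))); intros t Ht; minmax in Ht; [|ar].
  eapply dR_eq; [|apply (dR_comp (fun y => -1*G y) (fun t => - t) t (-1) (-1*(l (- t) ^ 2 * / (5 + - t) ^ 2)))].
  - unfold h, lw, l. rewrite Rabs_left1 by lra. ring.
  - auto_derive; [ar|ring].
  - apply (dR_scal G (-1)), GD. lra. }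
 rewrite <- (RInt_chas h (- T) 0 T) by ar. rewrite E1, E2, Ropp_0, Ropp_involutive.
 note (Gn T HT). lra.
Qed.

#[export] Hint Resolve cont_k1 cont_psz cont_Rz lw_cont : ana.

(** The transform of the averaging over [0, th]: bounded, and decaying once |t| exceeds 1/th. *)
Definition Eth (th : R) (s : C) : C := ((cexp (th*s) - 1)/(th*s))%C.

Lemma Hk_form th z (s : C) : 0 < th -> s <> 0%C -> Hk th z s = (cexp (z*s)*(Eth th s/s))%C.
Proof.
 intros Hth N. ha Nt : RtoC th <> 0%C by (intros E; injection E; lra). unfold Hk, Kz, Eth.
 replace (cexp ((z + th)%R*s)%C) with (cexp (z*s)*cexp (th*s))%C by (rewrite <- cexp_plus; f_equal; rewrite RtoC_plus; ring).
 rewrite RtoC_inv by lra. field. auto.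
Qed.

Lemma cexp_line (z sg t : R) : cexp (z*(sg, t))%C = (RtoC (exp (sg*z))*cexp (0, (t*z)%R))%C.
Proof.
 rewrite <- cexp_RtoC, <- cexp_plus. f_equal. ar.
Qed.

Lemma hol_Eth (U : C -> Prop) th : 0 < th -> (forall s, U s -> s <> 0%C) -> hol U (Eth th).
Proof.
 intros Hth H. unfold Eth. apply hol_div.
 - intros s Hs. apply Cmult_nz; [intros E; injection E; lra|ar].
 - apply hol_minus; [apply hol_cexpz|ar].
 - apply hol_mult; ar.
Qed.

Lemma hol_Hk (U : C -> Prop) th z : (forall s, U s -> s <> 0%C) -> hol U (Hk th z).
Proof. intros H. unfold Hk. apply hol_mult; [ar|]. apply hol_minus; apply hol_Kz; exact H. Qed.

Lemma Hk_le th z X (s t T : R) : 0 < th -> 0 <= z <= X -> 0 < s <= 2 -> 0 < T -> T <= Cmod (s, t) ->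
 Cmod (Hk th z (s, t)) <= 2/th*exp ((X + th)*2)/T ^ 2.
Proof.
 intros Hth Hz Hs HT HM. unfold Hk. rewrite Cmod_mult, Cmod_R, Rabs_pos_eq by ar.
 ha N : ((s, t) : C) <> 0%C by (apply Cmod_gt_0; lra).
 ha Q : forall y, 0 <= y <= X + th -> Cmod (Kz y (s, t)) <= exp ((X + th)*2)/T ^ 2.
 { intros y Hy. rewrite Kz_mod by exact N. simpl fst. ar. }
 replace (2/th*exp ((X + th)*2)/T ^ 2) with (/ th*(exp ((X + th)*2)/T ^ 2 + exp ((X + th)*2)/T ^ 2)) by ar.
 apply mle_l; [ar|]. via Cmod_sub_le. apply add_le; apply Q; lra.
Qed.

Section Line.
Variables (b sg th X : R) (N : nat).
Hypothesis Hb : 45/100 <= b <= 1.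
Hypothesis HZ : forall s, b < fst s -> Zf s <> 0%C.
Hypothesis Hsg : b < sg <= 3/2.
Hypothesis Hth : 0 < th <= / 5.
Hypothesis HX : 0 < X.
Let CF := 205/100/(sg - b) + 2.

Lemma CF_pos : 0 < CF.
Proof. unfold CF. ar. Qed.

Lemma F_line (s t : R) : sg <= s -> Cmod (Ff (s, t)) <= CF*lw t.
Proof.
 intros H. etr; [apply (F_bd b Hb HZ); lra|]. fold (lw t). apply mle_r; [left; apply lw_pos|].
 unfold CF. ar.
Qed.

Lemma hol_FU : hol (fun s => b < fst s) Ff.
Proof. apply hol_Ff. ar. Qed.

Lemma lw_le T : 1 <= T -> lw T <= 81/10*T.
Proof. intros H. unfold lw. rewrite Rabs_pos_eq by lra. note (ln_le_sub1 (5 + T) !!). lra. Qed.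

(** Moves the inversion integral from Re s = 2 to Re s = [sg]. K only has to exist, since every use
    lets T tend to infinity. *)
Lemma inv_sg : X + th <= ln (INR (S N)) -> exists K, 0 <= K /\ forall T z, 1 <= T -> 0 <= z <= X ->
 Cmod (VI (fun s => Ff s*Hk th z s)%C sg (- T) T - RtoC (2*PI*Rz th N z))%C <= K/T.
Proof.
 intros HN. note CF_pos as C0.
 set (K1 := / th*(2*((12 + 16*2)*exp ((X + th)*2))*Dr 2 + 2*(exp (X + th)*(4 + (X + th)*((12 + 16*2)*exp ((X + th)*2)))))).
 set (K2 := CF*(81/10)*(2/th*exp ((X + th)*2))).
 ha I0 : 0 < / th by ar.
 ha K20 : 0 <= K2. { unfold K2. ar. }
 ha P : forall T z, 1 <= T -> 0 <= z <= X -> Cmod (VI (fun s => Ff s*Hk th z s)%C sg (- T) T - RtoC (2*PI*Rz th N z))%C <= (K1 + (2 - sg)*(2*K2))/T.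
 { intros T z HT Hz. note (inversion th 2 X N !! !! HN z T HT Hz) as Iv.
  set (f := fun s : C => (Ff s*Hk th z s)%C) in *.
  ha hf : hol (fun s => b < fst s) f by (apply hol_mult; [apply hol_FU|apply hol_Hk; intros s Hs; apply fst_nz; lra]).
  ha Sd : forall s t : R, sg <= s <= 2 -> Rabs t = T -> Cmod (f (s, t)) <= K2/T.
  { intros s t Hs Ht. unfold f. rewrite Cmod_mult.
   note (F_line s t !!) as F1. note (Hk_le th z X s t T !! Hz !! !! (Cmod_ge_im s t T Ht)) as F2.
   assert (lw t <= 81/10*T). { replace (lw t) with (lw T); [apply lw_le, HT|]. unfold lw. rewrite Ht, Rabs_pos_eq by lra. ar. }
   replace (K2/T) with (CF*(81/10*T)*(2/th*exp ((X + th)*2)/T ^ 2)) by (unfold K2; field; lra).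
   apply mle; try apply Cmod_ge_0; [|ar]. ar. }
  ha Rb : Cmod (VI f 2 (- T) T - VI f sg (- T) T)%C <= (2 - sg)*(2*(K2/T)).
  { apply (rect_hol (fun s => b < fst s) f sg 2 (- T) T ((sg - b)/2)); try lra; [ar|ar|].
   intros s Hs. note (Sd s T Hs ltac:(apply Rabs_pos_eq; lra)). note (Sd s (- T) Hs ltac:(rewrite Rabs_Ropp; apply Rabs_pos_eq; lra)). lra. }
  replace (VI f sg (- T) T - RtoC (2*PI*Rz th N z))%C with ((VI f 2 (- T) T - RtoC (2*PI*Rz th N z)) - (VI f 2 (- T) T - VI f sg (- T) T))%C by ring.
  via Cmod_sub_le. etr; [apply add_le; [exact Iv|exact Rb]|]. right. unfold K1. ar. }
 exists (K1 + (2 - sg)*(2*K2)). split; [|ar].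
 specialize (P 1 0 !! !!). via Cmod_ge_0. via P. ar.
Qed.

(** On Re s = [sg], [Ph1] is the transform of [Rz] and [Ph2] that of its difference quotient [rz]:
    taking the quotient multiplies by s [Eth], which replaces the factor 1/s by a second [Eth]. *)
Definition Ph1 (t : R) : C := (Ff (sg, t)*(Eth th (sg, t)/(sg, t)))%C.
Definition Ph2 (t : R) : C := (Ff (sg, t)*(Eth th (sg, t)*Eth th (sg, t)))%C.

Lemma Ph1_cont t : Ccont Ph1 t.
Proof.
 apply (hol_cont (fun s => b < fst s) (fun s => Ff s*(Eth th s/s))%C sg t); [|ar].
 ha NZ : forall s : C, b < fst s -> s <> 0%C by (intros s Hs; apply fst_nz; lra).
 apply hol_mult; [apply hol_FU|]. apply hol_div; [ar|apply hol_Eth; [lra|ar]|ar].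
Qed.

Lemma Ph2_cont t : Ccont Ph2 t.
Proof.
 apply (hol_cont (fun s => b < fst s) (fun s => Ff s*(Eth th s*Eth th s))%C sg t); [|ar].
 ha NZ : forall s : C, b < fst s -> s <> 0%C by (intros s Hs; apply fst_nz; lra).
 apply hol_mult; [apply hol_FU|]. apply hol_mult; apply hol_Eth; try lra; exact NZ.
Qed.

Lemma sg_nz (t : R) : ((sg, t) : C) <> 0%C.
Proof. apply fst_nz. ar. Qed.

Lemma Ph1_int T : 0 <= T -> RInt (fun t => Cmod (Ph1 t) ^ 2) (- T) T <= CF ^ 2*exp (2*(th*sg))*1700.
Proof.
 intros HT. set (A := exp (th*sg)). replace (exp (2*(th*sg))) with (A ^ 2) by (unfold A; simpl; rewrite Rmult_1_r, <- exp_plus; f_equal; ring).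
 ha hc : forall t, continuous (fun t => lw t ^ 2 * / (5 + Rabs t) ^ 2) t by (intros; apply (cR_mult (fun t => lw t ^ 2)); [ar|apply inv5_cont]).
 mid (RInt (fun t => CF ^ 2*A ^ 2*125*(lw t ^ 2 * / (5 + Rabs t) ^ 2)) (- T) T).
 - apply RInt_mono; [lra|intros; apply cR_sq, Ccont_Cmod, Ph1_cont|ar|].
  intros t _. unfold Ph1. rewrite Cmod_mult, Cmod_div by apply sg_nz.
  note (F_line sg t !!) as F1. destruct (E1_bound th (sg, t) !! ltac:(simpl; lra)) as [E _]. fold (Eth th (sg, t)) in E. simpl fst in E. fold A in E.
  ha N0 : 0 < Cmod (sg, t) by (apply Cmod_gt_0, sg_nz).
  ha Q : / Cmod (sg, t) ^ 2 <= 125 * / (5 + Rabs t) ^ 2.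
  { note (Rabs_pos t). apply (mle_rr ((5 + Rabs t) ^ 2)); [ar|]. rewrite Rmult_assoc, Rinv_l, Rmult_1_r by ar.
   rewrite Rmult_comm. apply div_le; [ar|]. rewrite Cmod_sq. simpl fst. simpl snd. rewrite <- (pow2_abs t). 
   assert (45/100 <= sg) by lra. note (pow2_ge_0 (Rabs t - 5/124)). ar. }
  replace ((Cmod (Ff (sg, t))*(Cmod (Eth th (sg, t))/Cmod (sg, t))) ^ 2) with (Cmod (Ff (sg, t)) ^ 2*(Cmod (Eth th (sg, t)) ^ 2 * / Cmod (sg, t) ^ 2)) by ar.
  replace (CF ^ 2*A ^ 2*125*(lw t ^ 2 * / (5 + Rabs t) ^ 2)) with ((CF*lw t) ^ 2*(A ^ 2*(125 * / (5 + Rabs t) ^ 2))) by ring.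
  apply mle; [ar|ar|ar|].
  apply mle; [ar|ar|ar|ar].
 - rewrite RInt_scalR by ar. note (lw_int T HT).
  ar.
Qed.

Let Q := ln (/ th) + 31/10.

Lemma lw_Q t : lw t <= Q + th*Rabs t.
Proof.
 unfold lw, Q. note (Rabs_pos t). ha I0 : 0 < / th by ar.
 replace (5 + Rabs t) with (/ th*(th*(5 + Rabs t))) by ar. rewrite ln_mult by ar.
 note (ln_le_sub1 (th*(5 + Rabs t)) ltac:(apply mul_pos; lra)). lra.
Qed.

(** Without the factor 1/s only the fourth power of |[Eth]| makes the integral converge. It cuts off
    at |t| about 1/th, so the result is of order (log (1/th))^2/th. With m = th |t|, the majorant
    10/(4 + m^2) is a multiple of a Poisson kernel and integrates to an arctangent. *)
Lemma Ph2_int T : 20 <= Q -> 0 <= T -> RInt (fun t => Cmod (Ph2 t) ^ 2) (- T) T <= CF ^ 2*exp (4*(th*sg))*(Q ^ 2*(5*PI/th)).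
Proof.
 intros HQ HT. set (A := exp (th*sg)). ha A0 : 0 < A by apply exp_pos.
 replace (exp (4*(th*sg))) with (A ^ 4) by (unfold A; simpl; rewrite Rmult_1_r, <- !exp_plus; f_equal; ring).
 set (k := 2/th). ha k0 : 0 < k by (apply div_pos; lra).
 ha hc : forall t, continuous (fun t => k/(k ^ 2 + (t - 0) ^ 2)) t.
 { intros t. eapply cR_der. auto_derive; ar. }
 mid (RInt (fun t => CF ^ 2*A ^ 4*(Q ^ 2*(5/th))*(k/(k ^ 2 + (t - 0) ^ 2))) (- T) T).
 - apply RInt_mono; [lra|intros; apply cR_sq, Ccont_Cmod, Ph2_cont|ar|].
  intros t _. unfold Ph2. rewrite !Cmod_mult.
  note (F_line sg t !!) as F1. destruct (E1_bound th (sg, t) !! ltac:(simpl; lra)) as [E E']. fold (Eth th (sg, t)) in E, E'. simpl fst in E, E'. fold A in E, E'.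
  set (m := th*Rabs t). ha m0 : 0 <= m by (apply mul_nn; [lra|ar]). note (lw_Q t) as LQ. fold m in LQ.
  set (e := Cmod (Eth th (sg, t))) in *. ha e0 : 0 <= e by apply Cmod_ge_0. set (f := Cmod (Ff (sg, t))) in *. ha f0 : 0 <= f by apply Cmod_ge_0.
  note CF_pos as C0.
  ha F2 : f <= CF*(Q + m) by ar.
  replace (CF ^ 2*A ^ 4*(Q ^ 2*(5/th))*(k/(k ^ 2 + (t - 0) ^ 2))) with (CF ^ 2*A ^ 4*(10*Q ^ 2/(4 + m ^ 2))).
  2: { unfold m, k. rewrite Rpow_mult_distr, pow2_abs, Rminus_0_r. note (pow2_ge_0 t). note (pow2_ge_0 (th*t)). ar. }
  ha Qm : Q + m <= Q*(1 + m/20) by nra.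
  replace ((f*(e*e)) ^ 2) with (f ^ 2*e ^ 4) by ring.
  ha f2 : f ^ 2 <= CF ^ 2*(Q ^ 2*(1 + m/20) ^ 2).
  { rewrite <- !Rpow_mult_distr. apply pow_incr. ar. }
  note (pow2_ge_0 m) as mm.
  ha G : e ^ 4*(1 + m/20) ^ 2 <= A ^ 4*(10/(4 + m ^ 2)).
  (* Up to m = 2 the bound |[Eth]| <= A is used, beyond it |[Eth]| <= 2A/m. *)
  { ha A4 : 0 < A ^ 4 by ar. destruct (Rle_dec m 2) as [L|L].
   - assert (e ^ 4 <= A ^ 4) by ar. assert ((1 + m/20) ^ 2 <= 10/(4 + m ^ 2)); [apply le_div; [lra|]; assert (m*m <= 4) by nra; assert ((1 + m/20) ^ 2 <= 121/100) by nra; nra|].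
    apply mle; [ar|ar|ar|ar].
   - ha Em : e <= A*(2/m).
    { via E'. replace (A*(2/m)) with (2*A * / m) by ar. unfold Rdiv. apply mle_l; [lra|].
     apply inv_le; [lra|]. unfold m. apply mle_l; [lra|]. exact (Cmod_snd (sg, t)). }
    ha E4 : e ^ 4 <= A ^ 4*(16/m ^ 4).
    { replace (A ^ 4*(16/m ^ 4)) with ((A*(2/m)) ^ 4) by ar. ar. }
    mid (A ^ 4*(16/m ^ 4)*(1 + m/20) ^ 2); [ar|].
    rewrite Rmult_assoc. apply mle_l; [lra|]. apply le_div; [lra|].
    ha m4 : 0 < m ^ 4 by ar. apply (mle_rr (m ^ 4)); [ar|].
    replace (16/m ^ 4*(1 + m/20) ^ 2*(4 + m ^ 2)*m ^ 4) with (16*(1 + m/20) ^ 2*(4 + m ^ 2)) by ar.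
    assert ((1 + m/20) ^ 2 <= (55/100*m) ^ 2) by ar. ar. }
  mid (CF ^ 2*(Q ^ 2*(1 + m/20) ^ 2)*e ^ 4); [ar|].
  replace (CF ^ 2*(Q ^ 2*(1 + m/20) ^ 2)*e ^ 4) with (CF ^ 2*Q ^ 2*(e ^ 4*(1 + m/20) ^ 2)) by ring.
  replace (CF ^ 2*A ^ 4*(10*Q ^ 2/(4 + m ^ 2))) with (CF ^ 2*Q ^ 2*(A ^ 4*(10/(4 + m ^ 2)))) by ar.
  apply mle_l; ar.
 - rewrite RInt_scalR by ar. rewrite (RI_uniq _ _ _ _ (RInt_atan k 0 (- T) T k0)).
  note (atan_bound ((T - 0)/k)). note (atan_bound ((- T - 0)/k)).
  replace (CF ^ 2*A ^ 4*(Q ^ 2*(5*PI/th))) with (CF ^ 2*A ^ 4*(Q ^ 2*(5/th))*PI) by ar.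
  ar.
Qed.

Lemma L2_R : X + th <= ln (INR (S N)) ->
 RInt (fun z => Rz th N z ^ 2*exp (- 2*sg*z)) 0 X <= exp 1/(2*PI)*(CF ^ 2*exp (2*(th*sg))*1700).
Proof.
 intros HN. destruct (inv_sg HN) as [K [K0 HK]].
 apply (L2_transfer (Rz th N) Ph1 sg X K); try lra; [apply Ph1_cont|ar|intros T HT; apply Ph1_int; lra|].
 intros T z HT Hz. replace (RtoC (exp (sg*z))*CInt (fun t => Ph1 t*cexp (0, (t*z)%R))%C (- T) T)%C with (VI (fun s => Ff s*Hk th z s)%C sg (- T) T); [ar|].
 rewrite <- CInt_scal.
 - apply CInt_ext; [lra|]. intros t _. rewrite (Hk_form th z (sg, t)) by (try lra; apply sg_nz). rewrite cexp_line. unfold Ph1. ring.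
 - apply exCI_cont; [lra|]. intros t _. apply Ccont_mult; [apply Ph1_cont|]. apply (C2_1 (fun _ t => cexp (0, (t*z)%R)) 0). apply (C2_cexp (fun _ t => (0, (t*z)%R))). split; simpl; c2t.
Qed.

End Line.

(** Divided by w = e^z, this is the error of the smoothed density of psi at w; see [qd_rz]. *)
Definition rz (th : R) (N : nat) (z : R) : R := (Rz th N (z + th) - Rz th N z)/th.

Lemma cont_rz th N z : continuous (rz th N) z.
Proof.
 unfold rz, Rdiv. apply cR_mult; [|ar]. apply cR_minus; [|ar].
 apply (cR_comp (Rz th N) (fun z => z + th)); ar.
Qed.

Lemma L2_rho b sg th X N : 45/100 <= b <= 1 -> (forall s, b < fst s -> Zf s <> 0%C) -> b < sg <= 3/2 -> 0 < th <= / 5 -> 0 < X ->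
 X + 2*th <= ln (INR (S N)) -> 20 <= ln (/ th) + 31/10 ->
 RInt (fun z => rz th N z ^ 2*exp (- 2*sg*z)) 0 X <=
  exp 1/(2*PI)*((205/100/(sg - b) + 2) ^ 2*exp (4*(th*sg))*((ln (/ th) + 31/10) ^ 2*(5*PI/th))).
Proof.
 intros Hb HZ Hsg Hth HX HN HQ. destruct (inv_sg b sg th (X + th) N Hb HZ Hsg Hth !! !!) as [K [K0 HK]].
 apply (L2_transfer (rz th N) (Ph2 sg th) sg X (2*K/th)); try lra.
 - apply div_ge0; lra.
 - apply (Ph2_cont b); asm.
 - apply cont_rz.
 - intros T HT. apply (Ph2_int b); try asm; lra.
 - intros T z HT Hz. note (HK T z HT !!) as H0. note (HK T (z + th) HT !!) as H1.
  set (U := fun s : C => b < fst s). ha NZ : forall s : C, U s -> s <> 0%C by (intros s Hs; unfold U in Hs; apply fst_nz; lra).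
  ha hF : forall y, hol U (fun s => Ff s*Hk th y s)%C by (intros y; apply hol_mult; [apply (hol_FU b); asm|apply hol_Hk, NZ]).
  ha HU : forall t, - T <= t <= T -> U (sg, t) by ar.
  ha E : (RtoC (exp (sg*z))*CInt (fun t => Ph2 sg th t*cexp (0, (t*z)%R))%C (- T) T)%C =
   (RtoC (/ th)*(VI (fun s => Ff s*Hk th (z + th) s)%C sg (- T) T - VI (fun s => Ff s*Hk th z s)%C sg (- T) T))%C.
  { rewrite <- (VI_minus U (fun s => Ff s*Hk th (z + th) s)%C (fun s => Ff s*Hk th z s)%C) by ar.
   rewrite <- (VI_scal U (fun s => Ff s*Hk th (z + th) s - Ff s*Hk th z s)%C) by ar.
   rewrite <- CInt_scal.
   - apply CInt_ext; [lra|]. intros t _. ha Ns : ((sg, t) : C) <> 0%C by (apply fst_nz; simpl; lra).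
    rewrite !(Hk_form th _ (sg, t)) by ar.
    ha Cz : cexp ((z + th)%R*(sg, t))%C = (cexp (z*(sg, t))*(1 + th*(sg, t)*Eth th (sg, t)))%C.
    { rewrite RtoC_plus. replace ((z + th)*(sg, t))%C with (z*(sg, t) + th*(sg, t))%C by cring. rewrite cexp_plus. f_equal.
     unfold Eth. set (s := ((sg, t) : C)) in *. field. split; [ar|intros E; injection E; lra]. }
    rewrite Cz, <- Cmult_assoc. rewrite (Cmult_comm (Ph2 sg th t)), Cmult_assoc, <- cexp_line. unfold Ph2. rewrite RtoC_inv by lra.
    set (s := ((sg, t) : C)) in *. generalize (cexp (z*s)%C) (Ff s) (Eth th s). intros c f e. field. split; [ar|intros E; injection E; lra].
   - apply exCI_cont; [lra|]. intros t _. apply Ccont_mult; [apply (Ph2_cont b); asm|]. apply (C2_1 (fun _ t => cexp (0, (t*z)%R)) 0). apply (C2_cexp (fun _ t => (0, (t*z)%R))). split; simpl; c2t. }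
  rewrite E. replace (RtoC (2*PI*rz th N z)) with (RtoC (/ th)*(RtoC (2*PI*Rz th N (z + th)) - RtoC (2*PI*Rz th N z)))%C.
  2: { rewrite <- RtoC_minus, <- RtoC_mult. f_equal. unfold rz. ar. }
  set (V1 := VI (fun s => Ff s*Hk th (z + th) s)%C sg (- T) T) in *. set (V0 := VI (fun s => Ff s*Hk th z s)%C sg (- T) T) in *.
  replace (RtoC (/ th)*(V1 - V0) - RtoC (/ th)*(RtoC (2*PI*Rz th N (z + th)) - RtoC (2*PI*Rz th N z)))%C with
   (RtoC (/ th)*((V1 - RtoC (2*PI*Rz th N (z + th))) - (V0 - RtoC (2*PI*Rz th N z))))%C by ring.
  rewrite Cmod_mult, Cmod_R, Rabs_pos_eq by ar.
  replace (2*K/th/T) with (/ th*(K/T + K/T)) by ar. apply mle_l; [ar|].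
  via Cmod_sub_le. lra.
Qed.

#[export] Hint Resolve cont_rz : ana.

Lemma ln_sq y c d : 0 < y -> 0 < c -> y <= c ^ 2 -> ln c <= d -> ln y <= 2*d.
Proof. intros Hy Hc H1 H2. mid (ln (c ^ 2)); [ar|]. rewrite ln_pow by lra. ar. Qed.

(** * The linear term *)

Lemma Tt_integrand_real k n (a x : R) : (1 <= n)%nat ->
 (RtoC (wt x)*(- RtoC (ln (INR n + x))) ^ k*npw (INR n + x) ((a, 0) + 2))%C = RtoC (wt x*(- ln (INR n + x)) ^ k*rpw (INR n + x) (a + 2)).
Proof.
 intros Hn. replace ((a, 0) + 2)%C with ((a + 2, 0) : C) by ar.
 rewrite npw_real, <- RtoC_opp, <- RtoC_pow, <- !RtoC_mult. ar.
Qed.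

(** On the real axis all integrands are real, and each derivative in s brings a factor -log, so
    [hk 0] and [hk 1] have opposite signs. *)
Lemma hk_sign a : -1 < a -> 0 <= fst (hk 0 (a, 0)) /\ fst (hk 1 (a, 0)) <= 0 /\ snd (hk 0 (a, 0)) = 0 /\ snd (hk 1 (a, 0)) = 0.
Proof.
 intros Ha.
 ha Im : forall k, snd (hk k (a, 0)) = 0.
 { intros k. unfold hk, CSer; cbn [snd]. rewrite (Series_ext _ (fun _ => 0)); [|].
  - apply is_series_unique. apply is_series_Reals. intros eps He. exists 0%nat. intros n _. rewrite sum_eq_R0 by refl. unfold Rdist. rewrite Rminus_0_r, Rabs_R0. exact He.
  - intros n. unfold Tt, CInt. cbn [snd]. rewrite (RInt_ext _ (fun _ => 0)); [rewrite RInt_const; apply Rmult_0_r|]. intros x _. rewrite Tt_integrand_real by lia. ar. }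
 ha Re : forall k n, fst (Tt k (S n) (a, 0)) = RInt (fun x => wt x*(- ln (INR (S n) + x)) ^ k*rpw (INR (S n) + x) (a + 2)) 0 1.
 { intros k n. unfold Tt, CInt. cbn [fst]. apply RInt_ext. intros x _. rewrite Tt_integrand_real by lia. ar. }
 ha ExR : forall k n, ex_RInt (fun x => wt x*(- ln (INR (S n) + x)) ^ k*rpw (INR (S n) + x) (a + 2)) 0 1.
 { intros k n. destruct (Tt_ex k (S n) ltac:(lia) (a, 0)) as [E _]. eapply ex_RInt_ext; [|exact E]. intros x _. cbv beta. rewrite Tt_integrand_real by lia. ar. }
 ha Ln : forall n x, 0 < x < 1 -> 0 <= ln (INR (S n) + x).
 { intros n x Hx. rewrite <- ln_1. apply ln_le; [lra|]. assert (1 <= INR (S n)) by (apply (le_INR 1); lia). lra. }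
 ha ES : forall k, ex_series (fun n => fst (Tt k (S n) (a, 0))) by (intros k; apply exs_fst, hk_ex; exact Ha).
 repeat split; try apply Im.
 - unfold hk, CSer; cbn [fst]. apply (rsum_le_Series (fun n => fst (Tt 0 (S n) (a, 0))) 0); [|ar].
  intros n. rewrite Re. apply RInt_ge_0; [lra|ar|]. intros x Hx. apply mul_nn; [|left; apply rpw_pos]. rewrite pow_O, Rmult_1_r. apply wt_pos; lra.
 - unfold hk, CSer; cbn [fst]. assert (0 <= - Series (fun n => fst (Tt 1 (S n) (a, 0)))); [|lra]. rewrite <- Series_opp.
  apply (rsum_le_Series (fun n => - fst (Tt 1 (S n) (a, 0))) 0).
  + intros n. rewrite Re. enough (RInt (fun x => wt x*(- ln (INR (S n) + x)) ^ 1*rpw (INR (S n) + x) (a + 2)) 0 1 <= 0) by lra.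
   replace 0 with (RInt (fun _ => 0) 0 1) at 2 by (rewrite RInt_const; apply Rmult_0_r). apply RInt_le; [lra|ar|apply ex_RInt_const|].
   intros x Hx. specialize (Ln n x Hx). note (rpw_pos (INR (S n) + x) (a + 2)). assert (0 <= wt x) by (apply wt_pos; lra). rewrite pow_1.
   assert (0 <= wt x*ln (INR (S n) + x)*rpw (INR (S n) + x) (a + 2)) by ar. lra.
  + apply (ex_series_opp (V := RNM)), ES.
Qed.

(** An upper bound for Z'/Z: the term of Z' with [hk 1] has the favourable sign and is dropped, and
    Z >= (a + 1)/2 because [hk 0] is nonnegative. *)
Lemma negF_real a : 1 <= a -> - fst (Ff (a, 0)) <= (1 + (3*a ^ 2 - 1)*((a + 2)/(a + 1))/6)/(a + 1).
Proof.
 intros Ha. destruct (hk_sign a !!) as (h0 & h1 & s0 & s1). note (h0_bound (a, 0) ltac:(simpl; lra)) as B. simpl fst in B.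
 note (Cmod_fst (hk 0 (a, 0))) as B2. rewrite Rabs_pos_eq in B2 by exact h0.
 set (h := fst (hk 0 (a, 0))) in *. set (g := fst (hk 1 (a, 0))) in *.
 ha E0 : hk 0 (a, 0) = RtoC h by (apply pair_eq; simpl; auto). ha E1 : hk 1 (a, 0) = RtoC g by (apply pair_eq; simpl; auto).
 ha Zr : Zf (a, 0) = RtoC (1 + (a - 1)/2 + (a*a*a - a)*h).
 { unfold Zf. rewrite E0. change ((a, 0) : C) with (RtoC a). unfold Rdiv. rewrite RtoC_plus, RtoC_plus, !RtoC_mult, RtoC_minus, RtoC_inv, RtoC_minus, !RtoC_mult by lra. ar. }
 ha Z1r : Z1 (a, 0) = RtoC (/ 2 + ((3*a*a - 1)*h + (a*a*a - a)*g)).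
 { unfold Z1. rewrite E0, E1. change ((a, 0) : C) with (RtoC a). rewrite !RtoC_plus, !RtoC_mult, !RtoC_minus, RtoC_inv, !RtoC_mult by lra. ar. }
 unfold Ff. rewrite Zr, Z1r. set (zz := 1 + (a - 1)/2 + (a*a*a - a)*h).
 ha z1 : (a + 1)/2 <= zz. { unfold zz. assert (0 <= (a*a*a - a)*h) by (apply mul_nn; [nra|lra]). lra. }
 rewrite <- RtoC_div, <- RtoC_opp by lra. unfold RtoC at 1. cbn [fst]. rewrite Ropp_involutive. apply div_le; [lra|].
 set (c := (3*a ^ 2 - 1)*((a + 2)/(a + 1))/6).
 ha Hc : / 2 + ((3*a*a - 1)*h + (a*a*a - a)*g) <= / 2*(1 + c).
 { assert ((a*a*a - a)*g <= 0) by (assert (0 <= a*a*a - a) by nra; nra).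
  assert ((3*a*a - 1)*h <= (3*a*a - 1)*(/ 12*((a + 2)/(a + 1)))) by (apply mle_l; [nra|lra]).
  unfold c. lra. }
 via Hc. assert (0 <= c). { unfold c. assert (0 <= (a + 2)/(a + 1)) by ar. assert (0 <= 3*a ^ 2 - 1) by nra. ar. }
 mid ((1 + c)/(a + 1)*((a + 1)/2)); [right; field; lra|]. ar.
Qed.

(** The single value of P that governs the linear term. A loss of about one percent in the
    exponentials turns this 2.52 into the 2.56 of the final count. *)
Lemma P_real_bound sg : 1/2 <= sg <= 101/100 -> fst (Pp ((2*sg + / 3)%R, 0))/(sg + / 3) <= 252/100.
Proof.
 intros Hs. set (a := 2*sg + / 3). ha Ha : 4/3 <= a <= 2354/1000 by (unfold a; lra).
 replace (sg + / 3) with ((a + / 3)/2) by (unfold a; field).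
 ha E : fst (Pp (a, 0)) = ln (a + 2) - fst (Ff (a, 0)).
 { unfold Pp. change (fst (Clog ((a, 0) + 2) - Ff (a, 0))%C) with (fst (Clog ((a, 0) + 2)%C) - fst (Ff (a, 0))). f_equal.
  rewrite Clog_fst by ar. f_equal. replace ((a, 0) + 2)%C with (RtoC (a + 2)) by ar.
  rewrite Cmod_R, Rabs_pos_eq; lra. }
 rewrite E. note (negF_real a !!) as NF.
 ha L3 : ln (10/3) <= 12095/10000.
 { note (ln_le256 (10/3) (472/100000) !! !! !!). lra. }
 ha LT : ln (a + 2) <= 12095/10000 + 3/10*(a - 4/3).
 { replace (a + 2) with (10/3*(1 + 3/10*(a - 4/3))) by field. rewrite ln_mult by lra. note (ln_le_sub1 (1 + 3/10*(a - 4/3)) !!). lra. }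
 apply div_le; [lra|].
 ha NF2 : (1 + (3*a ^ 2 - 1)*((a + 2)/(a + 1))/6)/(a + 1) <= 871/1000 + 6/10*(a - 4/3).
 { apply div_le; [lra|]. replace ((3*a ^ 2 - 1)*((a + 2)/(a + 1))/6) with ((3*a ^ 2 - 1)*(a + 2)/6/(a + 1)) by ar.
  apply (mle_rr (a + 1)); [lra|]. replace ((1 + (3*a ^ 2 - 1)*(a + 2)/6/(a + 1))*(a + 1)) with (a + 1 + (3*a ^ 2 - 1)*(a + 2)/6) by ar.
  ar. }
 lra.
Qed.

Lemma RInt_sub (f g : R -> R) a b : a <= b -> (forall t, continuous f t) -> (forall t, continuous g t) ->
 RInt (fun t => f t - g t) a b = RInt f a b - RInt g a b.
Proof. intros H A B. apply (RInt_minus (V := RCN)); auto using exR. Qed.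

Lemma Cd_conj (f : C -> C) (s l : C) : Cd f s l -> Cd (fun z => Cconj (f (Cconj z))) (Cconj s) (Cconj l).
Proof.
 intros H eps He. destruct (H eps He) as [d [Hd Hh]]. exists d. split; [ar|]. intros h Hm.
 rewrite <- (Cmod_conj h) in Hm. specialize (Hh (Cconj h) Hm). rewrite Cmod_conj in Hh.
 rewrite Cplus_conj, Cconj_conj. replace (Cconj (f (s + Cconj h)) - Cconj (f s) - Cconj l*h)%C with (Cconj (f (s + Cconj h) - f s - l*Cconj h)%C).
 - rewrite Cmod_conj. exact Hh.
 - ar.
Qed.

Lemma Z1_conj s : -1 < fst s -> Z1 (Cconj s) = Cconj (Z1 s).
Proof.
 intros Hs. apply (Cd_unique Zf (Cconj s)); [apply Zf_Cd; exact Hs|].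
 apply (Cd_ext_loc (fun z => Cconj (Zf (Cconj z))) Zf (Cconj s) _ (1 + fst s)); [lra| |apply Cd_conj, Zf_Cd, Hs].
 intros z Hz. rewrite <- Zf_conj, Cconj_conj; [ar|]. note (Cmod_fst (z - Cconj s)%C) as F. simpl in F. apply abs_btw in F. ar.
Qed.

Lemma Ff_conj s : -1 < fst s -> Zf s <> 0%C -> Ff (Cconj s) = Cconj (Ff s).
Proof. intros Hs HZ. unfold Ff. rewrite Z1_conj, Zf_conj, Copp_conj, Cdiv_conj by asm. ar. Qed.

Lemma Pp_conj s : -1 < fst s -> Zf s <> 0%C -> Pp (Cconj s) = Cconj (Pp s).
Proof.
 intros Hs HZ. unfold Pp. rewrite Cminus_conj, Ff_conj by asm. f_equal.
 unfold Clog. apply pair_eq; simpl.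
 - f_equal. f_equal. ring.
 - rewrite <- atan_opp. f_equal. ar.
Qed.

Lemma le_inv_limit2 y A B : (forall T, 2 <= T -> y <= A + B/T) -> y <= A.
Proof.
 intros H. apply (le_inv_limit y A (B/2)). intros T HT. specialize (H (2*T) !!). replace (B/2/T) with (B/(2*T)) by ar. ar.
Qed.

(** By Cauchy-Schwarz (5 + |t|)^2 <= 401 (1/16 + t^2), and 401 times the bound 13.6 of [lw_int] is
    below 5460. *)
Lemma line_bound (g : C -> C) U r M T : 1/4 <= r -> 0 <= T -> 0 <= M -> hol U g -> (forall t, U (r, t)) ->
 (forall t, Cmod (g (r, t)) <= M*(lw t/Cmod (r, t) ^ 2)) -> Cmod (VI g r (- T) T) <= M*5460.
Proof.
 intros Hr HT HM Hg HU HB.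
 ha hc : forall t, continuous (fun t => lw t ^ 2 * / (5 + Rabs t) ^ 2) t by (intros; apply (cR_mult (fun t => lw t ^ 2)); [ar|apply inv5_cont]).
 mid (RInt (fun t => M*401*(lw t ^ 2 * / (5 + Rabs t) ^ 2)) (- T) T).
 - apply CInt_norm; [lra|apply (hol_exCI U g); [lra|ar|ar]|ar|].
  intros t _. via HB. rewrite Rmult_assoc. apply mle_l; [ar|].
  note (Rabs_pos t) as t0. ha l1 : 1 <= lw t by (unfold lw; assert (0 <= ln (5 + Rabs t)) by (rewrite <- ln_1; apply ln_le; lra); lra).
  ha N0 : 0 < Cmod (r, t) by (apply Cmod_gt_0, fst_nz; simpl; lra).
  mid (lw t ^ 2 * / Cmod (r, t) ^ 2).
  + unfold Rdiv. apply mle_r; [ar|]. simpl. nra.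
  + replace (401*(lw t ^ 2 * / (5 + Rabs t) ^ 2)) with (lw t ^ 2*(401 * / (5 + Rabs t) ^ 2)) by ring. apply mle_l; [ar|].
   apply (mle_rr ((5 + Rabs t) ^ 2)); [ar|]. rewrite Rmult_assoc, Rinv_l, Rmult_1_r by ar.
   rewrite Rmult_comm. apply div_le; [ar|]. rewrite Cmod_sq. simpl fst. simpl snd. rewrite <- (pow2_abs t).
   note (pow2_ge_0 (Rabs t - 5/400)). assert (/ 16 <= r ^ 2) by nra. nra.
 - rewrite RInt_scalR by ar. note (lw_int T HT). nra.
Qed.

Section FirstOrder.
Variables (b sg : R).
Hypothesis Hb : 45/100 <= b <= 1.
Hypothesis HZ : forall s, b < fst s -> Zf s <> 0%C.
Hypothesis Hsg : b < sg <= 3/2.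
Let CF := 205/100/(sg - b) + 2.
Let A := sg + / 3.
Let U (s : C) := b < fst s.

Lemma F_sg (s t : R) : sg <= s -> Cmod (Ff (s, t)) <= CF*lw t.
Proof. apply (F_line b sg Hb HZ Hsg). Qed.

Lemma CF0 : 0 < CF.
Proof. exact (CF_pos b sg Hsg). Qed.

(** With T = tau^2 a logarithm of T is at most linear in tau. So P is O(sqrt T) on the box, and the
    tails in Poisson's formula are O(1/tau). *)
Lemma P_box tau (s t : R) : 1 <= tau -> sg <= s <= sg + tau ^ 2 -> Rabs t <= tau ^ 2 -> Cmod (Pp (s, t)) <= (8 + 10*CF)*tau.
Proof.
 intros H1 Hs Ht. unfold Pp. via Cmod_sub_le. note (Rabs_pos t) as t0. note CF0 as C0.
 ha Q1 : Cmod (Clog ((s, t) + 2)%C) <= 8*tau.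
 { etr; [apply Clog_bound; simpl; lra|]. simpl. rewrite Rplus_0_r.
  assert (ln (s + 2 + Rabs t) <= 2*(2*tau + 1)); [|lra].
  apply (ln_sq _ (2*tau + 2)); [lra|lra|nra|]. note (ln_le_sub1 (2*tau + 2) !!). lra. }
 ha Q2 : lw t <= 91/10*tau.
 { unfold lw. assert (ln (5 + Rabs t) <= 2*(2 + tau)); [|lra]. apply (ln_sq _ (3 + tau)); [lra|lra|nra|]. note (ln_le_sub1 (3 + tau) !!). lra. }
 note (F_sg s t !!) as Q3. ar.
Qed.

(* Poisson's formula at height 0, obtained by moving the line of integration to the right. *)
Lemma poisson tau : 2 <= tau ->
 RInt (fun t => fst (Pp (sg, t))/(A ^ 2 + t ^ 2)) (- tau ^ 2) (tau ^ 2) <= PI/A*fst (Pp ((sg + A)%R, 0)) + 24*(8 + 10*CF)/tau.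
Proof.
 intros Ht. set (T := tau ^ 2). ha HT : 2*tau <= T by (unfold T; nra). ha A0 : 78/100 <= A <= 11/6 by (unfold A; lra).
 set (pa := Pp ((sg + A)%R, 0)). set (a := (((sg + A)%R, 0) : C)).
 set (f := fun s : C => ((Pp s - pa)/((s - a)*(s - ((sg - A)%R, 0))))%C).
 set (V := fun s : C => b < fst s /\ s <> a). set (Cp := 8 + 10*CF). note CF0 as C0.
 ha Nz : forall s, V s -> ((s - a)*(s - ((sg - A)%R, 0)))%C <> 0%C.
 { intros s [H1 H2]. apply Cmult_nz.
  - intros E. apply H2. replace s with ((s - a) + a)%C by ring. rewrite E. ring.
  - apply fst_nz. simpl. unfold A. lra. }
 ha hf : hol V f.
 { unfold f. apply hol_div; [ar|apply hol_minus; [|ar]|].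
  - apply (hol_sub V U); [ar|apply hol_Pp; asm].
  - ar. }
 ha Pb : forall s t : R, sg <= s <= sg + T -> Rabs t <= T -> Cmod (Pp (s, t) - pa)%C <= 2*(Cp*tau).
 { intros s t Hs Htt. via Cmod_sub_le.
  note (P_box tau s t !! Hs Htt). note (P_box tau (sg + A) 0 !! ltac:(fold T; lra) ltac:(rewrite Rabs_R0; fold T; lra)). fold pa in H0. unfold Cp. lra. }
 ha fm : forall s t : R, V (s, t) -> sg <= s <= sg + T -> Rabs t <= T -> forall D, 0 < D -> D <= Cmod (((s, t) - a)*((s, t) - ((sg - A)%R, 0)))%C -> Cmod (f (s, t)) <= 2*(Cp*tau)/D.
 { intros s t HV Hs Htt D HD HD2. unfold f. rewrite Cmod_div by ar. unfold Rdiv. apply mle; [ar|ar|ar|ar]. }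
 ha ae : forall s t : R, ((s, t) - a)%C = ((s - (sg + A))%R, t) /\ ((s, t) - ((sg - A)%R, 0))%C = ((s - (sg - A))%R, t).
 { ar. }
 ha Sd : forall s t : R, sg <= s <= sg + T -> Rabs t = T -> Cmod (f (s, t)) <= 2*(Cp*tau)/T ^ 2.
 { intros s t Hs Htt. apply fm; try lra; [|ar|].
  - split; [ar|]. intros E. unfold a in E. injection E as _ E. rewrite E, Rabs_R0 in Htt. lra.
  - rewrite Cmod_mult. destruct (ae s t) as [-> ->]. simpl. rewrite Rmult_1_r. apply mle; try lra; apply Cmod_ge_im, Htt. }
 destruct (quot_bounded Pp (sg + A) 0 (Pd ((sg + A)%R, 0)) (Pp_Cd b Hb HZ ((sg + A)%R, 0) ltac:(simpl; lra))) as [r [K [Hr HK]]]. fold pa in HK.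
 ha R1 : Cmod (VI f (sg + T) (- T) T - VI f sg (- T) T)%C <= (sg + T - sg)*(2*(2*(Cp*tau)/T ^ 2)).
 { apply (rect_sing V f sg (sg + T) (- T) T (sg - b) (sg + A) 0 (Rmin r (sg/2)) (K*(2/sg))); try lra.
  - apply Rmin_pos; lra.
  - intros s t Hs _ N. split; ar.
  - exact hf.
  - intros s t H1 H2 N. rmins. unfold f. ha Q : Rabs (s - (sg + A)) < sg/2 by lra. apply Rabs_lt_between in Q.
   rewrite Cmod_div by (apply Nz; split; ar).
   rewrite Cmod_mult. 
   ha N1 : ((s, t) - a)%C <> 0%C. { intros E. apply N. fold a. replace ((s, t) : C) with (((s, t) - a) + a)%C by cring. rewrite E. ring. }
   ha N2 : sg/2 <= Cmod ((s, t) - ((sg - A)%R, 0))%C.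
   { destruct (ae s t) as [_ ->]. etr; [|apply Cmod_ge_re]. rewrite Rabs_pos_eq; unfold A in *; lra. }
   specialize (HK s t !! !! N). fold a in HK. rewrite Cmod_div in HK by exact N1. ha P1 : 0 < Cmod ((s, t) - a)%C by (apply Cmod_gt_0, N1).
   replace (Cmod (Pp (s, t) - pa)%C/(Cmod ((s, t) - a)%C*Cmod ((s, t) - ((sg - A)%R, 0))%C)) with (Cmod (Pp (s, t) - pa)%C/Cmod ((s, t) - a)%C * / Cmod ((s, t) - ((sg - A)%R, 0))%C) by ar.
   apply mle; [ar|ar|ar|].
   replace (2/sg) with (/ (sg/2)) by ar. apply inv_le; lra.
  - intros s Hs. note (Sd s T Hs ltac:(apply Rabs_pos_eq; lra)). note (Sd s (- T) Hs ltac:(rewrite Rabs_Ropp; apply Rabs_pos_eq; lra)). lra. }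
 ha NT : forall t : R, V ((sg + T)%R, t). { intros t. split; [ar|]. intros E. unfold a in E. injection E as E. ar. }
 ha Ns : forall t : R, V (sg, t). { intros t. split; [ar|]. intros E. unfold a in E. injection E as E. lra. }
 ha R2 : Cmod (VI f (sg + T) (- T) T) <= (T - - T)*(2*(Cp*tau)/(T ^ 2/2)).
 { apply (VI_norm_const V f); [lra|ar|ar|]. intros t Htt. apply fm; [ar|lra|apply Rabs_le; lra|ar|].
  rewrite Cmod_mult. destruct (ae (sg + T) t) as [-> ->].
  assert (T/2 <= Cmod ((sg + T - (sg + A))%R, t)). { etr; [|apply Cmod_ge_re]. rewrite Rabs_pos_eq; nra. }
  assert (T <= Cmod ((sg + T - (sg - A))%R, t)). { etr; [|apply Cmod_ge_re]. rewrite Rabs_pos_eq; nra. }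
  nra. }
 ha B : Cmod (VI f sg (- T) T) <= 24*Cp/tau.
 { replace (VI f sg (- T) T) with (VI f (sg + T) (- T) T - (VI f (sg + T) (- T) T - VI f sg (- T) T))%C by ring.
  via Cmod_sub_le. etr; [apply add_le; [exact R2|exact R1]|].
  unfold T. replace ((tau ^ 2 - - tau ^ 2)*(2*(Cp*tau)/((tau ^ 2) ^ 2/2)) + (sg + tau ^ 2 - sg)*(2*(2*(Cp*tau)/(tau ^ 2) ^ 2))) with (12*Cp/tau) by ar.
  unfold Rdiv. apply mle_r; [ar|]. unfold Cp. lra. }
 ha Ap : 0 < A by lra.
 ha E : fst (VI f sg (- T) T) = RInt (fun t => fst pa*(/ A*(A/(A ^ 2 + (t - 0) ^ 2))) - fst (Pp (sg, t))/(A ^ 2 + t ^ 2)) (- T) T.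
 { unfold VI, CInt. cbn [fst]. apply RInt_eq. intros t. unfold f. destruct (ae sg t) as [-> ->].
  replace (((sg - (sg + A))%R, t)*((sg - (sg - A))%R, t))%C with (RtoC (- (A ^ 2 + t ^ 2))) by ar.
  note (sumsq_pos A t Ap) as Q. unfold Cdiv. rewrite <- RtoC_inv by lra. generalize (Pp (sg, t)) pa. intros u v.
  rewrite Rminus_0_r. simpl. ar. }
 ha c1 : forall t, continuous (fun t => A/(A ^ 2 + (t - 0) ^ 2)) t.
 { intros t. eapply cR_der. auto_derive; ar. }
 ha c3 : forall t, continuous (fun t => fst (Pp (sg, t))/(A ^ 2 + t ^ 2)) t.
 { intros t. unfold Rdiv. apply cR_mult; [apply (hol_cont U Pp sg t); [apply hol_Pp; asm|ar]|].
  eapply cR_der. auto_derive; ar. }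
 rewrite (RInt_sub (fun t => fst pa*(/ A*(A/(A ^ 2 + (t - 0) ^ 2))))) in E; [|lra|intros; apply cR_mult; [ar|apply cR_mult; ar]|ar].
 rewrite !RInt_scalR in E by (apply exR; [lra|first [exact c1|intros; apply cR_mult; ar]]).
 rewrite (RI_uniq _ _ _ _ (RInt_atan A 0 (- T) T Ap)) in E.
 note (atan_bound ((T - 0)/A)) as B1'. note (atan_bound ((- T - 0)/A)) as B2'.
 note (Cmod_fst (VI f sg (- T) T)) as Fs. apply abs_btw in Fs. rewrite E in Fs.
 ha P0 : 0 <= fst pa by (apply (ReP_pos b Hb HZ); simpl; lra).
 set (at2 := atan ((T - 0)/A) - atan ((- T - 0)/A)) in *.
 assert (fst pa*(/ A*at2) <= PI/A*fst pa).
 { replace (PI/A*fst pa) with (fst pa*(/ A*PI)) by ar. apply mle_l; [ar|]. apply mle_l; [ar|unfold at2; lra]. }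
 ar.
Qed.
End FirstOrder.

Section FirstOrderBound.
Variables (b sg th y : R) (N : nat).
Hypothesis Hb : 45/100 <= b <= 1.
Hypothesis HZ : forall s, b < fst s -> Zf s <> 0%C.
Hypothesis Hsg : b < sg <= 3/2.
Hypothesis Hth : 0 < th <= / 5.
Hypothesis Hy : 0 < y.
Hypothesis HN : y + th <= ln (INR (S N)).
Let CF := 205/100/(sg - b) + 2.
Let A := sg + / 3.
Let I : R := RInt (fun z => Rz th N z*exp z) 0 y.
(** Integrating e^z [Hk th z s] over 0 <= z <= y gives k - k0, by [k_split]. The upper limit k
    carries the size e^{y (Re s + 1)}; k0 is the contribution of the lower limit. *)
Let k0 (s : C) : C := (Eth th s/(s*(s + 1)))%C.
Let k (s : C) : C := (cexp (y*(s + 1))*k0 s)%C.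

Lemma k_split (s : C) : 0 < fst s -> (CInt (fun z : R => RtoC (exp z)*Hk th z s) 0 y = k s - k0 s)%C.
Proof.
 intros Hs. ha N0 : s <> 0%C by (apply re_pos_nz, Hs). ha N1 : (s + 1)%C <> 0%C by (apply re_pos_nz; simpl; lra).
 ha E : forall z : R, (RtoC (exp z)*Hk th z s)%C = (Eth th s/s*cexp (z*(s + 1)))%C.
 { intros z. rewrite Hk_form by ar. replace (z*(s + 1))%C with (RtoC z + z*s)%C by ring. rewrite cexp_plus, cexp_RtoC. ring. }
 rewrite (Rd_FTC (fun z : R => (k0 s*cexp (z*(s + 1)))%C)).
 - unfold k. replace (RtoC 0*(s + 1))%C with (RtoC 0) by ring. rewrite cexp_RtoC, exp_0. ring.
 - lra.
 - intros z _. rewrite E. eapply Rd_eq; [|apply Rd_mult; [apply Rd_const|apply (Rd_comp cexp (fun y => y*(s + 1))%C z); [apply Cd_cexp|apply Rd_ray]]].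
  cbv beta. unfold k0. field. auto.
 - intros z _. apply (Ccont_ext (fun z : R => (Eth th s/s*cexp (z*(s + 1)))%C)); [ar|].
  apply Ccont_mult; [ar|]. eapply Rd_Ccont. apply (Rd_comp cexp (fun y => y*(s + 1))%C z); [apply Cd_cexp|apply Rd_ray].
Qed.

Lemma I_formula : exists K, forall T, 1 <= T -> Cmod (VI (fun s => Ff s*(k s - k0 s))%C sg (- T) T - RtoC (2*PI*I))%C <= K/T.
Proof.
 destruct (inv_sg b sg th y N Hb HZ Hsg Hth Hy HN) as [K [K0 HK]]. exists (y*(exp y*K)). intros T HT.
 set (g := fun t z : R => (Ph1 sg th t*(RtoC (exp z)*cexp (z*(sg, t))))%C).
 ha Hg : C2 g.
 { unfold g. apply (C2_mult (fun t z => Ph1 sg th t)); [apply C2_x; intros; apply (Ph1_cont b); asm|].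
  apply (C2_mult (fun t z => RtoC (exp z))); [apply (C2_y (fun z => RtoC (exp z))); intros; apply Ccont_R, cont_exp|].
  apply (C2_cexp (fun t z => RtoC z*(sg, t))%C). apply (C2_mult (fun t z => RtoC z) (fun t z => (sg, t))); [apply (C2_y RtoC); intros; apply Ccont_R, cont_id|apply C2_x; intros; apply Ccont_Im]. }
 ha Ge : forall t z, g t z = (RtoC (exp z)*(Ff (sg, t)*Hk th z (sg, t)))%C.
 { intros t z. rewrite (Hk_form th z (sg, t)) by (try lra; apply fst_nz; simpl; lra). unfold g, Ph1. ring. }
 ha hF : forall z, exCI (fun t => Ff (sg, t)*Hk th z (sg, t))%C (- T) T.
 { intros z. apply (hol_exCI (fun s => b < fst s) (fun s => Ff s*Hk th z s)%C); [lra|apply hol_mult; [apply (hol_FU b); asm|apply hol_Hk; intros s Hs; apply fst_nz; lra]|ar]. }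
 ha E : VI (fun s => Ff s*(k s - k0 s))%C sg (- T) T = CInt (fun z => RtoC (exp z)*VI (fun s => Ff s*Hk th z s)%C sg (- T) T)%C 0 y.
 { transitivity (CInt (fun t => CInt (fun z => g t z) 0 y) (- T) T).
  - apply CInt_ext; [lra|]. intros t _. rewrite (CInt_ext (fun z => g t z) (fun z => Ff (sg, t)*(RtoC (exp z)*Hk th z (sg, t)))%C) by (try lra; intros; rewrite Ge; ring).
   rewrite CInt_scal, k_split; [ar|ar|]. apply exCI_cont; [lra|]. intros z _.
   apply (Ccont_ext (fun z : R => (RtoC (exp z)*(cexp (z*(sg, t))*(Eth th (sg, t)/(sg, t))))%C)).
   + intros u. rewrite (Hk_form th u (sg, t)) by (try lra; apply fst_nz; simpl; lra). refl.
   + apply Ccont_mult; [apply Ccont_R, cont_exp|]. apply Ccont_mult; [|ar]. eapply Rd_Ccont. apply (Rd_comp cexp (fun y => y*(sg, t))%C z); [apply Cd_cexp|apply Rd_ray].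
  - rewrite CInt_fubini by ar. apply CInt_ext; [lra|]. intros z _. unfold VI. rewrite <- CInt_scal by apply hF.
   apply CInt_ext; [lra|]. ar. }
 ha Cv : forall z, Ccont (fun z => RtoC (exp z)*VI (fun s => Ff s*Hk th z s)%C sg (- T) T)%C z.
 { intros z. apply (Ccont_ext (fun z => CInt (fun t => g t z) (- T) T)); [|apply C2_CInt; [lra|ar]].
  intros u. unfold VI. rewrite <- CInt_scal by apply hF. apply CInt_ext; [lra|]. ar. }
 ha Cr : forall z, Ccont (fun z => RtoC (2*PI*(Rz th N z*exp z))) z.
 { intros z. apply Ccont_R. apply cR_mult; [ar|]. apply cR_mult; ar. }
 ha M : RtoC (2*PI*I) = CInt (fun z => RtoC (2*PI*(Rz th N z*exp z))) 0 y.
 { unfold CInt, RtoC; simpl. f_equal.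
  - symmetry. apply RInt_scalR, exR; [lra|]. intros z. apply cR_mult; ar.
  - rewrite RInt_const. symmetry. apply Rmult_0_r. }
 rewrite E, M, <- CInt_minus by (apply exCI_cont; [lra|auto]).
 replace (y*(exp y*K)/T) with ((y - 0)*(exp y*(K/T))) by ar.
 apply CInt_norm_const; [lra|apply exCI_cont; [lra|intros; apply Ccont_minus; auto]|]. intros z Hz.
 replace (RtoC (2*PI*(Rz th N z*exp z))) with (RtoC (exp z)*RtoC (2*PI*Rz th N z))%C by ar.
 match goal with |- Cmod ?e <= _ => replace e with (RtoC (exp z)*(VI (fun s => Ff s*Hk th z s)%C sg (- T) T - RtoC (2*PI*Rz th N z)))%C by ring end.
 rewrite Cmod_mult, Cmod_R, Rabs_pos_eq by ar.
 apply mle; [ar|ar|ar|ar].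
Qed.

Lemma k0_bd (r t : R) : 0 < r <= 3/2 -> Cmod (k0 (r, t)) <= exp (th*r)/(Cmod (r, t)*Cmod ((r + 1)%R, t)) /\ Cmod (k0 (r, t)) <= exp (th*r)/Cmod (r, t) ^ 2.
Proof.
 intros Hr. ha N0 : ((r, t) : C) <> 0%C by (apply fst_nz; simpl; lra).
 ha E : ((r, t) + 1)%C = ((r + 1)%R, t) by ar.
 ha N1 : (((r + 1)%R, t) : C) <> 0%C by (apply fst_nz; simpl; lra).
 destruct (E1_bound th (r, t) !! ltac:(simpl; lra)) as [B _]. fold (Eth th (r, t)) in B. simpl fst in B.
 ha P0 : 0 < Cmod (r, t) by (apply Cmod_gt_0, N0). ha P1 : 0 < Cmod ((r + 1)%R, t) by (apply Cmod_gt_0, N1).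
 ha M : Cmod (r, t) <= Cmod ((r + 1)%R, t) by (apply Cmod_pair_le; rewrite Rabs_pos_eq; lra).
 ha Q : Cmod (k0 (r, t)) <= exp (th*r)/(Cmod (r, t)*Cmod ((r + 1)%R, t)).
 { unfold k0. rewrite Cmod_div by (rewrite E; apply Cmult_nz; asm). rewrite Cmod_mult, E. ar. }
 split; [ar|]. via Q. apply mle_l; [ar|]. apply inv_le; [ar|]. ar.
Qed.

Lemma k_mod (s : C) : Cmod (k s) = exp (y*(fst s + 1))*Cmod (k0 s).
Proof. unfold k. rewrite Cmod_mult, cexp_zs_mod. ar. Qed.

Lemma hol_k0 (V : C -> Prop) : (forall s, V s -> 0 < fst s) -> hol V k0.
Proof.
 intros H. ha NZ : forall s, V s -> s <> 0%C by (intros s Hs; apply re_pos_nz, H, Hs).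
 unfold k0. apply hol_div; [|apply hol_Eth; [lra|ar]|ar].
 intros s Hs. specialize (H s Hs). apply Cmult_nz; apply re_pos_nz; simpl; lra.
Qed.

Lemma hol_k (V : C -> Prop) : (forall s, V s -> 0 < fst s) -> hol V k.
Proof.
 intros H. unfold k. apply hol_mult; [|apply hol_k0, H].
 apply (hol_comp V (fun _ => True) cexp (fun s => y*(s + 1))%C); [auto|ar|]. ar.
Qed.

(** For a factor g that extends to the left of the line: its contribution drops to e^{y (r + 1)},
    where absolute values and a large constant are affordable. *)
Lemma shift_left (V : C -> Prop) (g : C -> C) r c M M' T : 1 <= T -> 1/4 <= r <= c -> c <= 3/2 -> 0 <= M -> 0 <= M' -> hol V g -> (exists e, 0 < e /\ forall s t, r - e < s < c + e -> V (s, t)) ->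
 (forall s, V s -> 0 < fst s) -> (forall s t, r <= s <= c -> Cmod (g (s, t)) <= M*lw t) -> (forall t, Cmod (g (r, t)) <= M'*lw t) ->
 Cmod (VI (fun s => g s*k s)%C c (- T) T) <= M'*(exp (th*r)*exp (y*(r + 1)))*5460 + 2*(2*(M*(81/10)*(exp (th*(3/2))*exp (y*(5/2)))))/T.
Proof.
 intros HT Hr Hc HM HM' hg [e [He HV]] HVp HB HB'.
 ha hk : hol V (fun s => g s*k s)%C by (apply hol_mult; [ar|apply hol_k, HVp]).
 set (E := M*(81/10)*(exp (th*(3/2))*exp (y*(5/2)))).
 ha E0 : 0 <= E. { unfold E. ar. }
 ha Sd : forall s t : R, r <= s <= c -> Rabs t = T -> Cmod (g (s, t)*k (s, t))%C <= E/T.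
 { intros s t Hs Ht. rewrite Cmod_mult, k_mod. simpl fst. destruct (k0_bd s t !!) as [_ B].
  ha L : lw t <= 81/10*T. { replace (lw t) with (lw T); [apply lw_le, HT|]. unfold lw. rewrite Ht, Rabs_pos_eq by lra. ar. }
  replace (E/T) with (M*(81/10*T)*(exp (y*(5/2))*(exp (th*(3/2))/T ^ 2))) by (unfold E; field; lra).
  apply mle; [ar|ar| |].
  - etr; [apply HB; lra|]. apply mle_l; lra.
  - apply mle; [ar|ar|ar|]. via B.
   unfold Rdiv. apply mle; [ar|left; apply inv_pos, pow_lt, Cmod_gt_0, fst_nz; simpl; lra|ar|].
   apply inv_sq_le; [lra|apply Cmod_ge_im, Ht]. }
 ha R1 : Cmod (VI (fun s => g s*k s)%C c (- T) T - VI (fun s => g s*k s)%C r (- T) T)%C <= (c - r)*(2*(E/T)).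
 { apply (rect_hol V (fun s => g s*k s)%C r c (- T) T e); try lra; [ar|ar|].
  intros s Hs. note (Sd s T Hs ltac:(apply Rabs_pos_eq; lra)). note (Sd s (- T) Hs ltac:(rewrite Rabs_Ropp; apply Rabs_pos_eq; lra)). lra. }
 ha R2 : Cmod (VI (fun s => g s*k s)%C r (- T) T) <= M'*(exp (th*r)*exp (y*(r + 1)))*5460.
 { apply (line_bound (fun s => g s*k s)%C V); [lra|lra|ar|ar|ar|].
  intros t. rewrite Cmod_mult, k_mod. simpl fst. destruct (k0_bd r t !!) as [_ B].
  replace (M'*(exp (th*r)*exp (y*(r + 1)))*(lw t/Cmod (r, t) ^ 2)) with (M'*lw t*(exp (y*(r + 1))*(exp (th*r)/Cmod (r, t) ^ 2))) by ar.
  apply mle; [ar|ar|ar|]. ar. }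
 replace (VI (fun s => g s*k s)%C c (- T) T) with ((VI (fun s => g s*k s)%C c (- T) T - VI (fun s => g s*k s)%C r (- T) T) + VI (fun s => g s*k s)%C r (- T) T)%C by ring.
 via Cmod_triangle. rewrite Rplus_comm. apply add_le; [ar|]. via R1.
 replace (2*(2*E)/T) with (2*(2*(E/T))) by ar. ar.
Qed.

(** On Re s = [sg] write F = log(s + 2) - 2 Re P + conj P. There conj P(s) equals P(2 sg - s), which
    is holomorphic to the left, so it is moved to Re s = sg - 1/5 and the logarithm to Re s = 1/4.
    Only 2 Re P stays on the line; it is nonnegative, so taking absolute values loses nothing and
    [poisson] bounds its integral without a logarithm. *)
Lemma first_order : Rabs I <= exp (th*sg)*exp (y*(sg + 1))*(fst (Pp ((2*sg + / 3)%R, 0))/A)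
 + 5460*exp (2*th)*(exp (y*(5/4)) + 14*exp (y*(sg + 4/5)) + CF).
Proof.
 destruct I_formula as [K HK]. note PI_RGT_0 as P0. note PI2_3_2 as P32.
 ha C0 : 0 < CF by exact (CF_pos b sg Hsg). ha A0 : 0 < A by (unfold A; lra).
 set (Ey := exp (th*sg)*exp (y*(sg + 1))). ha Ey0 : 0 < Ey by (apply mul_pos; apply exp_pos).
 set (pa := fst (Pp ((2*sg + / 3)%R, 0))).
 set (E2 := exp (th*(3/2))*exp (y*(5/2))).
 set (Sm := 5460*exp (2*th)*(exp (y*(5/4)) + 14*exp (y*(sg + 4/5)) + CF)).
 ha eth : forall r, r <= 2 -> exp (th*r) <= exp (2*th) by (intros; apply exp_le; nra).
 enough (Q : 2*PI*Rabs I <= 2*(Ey*(PI/A*pa)) + Sm).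
 { apply (mle_rl (2*PI)); [lra|]. via Q.
  assert (0 <= Sm). { unfold Sm. ar. }
  ar. }
 apply (le_inv_limit2 _ _ (Rabs K + 2*Ey*(24*(8 + 10*CF)) + 2*(2*(1*(81/10)*E2)) + 2*(2*((1 + CF)*(81/10)*E2)))). intros tau Ht.
 set (T := tau ^ 2). ha HT : 1 <= T /\ tau <= T by (unfold T; split; nra). destruct HT as [HT1 HT2].
 set (V := fun s : C => b < fst s). set (W := fun s : C => 0 < fst s < 2*sg - b).
 set (Pc := fun s : C => Pp (RtoC (2*sg) + (-1)*s)%C).
 ha arg : forall s t : R, (RtoC (2*sg) + (-1)*(s, t))%C = ((2*sg - s)%R, (- t)%R) by ar.
 ha hPc : hol W Pc.
 { apply (hol_affine W V Pp); [|apply hol_Pp; asm]. intros [s t] Hs. unfold W, V in *. rewrite arg. simpl in *. lra. }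
 set (Lg := fun s : C => Clog (s + 2)%C).
 ha hLg : hol (fun s => 0 < fst s) Lg.
 { apply (hol_comp _ (fun s => 0 < fst s) Clog (fun z => z + 2)%C); [ar|apply hol_Clog|ar]. }
 ha Lgb : forall s t : R, 0 <= s <= 5/2 -> Cmod (Lg (s, t)) <= 1*lw t.
 { intros s t Hs. unfold Lg. etr; [apply Clog_bound; simpl; lra|]. simpl. unfold lw. rewrite Rmult_1_l, Rplus_0_r.
  ar. }
 assert (S1 := shift_left (fun s => 0 < fst s) Lg (1/4) sg 1 1 T HT1 !! !! !! !! hLg
  ltac:(exists (1/8); split; [lra|ar]) ltac:(auto) ltac:(intros; apply Lgb; lra) ltac:(intros; apply Lgb; lra)).
 ha lwo : forall t, lw (- t) = lw t by (intros; unfold lw; rewrite Rabs_Ropp; refl).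
 assert (S2 := shift_left W Pc (sg - 1/5) sg (1 + CF) 14 T HT1 !! !! !! !! hPc
  ltac:(exists (Rmin (1/8) (sg - b)); split; [apply Rmin_pos; lra|intros s t Hs; assert (Q1 := Rmin_l (1/8) (sg - b)); assert (Q2 := Rmin_r (1/8) (sg - b)); unfold W; simpl; lra])
  ltac:(intros s Hs; unfold W in Hs; lra)
  ltac:(intros s t Hs; unfold Pc, Pp; rewrite arg; via Cmod_sub_le; rewrite Rmult_plus_distr_r; rewrite <- (lwo t); apply add_le; [apply Lgb; lra|apply (F_line b sg Hb HZ Hsg); lra])
  ltac:(intros t; unfold Pc, Pp; rewrite arg; via Cmod_sub_le; replace (14*lw t) with (1*lw (- t) + 13*lw (- t)) by (rewrite lwo; ring); apply add_le; [apply Lgb; lra|];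
   etr; [apply (F_bd b Hb HZ); lra|]; apply mle_r; [left; apply lw_pos|]; replace (2*sg - (sg - 1/5) - b) with (/ 5 + (sg - b)) by field;
   ha Q1 : 205/100/(/ 5 + (sg - b)) <= 11 by (apply div_le; lra); lra)).
 ha S3 : Cmod (VI (fun s => Ff s*k0 s)%C sg (- T) T) <= CF*exp (th*sg)*5460.
 { apply (line_bound (fun s => Ff s*k0 s)%C V); [lra|lra|ar| |ar|].
  - apply hol_mult; [apply (hol_FU b); asm|apply hol_k0; intros s Hs; unfold V in Hs; lra].
  - intros t. rewrite Cmod_mult. destruct (k0_bd sg t !!) as [_ B].
   replace (CF*exp (th*sg)*(lw t/Cmod (sg, t) ^ 2)) with (CF*lw t*(exp (th*sg)/Cmod (sg, t) ^ 2)) by ar.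
   apply mle; [ar|ar|apply (F_line b sg Hb HZ Hsg); lra|ar]. }
 ha cP : forall t, Ccont (fun t => RtoC (2*fst (Pp (sg, t)))*k (sg, t))%C t.
 { intros t. apply Ccont_mult; [apply Ccont_R, cR_mult; [ar|apply (hol_cont V Pp sg t); [apply hol_Pp; asm|ar]]|].
  apply (hol_cont V k sg t); [apply hol_k; intros s Hs; unfold V in Hs; lra|ar]. }
 ha c3 : forall t, continuous (fun t => fst (Pp (sg, t))/(A ^ 2 + t ^ 2)) t.
 { intros t. unfold Rdiv. apply cR_mult; [apply (hol_cont V Pp sg t); [apply hol_Pp; asm|ar]|].
  eapply cR_der. auto_derive; ar. }
 ha S4 : Cmod (CInt (fun t => RtoC (2*fst (Pp (sg, t)))*k (sg, t))%C (- T) T) <= 2*Ey*(PI/A*pa + 24*(8 + 10*CF)/tau).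
 { note (poisson b sg Hb HZ Hsg tau Ht) as Po. fold A CF T in Po. replace (sg + A) with (2*sg + / 3) in Po by (unfold A; ring). fold pa in Po.
  mid (RInt (fun t => 2*Ey*(fst (Pp (sg, t))/(A ^ 2 + t ^ 2))) (- T) T).
  - apply CInt_norm; [lra|apply exCI_cont; [lra|auto]|apply exR; [lra|intros; apply cR_mult; ar]|].
   intros t _. ha p0 : 0 <= fst (Pp (sg, t)) by (apply (ReP_pos b Hb HZ); simpl; lra).
   rewrite Cmod_mult, Cmod_R, Rabs_pos_eq, k_mod by lra. change (fst (sg, t)) with sg. destruct (k0_bd sg t !!) as [B _].
   replace (2*Ey*(fst (Pp (sg, t))/(A ^ 2 + t ^ 2))) with (2*fst (Pp (sg, t))*(exp (y*(sg + 1))*(exp (th*sg)/(A ^ 2 + t ^ 2)))) by (unfold Ey, Rdiv; ring).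
   apply mle_l; [lra|]. apply mle_l; [ar|]. via B. apply mle_l; [ar|].
   (* |s| |s + 1| >= A^2 + t^2 on the line: this is what A = sg + 1/3 is chosen for, and it turns
      the weight into a Poisson kernel. *)
   apply inv_le; [ar|]. apply Rsqr_incr_0; [|ar|ar].
   rewrite Rsqr_mult, !Rsqr_pow2, !Cmod_sq. simpl fst. simpl snd. unfold A.
   ha u : 0 <= t ^ 2 by apply pow2_ge_0. set (w := t ^ 2) in *. 
   replace ((sg ^ 2 + w)*((sg + 1) ^ 2 + w)) with (((sg + / 3) ^ 2 + w) ^ 2 + (w*(2*sg/3 + 7/9) + ((sg ^ 2 + sg) ^ 2 - ((sg + / 3) ^ 2) ^ 2))) by field.
   assert (0 <= w*(2*sg/3 + 7/9)) by ar. assert (((sg + / 3) ^ 2) ^ 2 <= (sg ^ 2 + sg) ^ 2) by ar. lra.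
  - rewrite RInt_scalR by ar. ar. }
 ha E : VI (fun s => Ff s*(k s - k0 s))%C sg (- T) T = (VI (fun s => Lg s*k s)%C sg (- T) T - CInt (fun t => RtoC (2*fst (Pp (sg, t)))*k (sg, t))%C (- T) T
  + VI (fun s => Pc s*k s)%C sg (- T) T - VI (fun s => Ff s*k0 s)%C sg (- T) T)%C.
 { ha X1 : exCI (fun t => Lg (sg, t)*k (sg, t))%C (- T) T by (apply (hol_exCI (fun s => 0 < fst s) (fun s => Lg s*k s)%C); [lra|apply hol_mult; [ar|apply hol_k; auto]|ar]).
  ha X2 : exCI (fun t => Pc (sg, t)*k (sg, t))%C (- T) T by (apply (hol_exCI W (fun s => Pc s*k s)%C); [lra|apply hol_mult; [ar|apply hol_k; intros s Hs; unfold W in Hs; lra]|intros; unfold W; simpl; lra]).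
  ha X3 : exCI (fun t => Ff (sg, t)*k0 (sg, t))%C (- T) T by (apply (hol_exCI V (fun s => Ff s*k0 s)%C); [lra|apply hol_mult; [apply (hol_FU b); asm|apply hol_k0; intros s Hs; unfold V in Hs; lra]|ar]).
  ha X4 : exCI (fun t => RtoC (2*fst (Pp (sg, t)))*k (sg, t))%C (- T) T by (apply exCI_cont; [lra|auto]).
  unfold VI. rewrite <- CInt_minus, <- CInt_plus, <- CInt_minus; try asm.
  - apply CInt_ext; [lra|]. intros t _.
   ha Pe : Pc (sg, t) = Cconj (Pp (sg, t)).
   { unfold Pc. rewrite arg. replace (2*sg - sg) with sg by ring. change (sg, (- t)%R) with (Cconj (sg, t)). apply Pp_conj; [ar|apply HZ; simpl; lra]. }
   rewrite Pe. replace (Ff (sg, t)) with (Lg (sg, t) - Pp (sg, t))%C by ar.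
   replace (RtoC (2*fst (Pp (sg, t)))) with (Pp (sg, t) + Cconj (Pp (sg, t)))%C by ar. ring.
  - apply exCI_plus; [|ar]. unfold Cminus. apply exCI_plus; [ar|apply exCI_opp; asm].
  - unfold Cminus. apply exCI_plus; [ar|apply exCI_opp; asm]. }
 specialize (HK T HT1). rewrite E in HK.
 set (v1 := VI (fun s => Lg s*k s)%C sg (- T) T) in *. set (v2 := CInt (fun t => RtoC (2*fst (Pp (sg, t)))*k (sg, t))%C (- T) T) in *.
 set (v3 := VI (fun s => Pc s*k s)%C sg (- T) T) in *. set (v4 := VI (fun s => Ff s*k0 s)%C sg (- T) T) in *.
 ha B : 2*PI*Rabs I <= Cmod v1 + Cmod v2 + Cmod v3 + Cmod v4 + K/T.
 { replace (2*PI*Rabs I) with (Cmod (RtoC (2*PI*I))) by (rewrite Cmod_R, !Rabs_mult, (Rabs_pos_eq 2), (Rabs_pos_eq PI) by lra; refl).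
  replace (RtoC (2*PI*I)) with ((v1 - v2 + v3 - v4) - ((v1 - v2 + v3 - v4) - RtoC (2*PI*I)))%C by ring.
  via Cmod_sub_le. apply add_le; [|ar].
  via Cmod_sub_le. apply add_le_r. via Cmod_triangle. apply add_le_r. apply Cmod_sub_le. }
 ha T3 : forall c, 0 <= c -> c/T <= c/tau by ar.
 ha K1 : K/T <= Rabs K/tau by (etr; [|apply T3, Rabs_pos]; unfold Rdiv; apply mle_r; [left; apply inv_pos; lra|apply Rle_abs]).
 ha E20 : 0 < E2 by (apply mul_pos; apply exp_pos). fold E2 in S1, S2.
 note (T3 (2*(2*(1*(81/10)*E2))) !!) as t1. note (T3 (2*(2*((1 + CF)*(81/10)*E2))) ltac:(nra)) as t2.
 ha q1 : 1*(exp (th*(1/4))*exp (y*(1/4 + 1))) <= exp (2*th)*exp (y*(5/4)).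
 { rewrite Rmult_1_l. ar. }
 ha q2 : 14*(exp (th*(sg - 1/5))*exp (y*(sg - 1/5 + 1))) <= exp (2*th)*(14*exp (y*(sg + 4/5))).
 { replace (sg - 1/5 + 1) with (sg + 4/5) by field. note (eth (sg - 1/5) !!). note (exp_pos (y*(sg + 4/5))). nra. }
 ha q3 : CF*exp (th*sg) <= exp (2*th)*CF by (rewrite Rmult_comm; apply mle_r; [lra|ar]).
 replace ((Rabs K + 2*Ey*(24*(8 + 10*CF)) + 2*(2*(1*(81/10)*E2)) + 2*(2*((1 + CF)*(81/10)*E2)))/tau) with
  (Rabs K/tau + 2*Ey*(24*(8 + 10*CF)/tau) + 2*(2*(1*(81/10)*E2))/tau + 2*(2*((1 + CF)*(81/10)*E2))/tau) by ar.
 unfold Sm. lra.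
Qed.
End FirstOrderBound.

(** * Reduction of S(x) to the smoothed function *)

Definition jump (a v : R) : R := if Rle_dec a v then 1 else 0.
Definition psiN (N : nat) (v : R) : R := rsum (fun k => Lam k*jump (INR (S k)) v) N.

Lemma jump_le1 a v : 0 <= jump a v <= 1.
Proof. unfold jump. destruct (Rle_dec a v); lra. Qed.

Lemma rsum_le f g N : (forall k, (k < N)%nat -> f k <= g k) -> rsum f N <= rsum g N.
Proof. induction N as [|N IH]; intros H; simpl; [lra|]. apply add_le; ar. Qed.

Lemma rsum_minus f g N : rsum (fun n => f n - g n) N = rsum f N - rsum g N.
Proof. induction N as [|N IH]; simpl; [ring|ar]. Qed.

Lemma rsum_trunc f M N : (M <= N)%nat -> rsum (fun k => if Nat.ltb k M then f k else 0) N = rsum f M.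
Proof.
 intros H. induction H as [|N H IH].
 - apply rsum_ext. intros n Hn. apply Nat.ltb_lt in Hn. rewrite Hn. refl.
 - rewrite rsum_S, IH. ha E : Nat.ltb N M = false by (apply Nat.ltb_ge; lia). rewrite E. ring.
Qed.

Lemma sum_n_m_rsum (f : nat -> R) M : sum_n_m f 1 M = rsum (fun k => f (S k)) M.
Proof.
 induction M as [|M IH]; [ar|]. rewrite sum_n_Sm by lia. rewrite IH. ar.
Qed.

(** Induction on M: passing to M + 1 adds the diagonal k + j + 2 = M + 1, which is [G (S M)]; the 2
    comes from the shifted indices of [Lam]. *)
Lemma S_sum_nat M N : (M <= N)%nat ->
 sum_n_m G 1 M = rsum (fun k => Lam k*rsum (fun j => Lam j*(if Nat.leb (k + j + 2) M then 1 else 0)) N) N.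
Proof.
 intros H. rewrite sum_n_m_rsum. induction M as [|M IH].
 - simpl rsum at 1. symmetry. apply rsum_zero. intros k _. rewrite rsum_zero; [ring|]. intros j _.
  ha E : Nat.leb (k + j + 2) 0 = false by (apply Nat.leb_gt; lia). rewrite E. ring.
 - rewrite rsum_S, IH by lia.
  enough (E : G (S M) = rsum (fun k => Lam k*rsum (fun j => Lam j*(if Nat.leb (k + j + 2) (S M) then 1 else 0)) N - Lam k*rsum (fun j => Lam j*(if Nat.leb (k + j + 2) M then 1 else 0)) N) N).
  { rewrite rsum_minus in E. lra. }
  change (G (S M)) with (sum_n_m (fun l => vonMangoldt l*vonMangoldt (Nat.sub (S M) l)) 1 (Nat.sub (S M) 1)). replace (Nat.sub (S M) 1) with M by lia. rewrite sum_n_m_rsum. rewrite <- (rsum_trunc _ M N) by lia.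
  apply rsum_ext. intros k Hk. rewrite <- Rmult_minus_distr_l, <- rsum_minus.
  destruct (Nat.ltb_spec k M) as [L|L].
  + rewrite (rsum_ext _ (fun j => if Nat.eqb j (M - 1 - k) then Lam (M - 1 - k) else 0)).
   * rewrite rsum_delta by lia. unfold Lam. f_equal. f_equal. lia.
   * intros j Hj. destruct (Nat.eqb_spec j (M - 1 - k)) as [E|E]; destruct (Nat.leb_spec (k + j + 2) (S M)); destruct (Nat.leb_spec (k + j + 2) M); try lia; try (subst j; ring); ring.
  + rewrite rsum_zero; [ring|]. intros j Hj. destruct (Nat.leb_spec (k + j + 2) (S M)); destruct (Nat.leb_spec (k + j + 2) M); try lia; ring.
Qed.

Lemma floor_le x n : 0 <= x -> (n <= Z.to_nat (Int_part x))%nat <-> INR n <= x.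
Proof.
 intros Hx. destruct (base_Int_part x) as [B1 B2]. ha Hp : (0 <= Int_part x)%Z.
 { assert (-1 < IZR (Int_part x)) by lra. apply (lt_IZR (-1)) in H. lia. }
 rewrite INR_IZR_INZ. split; intros H.
 - mid (IZR (Int_part x)); [apply IZR_le; lia|lra].
 - assert (IZR (Z.of_nat n) < IZR (Int_part x + 1)) by (rewrite plus_IZR; lra). apply lt_IZR in H0. lia.
Qed.

(** S(x) is the sum over m of Lambda(m) psi(x - m), and N >= x makes the cut-off invisible. *)
Lemma S_sum_double x N : 0 <= x -> x <= INR N -> S_sum x = rsum (fun k => Lam k*psiN N (x - INR (S k))) N.
Proof.
 intros Hx HN. unfold S_sum. rewrite (S_sum_nat _ N).
 - apply rsum_ext. intros k _. f_equal. unfold psiN. apply rsum_ext. intros j _. f_equal. unfold jump.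
  note (floor_le x (k + j + 2) Hx) as F. rewrite !plus_INR in F. simpl (INR 2) in F.
  destruct (Rle_dec (INR (S j)) (x - INR (S k))) as [L|L]; rewrite !S_INR in L; destruct (Nat.leb_spec (k + j + 2) (Z.to_nat (Int_part x))) as [L2|L2]; try refl; exfalso.
  + assert ((k + j + 2 <= Z.to_nat (Int_part x))%nat) by ar. lia.
  + apply L. apply F in L2. lra.
 - apply INR_le. mid x; [apply (floor_le x _ Hx); lia|ar].
Qed.

Section Smooth.
Variables (th : R) (N : nat).
Hypothesis Hth : 0 < th <= / 5.

Lemma k1_bd z : 0 <= k1 th z <= 1.
Proof.
 unfold k1. unfold Rmax. destruct (Rle_dec 0 (z + th)), (Rle_dec 0 z); split; try (apply div_ge0; lra); apply div_le; lra.
Qed.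

Lemma k1_one z : 0 <= z -> k1 th z = 1.
Proof. intros H. unfold k1. rewrite !Rmax_right by lra. ar. Qed.

Lemma k1_mono z z' : z <= z' -> k1 th z <= k1 th z'.
Proof.
 intros H. unfold k1, Rdiv. apply mle_r; [ar|].
 unfold Rmax. destruct (Rle_dec 0 (z + th)), (Rle_dec 0 z), (Rle_dec 0 (z' + th)), (Rle_dec 0 z'); lra.
Qed.

Lemma psz_mono z z' : z <= z' -> psz th N z <= psz th N z'.
Proof. intros H. apply rsum_le. intros k _. apply mle_l; [apply Lam_bd|apply k1_mono; lra]. Qed.

Lemma psz_pos z : 0 <= psz th N z.
Proof.
 unfold psz. rewrite <- (rsum_zero (fun _ => 0) N) by auto. apply rsum_le. intros k _. apply mul_nn; [apply Lam_bd|apply k1_bd].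
Qed.

(** Lambda(1) = 0, so the first ramp starts at log 2 - [th], which lies beyond [th]. *)
Lemma psz_zero z : z <= th -> psz th N z = 0.
Proof.
 intros Hz. apply rsum_zero. intros k _. destruct k as [|k].
 - replace (Lam 0) with 0 by ar. ring.
 - rewrite k1_zero; [ring|lra|]. assert (ln 2 <= ln (INR (S (S k)))). { apply ln_le; [lra|]. apply (le_INR 2); lia. }
  note ln_lt_2. lra.
Qed.

Lemma psz_trivial z : psz th N z <= INR N*ln (INR (S N)).
Proof.
 unfold psz. mid (rsum (fun _ => ln (INR (S N))) N).
 - apply rsum_le. intros k Hk. note (Lam_bd k). note (k1_bd (z - ln (INR (S k)))).
  assert (ln (INR (S k)) <= ln (INR (S N))) by (apply ln_le; [apply lt_0_INR; lia|apply le_INR; lia]). nra.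
 - ha E : forall c, rsum (fun _ => c) N = INR N*c; [|rewrite E; lra].
  intros c. clear. induction N as [|n IH]; [ar|]. rewrite rsum_S, IH, S_INR. ring.
Qed.

Lemma psz_psiN v : 0 < v -> psiN N v <= psz th N (ln v).
Proof.
 intros Hv. apply rsum_le. intros k _. apply mle_l; [apply Lam_bd|]. unfold jump. destruct (Rle_dec (INR (S k)) v) as [L|L]; [|apply k1_bd].
 rewrite k1_one; [lra|]. assert (ln (INR (S k)) <= ln v) by (apply ln_le; [apply lt_0_INR; lia|ar]). lra.
Qed.

Lemma psiN_psz v z : 0 < v -> z + th <= ln v -> psz th N z <= psiN N v.
Proof.
 intros Hv Hz. apply rsum_le. intros k _. apply mle_l; [apply Lam_bd|]. unfold jump. destruct (Rle_dec (INR (S k)) v) as [L|L]; [apply k1_bd|].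
 rewrite k1_zero; [lra|lra|]. assert (ln v <= ln (INR (S k))) by ar. lra.
Qed.

Definition avg (g : R -> R) (a w : R) : R := / th*RInt g (ln w - a) (ln w - a + th).

Lemma avg_deriv (g : R -> R) a w : (forall z, continuous g z) -> 0 < w -> is_derive (avg g a) w ((g (ln w - a + th) - g (ln w - a))/(th*w)).
Proof.
 intros Hg Hw. set (Ps := (fun z => RInt g 0 z) : R -> R).
 ha ex : forall x y, ex_RInt g x y by (intros; apply (ex_RInt_continuous (V := RCN)); intros; apply Hg).
 ha DP : forall z, is_derive Ps z (g z).
 { intros z. apply (is_derive_RInt g Ps 0 z); [|ar]. exists (mkposreal 1 Rlt_0_1). intros y _. apply (RInt_correct (V := RCN)), ex. }
 apply (is_derive_ext (fun w => / th*(Ps (ln w - a + th) - Ps (ln w - a)))).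
 - intros t. unfold avg, Ps. f_equal. note (RInt_Chasles g 0 (ln t - a) (ln t - a + th) (ex _ _) (ex _ _)) as E. unfold plus in E; simpl in E. req. lra.
 - eapply dR_eq; [|apply dR_scal, dR_minus].
  2: { apply (dR_comp Ps (fun w => ln w - a + th)); [|ar]. auto_derive; [lra|ar]. }
  2: { apply (dR_comp Ps (fun w => ln w - a)); [|ar]. auto_derive; [lra|ar]. }
  ar.
Qed.

Lemma avg_between (g : R -> R) a w lo hi : (forall z, continuous g z) -> (forall z, ln w - a <= z <= ln w - a + th -> lo <= g z <= hi) -> lo <= avg g a w <= hi.
Proof.
 intros Hg H. unfold avg. set (u := ln w - a) in *.
 ha E : forall c : R, RInt (fun _ => c) u (u + th) = th*c by (intros c; rewrite RInt_const; change (scal (u + th - u) c) with ((u + th - u)*c); req; ring).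
 ha L1 : th*lo <= RInt g u (u + th) by (rewrite <- (E lo); apply RInt_mono; [lra|ar|ar|ar]).
 ha L2 : RInt g u (u + th) <= th*hi by (rewrite <- (E hi); apply RInt_mono; [lra|ar|ar|ar]).
 ha I0 : 0 < / th by ar.
 apply (mle_l (/ th)) in L1; [|lra]. apply (mle_l (/ th)) in L2; [|lra].
 rewrite <- !Rmult_assoc, Rinv_l, !Rmult_1_l in L1, L2 by lra. lra.
Qed.

(** A density of mass 1 on [m e^{-2 th}, m], the derivative of the averaged ramp of m. Spreading
    each jump of psi in this way produces the continuous density [qd]. *)
Definition kap (m w : R) : R := (k1 th (ln w - ln m + th) - k1 th (ln w - ln m))/(th*w).
Definition qd (w : R) : R := (psz th N (ln w + th) - psz th N (ln w))/(th*w).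

Lemma qd_sum w : qd w = rsum (fun k => Lam k*kap (INR (S k)) w) N.
Proof.
 unfold qd, psz. rewrite <- rsum_minus. unfold Rdiv. rewrite Rmult_comm, <- rsum_scal. apply rsum_ext. intros k _. unfold kap.
 replace (ln w + th - ln (INR (S k))) with (ln w - ln (INR (S k)) + th) by ring. ar.
Qed.

Lemma kap_pos m w : 0 < w -> 0 <= kap m w.
Proof. intros H. apply div_ge0; [|ar]. note (k1_mono (ln w - ln m) (ln w - ln m + th) !!). lra. Qed.

Lemma kap_supp m w : 0 < w -> 0 < m -> kap m w <> 0 -> m*exp (- (2*th)) <= w <= m.
Proof.
 intros Hw Hm H. split.
 - destruct (Rle_dec (m*exp (- (2*th))) w) as [L|L]; [ar|exfalso]. apply H. unfold kap.
  assert (ln w < ln m - 2*th). { replace (ln m - 2*th) with (ln (m*exp (- (2*th)))) by (rewrite ln_mult, ln_exp by ar; ring). apply ln_increasing; lra. }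
  rewrite !k1_zero by lra. unfold Rdiv. ring.
 - destruct (Rle_dec w m) as [L|L]; [ar|exfalso]. apply H. unfold kap. assert (ln m <= ln w) by ar. rewrite !k1_one by lra. ar.
Qed.

Lemma cont_lnf (g : R -> R) c w : (forall z, continuous g z) -> 0 < w -> continuous (fun w => g (ln w + c)) w.
Proof. intros Hg Hw. apply (cR_comp g (fun w => ln w + c)); [ar|apply Hg]. Qed.

Lemma cont_thw w : 0 < w -> continuous (fun w => / (th*w)) w.
Proof. intros Hw. eapply cR_der. auto_derive; [nra|ar]. Qed.

Lemma cont_kap m w : 0 < w -> continuous (kap m) w.
Proof.
 intros Hw. unfold kap, Rdiv. apply cR_mult; [|apply cont_thw, Hw]. apply cR_minus.
 - apply (continuous_ext (fun w => k1 th (ln w + (- ln m + th)))); [intros; f_equal; ring|apply cont_lnf; ar].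
 - apply (cont_lnf (k1 th) (- ln m)); ar.
Qed.

Lemma cont_qd w : 0 < w -> continuous qd w.
Proof.
 intros Hw. unfold qd, Rdiv. apply cR_mult; [|apply cont_thw, Hw]. apply cR_minus; [apply (cont_lnf (psz th N) th); ar|].
 apply (continuous_ext (fun w => psz th N (ln w + 0))); [intros; f_equal; ring|apply cont_lnf; ar].
Qed.

Lemma kap_int m Y : 1 <= Y -> 0 < m -> RInt (kap m) 1 Y <= 1 /\ (2 <= m <= Y -> RInt (kap m) 1 Y = 1).
Proof.
 intros HY Hm. ha E : RInt (kap m) 1 Y = avg (k1 th) (ln m) Y - avg (k1 th) (ln m) 1.
 { apply RI_uniq, (is_RInt_derive (avg (k1 th) (ln m))); intros w Hw; minmax in Hw; [apply avg_deriv; [ar|lra]|apply cont_kap; lra]. }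
 rewrite E. note (avg_between (k1 th) (ln m) Y 0 1 (cont_k1 th) (fun z _ => k1_bd z)). note (avg_between (k1 th) (ln m) 1 0 1 (cont_k1 th) (fun z _ => k1_bd z)).
 split; [lra|]. intros H1.
 ha L2 : ln 2 <= ln m by ar. ha LY : ln m <= ln Y by ar. note ln_lt_2.
 note (avg_between (k1 th) (ln m) Y 1 1 (cont_k1 th) ltac:(intros z Hz; rewrite k1_one by lra; lra)).
 note (avg_between (k1 th) (ln m) 1 0 0 (cont_k1 th) ltac:(rewrite ln_1; intros z Hz; rewrite k1_zero by lra; lra)). lra.
Qed.
End Smooth.

Definition ctn (f : R -> R) a b := forall t, a <= t <= b -> continuous f t.

Lemma ctn_ex f a b : a <= b -> ctn f a b -> ex_RInt f a b.
Proof. ar. Qed.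

Lemma ctn_mono f g a b : a <= b -> ctn f a b -> ctn g a b -> (forall t, a <= t <= b -> f t <= g t) -> RInt f a b <= RInt g a b.
Proof. intros H A B L. apply RInt_le; auto using ctn_ex. ar. Qed.

Lemma ctn_add f g a b : a <= b -> ctn f a b -> ctn g a b -> RInt (fun t => f t + g t) a b = RInt f a b + RInt g a b.
Proof. intros H A B. apply (RInt_plus (V := RCN)); auto using ctn_ex. Qed.

Lemma ctn_scal f k a b : a <= b -> ctn f a b -> RInt (fun t => k*f t) a b = k*RInt f a b.
Proof. intros H A. apply RInt_scalR, ctn_ex; asm. Qed.

Lemma ctn_pos f a b : a <= b -> ctn f a b -> (forall t, a <= t <= b -> 0 <= f t) -> 0 <= RInt f a b.
Proof. intros H A L. apply RInt_ge_0; auto using ctn_ex. ar. Qed.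

Lemma ctn_ext (f g : R -> R) a b : a <= b -> (forall t, a <= t <= b -> f t = g t) -> RInt f a b = RInt g a b.
Proof. intros H E. apply RInt_ext. intros t Ht. minmax in Ht. apply E. lra. Qed.

Lemma rsum_RInt (f : nat -> R -> R) N a b : a <= b -> (forall k, ctn (f k) a b) ->
 RInt (fun w => rsum (fun k => f k w) N) a b = rsum (fun k => RInt (f k) a b) N.
Proof.
 intros H C. induction N as [|N IH]; cbn [rsum]; [rewrite RInt_const; apply Rmult_0_r|].
 rewrite <- IH. apply ctn_add; [ar| |ar]. intros t Ht. apply cont_rsum. ar.
Qed.

Definition Gint (g : R -> R) (Y : R) : R := RInt (fun z => g z*exp z) 0 Y.

Lemma Gint_deriv (g : R -> R) z : (forall z, continuous g z) -> is_derive (Gint g) z (g z*exp z).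
Proof.
 intros Hg. ha C : forall z, continuous (fun z => g z*exp z) z by ar.
 apply (is_derive_RInt (fun z => g z*exp z) (Gint g) 0 z); [|ar]. exists (mkposreal 1 Rlt_0_1). intros y _.
 apply (RInt_correct (V := RCN)), (ex_RInt_continuous (V := RCN)). ar.
Qed.

Lemma Gint_0 g : Gint g 0 = 0.
Proof. unfold Gint. apply (RInt_point (V := RCN)). Qed.

Lemma subst_refl (g : R -> R) X : 2 <= X -> (forall z, continuous g z) -> RInt (fun w => g (ln (X - w))) 1 (X - 1) = Gint g (ln (X - 1)).
Proof.
 intros HX Hg. transitivity ((-1)*Gint g (ln (X - (X - 1))) - (-1)*Gint g (ln (X - 1))).
 - apply RI_uniq, (is_RInt_derive (fun w => (-1)*Gint g (ln (X - w)))); intros w Hw; minmax in Hw.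
  + eapply dR_eq; [|apply dR_scal, (dR_comp (Gint g) (fun w => ln (X - w))); [auto_derive; [lra|refl]|apply Gint_deriv, Hg]].
   rewrite exp_ln by lra. field. lra.
  + apply (cR_comp g (fun w => ln (X - w))); [ar|apply Hg].
 - replace (X - (X - 1)) with 1 by ring. rewrite ln_1, Gint_0. ar.
Qed.

Lemma subst_exp (g : R -> R) c Y : 1 <= Y -> (forall z, continuous g z) -> RInt (fun w => g (ln w + c)) 1 Y = exp (- c)*(Gint g (ln Y + c) - Gint g c).
Proof.
 intros HY Hg. transitivity (exp (- c)*Gint g (ln Y + c) - exp (- c)*Gint g (ln 1 + c)).
 - apply RI_uniq, (is_RInt_derive (fun w => exp (- c)*Gint g (ln w + c))); intros w Hw; minmax in Hw.
  + eapply dR_eq; [|apply dR_scal, (dR_comp (Gint g) (fun w => ln w + c)); [auto_derive; [lra|refl]|apply Gint_deriv, Hg]].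
   rewrite exp_plus, exp_ln, exp_Ropp by lra. field. split; [lra|ar].
  + apply cont_lnf; [ar|lra].
 - rewrite ln_1, Rplus_0_l. ar.
Qed.

Lemma psiN_small N v : v < 1 -> psiN N v = 0.
Proof.
 intros H. apply rsum_zero. intros k _. cbv beta. note (INR_ge1 k) as I1.
 ha E : jump (INR (S k)) v = 0 by (unfold jump; destruct (Rle_dec (INR (S k)) v) as [L|L]; [lra|ar]). rewrite E. ring.
Qed.

Lemma psiN_pos N v : 0 <= psiN N v.
Proof. unfold psiN. rewrite <- (rsum_zero (fun _ => 0) N) by auto. apply rsum_le. intros k _. apply mul_nn; [apply Lam_bd|apply jump_le1]. Qed.

Section Sandwich.
Variables (th : R) (N : nat).
Hypothesis Hth : 0 < th <= / 5.
Let p (v : R) := psz th N (ln v).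
Definition Dc (X : R) : R := RInt (fun w => psz th N (ln (X - w))*qd th N w) 1 (X - 1).

Lemma cont_p X w : w < X -> continuous (fun w => psz th N (ln (X - w))) w.
Proof. intros H. apply (cR_comp (psz th N) (fun w => ln (X - w))); [ar|apply cont_psz]. Qed.

Lemma Dc_sum X : 2 <= X -> Dc X = rsum (fun k => Lam k*RInt (fun w => p (X - w)*kap th (INR (S k)) w) 1 (X - 1)) N.
Proof.
 intros HX. ha C : forall k, ctn (fun w => p (X - w)*kap th (INR (S k)) w) 1 (X - 1).
 { intros k w Hw. apply cR_mult; [apply cont_p; lra|apply cont_kap; lra]. }
 transitivity (RInt (fun w => rsum (fun k => Lam k*(p (X - w)*kap th (INR (S k)) w)) N) 1 (X - 1)).
 - apply ctn_ext; [lra|]. intros w Hw. rewrite qd_sum. rewrite <- rsum_scal. apply rsum_ext. intros k _. unfold p. ring.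
 - rewrite rsum_RInt.
  + apply rsum_ext. intros k _. apply ctn_scal; [lra|ar].
  + lra.
  + intros k w Hw. ar.
Qed.

(** The mass at m is spread to the left, so X - w >= X - m, and [psz] dominates psi: both changes
    increase the sum. *)
Lemma S_upper X : 3 <= X <= INR N -> S_sum X <= Dc X.
Proof.
 intros HX. rewrite (S_sum_double X N) by lra. rewrite Dc_sum by lra. apply rsum_le. intros k _.
 ha C : ctn (fun w => p (X - w)*kap th (INR (S k)) w) 1 (X - 1).
 { intros w Hw. apply cR_mult; [apply cont_p; lra|apply cont_kap; lra]. }
 ha Ck : ctn (kap th (INR (S k))) 1 (X - 1) by (intros w Hw; apply cont_kap; lra).
 destruct k as [|k]; [replace (Lam 0) with 0 by ar; lra|].
 apply mle_l; [apply Lam_bd|]. set (m := INR (S (S k))) in *. ha m2 : 2 <= m by (apply (le_INR 2); lia).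
 destruct (Rle_dec m (X - 1)) as [L|L].
 - etr; [apply (psz_psiN th N Hth); lra|].
  ha E : psz th N (ln (X - m)) = RInt (fun w => psz th N (ln (X - m))*kap th m w) 1 (X - 1).
  { rewrite ctn_scal by ar. rewrite (proj2 (kap_int th Hth m (X - 1) !! !!) !!), Rmult_1_r. ar. }
  rewrite E. clear E.
  apply ctn_mono; [lra|intros w Hw; apply cR_mult; ar|ar|].
  intros w Hw. destruct (Req_dec (kap th m w) 0) as [E|E]; [ar|].
  apply mle_r; [apply kap_pos; lra|]. apply psz_mono; [ar|]. destruct (kap_supp th Hth m w !! !! E). apply ln_le; lra.
 - rewrite psiN_small by lra. apply ctn_pos; [lra|ar|]. intros w Hw. apply mul_nn; [apply psz_pos, Hth|apply kap_pos; lra].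
Qed.

(** Where [kap] does not vanish, w >= m e^{-2 th}, so X e^{-2 th} - w <= (X - m) e^{-2 th}. This
    factor more than pays for the averaging in [psz], which looks ahead by [th] only. *)
Lemma S_lower X : 3 <= X <= INR N -> 2 <= X*exp (- (2*th)) -> Dc (X*exp (- (2*th))) <= S_sum X.
Proof.
 intros HX HX'. rewrite (S_sum_double X N) by lra. set (X' := X*exp (- (2*th))) in *. rewrite Dc_sum by lra. apply rsum_le. intros k _.
 apply mle_l; [apply Lam_bd|]. set (m := INR (S k)). ha m1 : 1 <= m by (apply INR_ge1).
 ha C : ctn (fun w => p (X' - w)*kap th m w) 1 (X' - 1) by (intros w Hw; apply cR_mult; [apply cont_p; lra|apply cont_kap; lra]).
 ha Ck : ctn (kap th m) 1 (X' - 1) by (intros w Hw; apply cont_kap; lra).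
 mid (RInt (fun w => psiN N (X - m)*kap th m w) 1 (X' - 1)).
 - apply ctn_mono; [lra|ar|intros w Hw; apply cR_mult; ar|].
  intros w Hw. destruct (Req_dec (kap th m w) 0) as [E|E]; [ar|].
  apply mle_r; [apply kap_pos; lra|]. destruct (kap_supp th Hth m w !! !! E) as [S1 _].
  note (exp_pos (- (2*th))) as e0. ha G : X' - w <= (X - m)*exp (- (2*th)) by (unfold X'; lra).
  ha Xm : 0 < X - m by ar.
  apply psiN_psz; [ar|ar|]. assert (ln (X' - w) <= ln ((X - m)*exp (- (2*th)))) by ar.
  rewrite ln_mult, ln_exp in H by ar. lra.
 - rewrite ctn_scal by ar. note (proj1 (kap_int th Hth m (X' - 1) !! !!)). note (psiN_pos N (X - m)). nra.
Qed.

Let e1 := (exp th - 1)/th.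
Definition third (X : R) : R := RInt (fun w => Rz th N (ln (X - w))*(rz th N (ln w)/w)) 1 (X - 1).

Lemma qd_rz w : 0 < w -> qd th N w = e1 ^ 2 + rz th N (ln w)/w.
Proof.
 intros Hw. unfold qd, rz, Rz. fold e1. rewrite exp_plus, exp_ln by lra.
 replace (exp th) with (1 + e1*th) by (unfold e1; field; lra). ar.
Qed.

Let Q (w : R) := avg th (psz th N) 0 w.

Lemma Q_deriv w : 0 < w -> is_derive Q w (qd th N w).
Proof.
 intros Hw. eapply dR_eq; [|apply (avg_deriv th Hth (psz th N) 0 w); [apply cont_psz|exact Hw]]. rewrite !Rminus_0_r. ar.
Qed.

(** Insert psz = Rz + e1 v - 1 and qd = e1^2 + rz/w. The product of the two errors is [third], the
    error Rz against e1^2 is linear, and the main part times qd is integrated by parts with Q, an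
    antiderivative of qd that vanishes at 1. *)
Lemma Dc_split X : 3 <= X -> Dc X = third X + e1 ^ 2*Gint (Rz th N) (ln (X - 1)) + (e1*RInt Q 1 (X - 1) + (e1 - 1)*Q (X - 1)).
Proof.
 intros HX.
 ha cR : ctn (fun w => Rz th N (ln (X - w))) 1 (X - 1).
 { intros w Hw. apply (cR_comp (Rz th N) (fun w => ln (X - w))); [ar|apply cont_Rz]. }
 ha cq : ctn (qd th N) 1 (X - 1) by (intros w Hw; apply cont_qd; lra).
 ha cr : ctn (fun w => rz th N (ln w)/w) 1 (X - 1).
 { intros w Hw. unfold Rdiv. apply cR_mult; [apply (continuous_ext (fun w => rz th N (ln w + 0))); [intros; f_equal; ring|apply cont_lnf; [ar|lra]]|].
  ar. }
 ha cQ : ctn Q 1 (X - 1) by (intros w Hw; eapply cR_der, Q_deriv; lra).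
 ha cM : ctn (fun w => e1*(X - w) - 1) 1 (X - 1) by (intros w Hw; eapply cR_der; auto_derive; [exact I|refl]).
 ha E : Dc X = third X + e1 ^ 2*RInt (fun w => Rz th N (ln (X - w))) 1 (X - 1) + RInt (fun w => (e1*(X - w) - 1)*qd th N w) 1 (X - 1).
 { unfold third. rewrite <- ctn_scal by ar. rewrite <- !ctn_add; try lra.
  - apply ctn_ext; [lra|]. intros w Hw. rewrite qd_rz by lra. 
   ha Ez : psz th N (ln (X - w)) = Rz th N (ln (X - w)) + e1*(X - w) - 1 by (unfold Rz; fold e1; rewrite exp_ln by lra; ring).
   rewrite Ez. ring.
  - intros w Hw. apply cR_plus; [apply cR_mult; ar; lra|apply cR_mult; ar].
  - intros w Hw. apply cR_mult; ar.
  - intros w Hw. apply cR_mult; ar; lra.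
  - intros w Hw. apply cR_mult; ar. }
 rewrite E, subst_refl by ar. f_equal.
 ha F : RInt (fun w => (e1*(X - w) - 1)*qd th N w + - e1*Q w) 1 (X - 1) = (e1*(X - (X - 1)) - 1)*Q (X - 1) - (e1*(X - 1) - 1)*Q 1.
 { apply RI_uniq, (is_RInt_derive (fun w => (e1*(X - w) - 1)*Q w)); intros w Hw; minmax in Hw.
  - eapply dR_eq; [|apply (dR_mult (fun w => e1*(X - w) - 1) Q w (- e1) (qd th N w)); [auto_derive; [exact I|ring]|apply Q_deriv; lra]]. ring.
  - apply cR_plus; [apply cR_mult; ar|apply cR_mult; ar]. }
 ha Q1 : Q 1 = 0.
 { unfold Q. assert (0 <= avg th (psz th N) 0 1 <= 0); [|lra]. apply avg_between; [ar|ar|]. intros z Hz. rewrite ln_1 in Hz. rewrite psz_zero by lra. lra. }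
 rewrite ctn_add, ctn_scal in F; try lra; [| |intros w Hw; apply cR_mult; ar|intros w Hw; apply cR_mult; ar]; try exact cQ.
 rewrite Q1 in F. ar.
Qed.

Lemma e1_ge1 : 1 <= e1.
Proof. unfold e1. apply le_div; [lra|]. note (exp_ineq1_le th). lra. Qed.

Lemma Phi_eq Y : 0 <= Y -> Gint (psz th N) Y = Gint (Rz th N) Y + e1*(exp (2*Y) - 1)/2 - (exp Y - 1).
Proof.
 intros HY. ha E : RInt (fun z => e1*(exp z*exp z) + -1*exp z) 0 Y = e1*(exp (2*Y) - 1)/2 - (exp Y - 1).
 { transitivity ((e1/2*exp (2*Y) - exp Y) - (e1/2*exp (2*0) - exp 0)).
  - apply RI_uniq, (is_RInt_derive (fun z => e1/2*exp (2*z) - exp z)); intros z _.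
   + auto_derive; [ar|]. replace (2*z) with (z + z) by ring. rewrite exp_plus. field.
   + apply cR_plus; apply cR_mult; try apply c_cst; try apply cR_mult; apply cont_exp.
  - rewrite Rmult_0_r, exp_0. ar. }
 unfold Rminus at 1. rewrite Rplus_assoc. change (e1*(exp (2*Y) - 1)/2 + - (exp Y - 1)) with (e1*(exp (2*Y) - 1)/2 - (exp Y - 1)). rewrite <- E. unfold Gint.
 rewrite <- ctn_add; [|lra|intros z _; apply cR_mult; ar|intros z _; apply cR_plus; apply cR_mult; try apply c_cst; try apply cR_mult; apply cont_exp].
 apply ctn_ext; [lra|]. intros z _. unfold Rz. fold e1. ring.
Qed.

(** Q is a mean of [psz], so its integral is at most that of [psz] shifted by [th]. By [Phi_eq] this
    brings the linear term a second time, which is why 2.56 is counted twice. *)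
Lemma Dc_upper X : 3 <= X -> Dc X <= Rabs (third X) + e1 ^ 2*Rabs (Gint (Rz th N) (ln (X - 1))) + e1*Rabs (Gint (Rz th N) (ln (X - 1) + th))
 + e1 ^ 2*exp th*X ^ 2/2 + (e1 - 1)*(INR N*ln (INR (S N))).
Proof.
 intros HX. rewrite Dc_split by exact HX. note e1_ge1 as E1. set (y := ln (X - 1)). ha y0 : 0 <= y by (unfold y; rewrite <- ln_1; apply ln_le; lra).
 ha cQ : ctn Q 1 (X - 1) by (intros w Hw; eapply cR_der, Q_deriv; lra).
 ha QU : forall w, 1 <= w <= X - 1 -> Q w <= psz th N (ln w + th).
 { intros w Hw. apply (avg_between th Hth (psz th N) 0 w 0); [ar|]. intros z Hz. split; [apply psz_pos, Hth|apply psz_mono; [ar|lra]]. }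
 ha I1 : RInt Q 1 (X - 1) <= exp (- th)*(Gint (Rz th N) (y + th) + e1*exp (2*(y + th))/2).
 { mid (RInt (fun w => psz th N (ln w + th)) 1 (X - 1)).
  - apply ctn_mono; [lra|ar|intros w Hw; apply cont_lnf; [ar|lra]|ar].
  - rewrite subst_exp by ar. fold y. apply mle_l; [ar|].
   assert (0 <= Gint (psz th N) th) by (apply ctn_pos; [lra|intros z _; apply cR_mult; ar|intros z _; apply mul_nn; [apply psz_pos, Hth|ar]]).
   rewrite Phi_eq by lra. assert (1 <= exp (y + th)) by (apply exp_ge1; lra). lra. }
 ha Q2 : (e1 - 1)*Q (X - 1) <= (e1 - 1)*(INR N*ln (INR (S N))).
 { apply mle_l; [lra|]. etr; [apply QU; lra|apply psz_trivial, Hth]. }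
 ha I2 : e1*RInt Q 1 (X - 1) <= e1*Rabs (Gint (Rz th N) (y + th)) + e1 ^ 2*exp th*X ^ 2/2.
 { mid (e1*(exp (- th)*(Gint (Rz th N) (y + th) + e1*exp (2*(y + th))/2))); [ar|].
  replace (e1*(exp (- th)*(Gint (Rz th N) (y + th) + e1*exp (2*(y + th))/2))) with (e1*(exp (- th)*Gint (Rz th N) (y + th)) + e1 ^ 2*(exp (- th)*exp (2*(y + th)))/2) by field.
  apply add_le.
  - apply mle_l; [lra|]. note (Rle_abs (Gint (Rz th N) (y + th))). note (Rabs_pos (Gint (Rz th N) (y + th))).
   assert (exp (- th) <= 1) by (rewrite <- exp_0; apply exp_le; lra). note (exp_pos (- th)). nra.
  - replace (exp (- th)*exp (2*(y + th))) with (exp th*(X - 1) ^ 2).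
   + assert ((X - 1) ^ 2 <= X ^ 2) by ar. note (exp_pos th). assert (0 <= e1 ^ 2*exp th) by ar. nra.
   + replace (2*(y + th)) with (y + y + 2*th) by ring. rewrite <- exp_plus. replace (- th + (y + y + 2*th)) with (th + (y + y)) by ring.
    rewrite !exp_plus. unfold y. rewrite exp_ln by lra. ring. }
 note (Rle_abs (third X)). note (Rle_abs (Gint (Rz th N) y)). ar.
Qed.

Lemma Dc_lower X : 3 <= X -> X ^ 2/2 - Rabs (third X) - (e1 ^ 2 + e1)*Rabs (Gint (Rz th N) (ln (X - 1))) - (1 + e1)*X <= Dc X.
Proof.
 intros HX. rewrite Dc_split by exact HX. note e1_ge1 as E1. set (y := ln (X - 1)). ha y0 : 0 <= y by (unfold y; rewrite <- ln_1; apply ln_le; lra).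
 ha cQ : ctn Q 1 (X - 1) by (intros w Hw; eapply cR_der, Q_deriv; lra).
 ha QL : forall w, 1 <= w <= X - 1 -> psz th N (ln w + 0) <= Q w.
 { intros w Hw. assert (H := avg_between th Hth (psz th N) 0 w (psz th N (ln w + 0)) (psz th N (ln w + th)) (cont_psz th N)). apply H. intros z Hz. split; apply psz_mono; try exact Hth; lra. }
 ha I1 : Gint (psz th N) y <= RInt Q 1 (X - 1).
 { replace (Gint (psz th N) y) with (RInt (fun w => psz th N (ln w + 0)) 1 (X - 1)).
  - apply ctn_mono; [lra|intros w Hw; apply cont_lnf; [ar|lra]|ar|ar].
  - rewrite subst_exp by ar. rewrite Gint_0, Ropp_0, exp_0, Rplus_0_r. unfold y. ar. }
 ha Q2 : 0 <= (e1 - 1)*Q (X - 1). { apply mul_nn; [lra|]. etr; [apply psz_pos, Hth|apply QL; lra]. }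
 rewrite Phi_eq in I1 by exact y0. ha E2 : exp (2*y) = (X - 1) ^ 2 by (replace (2*y) with (y + y) by ring; rewrite exp_plus; unfold y; rewrite exp_ln by lra; ring).
 ha E3 : exp y = X - 1 by (unfold y; apply exp_ln; lra). rewrite E2, E3 in I1.
 set (g := Gint (Rz th N) y) in *. ha I2 : e1*(g + e1*((X - 1) ^ 2 - 1)/2 - (X - 1 - 1)) <= e1*RInt Q 1 (X - 1) by ar.
 fold y. fold g. note (Rle_abs (- third X)) as H1. note (Rle_abs (- g)) as H2. rewrite Rabs_Ropp in H1, H2. 
 ha e2 : 0 <= e1 ^ 2 by apply pow2_ge_0.
 ha G1 : - (e1 ^ 2*Rabs g) <= e1 ^ 2*g by nra. ha G2 : - (e1*Rabs g) <= e1*g by nra.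
 assert (1 <= e1 ^ 2) by nra. assert (0 <= (X - 1) ^ 2 - 1) by nra. nra.
Qed.

(* Cauchy-Schwarz in its arithmetic-geometric form *)
Lemma third_bound X sg J1 J2 : 3 <= X -> 1/2 <= sg -> 0 < J1 -> 0 < J2 ->
 RInt (fun z => Rz th N z ^ 2*exp (- 2*sg*z)) 0 (ln (X - 1)) <= J1 -> RInt (fun z => rz th N z ^ 2*exp (- 2*sg*z)) 0 (ln (X - 1)) <= J2 ->
 Rabs (third X) <= exp (2*sg*ln (X - 1))*sqrt (J1*J2).
Proof.
 intros HX Hsg HJ1 HJ2 B1 B2. set (y := ln (X - 1)) in *. ha y0 : 0 <= y by (unfold y; rewrite <- ln_1; apply ln_le; lra).
 ha cR : ctn (fun w => Rz th N (ln (X - w))) 1 (X - 1).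
 { intros w Hw. apply (cR_comp (Rz th N) (fun w => ln (X - w))); [ar|apply cont_Rz]. }
 ha cr : ctn (fun w => rz th N (ln w)/w) 1 (X - 1).
 { intros w Hw. unfold Rdiv. apply cR_mult; [apply (continuous_ext (fun w => rz th N (ln w + 0))); [intros; f_equal; ring|apply cont_lnf; [ar|lra]]|].
  ar. }
 ha ec : forall c z, continuous (fun z => exp (c*z)) z by (intros c z; eapply cR_der; auto_derive; [exact I|refl]).
 ha N1 : RInt (fun w => Rz th N (ln (X - w)) ^ 2) 1 (X - 1) <= exp ((2*sg + 1)*y)*J1.
 { rewrite (subst_refl (fun z => Rz th N z ^ 2)) by ar. fold y. unfold Gint.
  mid (RInt (fun z => exp ((2*sg + 1)*y)*(Rz th N z ^ 2*exp (- 2*sg*z))) 0 y).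
  - apply ctn_mono; [lra|intros z _; apply cR_mult; ar|intros z _; apply cR_mult; [ar|apply cR_mult; ar]|].
   intros z Hz. replace (exp ((2*sg + 1)*y)*(Rz th N z ^ 2*exp (-2*sg*z))) with (Rz th N z ^ 2*(exp ((2*sg + 1)*y)*exp (-2*sg*z))) by ring.
   apply mle_l; [ar|]. rewrite <- exp_plus. apply exp_le. nra.
  - rewrite ctn_scal by first [lra|intros z _; apply cR_mult; ar]. ar. }
 ha N2 : RInt (fun w => (rz th N (ln w)/w) ^ 2) 1 (X - 1) <= exp ((2*sg - 1)*y)*J2.
 { set (g := fun z => rz th N z ^ 2*exp (- 2*z)). ha cg : forall z, continuous g z by (intros; apply cR_mult; ar).
  replace (RInt (fun w => (rz th N (ln w)/w) ^ 2) 1 (X - 1)) with (RInt (fun w => g (ln w + 0)) 1 (X - 1)).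
  2: { apply ctn_ext; [lra|]. intros w Hw. unfold g. rewrite Rplus_0_r. replace (- 2*ln w) with (- (ln w + ln w)) by ring. rewrite exp_Ropp, exp_plus, exp_ln by lra. ar. }
  rewrite subst_exp, Gint_0, Ropp_0, exp_0, Rplus_0_r, Rminus_0_r, Rmult_1_l by ar. fold y. unfold Gint.
  mid (RInt (fun z => exp ((2*sg - 1)*y)*(rz th N z ^ 2*exp (- 2*sg*z))) 0 y).
  - apply ctn_mono; [lra|intros z _; apply cR_mult; ar|intros z _; apply cR_mult; [ar|apply cR_mult; ar]|].
   intros z Hz. unfold g. replace (exp ((2*sg - 1)*y)*(rz th N z ^ 2*exp (-2*sg*z))) with (rz th N z ^ 2*(exp ((2*sg - 1)*y)*exp (-2*sg*z))) by ring.
   rewrite Rmult_assoc. apply mle_l; [ar|]. rewrite <- !exp_plus. apply exp_le. nra.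
  - rewrite ctn_scal by first [lra|intros z _; apply cR_mult; ar]. ar. }
 set (a := exp ((2*sg + 1)*y)*J1) in *. set (b := exp ((2*sg - 1)*y)*J2) in *.
 ha a0 : 0 < a by (apply mul_pos; ar). ha b0 : 0 < b by (apply mul_pos; ar).
 set (lam := sqrt (b/a)). ha l0 : 0 < lam by (apply sqrt_lt_R0, div_pos; asm).
 ha C1 : ctn (fun w => Rz th N (ln (X - w)) ^ 2) 1 (X - 1) by (intros w Hw; apply cR_sq, cR, Hw).
 ha C2' : ctn (fun w => (rz th N (ln w)/w) ^ 2) 1 (X - 1) by (intros w Hw; apply (cR_sq (fun w => rz th N (ln w)/w)), cr, Hw).
 ha Cp : ctn (fun w => Rz th N (ln (X - w))*(rz th N (ln w)/w)) 1 (X - 1) by (intros w Hw; apply cR_mult; ar).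
 ha AG : forall w, 1 <= w <= X - 1 -> Rabs (Rz th N (ln (X - w))*(rz th N (ln w)/w)) <= lam/2*Rz th N (ln (X - w)) ^ 2 + / (2*lam)*(rz th N (ln w)/w) ^ 2.
 { intros w _. set (r := Rz th N (ln (X - w))). set (s := rz th N (ln w)/w). rewrite Rabs_mult, <- (pow2_abs r), <- (pow2_abs s).
  set (r' := Rabs r). set (s' := Rabs s). assert (0 <= / (2*lam)*(lam*r' - s') ^ 2) by ar.
  replace (lam/2*r' ^ 2 + / (2*lam)*s' ^ 2) with (r'*s' + / (2*lam)*(lam*r' - s') ^ 2) by ar. lra. }
 ha T : Rabs (third X) <= lam/2*a + / (2*lam)*b.
 { unfold third. etr; [apply abs_RInt_le; [lra|apply ctn_ex; [lra|exact Cp]]|].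
  mid (RInt (fun w => lam/2*Rz th N (ln (X - w)) ^ 2 + / (2*lam)*(rz th N (ln w)/w) ^ 2) 1 (X - 1)).
  - apply ctn_mono; [lra|intros w Hw; apply cR_abs, Cp, Hw|intros w Hw; apply cR_plus; apply cR_mult; try apply c_cst; ar|ar].
  - rewrite ctn_add, !ctn_scal; try lra; try asm; try (intros w Hw; apply cR_mult; ar); try (intros w Hw; apply cR_mult; ar).
   ar. }
 via T. right.
 ha la : lam ^ 2 = b/a by (unfold lam; simpl; rewrite Rmult_1_r; apply sqrt_sqrt; left; apply div_pos; asm).
 transitivity (lam*a).
 - assert (b = lam ^ 2*a) by (rewrite la; field; lra). rewrite H at 1. field. lra.
 - replace (lam*a) with (sqrt (b*a)).
  + replace (b*a) with ((exp (2*sg*y)*exp (2*sg*y))*(J1*J2)).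
   * rewrite sqrt_mult, sqrt_square; [ar|ar|ar|ar].
   * unfold a, b. rewrite <- exp_plus. replace (2*sg*y + 2*sg*y) with ((2*sg - 1)*y + (2*sg + 1)*y) by ring. rewrite exp_plus. ring.
  + replace (b*a) with ((lam*a)*(lam*a)); [apply sqrt_square; apply mul_nn; lra|]. replace (lam*a*(lam*a)) with (lam ^ 2*a*a) by ring. rewrite la. ar.
Qed.
End Sandwich.

Lemma exp_neg_small u : 0 < u -> exp (- u) <= / u.
Proof. intros H. rewrite exp_Ropp. apply inv_le; [ar|]. note (exp_ineq1_le u). lra. Qed.

Lemma exp_small_le u : 0 <= u <= / 2 -> exp u <= 1 + u + u ^ 2.
Proof.
 intros H. ha D : 1 + 0 + 0 ^ 2 - exp 0 <= 1 + u + u ^ 2 - exp u.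
 { apply (incr_deriv (fun u => 1 + u + u ^ 2 - exp u) (fun u => 1 + 2*u - exp u)); [lra| |].
  - intros x _. auto_derive; [ar|]. ring.
  - intros x Hx. assert (exp x*(1 - x) <= 1).
   { note (exp_ineq1_le (- x)). note (exp_pos x). rewrite exp_Ropp in H0. apply (mle_l (exp x)) in H0; [|lra]. rewrite Rinv_r in H0 by lra. lra. }
   ar. }
 rewrite exp_0 in D. lra.
Qed.

Lemma ln10 : ln 10 <= 233/100.
Proof.
 note (ln_le256 10 (91/10000) !! !! !!). lra.
Qed.

(** * All zeros to the left of the exponent *)

Section CaseA.
Variables (b L : R).
Hypothesis Hb : 1/2 <= b <= 1.
Hypothesis HZ : forall s, b < fst s -> Zf s <> 0%C.
Hypothesis HL : 10 ^ 13 <= L.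
Hypothesis Hu : 5*ln L <= (1 - b)*L.
Let x := exp L.
Let u := (1 - b)*L.
Let th := exp (- u)/10.
Let E0 := exp ((1 + b)*L).
Variable N : nat.
Hypothesis HN : 3*x <= INR N <= 3*x + 1.

Lemma L_big : 10000000000000 <= L.
Proof. lra. Qed.

Lemma lnL_ge : 4 <= ln L.
Proof.
 note L_big. mid (ln (2 ^ 8)); [rewrite ln_pow by lra; simpl INR; note ln_lt_2; lra|ar].
Qed.

Lemma eu : exp (- u) <= / L ^ 5.
Proof.
 note L_big. replace (/ L ^ 5) with (exp (- (5*ln L))); [apply exp_le; unfold u; lra|].
 rewrite exp_Ropp. f_equal. replace (5*ln L) with (INR 5*ln L) by ar. rewrite <- ln_pow by lra. apply exp_ln, pow_lt; lra.
Qed.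

Lemma th_small : 0 < th /\ th <= / 10 ^ 14.
Proof.
 note eu. note (exp_pos (- u)). note L_big as HB. unfold th. split; [lra|].
 assert (L <= L ^ 5). { simpl. assert (1 <= L*L) by nra. assert (1 <= L*L*(L*L)) by nra. ar. }
 assert (/ L ^ 5 <= / 10 ^ 13). { ar. } lra.
Qed.

(** The unit of the smoothing cost, measured against the final bound E0; the divisor 10 in [th]
    keeps it well below the linear term. *)
Lemma th_x2 : th*(x*x) = E0/10.
Proof.
 unfold th, x, E0. replace (exp (- u)/10*(exp L*exp L)) with (exp (- u)*(exp L*exp L)/10) by field. rewrite <- !exp_plus. f_equal. f_equal. unfold u. ring.
Qed.

Lemma x_big : 10 ^ 13 <= x.
Proof. unfold x. note (exp_ineq1_le L). lra. Qed.

Lemma lnSN : L + 1 <= ln (INR (S N)).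
Proof.
 assert (ln (3*x) <= ln (INR (S N))). { apply ln_le; [note x_big; lra|]. rewrite S_INR. lra. }
 rewrite ln_mult in H by (try apply exp_pos; lra). unfold x in H. rewrite ln_exp in H. 
 assert (1 <= ln 3). { rewrite <- (ln_exp 1). apply ln_le; [ar|apply exp_le_3]. } lra.
Qed.

Lemma relE (c d : R) : 0 < d -> c <= (1 + b)*L - d*L -> exp c <= E0/(d*L).
Proof.
 intros Hd Hc. note L_big. mid (exp ((1 + b)*L + - (d*L))); [ar|]. rewrite exp_plus. apply mle_l; [left; apply exp_pos|].
 apply exp_neg_small. nra.
Qed.

Lemma first_A Y : 0 < Y <= L + th -> Rabs (Gint (Rz th N) Y) <= 256/100*E0.
Proof.
 (* Going 1/(100 L) beyond the line costs only e^{1/100} in x^{1 + sg}. The factor 1/(sg - b), then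
    of order L, multiplies a term that carries no power of x. *)
 intros HY. destruct th_small as [t0 t1]. note L_big as LB. set (sg := b + / (100*L)).
 ha iL : 0 < / (100*L) <= / 100000 by ar.
 ha Hsg : b < sg <= 3/2 by (unfold sg; lra).
 note lnSN as LN.
 note (first_order b sg th Y N !! HZ Hsg !! !! !!) as F. fold (Gint (Rz th N) Y) in F.
 note (P_real_bound sg ltac:(unfold sg; lra)) as PB.
 ha Ep : 0 < E0 by apply exp_pos.
 ha T : exp (th*sg)*exp (Y*(sg + 1)) <= 1011/1000*E0.
 { rewrite <- exp_plus. mid (exp ((1 + b)*L + 101/10000)).
  - apply exp_le. assert (Y*(sg + 1) <= (L + th)*(sg + 1)) by ar.
   ha Li : L * / (100*L) = / 100 by ar.
   ha E : (L + th)*(sg + 1) = (1 + b)*L + L * / (100*L) + th*(sg + 1) by (unfold sg; ring).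
   assert (th*sg + th*(sg + 1) <= th*4) by nra. lra.
  - rewrite exp_plus. note (exp_small_le (101/10000) !!). unfold E0. note (exp_pos ((1 + b)*L)). nra. }
 ha T1 : exp (Y*(5/4)) <= E0/((1/5)*L) by (apply relE; nra).
 ha T2 : exp (Y*(sg + 4/5)) <= E0/((1/10)*L).
 { apply relE; [lra|]. ha Li : L * / (100*L) = / 100 by ar.
  assert (Y*(sg + 4/5) <= (L + th)*(sg + 4/5)) by ar.
  ha E : (L + th)*(sg + 4/5) = (4/5 + b)*L + L * / (100*L) + th*(sg + 4/5) by (unfold sg; ring).
  assert (th*(sg + 4/5) <= th*4) by nra. lra. }
 ha T3 : 205/100/(sg - b) + 2 <= E0*(1000/L).
 { replace (sg - b) with (/ (100*L)) by (unfold sg; ring). replace (205/100 / / (100*L) + 2) with (205*L + 2) by ar.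
  assert (L/2*(L/2) <= E0). { unfold E0. mid (exp (L/2)*exp (L/2)); [|rewrite <- exp_plus; apply exp_le; nra]. note (exp_ineq1_le (L/2)). ar. }
  mid (L/2*(L/2)*(1000/L)); [|ar].
  replace (L/2*(L/2)*(1000/L)) with (250*L) by ar. lra. }
 ha eth : exp (2*th) <= 2 by (note (exp_small_le (2*th) !!); nra).
 via F.
 mid (1011/1000*E0*(252/100) + 5460*2*(E0/((1/5)*L) + 14*(E0/((1/10)*L)) + E0*(1000/L))).
 - apply add_le.
  + apply mle; [ar| |ar|ar].
   apply div_ge0; [apply (ReP_pos b !! HZ); simpl; lra|lra].
  + note (exp_pos (Y*(5/4))). note (exp_pos (Y*(sg + 4/5))). assert (0 < 205/100/(sg - b) + 2) by ar.
   apply mle; [ar|lra|lra|lra].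
 - replace (E0/(1/5*L) + 14*(E0/(1/10*L)) + E0*(1000/L)) with (E0*(1145 * / L)) by ar.
  assert (/ L <= / 10 ^ 13) by ar. ar.
Qed.

(** Write u = 5 log L + d. Then e^{-u/2} cancels L^2 and still leaves L^(-1/2) against a logarithm:
    this is what the 5 in [Hu] buys. *)
Lemma Q_est : L ^ 2*(u + 63/10)*exp (- (u/2)) <= 5/10 ^ 5.
Proof.
 note L_big as LB. set (m := ln L). note lnL_ge as m4. fold m in m4. set (d := u - 5*m). ha d0 : 0 <= d by (unfold d, u; fold m in Hu; lra).
 replace u with (5*m + d) by (unfold d; ring).
 replace (- ((5*m + d)/2)) with (- (m/2) + (- (d/2)) + - (INR 2*m)) by (simpl INR; field). rewrite !exp_plus.
 ha E2 : exp (- (INR 2*m)) = / L ^ 2 by (rewrite exp_Ropp; f_equal; unfold m; rewrite <- ln_pow by lra; apply exp_ln, pow_lt; lra).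
 rewrite E2. replace (L ^ 2*(5*m + d + 63/10)*(exp (- (m/2))*exp (- (d/2)) * / L ^ 2)) with ((5*m + d + 63/10)*exp (- (d/2))*exp (- (m/2))) by ar.
 ha D1 : (5*m + d + 63/10)*exp (- (d/2)) <= 5*m + 63/10.
 { assert (exp (- (d/2)) <= / (1 + d/2)). { rewrite exp_Ropp. apply inv_le; [lra|]. note (exp_ineq1_le (d/2)). lra. }
  mid ((5*m + d + 63/10) * / (1 + d/2)); [ar|]. apply (div_le (5*m + d + 63/10)); [lra|]. nra. }
 set (L0 := 10 ^ 13). ha L00 : 0 < L0 by (unfold L0; lra).
 set (r := sqrt (L/L0)). ha r1 : 1 <= r. { unfold r. rewrite <- sqrt_1. apply sqrt_le_1_alt. apply le_div; [ar|]. unfold L0. lra. }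
 ha rr : L = L0*(r*r). { unfold r. rewrite sqrt_sqrt by ar. ar. }
 ha M : m <= 3030/100 + 2*(r - 1).
 { unfold m. rewrite rr. rewrite ln_mult by ar. rewrite ln_mult by lra. unfold L0. rewrite ln_pow by lra. simpl INR.
  note ln10. note (ln_le_sub1 r !!). lra. }
 ha Em : exp (- (m/2)) <= / (3162277*r).
 { rewrite exp_Ropp. apply inv_le; [lra|]. apply Rsqr_incr_0; [|lra|ar]. unfold Rsqr. rewrite <- exp_plus. replace (m/2 + m/2) with m by field. unfold m. rewrite exp_ln by lra. rewrite rr at 1.
  replace (3162277*r*(3162277*r)) with (3162277*3162277*(r*r)) by ring. apply mle_r; [nra|]. unfold L0. lra. }
 mid ((5*m + 63/10) * / (3162277*r)).
 - apply mle; [|ar|ar|ar]. apply mul_nn; [lra|ar].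
 - apply (div_le (5*m + 63/10)); [lra|]. nra.
Qed.

(** Here sg - b = 1/L, which keeps x^{2 sg} within a constant of x^{2b}. The mean squares J1 and J2
    are of order L^2 and L^2 u^2 e^u, so their geometric mean is L^2 u e^{u/2}; and x^{2b} e^{u/2} =
    E0 e^{-u/2}, which [Q_est] handles. *)
Lemma third_A X : 3 <= X <= x -> Rabs (third th N X) <= 6/10*E0.
Proof.
 intros HX. destruct th_small as [t0 t1]. note L_big as LB. set (sg := b + / L).
 ha iL : 0 < / L <= / 100000 by ar.
 ha Hsg : b < sg <= 3/2 by (unfold sg; lra). note lnSN as LN.
 set (y := ln (X - 1)). ha y0 : 0 < y by (unfold y; rewrite <- ln_1; apply ln_increasing; lra).
 ha yL : y <= L. { unfold y. rewrite <- (ln_exp L). apply ln_le; [lra|]. fold x. lra. }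
 set (Q := ln (/ th) + 31/10).
 ha lth : ln (/ th) = u + ln 10.
 { unfold th. rewrite Rinv_div. unfold Rdiv. rewrite ln_mult by ar. rewrite ln_Rinv, ln_exp by apply exp_pos. ring. }
 note ln10 as l10. note lnL_ge as m4.
 ha l10' : 0 <= ln 10 by (rewrite <- ln_1; apply ln_le; lra).
 ha u20 : 20 <= u by (unfold u; lra).
 ha HQ : 20 <= Q <= u + 63/10 by (unfold Q; lra).
 set (CF := 205/100/(sg - b) + 2). ha CFe : CF = 205/100*L + 2 by (unfold CF; replace (sg - b) with (/ L) by (unfold sg; ring); field; lra).
 ha CFb : 0 < CF <= 206/100*L by ar.
 note PI_RGT_0 as P0. note PI2_3_2 as P3. note PI_4 as P4. note exp_le_3 as e3. note (exp_pos 1) as e0.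
 set (J1 := exp 1/(2*PI)*(CF ^ 2*exp (2*(th*sg))*1700)). set (J2 := exp 1/(2*PI)*(CF ^ 2*exp (4*(th*sg))*(Q ^ 2*(5*PI/th)))).
 ha B1 : RInt (fun z => Rz th N z ^ 2*exp (- 2*sg*z)) 0 y <= J1 by (apply (L2_R b sg th y N); try asm; lra).
 ha B2 : RInt (fun z => rz th N z ^ 2*exp (- 2*sg*z)) 0 y <= J2 by (apply (L2_rho b sg th y N); try asm; try lra; unfold Q in HQ; lra).
 ha ep : 0 < exp 1/(2*PI) <= / 2. { split; [ar|apply div_le; lra]. }
 ha CF2 : 0 < CF ^ 2 by ar. ha Q2 : 0 < Q ^ 2 by ar.
 ha pt : 0 < 5*PI/th by ar.
 ha J1p : 0 < J1 by (unfold J1; note (exp_pos (2*(th*sg))); apply mul_pos; [lra|]; apply mul_pos; [ar|lra]).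
 ha J2p : 0 < J2 by (unfold J2; note (exp_pos (4*(th*sg))); apply mul_pos; [lra|]; apply mul_pos; ar).
 note (third_bound th N !! X sg J1 J2 !! ltac:(unfold sg; lra) J1p J2p B1 B2) as TB. fold y in TB.
 set (K := 1270*(L ^ 2*(u + 63/10)*exp (u/2))).
 ha K0 : 0 <= K by (unfold K; note (exp_pos (u/2)); note (pow2_ge_0 L); apply mul_nn; [lra|]; apply mul_nn; [ar|lra]).
 ha SQ : sqrt (J1*J2) <= K.
 { rewrite <- (sqrt_square K) by exact K0. apply sqrt_le_1_alt.
  ha it : / th = 10*(exp (u/2)*exp (u/2)). { unfold th. rewrite <- exp_plus. replace (u/2 + u/2) with u by field. rewrite exp_Ropp. ar. }
  set (w := exp (u/2)) in *. ha w0 : 0 < w by apply exp_pos.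
  replace (J1*J2) with ((exp 1/(2*PI)) ^ 2*(exp (2*(th*sg))*exp (4*(th*sg)))*((CF ^ 2) ^ 2*Q ^ 2)*(8500*PI * / th)) by (unfold J1, J2; field; lra).
  rewrite it, <- exp_plus.
  ha ee : exp (2*(th*sg) + 4*(th*sg)) <= 101/100. { ha v0 : 0 <= th*sg by ar. ha v1 : th*sg <= th*(3/2) by ar.
   set (v := 2*(th*sg) + 4*(th*sg)). ha v2 : 0 <= v <= / 1000 by (unfold v; lra). note (exp_small_le v !!). ar. }
  ha e2 : (exp 1/(2*PI)) ^ 2 <= / 4 by ar.
  ha c4 : (CF ^ 2) ^ 2 <= 1801/100*L ^ 4. { replace ((CF ^ 2) ^ 2) with (CF ^ 4) by ring. mid ((206/100*L) ^ 4); [ar|]. ar. }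
  ha q2 : Q ^ 2 <= (u + 63/10) ^ 2 by ar.
  replace (K*K) with (1612900*(L ^ 4*(u + 63/10) ^ 2)*(w*w)) by (unfold K; ring).
  mid (/ 4*(101/100)*(1801/100*L ^ 4*(u + 63/10) ^ 2)*(8500*4*(10*(w*w)))).
  - note (exp_pos (2*(th*sg) + 4*(th*sg))). note (pow2_ge_0 (exp 1/(2*PI))). assert (0 < w*w) by nra.
   apply mle; [ar|ar| |].
   + apply mle; [ar|ar| |].
    * apply mle; lra.
    * apply mle; [ar|lra|ar|ar].
   + apply mle; nra.
  - assert (0 <= L ^ 4*(u + 63/10) ^ 2) by ar. assert (0 < w*w) by nra. ar. }
 via TB.
 ha Ey : exp (2*sg*y) <= exp (2*b*L)*9.
 { mid (exp (2*b*L + 1 + 1)).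
  - apply exp_le. mid (2*sg*L); [ar|]. unfold sg. assert (/ L*L = 1) by ar. nra.
  - rewrite !exp_plus. note (exp_pos (2*b*L)). replace (exp (2*b*L)*exp 1*exp 1) with (exp (2*b*L)*(exp 1*exp 1)) by ring. apply mle_l; [lra|nra]. }
 mid (exp (2*b*L)*9*K).
 - apply mle; [ar|ar|ar|ar].
 - unfold K. ha Ex : exp (2*b*L)*exp (u/2) = E0*exp (- (u/2)) by (unfold E0; rewrite <- !exp_plus; f_equal; unfold u; field).
  replace (exp (2*b*L)*9*(1270*(L ^ 2*(u + 63/10)*exp (u/2)))) with (11430*(L ^ 2*(u + 63/10))*(exp (2*b*L)*exp (u/2))) by ring.
  rewrite Ex. replace (11430*(L ^ 2*(u + 63/10))*(E0*exp (- (u/2)))) with (11430*E0*(L ^ 2*(u + 63/10)*exp (- (u/2)))) by ring.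
  note Q_est as QE. ha Ep : 0 < E0 by apply exp_pos. ar.
Qed.

(** The two estimates are premises, so that both cases share this bookkeeping. In units of E0: twice
    2.56 from the linear term, 0.6 from the bilinear one and at most 0.35 from the smoothing, about
    6.08 in all. *)
Lemma assemble : (forall Y, 0 < Y <= L + th -> Rabs (Gint (Rz th N) Y) <= 256/100*E0) -> (forall X, 3 <= X <= x -> Rabs (third th N X) <= 6/10*E0) ->
 Rabs (S_sum x - x ^ 2/2) <= 679/100*E0.
Proof.
 intros H1A H3A.
 destruct th_small as [t0 t1]. note L_big as LB. note x_big as XB. ha Ep : 0 < E0 by apply exp_pos.
 set (e1 := (exp th - 1)/th).
 ha e1b : 1 <= e1 <= 1 + 2*th.
 { unfold e1. split; [apply le_div; [lra|]; note (exp_ineq1_le th); lra|]. apply div_le; [lra|]. note (exp_small_le th !!). nra. }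
 ha xE : x <= E0/(1/2*L) by (unfold x; apply relE; [lra|nra]).
 ha E1 : E0/(1/2*L) <= E0/10 ^ 6 by ar.
 ha lx : ln x = L by (unfold x; apply ln_exp).
 ha tx : th*(x*x) = E0/10 by exact th_x2.
 apply Rabs_le. split.
 - set (X' := x*exp (- (2*th))).
  ha ex : 1 - 2*th <= exp (- (2*th)) <= 1. { split; [note (exp_ineq1_le (- (2*th))); lra|]. rewrite <- exp_0. ar. }
  assert (X'b : 3 <= X' <= x) by (unfold X'; nra).
  note (S_lower th N !! x !! ltac:(fold X'; lra)) as SL. fold X' in SL.
  note (Dc_lower th N !! X' !!) as DL. fold e1 in DL.
  note (H3A X' X'b) as TA.
  ha yb : 0 < ln (X' - 1) <= L. { split; [rewrite <- ln_1; apply ln_increasing; lra|]. rewrite <- lx. ar. }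
  note (H1A (ln (X' - 1)) !!) as FA.
  ha X2 : x ^ 2*(1 - 4*th) <= X' ^ 2. { unfold X'. rewrite Rpow_mult_distr. apply mle_l; [ar|]. nra. }
  ha G : (e1 ^ 2 + e1)*Rabs (Gint (Rz th N) (ln (X' - 1))) <= 2001/1000*(256/100*E0) by (apply mle; [nra|ar|nra|ar]).
  assert ((1 + e1)*X' <= 3*x) by ar.
  replace (x ^ 2*(1 - 4*th)) with (x ^ 2 - 4*(th*(x*x))) in X2 by ring. rewrite tx in X2. lra.
 - note (S_upper th N !! x !!) as SU. note (Dc_upper th N !! x !!) as DU. fold e1 in DU.
  note (H3A x !!) as TA.
  ha yb : 0 < ln (x - 1) <= L. { split; [rewrite <- ln_1; apply ln_increasing; lra|]. rewrite <- lx at 1. ar. }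
  note (H1A (ln (x - 1)) !!) as FA. note (H1A (ln (x - 1) + th) !!) as FB.
  ha G1 : e1 ^ 2*Rabs (Gint (Rz th N) (ln (x - 1))) <= 10005/10000*(256/100*E0) by (apply mle; [nra|ar|nra|ar]).
  ha G2 : e1*Rabs (Gint (Rz th N) (ln (x - 1) + th)) <= 10005/10000*(256/100*E0) by ar.
  ha M1 : e1 ^ 2*exp th <= 1 + 7*th. { note (exp_small_le th !!). assert (e1 ^ 2 <= 1 + 5*th) by nra. note (exp_pos th). nra. }
  ha M2 : e1 ^ 2*exp th*x ^ 2/2 <= x ^ 2/2 + 7/2*(E0/10).
  { ar. }
  ha M3 : (e1 - 1)*(INR N*ln (INR (S N))) <= E0/10 ^ 3.
  { ha lN : ln (INR (S N)) <= x. { mid (ln (4*x)); [apply ln_le; [apply lt_0_INR; lia|rewrite S_INR; lra]|]. rewrite ln_mult, lx by lra. note (ln_le_sub1 4 !!). note (exp_ineq1_le (L/2)). unfold x. 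
    replace L with (L/2 + L/2) at 2 by field. rewrite exp_plus. nra. }
   assert (0 <= ln (INR (S N))) by (note lnSN; lra).
   mid (2*th*(4*x*(L + 4))).
   - apply mle; [lra|ar|lra|]. apply mle; [lra|ar|lra|].
    mid (ln (4*x)); [apply ln_le; [apply lt_0_INR; lia|rewrite S_INR; lra]|]. rewrite ln_mult, lx by lra. note (ln_le_sub1 4 !!). lra.
   - replace (2*th*(4*x*(L + 4))) with (8*(th*x)*(L + 4)) by ring. assert (th*x <= E0/10/x). { apply le_div; [lra|]. ar. }
    assert (L*10 ^ 12 <= x). { unfold x. mid (L/2*(L/2)); [nra|]. replace L with (L/2 + L/2) at 3 by field. rewrite exp_plus. note (exp_ineq1_le (L/2)). ar. }
    mid (8*(E0/10/x)*(2*L)).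
    + apply mle; [ar|lra|lra|lra].
    + replace (8*(E0/10/x)*(2*L)) with (E0*(16/10*(L/x))) by ar. apply mle_l; [lra|].
     assert (L/x <= / 10 ^ 12). { apply div_le; [lra|]. ar. } lra. }
  lra.
Qed.
Lemma caseA_bound : Rabs (S_sum x - x ^ 2/2) <= 679/100*E0.
Proof. exact (assemble first_A third_A). Qed.
End CaseA.

(** [B1] speaks of the open strip only; on Re s >= 1 the zero-free region takes over. *)
Lemma Zf_nz_B1 b (s : C) : 0 <= b -> Defs.B1 <= b -> b < fst s -> Zf s <> 0%C.
Proof.
 intros H0 HB Hs E. destruct (Rlt_dec (fst s) 1) as [L|L].
 - note (Zf_zero_le_B1 s !! E). lra.
 - revert E. apply zero_free. assert (0 < / (135*ln (Rabs (snd s) + 4))); [|lra]. apply inv_pos. apply mul_pos; [lra|].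
  rewrite <- ln_1. apply ln_increasing; note (Rabs_pos (snd s)); lra.
Qed.

(** * The lower bound 1/2 for the supremum of the real parts *)

Section Gap.
Variables (M N : nat) (th : R).
Hypothesis HM : (1 <= M)%nat.
Hypothesis Hth : th = / (16*INR M).

(** From n + 1/4 to n + 1/2, and even after a further shift by 2 [th], no integer is met. So [psz]
    is constant there, and the difference quotient of [Rz] is that of the main term alone. *)
Lemma gap_rz n z : (M <= n < 2*M)%nat -> ln (INR n + 1/4) <= z <= ln (INR n + 1/2) -> rz th N z = - ((exp th - 1)/th) ^ 2*exp z.
Proof.
 intros Hn Hz. ha M1 : 1 <= INR M by (apply (le_INR 1); exact HM).
 ha n1 : INR M <= INR n by (apply le_INR; lia). ha n2 : INR n <= 2*INR M by (change 2 with (INR 2); rewrite <- mult_INR; apply le_INR; lia).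
 ha t0 : 0 < th <= / 16 by (rewrite Hth; split; ar).
 ha G : ln (INR n + 1/2) + 2*th <= ln (INR n + 1).
 { note (ln_ge_frac ((INR n + 1)/(INR n + 1/2)) ltac:(apply div_pos; lra)) as F. rewrite ln_div in F by lra.
  rewrite Rinv_div in F. assert (2*th <= 1 - (INR n + 1/2)/(INR n + 1)); [|lra].
  replace (1 - (INR n + 1/2)/(INR n + 1)) with (1/2/(INR n + 1)) by ar. apply le_div; [lra|]. rewrite Hth.
  apply (mle_rl (16*INR M)); [lra|]. replace (16*INR M*(2 * / (16*INR M)*(INR n + 1))) with (2*(INR n + 1)) by ar. lra. }
 ha E : psz th N (z + th) = psz th N z.
 { apply rsum_ext. intros k _. f_equal. destruct (Nat.le_gt_cases (S k) n) as [L|L].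
  - assert (ln (INR (S k)) <= ln (INR n + 1/4)). { apply ln_le; [apply lt_0_INR; lia|]. apply le_INR in L. lra. }
   rewrite !k1_one by lra. refl.
  - assert (ln (INR n + 1) <= ln (INR (S k))). { apply ln_le; [lra|]. rewrite <- S_INR. apply le_INR. lia. }
   rewrite !k1_zero by lra. ar. }
 unfold rz, Rz. rewrite E, exp_plus. ar.
Qed.

(** On each gap the integrand is at least M^{1 - 2 sg} e^z by [gap_rz], and e^z integrates to 1/4
    over it. *)
Lemma gap_sum sg : 0 <= sg <= 1/2 -> forall k, (k <= M)%nat ->
 INR k*(/ 4*exp ((1 - 2*sg)*ln (INR M))) <= RInt (fun z => rz th N z ^ 2*exp (- 2*sg*z)) 0 (ln (INR (M + k) + 1/4)).
Proof.
 intros Hsg. ha M1 : 1 <= INR M by (apply (le_INR 1); exact HM).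
 ha t0 : 0 < th by (rewrite Hth; apply inv_pos; lra).
 set (f := fun z => rz th N z ^ 2*exp (- 2*sg*z)).
 ha fc : forall z, continuous f z by (intros z; apply cR_mult; ar).
 ha f0 : forall z, 0 <= f z by (intros z; apply mul_nn; ar).
 induction k as [|k IH]; intros Hk.
 - simpl INR at 1. rewrite Rmult_0_l. apply RInt_pos; [|ar|ar]. rewrite <- ln_1. apply ln_le; [lra|]. rewrite Nat.add_0_r. lra.
 - specialize (IH ltac:(lia)). set (n := (M + k)%nat) in *. replace (M + S k)%nat with (S n) by (unfold n; lia).
  ha n1 : INR M <= INR n by (apply le_INR; unfold n; lia).
  set (a := ln (INR n + 1/4)). set (c := ln (INR n + 1/2)). set (d := ln (INR (S n) + 1/4)).
  ha a0 : 0 <= a by (unfold a; rewrite <- ln_1; apply ln_le; lra). ha ac : a <= c by (apply ln_le; lra). ha cd : c <= d by (apply ln_le; [lra|rewrite S_INR; lra]).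
  rewrite <- (RInt_chas f 0 a d), <- (RInt_chas f a c d) by ar.
  ha P2 : 0 <= RInt f c d by (apply RInt_pos; ar).
  ha P1 : / 4*exp ((1 - 2*sg)*ln (INR M)) <= RInt f a c.
  { ha E : RInt exp a c = / 4.
   { transitivity (exp c - exp a).
    - apply RI_uniq, (is_RInt_derive exp exp); intros z _; [auto_derive; [ar|ring]|ar].
    - unfold a, c. rewrite !exp_ln by lra. ar. }
   mid (RInt (fun z => exp ((1 - 2*sg)*ln (INR M))*exp z) a c).
   - rewrite RInt_scalR by ar. rewrite E. lra.
   - apply RInt_mono; [ar|intros; apply cR_mult; ar|ar|].
    intros z Hz. unfold f. rewrite (gap_rz n z) by (try exact Hz; unfold n; lia). set (e := (exp th - 1)/th).
    ha e1 : 1 <= e by (apply le_div; [ar|note (exp_ineq1_le th); lra]).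
    ha e4 : 1 <= e ^ 4 by (apply pow_R1_Rle; exact e1).
    replace ((- e ^ 2*exp z) ^ 2*exp (-2*sg*z)) with (e ^ 4*(exp z*exp (-2*sg*z)*exp z)) by ring.
    mid (1*(exp z*exp (-2*sg*z)*exp z)); [|ar].
    rewrite Rmult_1_l. apply mle_r; [ar|]. rewrite <- exp_plus. apply exp_le.
    assert (ln (INR M) <= z) by (mid a; [apply ln_le; lra|lra]). nra. }
  rewrite S_INR. fold a in IH. lra.
Qed.
End Gap.

(** If all zeros had real part at most some b < 1/2, [L2_rho] with th = 1/(16 M) would bound the
    weighted mean square of [rz] by a constant times M (log M)^2, for a sg strictly between b and
    1/2. The M gaps between M and 2M force at least M^{2 - 2 sg}/4, which is more for large M. *)
Theorem B1_ge_half : 1/2 <= Defs.B1.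
Proof.
 destruct (Rle_dec (1/2) Defs.B1) as [H|H]; [ar|exfalso].
 (* 45/100 is the least value for which the reflection bounds are available. The maximum also covers
    the value 0 that [real] would give to [B1] if there were no zero at all. *)
 set (b := Rmax Defs.B1 (45/100)). ha Hb : 45/100 <= b < 1/2 by (unfold b; split; [apply Rmax_r|apply Rmax_lub_lt; lra]).
 ha HZ : forall s, b < fst s -> Zf s <> 0%C by (intros s Hs; apply (Zf_nz_B1 b s); [lra|apply Rmax_l|ar]).
 set (sg := (b + 1/2)/2). ha Hsg : b < sg < 1/2 by (unfold sg; lra). set (a := 1 - 2*sg). ha a0 : 0 < a by (unfold a; lra).
 set (CF := 205/100/(sg - b) + 2). set (Cst := exp 1/(2*PI)*(CF ^ 2*exp 1*(80*PI))).
 note PI_RGT_0 as P0. note (exp_pos 1) as e0.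
 ha C0 : 0 <= Cst. { unfold Cst. ar. }
 set (m0 := 20 + 432*Cst/a ^ 3). ha a3 : 0 < a ^ 3 by ar. ha q0 : 0 <= 432*Cst/a ^ 3 by ar.
 destruct (INR_unbounded (exp m0)) as [M HM].
 ha eM : 1 <= exp m0 by (apply exp_ge1; unfold m0; lra). ha M1 : (1 <= M)%nat by (apply INR_le; simpl; lra).
 set (m := ln (INR M)). ha mm : m0 <= m. { unfold m. rewrite <- (ln_exp m0). ar. }
 set (th := / (16*INR M)). ha Mp : 1 <= INR M by lra.
 ha t0 : 0 < th <= / 16 by (unfold th; split; ar).
 set (N := (4*M + 4)%nat). set (X := ln (INR (M + M) + 1/4)).
 ha X0 : 0 < X. { unfold X. rewrite <- ln_1. apply ln_increasing; [lra|]. rewrite plus_INR. lra. }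
 ha l16 : 0 <= ln 16 <= 31/10 + 1. { split; [rewrite <- ln_1; apply ln_le; lra|]. replace 16 with (2 ^ 4) by ring. rewrite ln_pow by lra. simpl INR. note (ln_le_sub1 2 !!). lra. }
 ha lt : ln (/ th) = ln 16 + m by (unfold th; rewrite Rinv_inv, ln_mult by lra; refl).
 note (gap_sum M N th M1 eq_refl sg !! M (le_n M)) as G. fold m a X in G.
 assert (R2 := L2_rho b sg th X N !! HZ !! !! X0).
 ha HX : X + 2*th <= ln (INR (S N)).
 { mid (ln ((INR (M + M) + 1/4)*(1 + 1/2))).
  - rewrite ln_mult by (rewrite ?plus_INR; lra). fold X. note (ln_ge_frac (1 + 1/2) !!). lra.
  - apply ln_le; [rewrite plus_INR; lra|]. unfold N. rewrite S_INR, !plus_INR, mult_INR. ar. }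
 specialize (R2 HX ltac:(rewrite lt; unfold m0 in mm; lra)). rewrite lt in R2. fold CF in R2.
 ha B : INR M*(/ 4*exp (a*m)) <= INR M*(Cst*(m + 8) ^ 2).
 { via G. via R2. replace (5*PI/th) with (80*PI*INR M) by (unfold th; field; lra).
  replace (INR M*(Cst*(m + 8) ^ 2)) with (exp 1/(2*PI)*(CF ^ 2*exp 1*((m + 8) ^ 2*(80*PI*INR M)))) by (unfold Cst; ring).
  apply mle_l; [ar|]. apply mle.
  - apply mul_nn; ar.
  - apply mul_nn; [ar|nra].
  - apply mle_l; [ar|]. apply exp_le. nra.
  - apply mle_r; [nra|]. apply pow_incr. unfold m0 in mm. lra. }
 apply mle_rl in B; [|lra].
 ha E3 : (a*m/3) ^ 3 < exp (a*m).
 { replace (a*m) with (a*m/3 + a*m/3 + a*m/3) at 2 by field. rewrite !exp_plus. set (v := a*m/3). assert (0 <= v) by (unfold v; apply div_ge0; [apply mul_nn; unfold m0 in mm; lra|lra]).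
  note (exp_ineq1_le v). note (exp_pos v). assert (v ^ 2 < exp v*exp v) by ar. ar. }
 ha m20 : 20 <= m by (unfold m0 in mm; lra).
 ha F : a ^ 3*m < 432*Cst.
 { assert ((m + 8) ^ 2 <= 4*m ^ 2) by nra. ar. }
 ha K : a ^ 3*m0 <= a ^ 3*m by ar. unfold m0 in K. replace (a ^ 3*(20 + 432*Cst/a ^ 3)) with (20*a ^ 3 + 432*Cst) in K by ar. lra.
Qed.

(** * The exponent to the left of some zero *)

(** The reflection bound at the point 1 + 1/L: the pole accounts for L, and the remaining terms stay
    below 1. *)
Lemma Dr_near1 L : 1 <= L -> Dr (1 + / L) <= L + 1.
Proof.
 intros HL. ha iL : 0 < / L <= 1 by (split; [ar|rewrite <- Rinv_1; apply inv_le; lra]). set (t := / L) in *.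
 note (refl_F 1 !! Zf_nz1 (1 + t) 0 !! !!) as Z.
 rewrite Ff_D in Z by ar. rewrite fst_sub_inv in Z. rewrite Dser_real in Z by lra.
 replace (1 + t - 1) with t in Z by ring. simpl fst in Z.
 replace (t/(t*(t*1) + 0*(0*1))) with L in Z by (unfold t; field; lra).
 note ln2925. ar.
Qed.

Lemma Hk_le_line th z (s t E q : R) : 0 < th -> 0 < s -> 0 < q -> exp (z*s) <= E -> exp ((z + th)*s) <= E -> q <= Cmod (s, t) ->
 Cmod (Hk th z (s, t)) <= 2/th*E/q ^ 2.
Proof.
 intros Hth Hs Hq E1 E2 HM. unfold Hk. rewrite Cmod_mult, Cmod_R, Rabs_pos_eq by ar.
 ha N : ((s, t) : C) <> 0%C by (apply Cmod_gt_0; lra).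
 ha Q : forall y, exp (y*s) <= E -> Cmod (Kz y (s, t)) <= E/q ^ 2.
 { intros y Hy. rewrite Kz_mod by exact N. ar. }
 replace (2/th*E/q ^ 2) with (/ th*(E/q ^ 2 + E/q ^ 2)) by ar.
 apply mle_l; [ar|]. via Cmod_sub_le. apply add_le; apply Q; asm.
Qed.

Lemma RInt_inv_sq a b : 0 < a -> a <= b -> RInt (fun t => / t ^ 2) a b <= / a.
Proof.
 intros Ha Hb. assert (0 < / b) by ar. replace (RInt (fun t => / t ^ 2) a b) with ((- / b) - (- / a)); [lra|].
 symmetry. apply RI_uniq. apply (is_RInt_derive (fun t => - / t)); intros t Ht; minmax in Ht.
 - auto_derive; [lra|]. field. lra.
 - eapply cR_der. auto_derive; ar.
Qed.

Lemma RInt_inv_sq_neg a b : 0 < a -> a <= b -> RInt (fun t => / t ^ 2) (- b) (- a) <= / a.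
Proof.
 intros Ha Hb. assert (0 < / b) by ar. replace (RInt (fun t => / t ^ 2) (- b) (- a)) with ((- / - a) - (- / - b)); [rewrite !Rinv_opp; lra|].
 symmetry. apply RI_uniq. apply (is_RInt_derive (fun t => - / t)); intros t Ht; minmax in Ht.
 - auto_derive; [lra|]. field. lra.
 - eapply cR_der. auto_derive; ar.
Qed.

Section CaseB.
Variables (L lam : R) (N : nat).
Hypothesis HL : 10 ^ 13 <= L.
Hypothesis Hl : 5*ln L <= lam.
Hypothesis Hl3 : 10 ^ 5*lam ^ 3 <= L.
Let x := exp L.
Let Y := exp lam.
Let th := exp (- lam)/10.
(** With Y = e^lam, which is x^delta, the choice T = Y^3 makes the part of the inversion integral
    beyond T, of size L Y x/T, smaller than x/Y. *)
Let T := exp (3*lam).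
Let kp := / (135*ln (T + 6)).
Let c := 1 + / L.
Hypothesis HN : 3*x <= INR N <= 3*x + 1.

Lemma lam_ge : 20 <= lam.
Proof. note (lnL_ge L HL). lra. Qed.

Lemma Y_ge : L ^ 5 <= Y.
Proof.
 unfold Y. replace (L ^ 5) with (exp (5*ln L)); [ar|]. replace (5*ln L) with (INR 5*ln L) by ar. rewrite <- ln_pow by lra. apply exp_ln, pow_lt; lra.
Qed.

Lemma Y_L : L <= Y.
Proof.
 apply Rle_trans with (2 := Y_ge). assert (1 <= L ^ 4) by (apply pow_R1_Rle; lra). ar.
Qed.

Lemma T_Y : T = Y ^ 3.
Proof. unfold T, Y. simpl. rewrite Rmult_1_r, <- !exp_plus. f_equal. ring. Qed.

Lemma T_big : 10 ^ 13 <= T.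
Proof. rewrite T_Y. note Y_L. ar. Qed.

Lemma lnT8 : ln (T + 8) <= 4*lam.
Proof.
 note T_big. note lam_ge. mid (ln (T*2)); [ar|]. rewrite ln_mult by lra. unfold T. rewrite ln_exp. note (ln_le_sub1 2 !!). lra.
Qed.

Lemma kp_bd : / (540*lam) <= kp <= / 135.
Proof.
 note T_big. note lam_ge. note lnT8. assert (ln (T + 6) <= ln (T + 8)) by ar.
 assert (1 <= ln (T + 6)). { rewrite <- (ln_exp 1). apply ln_le; [ar|]. note exp_le_3. lra. }
 unfold kp. ar.
Qed.

Lemma th_bd : 0 < th <= / 1000 /\ / th = 10*Y.
Proof.
 destruct (th_small (1 - lam/L) L !!) as [A B]. { replace ((1 - (1 - lam/L))*L) with lam by ar. ar. }
 replace (exp (- ((1 - (1 - lam/L))*L))/10) with th in A, B by (unfold th; do 3 f_equal; field; lra).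
 split; [lra|]. unfold th, Y. rewrite exp_Ropp. ar.
Qed.

Lemma near_zf (s : C) (t0 : R) : Rabs t0 <= T -> 1 - kp < fst s -> Rabs (snd s - t0) < 2 -> Zf s <> 0%C.
Proof.
 intros H1 H2 H3. apply zero_free. apply Rle_lt_trans with (2 := H2). note T_big.
 ha A : Rabs (snd s) <= T + 2. { replace (snd s) with ((snd s - t0) + t0) by ring. via Rabs_triang. lra. }
 assert (0 < ln (Rabs (snd s) + 4)). { rewrite <- ln_1. apply ln_increasing; note (Rabs_pos (snd s)); lra. }
 assert (ln (Rabs (snd s) + 4) <= ln (T + 6)) by ar.
 assert (kp <= / (135*ln (Rabs (snd s) + 4))); [|lra]. unfold kp. ar.
Qed.

(** Zeros are excluded only up to a height of about T, so the local bound [F_growth] is used. Its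
    powers of lam are absorbed by lam^3 <= L/10^5. *)
Lemma F_mid (s t : R) : 1 - kp/2 <= s <= 2 -> Rabs t <= T -> Cmod (Ff (s, t)) <= L ^ 3.
Proof.
 intros Hs Ht. note kp_bd as K. note lam_ge as l20. note lnT8 as l8. note T_big as TB.
 ha k0 : 0 < / (540*lam) by ar.
 note (F_growth (1 - kp) t !! (fun s => near_zf s t Ht) s !!) as G. cbv zeta in G.
 via G. note (Rabs_pos t).
 ha A : ln (8 + Rabs t) <= 4*lam by (etr; [|exact l8]; apply ln_le; lra).
 ha A0 : 0 <= ln (8 + Rabs t) by (rewrite <- ln_1; apply ln_le; lra).
 ha D : / (s - (1 - kp)) <= 1080*lam.
 { replace (1080*lam) with (/ (/ (540*lam)/2)) by ar. ar. }
 unfold Rdiv. rewrite <- pow_inv.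
 mid (8*(13*lam)*(1080*lam) ^ 3).
 - apply mle; [lra|ar|lra|]. apply pow_incr. split; ar.
 - replace (8*(13*lam)*(1080*lam) ^ 3) with (131010048000*(lam*lam ^ 3)) by ring.
  ha l3 : 0 <= lam ^ 3 by ar. ha lL : lam <= L. { ar. }
  ar.
Qed.

Lemma F_right t : 1 <= Rabs t -> Cmod (Ff (c, t)) <= 2*L.
Proof.
 intros Ht. ha iL : 0 < / L by ar. rewrite Ff_D by (cbn [fst]; unfold c; lra). via Cmod_sub_le.
 note (Dser_norm (c, t) ltac:(cbn [fst]; unfold c; lra)) as D. cbn [fst] in D. note (Dr_near1 L !!) as D1. fold c in D1.
 rewrite sub1_pt. ha C1 : 1 <= Cmod ((c - 1)%R, t). { note (Cmod_ge_im (c - 1) t _ eq_refl). lra. }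
 rewrite Cmod_inv by (apply Cmod_gt_0; lra).
 set (m := Cmod ((c - 1)%R, t)) in *. assert (/ m <= 1) by (rewrite <- Rinv_1; apply inv_le; lra). lra.
Qed.

(** Moving the line kp/2 to the left of 1 gains the factor e^{-L kp/2}, that is Y^6. One Y is spent
    on 1/th and three on the length of the segment; x/Y^2 remains, which leaves one spare Y for the
    powers of L. *)
Lemma kp_gain : 6*lam + 1 <= L*(kp/2).
Proof.
 note kp_bd. note lam_ge. assert (L*(/ (540*lam)/2) <= L*(kp/2)) by ar.
 assert (7*lam <= L*(/ (540*lam)/2)); [|lra]. replace (L*(/ (540*lam)/2)) with (L/(1080*lam)) by ar. apply le_div; [lra|].
 ar.
Qed.

Section Sup.
Variables (z T' : R).
Hypothesis Hz : 0 <= z <= L + th.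
Hypothesis HT' : T <= T'.
Let f (s : C) := (Ff s*Hk th z s)%C.

Lemma exp_c y (s : R) : 0 <= y <= L + 2*th -> 0 < s <= c -> exp (y*s) <= 4*x.
Proof.
 intros Hy Hs. destruct th_bd as [t0 _]. ha iL : 0 < / L <= / 1000 by ar.
 ha A : y*s <= (L + 2*th)*c by ar.
 ha B : (L + 2*th)*c <= L + 1 + 1/10. { unfold c. replace ((L + 2*th)*(1 + / L)) with (L + 1 + 2*th + 2*th * / L) by ar. nra. }
 mid (exp (L + (1 + 1/10))); [ar|]. rewrite !exp_plus. fold x. note (exp_pos L). note exp_le_3. note (exp_pos 1).
 note (exp_small_le (1/10) !!). note (exp_pos (1/10)). rewrite Rmult_comm. apply mle_r; [unfold x; lra|]. nra.
Qed.

Lemma Hk_right (s t q : R) : 0 < s <= c -> 0 < q -> q <= Rabs t -> Cmod (Hk th z (s, t)) <= 80*(Y*x)/q ^ 2.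
Proof.
 intros Hs Hq Ht. destruct th_bd as [t0 t1]. note (Cmod_ge_im s t _ eq_refl).
 replace (80*(Y*x)/q ^ 2) with (2/th*(4*x)/q ^ 2) by (unfold Rdiv at 2; rewrite t1; field; lra).
 apply Hk_le_line; try lra; apply exp_c; lra.
Qed.

Lemma hol_f_right : hol (fun s => 1 < fst s) f.
Proof.
 apply hol_mult; [apply hol_Ff; intros s Hs; split; [lra|apply Zf_nz1, Hs]|apply hol_Hk; intros s Hs; apply fst_nz; lra].
Qed.

Lemma c_bd : 1 < c <= 1 + / 1000.
Proof. unfold c. ha iL : 0 < / L <= / 1000 by ar. lra. Qed.

(** Beyond T the line stays at c = 1 + 1/L, where the Dirichlet series bounds F by 2L, and the
    kernel decays like 1/t^2. *)
Lemma tail_bd a b : a <= b -> (forall t, a <= t <= b -> T <= Rabs t) -> RInt (fun t => / t ^ 2) a b <= / T ->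
 Cmod (CInt (fun t => f (c, t)) a b) <= 160*L*(Y*x)/T.
Proof.
 intros Hab Ha HI. note c_bd as cb. note T_big as TB.
 ha nz : forall t, a <= t <= b -> t <> 0 by (intros t Ht E; specialize (Ha t Ht); rewrite E, Rabs_R0 in Ha; lra).
 ha ct : ctn (fun t => / t ^ 2) a b by (intros t Ht; eapply cR_der; auto_derive; [simpl; apply Rmult_integral_contrapositive_currified; [apply nz, Ht|rewrite Rmult_1_r; apply nz, Ht]|refl]).
 mid (RInt (fun t => 160*L*(Y*x) * / t ^ 2) a b).
 - apply (CInt_norm (fun t => f (c, t)) (fun t => 160*L*(Y*x) * / t ^ 2)); [ar|apply (hol_exCI (fun s => 1 < fst s)); [ar|apply hol_f_right|ar]| |].
  + apply ctn_ex; [ar|]. intros t Ht. apply cR_mult; ar.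
  + intros t Ht. specialize (Ha t !!). unfold f. rewrite Cmod_mult.
   note (F_right t !!) as F1. note (Hk_right c t (Rabs t) !! !! !!) as F2. rewrite pow2_abs in F2.
   replace (160*L*(Y*x) * / t ^ 2) with (2*L*(80*(Y*x)/t ^ 2)) by ar.
   apply mle; try apply Cmod_ge_0; asm.
 - rewrite ctn_scal by asm. apply mle_l; [|ar]. unfold Y, x. ar.
Qed.

Lemma mid_bd : Cmod (VI f c (- T) T) <= 160*L ^ 3*(Y*x)/T ^ 2 + 160*L ^ 3*x/Y ^ 2.
Proof.
 note c_bd as cb. note T_big as TB. note kp_bd as K. note lam_ge as l20. destruct th_bd as [t0 t1]. ha k0 : 0 < / (540*lam) by ar.
 ha Y0 : 0 < Y by apply exp_pos. ha x0 : 0 < x by apply exp_pos. ha L3 : 0 <= L ^ 3 by ar.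
 set (sg := 1 - kp/2). set (U := fun s : C => 1 - kp < fst s /\ Rabs (snd s) < T + 1).
 ha hf : hol U f.
 { apply hol_mult; [apply hol_Ff; intros s [H1 H2]; split; [lra|]|apply hol_Hk; intros s [H1 _]; apply fst_nz; lra].
  destruct (Rle_dec (Rabs (snd s)) T) as [Q|Q]; [apply (near_zf s (snd s)); [ar|ar|rewrite Rminus_diag, Rabs_R0; lra]|].
  destruct (Rle_dec 0 (snd s)) as [P|P].
  - rewrite Rabs_pos_eq in H2, Q by lra. apply (near_zf s T); [rewrite Rabs_pos_eq; lra|ar|apply Rabs_def1; lra].
  - rewrite Rabs_left in H2, Q by lra. apply (near_zf s (- T)); [rewrite Rabs_Ropp, Rabs_pos_eq; lra|ar|apply Rabs_def1; lra]. }
 ha Sd : forall s t : R, sg <= s <= c -> Rabs t = T -> Cmod (f (s, t)) <= L ^ 3*(80*(Y*x)/T ^ 2).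
 { intros s t Hs Ht. unfold f. rewrite Cmod_mult. unfold sg in Hs. apply mle; try apply Cmod_ge_0; [apply F_mid; lra|apply Hk_right; lra]. }
 ha R1 : Cmod (VI f c (- T) T - VI f sg (- T) T)%C <= (c - sg)*(2*(L ^ 3*(80*(Y*x)/T ^ 2))).
 { apply (rect_hol U f sg c (- T) T (kp/4)); [unfold sg; lra|lra|lra| |ar|].
  - intros s t Hs Ht. split; cbn [fst snd]; [unfold sg in Hs; lra|apply Rabs_def1; lra].
  - intros s Hs. note (Sd s T Hs ltac:(apply Rabs_pos_eq; lra)). note (Sd s (- T) Hs ltac:(rewrite Rabs_Ropp; apply Rabs_pos_eq; lra)). lra. }
 ha He : forall y, 0 <= y <= L + 2*th -> y*sg <= L - 6*lam.
 { intros y Hy. mid ((L + 2*th)*sg); [apply mle_r; unfold sg; lra|]. unfold sg. note kp_gain.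
  replace ((L + 2*th)*(1 - kp/2)) with (L - L*(kp/2) + 2*th*(1 - kp/2)) by ring. assert (2*th*(1 - kp/2) <= 1) by nra. lra. }
 ha EY : exp (L - 6*lam) = x/Y ^ 6.
 { unfold x, Y, Rminus, Rdiv. rewrite exp_plus, exp_Ropp. do 2 f_equal. simpl. rewrite Rmult_1_r, <- !exp_plus. f_equal. ring. }
 ha R2 : Cmod (VI f sg (- T) T) <= (T - - T)*(L ^ 3*(2/th*(x/Y ^ 6)/(1/2) ^ 2)).
 { apply (VI_norm_const U); [lra| |ar|].
  - intros t Ht. split; cbn [fst snd]; [unfold sg; lra|]. apply Rle_lt_trans with T; [apply Rabs_le; lra|lra].
  - intros t Ht. assert (Rabs t <= T) by (apply Rabs_le; lra). unfold f. rewrite Cmod_mult. apply mle; try apply Cmod_ge_0; [apply F_mid; unfold sg; lra|].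
   apply Hk_le_line; try lra; [unfold sg; lra|rewrite <- EY; apply exp_le, He; lra|rewrite <- EY; apply exp_le, He; lra|].
   apply Rle_trans with (2 := Cmod_ge_re sg t). rewrite Rabs_pos_eq; unfold sg; lra. }
 replace (VI f c (- T) T) with ((VI f c (- T) T - VI f sg (- T) T) + VI f sg (- T) T)%C by ring. via Cmod_triangle. apply add_le.
 - via R1. ha W : 0 <= 2*(L ^ 3*(80*(Y*x)/T ^ 2)).
  { ar. }
  replace (160*L ^ 3*(Y*x)/T ^ 2) with (1*(2*(L ^ 3*(80*(Y*x)/T ^ 2)))) by ar. apply mle_r; [ar|]. unfold sg. lra.
 - via R2. unfold Rdiv at 2. rewrite t1, T_Y. right. ar.
Qed.

Lemma total_bd : Cmod (VI f c (- T') T') <= x/Y/10 ^ 3.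
Proof.
 note T_big as TB. note c_bd as cb. note Y_ge as Y5. note Y_L as YL.
 ha Y0 : 0 < Y by apply exp_pos. ha x0 : 0 < x by apply exp_pos.
 ha ex : forall a b, a <= b -> exCI (fun t => f (c, t)) a b.
 { intros a b Hab. apply (hol_exCI (fun s => 1 < fst s)); [ar|apply hol_f_right|ar]. }
 unfold VI. rewrite <- (CInt_Chasles _ (- T') (- T) T'), <- (CInt_Chasles _ (- T) T T') by ar.
 ha A1 : Cmod (CInt (fun t => f (c, t)) (- T') (- T)) <= 160*L*(Y*x)/T.
 { apply tail_bd; [lra| |apply RInt_inv_sq_neg; lra]. intros t Ht. rewrite Rabs_left; lra. }
 ha A3 : Cmod (CInt (fun t => f (c, t)) T T') <= 160*L*(Y*x)/T.
 { apply tail_bd; [lra| |apply RInt_inv_sq; lra]. intros t Ht. rewrite Rabs_pos_eq; lra. }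
 note mid_bd as A2. unfold VI in A2. rewrite T_Y in A1, A2, A3.
 via Cmod_triangle. etr; [apply add_le_l, Cmod_triangle|]. rewrite T_Y.
 ha i0 : 0 < x/Y by ar.
 ha L3 : L ^ 3/Y <= / 10 ^ 13.
 { apply div_le; [lra|]. assert (0 < L ^ 3) by ar. assert (10 ^ 13*L ^ 3 <= L ^ 5). { replace (L ^ 5) with (L ^ 2*L ^ 3) by ring. apply mle_r; nra. } lra. }
 ha L1 : L/Y <= L ^ 3/Y. { apply mle_r; [ar|]. ar. }
 ha iY : 0 < / Y ^ 3 <= 1. { assert (1 <= Y ^ 3) by ar. split; [ar|]. rewrite <- Rinv_1. ar. }
 ha L3p : 0 <= L ^ 3/Y by ar. ha L0p : 0 <= L/Y by ar.
 replace (160*L*(Y*x)/Y ^ 3) with (x/Y*(160*(L/Y))) in A1, A3 by ar.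
 replace (160*L ^ 3*(Y*x)/(Y ^ 3) ^ 2 + 160*L ^ 3*x/Y ^ 2) with (x/Y*(160*(L ^ 3/Y) * / Y ^ 3 + 160*(L ^ 3/Y))) in A2 by ar.
 assert (160*(L ^ 3/Y) * / Y ^ 3 <= 160*(L ^ 3/Y)*1) by ar.
 ar.
Qed.
End Sup.

(** [total_bd] is uniform in T' >= T, so the truncation error of [inversion] is sent to 0 while the
    height T, at which the contour is bent, stays fixed. *)
Lemma Rz_sup z : 0 <= z <= L + th -> Rabs (Rz th N z) <= x/Y/10 ^ 3.
Proof.
 intros Hz. destruct th_bd as [t0 t1]. note c_bd as cb. note T_big as TB.
 note (lnSN L HL N HN) as LN.
 note (inversion th c (L + th) N !! !! !! z) as Iv. cbv zeta in Iv.
 set (KK := 2*_*Dr c + _) in Iv.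
 ha i0 : 0 < x/Y by (apply div_pos; apply exp_pos).
 apply (le_inv_limit _ _ (Rabs (/ th*KK))). intros S HS. set (T' := Rmax T S). assert (T <= T') by apply Rmax_l. assert (S <= T') by apply Rmax_r.
 specialize (Iv T' !! Hz). note (total_bd z T' Hz H) as B.
 note (Cmod_sub_ge (RtoC (2*PI*Rz th N z)) (VI (fun s => Ff s*Hk th z s)%C c (- T') T')) as S1. rewrite Cmod_sym in S1.
 rewrite Cmod_R, Rabs_mult, (Rabs_pos_eq (2*PI)) in S1 by (note PI_RGT_0; lra).
 ha D : / th*(KK/T') <= Rabs (/ th*KK)/S.
 { replace (/ th*(KK/T')) with (/ th*KK * / T') by ar. mid (Rabs (/ th*KK) * / T'); [apply mle_r; [ar|apply Rle_abs]|].
  apply mle_l; ar. }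
 note PI2_3_2. note (Rabs_pos (Rz th N z)). ar.
Qed.

Lemma E_pos : 0 < x/Y/10 ^ 3 <= x.
Proof.
 ha x0 : 0 < x by apply exp_pos. note Y_L. ha i0 : 0 < x/Y by ar. split; [lra|].
 assert (x/Y <= x); [|lra]. apply div_le; [lra|]. nra.
Qed.

Lemma first_B Z : 0 < Z <= L + th -> Rabs (Gint (Rz th N) Z) <= 256/100*(x*x/Y).
Proof.
 intros HZ. destruct th_bd as [t0 t1]. note E_pos as Ep. set (E := x/Y/10 ^ 3) in *. ha x0 : 0 < x by apply exp_pos. ha Y0 : 0 < Y by apply exp_pos.
 unfold Gint. ha C : forall z, continuous (fun z => Rz th N z*exp z) z by ar.
 etr; [apply abs_RInt_le; [lra|apply exR; [lra|exact C]]|].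
 mid (RInt (fun z => E*exp z) 0 Z).
 - apply RInt_le; [lra|ar|ar|].
  intros z Hz. rewrite Rabs_mult, (Rabs_pos_eq (exp z)) by ar. apply mle_r; [ar|apply Rz_sup; lra].
 - replace (RInt (fun z => E*exp z) 0 Z) with (E*exp Z - E*exp 0).
  2: { symmetry. apply RI_uniq. apply (is_RInt_derive (fun z => E*exp z)); intros z _; [auto_derive; [ar|ring]|ar]. }
  assert (exp Z <= 2*x). { mid (exp (L + th)); [ar|]. rewrite exp_plus. fold x. assert (exp th <= 2); [|nra]. note (exp_small_le th !!). ar. }
  rewrite exp_0. assert (E*exp Z <= E*(2*x)) by ar. replace (x*x/Y) with (1000*(E*x)) by (unfold E; field; lra). nra.
Qed.

(** With [Rz] uniformly small it suffices to bound rz/w in mean: it equals qd - e1^2, where qd is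
    nonnegative with total mass O(x). *)
Lemma third_B X : 3 <= X <= x -> Rabs (third th N X) <= 6/10*(x*x/Y).
Proof.
 intros HX. destruct th_bd as [t0 t1]. note E_pos as Ep. set (E := x/Y/10 ^ 3) in *. ha x0 : 0 < x by apply exp_pos. ha Y0 : 0 < Y by apply exp_pos.
 ha th0 : 0 < th <= / 5 by lra. set (e1 := (exp th - 1)/th).
 ha et : 1 + th <= exp th <= 1 + th + th ^ 2 by (split; [apply exp_ineq1_le|apply exp_small_le; lra]).
 ha e1b : 1 <= e1 <= 11/10 by (unfold e1; split; [apply le_div; lra|apply div_le; [lra|nra]]).
 ha yL : forall w, 1 <= w <= X - 1 -> 0 <= ln w <= L.
 { intros w Hw. split; [rewrite <- ln_1; apply ln_le; lra|]. rewrite <- (ln_exp L). apply ln_le; [lra|]. fold x. lra. }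
 ha cR : ctn (fun w => Rz th N (ln (X - w))*(rz th N (ln w)/w)) 1 (X - 1).
 { intros w Hw. apply cR_mult.
  - apply (cR_comp (Rz th N) (fun w => ln (X - w))); [|ar]. eapply cR_der. auto_derive; [lra|ar].
  - apply cR_mult; [apply (cR_comp (rz th N) ln); [ar|apply cont_rz]|eapply cR_der; auto_derive; [lra|refl]]. }
 ha cq : ctn (qd th N) 1 (X - 1) by (intros w Hw; apply cont_qd; lra).
 unfold third. etr; [apply abs_RInt_le; [lra|apply ctn_ex; [lra|exact cR]]|].
 mid (RInt (fun w => E*(qd th N w + e1 ^ 2)) 1 (X - 1)).
 - apply ctn_mono; [lra|intros w Hw; apply cR_abs, cR, Hw|intros w Hw; apply cR_mult; ar|].
  intros w Hw. rewrite Rabs_mult. apply mle; try apply Rabs_pos.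
  + apply Rz_sup. note (yL (X - w) !!). lra.
  + note (qd_rz th N th0 w !!) as q. fold e1 in q. replace (rz th N (ln w)/w) with (qd th N w - e1 ^ 2) by lra.
   assert (0 <= qd th N w). { unfold qd. apply div_ge0; [note (psz_mono th N th0 (ln w) (ln w + th) !!); lra|ar]. }
   note (pow2_ge_0 e1). apply Rabs_le. lra.
 - rewrite ctn_scal, ctn_add; [|lra|ar|intros w _; apply c_cst|lra|intros w Hw; apply cR_plus; ar].
  rewrite RInt_const. change (scal (X - 1 - 1) (e1 ^ 2)) with ((X - 1 - 1)*e1 ^ 2).
  replace (RInt (qd th N) 1 (X - 1)) with (avg th (psz th N) 0 (X - 1) - avg th (psz th N) 0 1).
  2: { symmetry. apply RI_uniq. apply (is_RInt_derive (fun w => avg th (psz th N) 0 w)); intros w Hw; minmax in Hw; [apply Q_deriv; lra|ar]. }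
  ha A1 : 0 <= avg th (psz th N) 0 1 <= psz th N (ln 1 - 0 + th).
  { apply (avg_between th); [ar|ar|]. intros z Hz. split; [apply psz_pos, th0|apply psz_mono; lra]. }
  ha A2 : 0 <= avg th (psz th N) 0 (X - 1) <= psz th N (ln (X - 1) - 0 + th).
  { apply (avg_between th); [ar|ar|]. intros z Hz. split; [apply psz_pos, th0|apply psz_mono; lra]. }
  rewrite Rminus_0_r in A2. note (yL (X - 1) !!) as yl. note (Rz_sup (ln (X - 1) + th) !!) as RS. fold E in RS.
  ha P : psz th N (ln (X - 1) + th) <= 3*x. { assert (RA := Rle_abs (Rz th N (ln (X - 1) + th))). unfold Rz in RA at 1. fold e1 in RA. rewrite exp_plus, exp_ln in RA by lra.
   assert (e1*((X - 1)*exp th) <= 11/10*(x*(11/10))). { apply mle; [lra|ar|lra|apply mle; nra]. }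
   ar. }
  assert (e1 ^ 2 <= 2) by nra. assert ((X - 1 - 1)*e1 ^ 2 <= x*2) by ar.
  replace (x*x/Y) with (1000*(E*x)) by (unfold E; field; lra).
  ar.
Qed.

(** [assemble] is applied with b = 1 - lam/L, the exponent for which x^{1 + b} is x^2/Y. *)
Lemma caseB_bound : Rabs (S_sum x - x ^ 2/2) <= 679/100*exp (2*L - lam).
Proof.
 ha l3 : lam <= L/2. { ar. }
 note lam_ge as l20. set (b := 1 - lam/L).
 ha bL : (1 - b)*L = lam by (unfold b; field; lra). ha E1 : exp ((1 + b)*L) = exp (2*L - lam) by (f_equal; lra).
 ha E2 : exp (2*L - lam) = x*x/Y. { unfold x, Y, Rminus, Rdiv. rewrite exp_plus, exp_Ropp. f_equal. rewrite <- exp_plus. f_equal. ring. }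
 ha Hb : 1/2 <= b <= 1. { ar. }
 ha Hu : 5*ln L <= (1 - b)*L by lra.
 note (assemble b L Hb HL Hu N HN) as A. rewrite bL, E1, E2 in A. rewrite E2. exact (A first_B third_B).
Qed.
End CaseB.

(** * The Lambert condition *)

Lemma Rpower_frac_pow a p q n m : 0 < a -> p*INR n = INR m -> q = p -> Rpower a q ^ n = a ^ m.
Proof. intros Ha E ->. rewrite <- Rpower_pow by apply exp_pos. rewrite Rpower_mult, E. apply Rpower_pow, Ha. Qed.

(** [ln] is 0 on nonpositive reals, so a positive logarithm reveals a positive argument. *)
Lemma pos_of_ln_pos x : 0 < ln x -> 0 < x.
Proof. intros H. unfold ln in H. destruct (Rlt_dec 0 x) as [P|P]; [ar|lra]. Qed.

Lemma exp67 : exp (67/10) <= 1584.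
Proof.
 replace (67/10) with (1 + 1 + 1 + 1 + 1 + 1 + (35/100 + 35/100)) by lra. rewrite !exp_plus. note exp_le_3 as e3. note (exp_pos 1) as e0.
 note (exp_small_le (35/100) !!) as s. note (exp_pos (35/100)) as s0. set (e := exp 1) in *. set (g := exp (35/100)) in *.
 ha e2 : 0 < e*e <= 9 by nra. ha e4 : 0 < e*e*(e*e) <= 81 by nra. ha e6 : 0 < e*e*(e*e)*(e*e) <= 729 by nra.
 ar.
Qed.

Section Lambert.
Variables (w L : R).
Hypothesis Hw : is_LambertWm1 (- / (4*Rpower 5 (3/4)*Rpower 53.989 (3/4))) w.
Hypothesis HL : exp (-4*w) <= L.
Let K := (269945/1000) ^ 3.

(* With [v = - w] the Lambert equation reads [exp v = 4 A v], where [A ^ 4 = (5*53.989) ^ 3]. *)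
Lemma lambert_solved : exists A v, 66 <= A /\ A ^ 4 = K /\ 67/10 <= v /\ exp v = 4*A*v /\ w = - v.
Proof.
 destruct Hw as [w1 we]. set (A := Rpower 5 (3/4)*Rpower 53.989 (3/4)) in *.
 ha Ap : 0 < A by (unfold A; apply mul_pos; apply exp_pos).
 ha A4 : A ^ 4 = K.
 { unfold A. rewrite Rpow_mult_distr, (Rpower_frac_pow 5 (3/4) (3/4) 4 3), (Rpower_frac_pow 53.989 (3/4) (3/4) 4 3); try lra; try (simpl; lra). unfold K. lra. }
 ha A66 : 66 <= A. { destruct (Rle_dec 66 A) as [P|P]; [ar|exfalso]. assert (A ^ 4 <= 66 ^ 4) by ar. unfold K in A4. lra. }
 set (v := - w). ha E : exp v = 4*A*v.
 { replace (4*Rpower 5 (3/4)*Rpower 53.989 (3/4)) with (4*A) in we by (unfold A; ring). unfold v. rewrite exp_Ropp. note (exp_pos w) as e0.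
  apply (Rmult_eq_reg_r (exp w)); [|lra]. rewrite Rinv_l by lra. replace (4*A * - w*exp w) with (- (4*A)*(w*exp w)) by ring. rewrite we. ar. }
 exists A, v. repeat split; try asm; [|unfold v; ring].
 ha v1 : 1 <= v by (unfold v; lra). note exp_le_3 as e3. note (exp_pos 1) as e0.
 ha Ev : forall a, a <= v -> 0 <= a -> 264*a <= exp v by ar.
 ha low : forall a b, a <= v -> 0 <= a -> exp b <= 264*a -> b <= v.
 { intros a b H1 H2 H3. destruct (Rle_dec b v) as [P|P]; [ar|exfalso]. note (exp_increasing v b !!). ar. }
 ha e5 : exp 5 <= 243 /\ exp 6 <= 729.
 { replace 6 with (1 + 1 + 1 + 1 + 1 + 1) by lra. replace 5 with (1 + 1 + 1 + 1 + 1) by lra. rewrite !exp_plus. set (e := exp 1) in *.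
  ha e2 : 0 < e*e <= 9 by nra. ha e4 : 0 < e*e*(e*e) <= 81 by nra.
  ar. }
 (* Bootstrapping: v >= a gives e^v >= 264 a, and 264, 1320, 1584 are at least e^5, e^6 and
    e^{6.7}. *)
 note (low 1 5 !! !! !!) as v5. note (low 5 6 !! !! !!) as v6.
 note exp67. apply (low 6); lra.
Qed.

(** At log L = 4v the relation L = K (log L)^4 holds exactly, by the fourth power of e^v = 4 A v.
    Beyond that point, with d = log L - 4v, the left side grows by e^d and the right side by at most
    (1 + d/4)^4. *)
Lemma lambert_L : 10 ^ 13 <= L /\ 0 < ln L /\ K*ln L ^ 4 <= L.
Proof.
 destruct lambert_solved as (A & v & A66 & A4 & v6 & E & ->).
 ha E4 : exp (-4 * - v) = K*(4*v) ^ 4.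
 { replace (-4 * - v) with (v + v + v + v) by ring. rewrite !exp_plus, E, <- A4. ring. }
 ha L0 : 0 < exp (-4 * - v) by apply exp_pos.
 ha m1 : 4*v <= ln L. { rewrite <- (ln_exp (4*v)). apply ln_le; [ar|]. replace (4*v) with (-4 * - v) by ring. ar. }
 split; [|split; [lra|]].
 - apply Rle_trans with (2 := HL). rewrite E4. ha B : (268/10) ^ 4 <= (4*v) ^ 4 by ar.
  ha KB : 19600000 <= K by (unfold K; lra). mid (19600000*(268/10) ^ 4); [lra|]. apply mle; lra.
 - set (d := ln L - 4*v). ha d0 : 0 <= d by (unfold d; lra).
  replace L with (exp (-4 * - v)*exp d) at 2.
  2: { rewrite <- exp_plus. unfold d. replace (-4 * - v + (ln L - 4*v)) with (ln L) by ring. apply exp_ln. lra. }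
  rewrite E4, Rmult_assoc. apply mle_l; [ar|].
  replace (ln L) with (4*v*(1 + d/(4*v))) by (unfold d; field; lra). rewrite Rpow_mult_distr. apply mle_l; [ar|].
  mid (exp (d/4) ^ 4); [apply pow_incr|right; simpl; rewrite Rmult_1_r, <- !exp_plus; f_equal; field].
  assert (0 <= d/(4*v)) by ar. split; [lra|]. note (exp_ineq1_le (d/4)).
  assert (d/(4*v) <= d/4); [|lra]. ar.
Qed.
End Lambert.

Theorem theorem1 (x w : R) :
  is_LambertWm1 (- / (4 * Rpower 5 (3/4) * Rpower 53.989 (3/4))) w ->
  ln x >= exp (-4 * w) ->
  Rabs (S_sum x - x ^ 2 / 2) <= 6.794 * Rpower x (B1_star x + 1).
Proof.
 intros Hw HL. apply Rge_le in HL. destruct (lambert_L w (ln x) Hw HL) as (L13 & m0 & KL).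
 ha x0 : 0 < x by (apply pos_of_ln_pos; lra).
 unfold Rpower, B1_star. set (L := ln x) in *. set (m := ln L) in *. set (q := 1/(53.989*Rpower L (2/3)*Rpower m (1/3))).
 ha xL : x = exp L by (unfold L; rewrite exp_ln; lra). set (lam := q*L).
 note (exp_pos (2/3*ln L)) as P1. note (exp_pos (1/3*ln m)) as P2. fold (Rpower L (2/3)) in P1. fold (Rpower m (1/3)) in P2.
 ha q0 : 0 < q by (unfold q; apply div_pos; [lra|]; apply mul_pos; ar).
 ha lam0 : 0 < lam by (unfold lam; apply mul_pos; lra).
 ha lam3 : lam ^ 3 = L/(53.989 ^ 3*m).
 { note (Rpower_frac_pow L (2/3) (2/3) 3 2 !! ltac:(simpl; lra) eq_refl) as R1. note (Rpower_frac_pow m (1/3) (1/3) 3 1 !! ltac:(simpl; lra) eq_refl) as R2.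
  unfold lam, q. set (r1 := Rpower L (2/3)) in *. set (r2 := Rpower m (1/3)) in *.
  replace ((1/(53.989*r1*r2)*L) ^ 3) with (L ^ 3/(53.989 ^ 3*r1 ^ 3*r2 ^ 3)) by ar. rewrite R1, R2. ar. }
 (* The claim amounts to (5 m)^3 53.989^3 m = K m^4 <= L, which is the inequality of [lambert_L]:
    the threshold for log x is designed for it. *)
 ha l5 : 5*m <= lam.
 { destruct (Rle_dec (5*m) lam) as [P|P]; [ar|exfalso]. ha C : lam ^ 3 < (5*m) ^ 3. { assert (lam*lam < 5*m*(5*m)) by nra. ar. }
  rewrite lam3 in C. ha D : L < (5*m) ^ 3*(53.989 ^ 3*m).
  { apply (Rmult_lt_compat_r (53.989 ^ 3*m)) in C; [|lra]. replace (L/(53.989 ^ 3*m)*(53.989 ^ 3*m)) with L in C by ar. ar. }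
  ar. }
 ha m1 : 4 <= m by (apply lnL_ge, L13).
 ha l3 : 10 ^ 5*lam ^ 3 <= L.
 { rewrite lam3. replace (10 ^ 5*(L/(53.989 ^ 3*m))) with (10 ^ 5*L/(53.989 ^ 3*m)) by ar. apply div_le; [lra|]. ar. }
 (* N is about 3x: [psz] has to be complete a little beyond x, and log 3 >= 1 gives the room used in
    [lnSN]. *)
 destruct (nfloor_ex (3*exp L + 1)) as [N [N1 N2]]; [ar|].
 ha HN : 3*exp L <= INR N <= 3*exp L + 1 by lra.
 rewrite xL. destruct (Rle_dec Defs.B1 (1 - q)) as [P|P].
 - rewrite Rmin_left by exact P. note B1_ge_half as Bh. replace ((Defs.B1 + 1)*L) with ((1 + Defs.B1)*L) by ring.
  etr; [apply (caseA_bound Defs.B1 L) with (N := N); try asm; [lra|intros s Hs; apply (Zf_nz_B1 Defs.B1); lra|fold m; unfold lam in l5; nra]|].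
  apply mle_r; [ar|lra].
 - rewrite Rmin_right by lra. replace ((1 - q + 1)*L) with (2*L - lam) by (unfold lam; ring).
  etr; [apply (caseB_bound L lam N); asm|]. ar.
Qed.
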